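(* Let $H$ be a separable Hilbert space, let $\mathcal A\subseteq\mathcal B(H)$ be a semi-finite factor, and let $\tau$ be a normal semi-finite faithful trace on $\mathcal A$. For unit vectors $\psi,\varphi\in H$, the following are equivalent: (i) $\psi$ is approximately convertible to $\varphi$ via $\mathrm{LOCC}(\mathcal A)$; (ii) $\rho_\psi\prec\rho_\varphi$.
   Context: Normal means weak*-continuous. Inner products are linear in the first argument. **LOCC maps.** Let $\mathcal A\subseteq\mathcal B(H)$ be a von Neumann algebra and $\mathcal B=\mathcal A'$ its commutant. For a von Neumann subalgebra $\mathcal C\subseteq \mathcal B(H)$, $\mathrm{CP}^\sigma_{\mathcal C}(\mathcal B(H))$ is the set of normal completely positive maps $\Phi:\mathcal B(H)\to\mathcal B(H)$ with $\Phi(axb)=a\Phi(x)b$ for all $a,b\in\mathcal C$, $x\in\mathcal B(H)$; $\mathrm{UCP}^\sigma_{\mathcal C}(\mathcal B(H))$ is the subset of unital ones. - A *one-way right local map* relative to $\mathcal A$ is a map $\Phi\circ\Psi$ with $\Phi\in\mathrm{UCP}^\sigma_{\mathcal A}(\mathcal B(H))$ and $\Psi\in\mathrm{CP}^\sigma_{\mathcal B}(\mathcal B(H))$; a *one-way left local map* is a map $\Phi\circ\Psi$ with $\Phi\in\mathrm{CP}^\sigma_{\mathcal A}(\mathcal B(H))$ and $\Psi\in\mathrm{UCP}^\sigma_{\mathcal B}(\mathcal B(H))$. - An *instrument* is a collection $\mathcal I=(\Theta_k)_{k\in\mathbb N}$ of normal completely positive maps on $\mathcal B(H)$ such that $\sum_k\Theta_k(x)$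 converges weak* to a limit $\Theta_{\mathcal I}(x)$ for every $x\in\mathcal B(H)$, and $\Theta_{\mathcal I}$ is a normal unital completely positive map. Instruments differing only by a bijective relabelling of the index set are identified. - A *one-way right (left) instrument* relative to $\mathcal A$ is an instrument all of whose maps are one-way right (left) local maps relative to $\mathcal A$; a *one-way (local) instrument* is one which is either a one-way right or a one-way left instrument. - An instrument $(\Gamma_j)_{j\in\mathbb N}$ is a *coarse-graining* of $(\Theta_k)_{k\in\mathbb N}$ if there is a partition $\mathbb N=\bigcup_j S_j$ with $\Gamma_j=\sum_{k\in S_j}\Theta_k$ (point-weak* convergent) for all $j$. - An instrument $\mathcal J$ is *linked* to $\mathcal I=(\Theta_k)_k$ if there are one-way instruments $(\Theta_{ki})_{i\in\mathbb N}$, $k\in\mathbb N$, relative to $\mathcal A$ such that $\mathcal J$ is a coarse-graining of $(\Theta_k\circ\Theta_{ki})_{i,k\in\mathbb N}$. - A normal unital completely positive map $\Theta$ on $\mathcal B(H)$ is in $\mathrm{LOCC}(\mathcal A)$ if there are instruments $\mathcal I_0,\dots,\mathcal I_n$ such that $\mathcal I_0$ is a one-way local instrument relative to $\mathcal A$, $\mathcal I_{l+1}$ is linked to $\mathcal I_l$ for $l=0,\dots,n-1$, and $\Theta=\Theta_{\mathcal I_n}$. **Convertibility.** For $\psi\in H$, $\omega_\psi(x)=(x\psi,\psi)$, $x\in\mathcal B(H)$; for a normal map $\Theta$ on $\mathcal B(H)$, $\Theta_*$ is its predual, $\Theta_*(\omega)=\omega\circ\Theta$ for $\omega\in\mathcal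 B(H)_*$. A unit vector $\psi$ is *approximately convertible* to a unit vector $\varphi$ via $\mathrm{LOCC}(\mathcal A)$ if for every $\varepsilon>0$ there is $\Theta\in\mathrm{LOCC}(\mathcal A)$ with $\|\Theta_*(\omega_\psi)-\omega_\varphi\|<\varepsilon$. **Density operators and majorisation.** $L^1(\mathcal A,\tau)$ is identified with $\mathcal A_*$ and its elements with $\tau$-measurable operators affiliated with $\mathcal A$; $\rho_\psi\in L^1(\mathcal A,\tau)^+$ is the density operator of $\omega_\psi|_{\mathcal A}$, i.e. $\omega_\psi(a)=\tau(\rho_\psi a)$ for $a\in\mathcal A$. For a $\tau$-measurable $x$ and $t>0$, $\mu_t(x)=\inf\{\|xp\|: p\in\mathcal A\text{ a projection},\ \tau(1-p)\le t\}$. For positive $\tau$-measurable $x,y$, $x\prec y$ means $\int_0^s\mu_t(x)\,dt\le\int_0^s\mu_t(y)\,dt$ for all $0<s\le\infty$ and $\tau(x)=\tau(y)$. *)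

(* Defs.v *)
(* The scalars are R[i] for R : realType, and the norms are valued in R[i], as
   usual for normedModType R[i]. *)
From HB Require Import structures.
From mathcomp Require Import all_boot all_order all_algebra.
From mathcomp Require Import sesquilinear complex.
From mathcomp Require Import all_classical all_reals all_analysis.

Set Implicit Arguments.
Unset Strict Implicit.
Unset Printing Implicit Defensive.

Import Order.TTheory GRing.Theory Num.Theory.
Import numFieldNormedType.Exports.

Local Open Scope classical_set_scope.
Local Open Scope ring_scope.

(* {dot H for Num.conj} is linear in the first argument and conjugate-linear
   in the second. *)
HB.mixin Record isHilbert (R : realType) H of CompleteNormedModule R[i] H := {
  inner : {dot H for (@Num.conj R[i])} ;
  inner_norm : forall x : H, inner x x = `|x| ^+ 2
}.

#[short(type="hilbertType")]
HB.structure Definition Hilbert (R : realType) :=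
  {H of CompleteNormedModule R[i] H & isHilbert R H}.

Notation "<| x , y |>" := (inner x y)
  (at level 0, x at level 99, y at level 99, format "<| x ,  y |>")
  : ring_scope.

Definition separable_space (T : topologicalType) : Prop :=
  exists D : set T, countable D /\ dense D.

Definition hnorm (R : realType) (V : normedModType R[i]) (x : V) : R :=
  complex.Re `|x|.

Section BoundedOperators.
Context {R : realType} (H : hilbertType R).

Definition bounded_linear : {pred (H -> H)} :=
  fun T => `[< linear T /\ continuous T >].

Lemma bounded_linear_submod_closed : submod_closed bounded_linear.
Proof.
split.
  apply/asboolP; split; first by move=> a x y /=; rewrite scaler0 addr0.
  by move=> x; apply: cvg_cst.
move=> a S T /asboolP[linS cS] /asboolP[linT cT]; apply/asboolP; split.
  move=> c x y; rewrite !fctE linS linT !scalerDr !scalerA (mulrC a c).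
  by rewrite addrACA.
by move=> x; apply: cvgD; [apply: cvgZr; exact: cS|exact: cT].
Qed.

HB.instance Definition _ :=
  GRing.isSubmodClosed.Build R[i] (H -> H) bounded_linear
    bounded_linear_submod_closed.

Record bop := Bop { bop_fun :> H -> H; bop_in : bop_fun \in bounded_linear }.

HB.instance Definition _ := [isSub for bop_fun].
HB.instance Definition _ := [Choice of bop by <:].
HB.instance Definition _ := [SubChoice_isSubLmodule of bop by <:].

Lemma bop_id_subproof : idfun \in bounded_linear.
Proof. by apply/asboolP; split=> // x; apply: cvg_id. Qed.

Lemma bop_comp_subproof (S T : bop) : (S \o T) \in bounded_linear.
Proof.
case: S T => [S /= /asboolP[linS cS]] [T /= /asboolP[linT cT]].
apply/asboolP; split; first by move=> a x y /=; rewrite linT linS.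
by move=> x; apply: continuous_comp; [exact: cT|exact: cS].
Qed.

Definition bop_one : bop := Bop bop_id_subproof.
Definition bop_mul (S T : bop) : bop := Bop (bop_comp_subproof S T).

Lemma bop_mulA : associative bop_mul.
Proof. by move=> S T U; apply: val_inj. Qed.
Lemma bop_mul1 : left_id bop_one bop_mul.
Proof. by move=> S; apply: val_inj. Qed.
Lemma bop_mulr1 : right_id bop_one bop_mul.
Proof. by move=> S; apply: val_inj. Qed.
Lemma bop_mulDl : left_distributive bop_mul +%R.
Proof. by move=> S T U; apply: val_inj. Qed.
Lemma bop_mulDr : right_distributive bop_mul +%R.
Proof.
move=> S T U; apply: val_inj; apply/funext => x /=.
case: S => S /= /asboolP[linS _]; rewrite !fctE.
by rewrite -[T x]scale1r linS !scale1r.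
Qed.

HB.instance Definition _ := GRing.Zmodule_isPzRing.Build bop
  bop_mulA bop_mul1 bop_mulr1 bop_mulDl bop_mulDr.

End BoundedOperators.

Section Operators.
Context {R : realType} {H : hilbertType R}.
Implicit Types (x y p q u v : bop H) (A C : set (bop H)).

Definition adjoint_of x y : Prop :=
  forall xi eta : H, <| x xi, eta |> = <| xi, y eta |>.

Definition bpositive x : Prop := forall xi : H, 0 <= <| x xi, xi |>.

Definition projection p : Prop := p * p = p /\ adjoint_of p p.

Definition unitary u : Prop :=
  exists v, [/\ adjoint_of u v, v * u = 1 & u * v = 1].

Definition commutant C : set (bop H) :=
  [set y | forall x, C x -> x * y = y * x].

Definition von_neumann_algebra A : Prop :=
  (forall x y, A x -> adjoint_of x y -> A y) /\ commutant (commutant A) = A.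

Definition vN_factor A : Prop :=
  von_neumann_algebra A /\
  forall z, A z -> commutant A z -> exists c : R[i], z = c *: (1 : bop H).

Definition finite_projection A p : Prop :=
  [/\ A p, projection p &
   forall v w, A v -> adjoint_of v w ->
     w * v = p -> bpositive (p - v * w) -> v * w = p].

Definition semifinite A : Prop :=
  forall e, A e -> commutant A e -> projection e -> e != 0 ->
  exists p, [/\ finite_projection A p, p != 0 & bpositive (e - p)].

(* Only the values of a trace on positive elements are meaningful. *)
Definition pos_part A : set (bop H) := [set x | A x /\ bpositive x].

Local Open Scope ereal_scope.

Definition trace A (tau : bop H -> \bar R) : Prop :=
  [/\ forall x, pos_part A x -> 0 <= tau x,
      forall x y, pos_part A x -> pos_part A y -> tau (x + y)%R = tau x + tau y,
      forall (c : R) x, (0 <= c)%R -> pos_part A x ->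
        tau (c%:C%C *: x)%R = c%:E * tau x &
      forall x y, A x -> adjoint_of x y -> tau (y * x)%R = tau (x * y)%R].

Definition faithful_trace A (tau : bop H -> \bar R) : Prop :=
  forall x, pos_part A x -> tau x = 0 -> x = 0%R.

Definition semifinite_trace A (tau : bop H -> \bar R) : Prop :=
  forall x, pos_part A x -> x != 0%R ->
  exists y, [/\ pos_part A y, y != 0%R, bpositive (x - y)%R & tau y < +oo].

Definition normal_trace A (tau : bop H -> \bar R) : Prop :=
  forall (D : set (bop H)) x,
    D !=set0 -> D `<=` pos_part A ->
    (forall y z, D y -> D z ->
       exists w, [/\ D w, bpositive (w - y)%R & bpositive (w - z)%R]) ->
    A x -> (forall y, D y -> bpositive (x - y)%R) ->
    (forall z, A z -> (forall y, D y -> bpositive (z - y)%R) ->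
       bpositive (z - x)%R) ->
    tau x = ereal_sup [set tau y | y in D].

Definition nsf_trace A (tau : bop H -> \bar R) : Prop :=
  [/\ trace A tau, normal_trace A tau, semifinite_trace A tau &
      faithful_trace A tau].

End Operators.

(* The predual of B(H), and the topology sigma(B(H), B(H)_* ). *)
Section WeakStar.
Context {R : realType} (H : hilbertType R).

Definition square_summable (xi : nat -> H) : Prop :=
  cvgn (series (fun n => hnorm (xi n) ^+ 2)).

(* x |-> tr(t x), with the trace class operator t written as a sum of rank one
   operators. *)
Definition normal_functional (w : bop H -> R[i]) : Prop :=
  exists xi eta : nat -> H, [/\ square_summable xi, square_summable eta &
    forall x : bop H, series (fun n => <| x (xi n), eta n |>) @ \oo --> (w x : R[i]^o)].

Definition predual := {w : bop H -> R[i] | normal_functional w}.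

Definition predual_eval (x : bop H) :
  prod_topology (fun _ : predual => (R[i]^o : topologicalType)) :=
  fun w => sval w x.

Definition weakstar : topologicalType := initial_topology predual_eval.

End WeakStar.

Section Maps.
Context {R : realType} {H : hilbertType R}.
Implicit Types (A C : set (bop H)) (Phi Psi Theta : bop H -> bop H).
Implicit Types (I J Gamma : nat -> bop H -> bop H).

(* Positivity in M_n(B(H)) = B(H^n). *)
Definition mx_positive n (x : 'M[bop H]_n) : Prop :=
  forall xi : 'I_n -> H, 0 <= \sum_i \sum_j <| x i j (xi j), xi i |>.

Definition completely_positive Phi : Prop :=
  linear Phi /\
  forall n (x : 'M[bop H]_n), mx_positive x -> mx_positive (map_mx Phi x).

Definition normal_map Phi : Prop :=
  continuous (Phi : weakstar H -> weakstar H).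

Definition normal_CP Phi : Prop := normal_map Phi /\ completely_positive Phi.

Definition normal_UCP Phi : Prop := normal_CP Phi /\ Phi 1 = 1.

Definition CP_over C : set (bop H -> bop H) :=
  [set Phi | normal_CP Phi /\
     forall a x b, C a -> C b -> Phi (a * x * b) = a * Phi x * b].

Definition UCP_over C : set (bop H -> bop H) :=
  [set Phi | CP_over C Phi /\ Phi 1 = 1].

Definition one_way_right A Theta : Prop :=
  exists Phi Psi, [/\ UCP_over A Phi, CP_over (commutant A) Psi &
    Theta = Phi \o Psi].

Definition one_way_left A Theta : Prop :=
  exists Phi Psi, [/\ CP_over A Phi, UCP_over (commutant A) Psi &
    Theta = Phi \o Psi].

Definition sums_to (S : set nat) I Theta : Prop :=
  forall x, (fun n => \sum_(k < n | (k : nat) \in S) I k x : weakstar H)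
    @ \oo --> (Theta x : weakstar H).

Definition instrument_sum I Theta : Prop :=
  sums_to [set: nat] I Theta /\ normal_UCP Theta.

Definition instrument I : Prop :=
  (forall k, normal_CP (I k)) /\ exists Theta, instrument_sum I Theta.

Definition one_way_instrument A I : Prop :=
  instrument I /\
  ((forall k, one_way_right A (I k)) \/ (forall k, one_way_left A (I k))).

(* The blocks S j are allowed to be empty. *)
Definition coarse_graining Gamma I : Prop :=
  [/\ instrument Gamma, instrument I &
   exists S : nat -> set nat,
     [/\ trivIset [set: nat] S, \bigcup_j S j = [set: nat] &
         forall j, sums_to (S j) I (Gamma j)]].

(* Instruments are considered up to relabelling, so the family indexed by
   pairs (k, i) is listed along some bijection e. *)
Definition linked A J I : Prop :=
  exists K : nat -> nat -> bop H -> bop H,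
    (forall k, one_way_instrument A (K k)) /\
    exists e : nat -> nat * nat, bijective e /\
      coarse_graining J (fun m => I (e m).1 \o K (e m).1 (e m).2).

Definition LOCC A : set (bop H -> bop H) :=
  [set Theta | exists (n : nat) (I : nat -> nat -> bop H -> bop H),
    [/\ one_way_instrument A (I 0%N),
        forall l, (l < n)%N -> linked A (I l.+1) (I l) &
        instrument_sum (I n) Theta]].

End Maps.

Section Unbounded.
Context {R : realType} {H : hilbertType R}.
Implicit Types (X Y : set (H * H)) (A : set (bop H)) (tau : bop H -> \bar R).

(* An unbounded operator is given by its graph. *)
Definition graph (x : bop H) : set (H * H) := [set z | z.2 = x z.1].

Definition gdom X : set H := [set xi | exists eta, X (xi, eta)].

Definition gcomp X Y : set (H * H) :=
  [set z | exists2 m, Y (z.1, m) & X (m, z.2)].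

Definition gadd X Y : set (H * H) :=
  [set z | exists e1 e2, [/\ X (z.1, e1), Y (z.1, e2) & z.2 = e1 + e2]].

Definition gscale (c : R[i]) X : set (H * H) :=
  [set z | exists2 e, X (z.1, e) & z.2 = c *: e].

Definition gadjoint X : set (H * H) :=
  [set w | forall z, X z -> <| z.2, w.1 |> = <| z.1, w.2 |>].

Definition linear_graph X : Prop :=
  [/\ X (0, 0),
      forall (c : R[i]) xi eta xi' eta', X (xi, eta) -> X (xi', eta') ->
        X (c *: xi + xi', c *: eta + eta') &
      forall xi eta eta', X (xi, eta) -> X (xi, eta') -> eta = eta'].

Definition affiliated A X : Prop :=
  forall u, commutant A u -> unitary u ->
  forall z, X z -> X (u z.1, u z.2).

Definition gpositive X : Prop :=
  gadjoint X = X /\ forall z, X z -> 0 <= <| z.2, z.1 |>.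

Local Open Scope ereal_scope.

Definition cofinite_projections A tau (d : R) : set (bop H) :=
  [set p | [/\ A p, projection p & tau (1 - p)%R <= d%:E]].

Definition tau_measurable A tau X : Prop :=
  [/\ linear_graph X, closed X, dense (gdom X), affiliated A X &
      forall d : R, (0 < d)%R ->
        exists2 p, cofinite_projections A tau d p &
          forall xi, gdom X (p xi)].

(* The operator norm; +oo if X is not bounded or not everywhere defined. *)
Definition gnorm X : \bar R :=
  ereal_inf [set M%:E | M in [set M : R | (0 <= M)%R /\
    forall xi, exists2 eta, X (xi, eta) & (hnorm eta <= M * hnorm xi)%R]].

Definition opnorm (x : bop H) : \bar R := gnorm (graph x).

Definition mu A tau X (t : R) : \bar R :=
  ereal_inf [set gnorm (gcomp X (graph p)) | p in cofinite_projections A tau t].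

(* The canonical extension of tau to positive tau-measurable operators. *)
Definition tau_ext A tau X : \bar R :=
  ereal_sup [set tau y | y in [set y | pos_part A y /\
    forall z, X z -> (<| y z.1, z.1 |> <= <| z.2, z.1 |>)%R]].

Definition L1_pos A tau X : Prop :=
  [/\ tau_measurable A tau X, gpositive X & tau_ext A tau X < +oo].

(* Y belongs to L^1(A, tau) and tau(Y) = c, where tau on L^1(A, tau) is the
   linear extension of tau on its positive cone, the vector space operations
   being the strong ones (closures of the algebraic ones). *)
Definition L1_trace A tau Y (c : R[i]) : Prop :=
  exists X1 X2 X3 X4 : set (H * H),
    [/\ L1_pos A tau X1 /\ L1_pos A tau X2,
        L1_pos A tau X3 /\ L1_pos A tau X4,
        Y = closure (gadd (gadd X1 (gscale (-1)%R X2))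
              (gadd (gscale 'i%C X3) (gscale (- 'i%C)%R X4))) &
        c = Complex (fine (tau_ext A tau X1) - fine (tau_ext A tau X2))%R
                    (fine (tau_ext A tau X3) - fine (tau_ext A tau X4))%R].

Definition density_operator A tau (psi : H) X : Prop :=
  L1_pos A tau X /\
  forall a, A a -> L1_trace A tau (closure (gcomp X (graph a))) <| a psi, psi |>.

Definition majorized A tau X Y : Prop :=
  (forall s : \bar R, 0 < s ->
     \int[lebesgue_measure]_(t in [set t : R | (0 < t)%R /\ t%:E <= s])
       mu A tau X t <=
     \int[lebesgue_measure]_(t in [set t : R | (0 < t)%R /\ t%:E <= s])
       mu A tau Y t) /\
  tau_ext A tau X = tau_ext A tau Y.

End Unbounded.

Section Convertibility.
Context {R : realType} {H : hilbertType R}.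

Definition vector_functional (psi : H) (x : bop H) : R[i] := <| x psi, psi |>.

Definition predual_map (Theta : bop H -> bop H) (w : bop H -> R[i]) :
  bop H -> R[i] := w \o Theta.

Definition functional_norm (w : bop H -> R[i]) : \bar R :=
  ereal_sup [set (hnorm (w x : R[i]^o))%:E |
    x in [set x : bop H | (opnorm x <= 1)%E]].

Definition approx_convertible (A : set (bop H)) (psi phi : H) : Prop :=
  forall eps : R, 0 < eps -> exists2 Theta, LOCC A Theta &
    (functional_norm (fun x =>
       predual_map Theta (vector_functional psi) x - vector_functional phi x)%R
     < eps%:E)%E.

End Convertibility.

(* Main.v *)
(* For a vector [xi] let [K_s(xi)] be the supremum of [<a xi, xi>] over the
   effects [a] of [A] with [tau a <= s].  A layer-cake argument along the spectral
   projections of the density of [xi] identifies [K_s(xi)] with the integral of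
   its singular numbers over [(0, s]], so majorisation of the densities of [psi]
   and [phi] means [K_s(psi) <= K_s(phi)] for all [s > 0].

   Convertibility implies majorisation: [K_s] is symmetric in [A] and [A'], that
   is, [K_s(xi)] is also the supremum of [<b xi, xi>] over the positive [b] in
   [A'] whose quadratic form is below [K_s].  Hence an operator [y] dominates
   all effects of trace at most [s] as soon as it dominates all such [b]; one-way
   local maps respect one of the two families each, and so LOCC maps preserve
   this class of operators.  Apply this to [y = (K_s(phi) + d) p + c (1 - p)]
   with [p] the projection onto the line of [phi].

   Majorisation implies convertibility: after truncating both densities, the
   density of [psi] is a limit, in the norm of a trace vector, of convex
   combinations of operators [z rho_phi adj z] with contractions [z] in [A].  This
   is a Frank-Wolfe iteration whose linear problem is solved by matching the
   spectral projections of the gradient with those of [rho_phi].  Such a convex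
   combination is realised by a measurement in [A'] followed by a channel in [A]
   depending on the outcome. *)
Require Import Defs.
From HB Require Import structures.
From mathcomp Require Import all_boot all_order all_algebra.
From mathcomp Require Import sesquilinear complex.
From mathcomp Require Import all_classical all_reals all_analysis measurable_realfun.
From mathcomp Require Import ring lra.
Import Order.TTheory GRing.Theory Num.Theory numFieldNormedType.Exports.
Local Open Scope classical_set_scope.
Local Open Scope ring_scope.
Local Open Scope complex_scope.

Set Implicit Arguments.
Unset Strict Implicit.
Unset Printing Implicit Defensive.

(** * Hilbert spaces and bounded operators *)

(** Two obstacles shape the proof: no trace on the commutant is given, and the densities are
    unbounded. The first is met by describing the commutant side through quadratic forms alone; that
    enough such forms exist rests on the density of the vectors with a bounded density operator,
    which uses that the commutant is a factor. The second is met by working with the resolvent r =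
    (1 + X)^{-1}, whose spectral projections are those of X, and by comparing integrals with Ky Fan
    functionals through layers of height c, with c tending to 0.

    A mixture close to rho_psi in the trace-vector norm need not lie below rho_psi, whereas Kraus
    operators in the commutant exist only for dominated families. The mixture is therefore pushed
    below rho_psi by an explicit operator of A before it is realised.

    Truncating destroys the inequalities K_s(psi) <= K_s(phi) by an additive error. Shrinking psi by
    the factor sqrt(1 - e) restores them: for large s because K_s grows with s, for small s because
    it is concave in s. *)

Section HilbertBasics.
Context {R : realType} {H : hilbertType R}.
Implicit Types (x y z : H) (k : R[i]) (r : R) (C : set H).

Lemma ReD (a b : R[i]) : complex.Re (a + b) = complex.Re a + complex.Re b.
Proof. by case: a b => [? ?] [? ?]. Qed.
Lemma ReN (a : R[i]) : complex.Re (- a) = - complex.Re a.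
Proof. by case: a. Qed.
Lemma ReM_real (r : R) (a : R[i]) : complex.Re (r%:C * a) = r * complex.Re a.
Proof. by case: a => [u v] /=; rewrite mul0r subr0. Qed.
Lemma Reconj (a : R[i]) : complex.Re (Num.conj a) = complex.Re a.
Proof. by case: a. Qed.
Lemma conjCE (a : R[i]) : Num.conj a = (a^*)%C.
Proof. by []. Qed.

Lemma ipDl x y z : <| x + y , z |> = <|x,z|> + <|y,z|>.
Proof. exact: linearDl. Qed.
Lemma ipDr x y z : <| z, x + y |> = <|z,x|> + <|z,y|>.
Proof. exact: linearDr. Qed.
Lemma ipZl k x z : <| k *: x , z |> = k * <|x,z|>.
Proof. exact: linearZl_LR. Qed.
Lemma ipZr k x z : <| z, k *: x |> = Num.conj k * <|z,x|>.
Proof. exact: linearZr_LR. Qed.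
Lemma ipC x y : <| x , y |> = Num.conj <|y,x|>.
Proof. by rewrite [LHS]hermitian_subproof expr0 mul1r. Qed.

(** Real and imaginary parts of the inner product are both values of [rp] (by [ipE]), so estimates
    can be run in the ordered field [R], where [lra] and [nra] apply. *)
Definition rp x y : R := complex.Re <| x , y |>.
Definition nrm x : R := hnorm x.

Lemma rpDl x y z : rp (x + y) z = rp x z + rp y z.
Proof. by rewrite /rp ipDl ReD. Qed.
Lemma rpDr x y z : rp z (x + y) = rp z x + rp z y.
Proof. by rewrite /rp ipDr ReD. Qed.
Lemma rpC x y : rp x y = rp y x.
Proof. by rewrite /rp ipC Reconj. Qed.
Lemma rpZl r x z : rp (r%:C *: x) z = r * rp x z.
Proof. by rewrite /rp ipZl ReM_real. Qed.
Lemma rpZr r x z : rp z (r%:C *: x) = r * rp z x.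
Proof. by rewrite rpC rpZl rpC. Qed.
Lemma rpNl x z : rp (- x) z = - rp x z.
Proof. by rewrite -scaleN1r -(rmorphN1 (real_complex R)) rpZl mulN1r. Qed.
Lemma rpNr x z : rp z (- x) = - rp z x.
Proof. by rewrite rpC rpNl rpC. Qed.
Lemma rpBl x y z : rp (x - y) z = rp x z - rp y z.
Proof. by rewrite rpDl rpNl. Qed.
Lemma rpBr x y z : rp z (x - y) = rp z x - rp z y.
Proof. by rewrite rpDr rpNr. Qed.
Lemma rp0l x : rp 0 x = 0.
Proof. by rewrite -(subrr x) rpBl subrr. Qed.
Lemma rp0r x : rp x 0 = 0.
Proof. by rewrite rpC rp0l. Qed.
Lemma rpi x y : rp ('i%C *: x) y = - rp x ('i%C *: y).
Proof. by rewrite /rp ipZl ipZr; case: <|x,y|> => u v /=; simpc. Qed.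

Definition rpE := (rpDl, rpDr, rpBl, rpBr, rpZl, rpZr, rpNl, rpNr, rp0l, rp0r).

Lemma ipE x y : <|x, y|> = Complex (rp x y) (rp x ('i%C *: y)).
Proof. by rewrite /rp ipZr; case: <|x,y|> => u v /=; simpc. Qed.

Lemma normE x : `|x| = (nrm x)%:C.
Proof.
have := normr_ge0 x; rewrite /nrm /hnorm lecE => /andP[/eqP/=].
by case: `|x| => u v /= ->.
Qed.

Lemma nrm_ge0 x : 0 <= nrm x.
Proof. by have := normr_ge0 x; rewrite normE lecR. Qed.

Lemma nrm2 x : nrm x ^+ 2 = rp x x.
Proof.
rewrite /rp inner_norm normE expr2 /=; ring.
Qed.

Lemma rp_ge0 x : 0 <= rp x x.
Proof. by rewrite -nrm2 sqr_ge0. Qed.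

Lemma ipxx x : <|x, x|> = (rp x x)%:C.
Proof. by rewrite inner_norm normE -nrm2 expr2; apply/eqP; rewrite eq_complex /= !expr2; apply/andP; split; apply/eqP; ring. Qed.

Lemma nrm0 : nrm 0 = 0.
Proof. by rewrite /nrm /hnorm normr0. Qed.

Lemma nrm_eq0 x : nrm x = 0 -> x = 0.
Proof. by move=> E; apply/eqP; rewrite -normr_eq0 normE E. Qed.

Lemma rp_eq0 x : rp x x = 0 -> x = 0.
Proof. by rewrite -nrm2 => /eqP; rewrite sqrf_eq0 => /eqP/nrm_eq0. Qed.

Lemma rp_sq x y : rp x y ^+ 2 <= rp x x * rp y y.
Proof.
have [/rp_eq0->|y0] := eqVneq (rp y y) 0; first by rewrite !rpE expr0n mulr0.
have yp : 0 < rp y y by rewrite lt_def y0 rp_ge0.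
have := rp_ge0 ((rp y y)%:C *: x - (rp x y)%:C *: y).
rewrite !rpE (rpC y x) => h.
have : 0 <= rp y y * (rp x x * rp y y - rp x y ^+ 2) by lra.
by rewrite pmulr_rge0 // subr_ge0.
Qed.

Lemma rp_le x y : `|rp x y| <= nrm x * nrm y.
Proof.
rewrite -(@ler_pXn2r _ 2) ?nnegrE ?mulr_ge0 ?nrm_ge0 //.
by rewrite real_normK ?num_real // exprMn !nrm2 rp_sq.
Qed.

Lemma rp_le' x y : rp x y <= nrm x * nrm y.
Proof. exact: le_trans (ler_norm _) (rp_le x y). Qed.

Lemma nrmD x y : nrm (x + y) <= nrm x + nrm y.
Proof. by have := ler_normD x y; rewrite !normE -rmorphD lecR. Qed.
Lemma nrmN x : nrm (- x) = nrm x.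
Proof. by rewrite /nrm /hnorm normrN. Qed.
Lemma nrmBC x y : nrm (x - y) = nrm (y - x).
Proof. by rewrite -nrmN opprB. Qed.
Lemma nrmB x y : nrm (x - y) <= nrm x + nrm y.
Proof. by rewrite -(nrmN y) nrmD. Qed.
Lemma nrmZ k x : nrm (k *: x) = complex.Re `|k| * nrm x.
Proof.
rewrite {1}/nrm /hnorm normrZ normE; move: (normr_ge0 k); rewrite lecE => /andP[/eqP/=].
by case: `|k| => u v /= ->; simpc.
Qed.
Lemma nrmZr r x : nrm (r%:C *: x) = `|r| * nrm x.
Proof. by rewrite nrmZ normc_def /= expr0n addr0 sqrtr_sqr. Qed.
Lemma nrm_tri y x z : nrm (x - z) <= nrm (x - y) + nrm (y - z).
Proof. by apply: le_trans (nrmD _ _); rewrite addrA subrK. Qed.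
Lemma nrm_le_sq x r : 0 <= r -> rp x x <= r ^+ 2 -> nrm x <= r.
Proof. by move=> r0; rewrite -nrm2 ler_pXn2r ?nnegrE ?nrm_ge0. Qed.
Lemma sq_le_nrm x r : nrm x <= r -> rp x x <= r ^+ 2.
Proof.
move=> h; rewrite -nrm2 ler_pXn2r ?nnegrE ?nrm_ge0 //.
exact: le_trans (nrm_ge0 _) h.
Qed.

Lemma small0 (a : R) : (forall e : R, 0 < e -> a <= e) -> a <= 0.
Proof.
move=> h; rewrite leNgt; apply/negP => a0.
by have := h (a / 2) ltac:(lra); lra.
Qed.

Lemma small_eq x y : (forall e : R, 0 < e -> nrm (x - y) <= e) -> x = y.
Proof.
move=> h; apply/subr0_eq/nrm_eq0/le_anti; rewrite nrm_ge0 andbT.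
exact: small0.
Qed.

Definition hcvg (u : nat -> H) (l : H) : Prop :=
  forall e : R, 0 < e -> exists N, forall n, (N <= n)%N -> nrm (u n - l) <= e.

Lemma hcvg_unique u l l' : hcvg u l -> hcvg u l' -> l = l'.
Proof.
move=> h h'; apply: small_eq => e e0.
have [N hN] := h (e / 2) ltac:(lra); have [M hM] := h' (e / 2) ltac:(lra).
have := hN (maxn N M) (leq_maxl _ _); have := hM (maxn N M) (leq_maxr _ _).
by have := nrm_tri (u (maxn N M)) l l'; have := nrm_tri l (u (maxn N M)) l'; rewrite (nrmBC l (u _)); lra.
Qed.

Lemma hcauchy (u : nat -> H) :
  (forall e : R, 0 < e -> exists N, forall m n, (N <= m)%N -> (N <= n)%N ->
     nrm (u m - u n) <= e) -> exists l, hcvg u l.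
Proof.
move=> hu.
have /cauchy_cvgP : cauchy (u @ \oo).
  apply: cauchy_exP => e; rewrite ltcE => /andP[/= /eqP ei er].
  have [N hN] := hu (complex.Re e / 2) ltac:(rewrite divr_gt0 //).
  exists (u N); exists N => // n /= Nn.
  rewrite -ball_normE /= normE ltcE /= ei eqxx /=.
  apply: le_lt_trans (hN _ _ _ _) _ => //; rewrite /= in er *; lra.
move=> /cvg_ex[l /cvgrPdist_lt hl]; exists l => e e0.
have [|N _ hN] := hl e%:C; first by rewrite ltcR.
exists N => n /hN /=; rewrite normE ltcR nrmBC; exact: ltW.
Qed.

(** Norm closure of [C], with real tolerances to avoid filters on a space normed in [R[i]]. *)
Definition approx C x : Prop :=
  forall e : R, 0 < e -> exists2 c, C c & nrm (x - c) <= e.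

Lemma approx_sub C x : C x -> approx C x.
Proof. by move=> Cx e e0; exists x => //; rewrite subrr nrm0 ltW. Qed.

Lemma approx_cvg C (u : nat -> H) l : (forall n, C (u n)) -> hcvg u l -> approx C l.
Proof.
move=> Cu ul e e0; have [N hN] := ul e e0; exists (u N) => //.
by rewrite nrmBC hN.
Qed.

Lemma invS_small (e : R) : 0 < e -> exists N, forall n, (N <= n)%N -> n.+1%:R^-1 <= e.
Proof.
move=> e0; exists (Num.bound e^-1) => n Nn.
rewrite invf_ple ?posrE ?ltr0n //.
apply: le_trans (ltW (archi_boundP _)) _; first by rewrite invr_ge0 ltW.
by rewrite ler_nat leqW.
Qed.

Lemma approx_seq C x : approx C x ->
  exists u : nat -> H, (forall n, C (u n)) /\ hcvg u x.
Proof.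
move=> h; have h' n : exists c, C c /\ nrm (x - c) <= n.+1%:R^-1.
  by have [|c ? ?] := h n.+1%:R^-1; [rewrite invr_gt0 ltr0n|exists c].
have [u hu] := choice h'; exists u; split=> [n|e e0]; first by case: (hu n).
have [N hN] := invS_small e0; exists N => n /hN; have [_] := hu n.
rewrite nrmBC; exact: le_trans.
Qed.

(** The parallelogram law makes a minimising sequence Cauchy. Its limit [s] lies only in the closure
    of [C], so the variational inequality is obtained by moving towards the competitor from a late
    term [u n] instead of from [s]. *)
Lemma nearest C x : C !=set0 ->
  (forall a b (t : R), C a -> C b -> 0 <= t <= 1 -> C (a + t%:C *: (b - a))) ->
  exists2 s, approx C s & forall c, approx C c -> rp (x - s) (c - s) <= 0.
Proof.
move=> [c0 Cc0] cvx.
pose D := [set rp (x - c) (x - c) | c in C].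
have D0 : D !=set0 by exists (rp (x - c0) (x - c0)); exists c0.
have Dinf : has_inf D by split => //; exists 0 => _ [c _ <-]; exact: rp_ge0.
pose d := inf D.
have dle c : C c -> d <= rp (x - c) (x - c).
  by move=> Cc; apply: ge_inf; [case: Dinf|exists c].
have h n : exists c, C c /\ rp (x - c) (x - c) <= d + n.+1%:R^-1.
  have [|_ [c Cc <-] hc] := @inf_adherent _ D n.+1%:R^-1 _ Dinf.
    by rewrite invr_gt0 ltr0n.
  by exists c; split=> //; exact: ltW.
have [u hu] := choice h.
have mid a b : C a -> C b -> rp (a - b) (a - b) <=
    2 * (rp (x - a) (x - a) - d) + 2 * (rp (x - b) (x - b) - d).
  move=> Ca Cb; have := dle _ (cvx a b (2^-1) Ca Cb ltac:(lra)).
  by rewrite !rpE (rpC a x) (rpC b x) (rpC b a); lra.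
have [s hs] : exists s, hcvg u s.
  apply: hcauchy => e e0.
  have [N hN] := @invS_small (e ^+ 2 / 4) ltac:(rewrite divr_gt0 ?exprn_gt0 //).
  exists N => m n Nm Nn; apply: nrm_le_sq; first exact: ltW.
  have [Cm hm] := hu m; have [Cn hn] := hu n.
  move: (mid _ _ Cm Cn) (hN _ Nm) (hN _ Nn) hm hn.
  by move: (m.+1%:R^-1) (n.+1%:R^-1) => a b; lra.
exists s; first by apply: approx_cvg hs => n; case: (hu n).
have main c : C c -> rp (x - s) (c - s) <= 0.
  move=> Cc; apply: small0 => e e0.
  pose K := rp (c - s) (c - s); have K0 : 0 <= K := rp_ge0 _.
  pose B := 1 + nrm (x - s) + nrm (c - s).
  have B1 : 1 <= B by rewrite /B; have := nrm_ge0 (x - s); have := nrm_ge0 (c - s); lra.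
  (* The second-order term [t * B ^+ 2] then costs at most [e / 2]; [dl] below makes the replacement
     of [s] by [u n] negligible against [t * e]. *)
  pose t := Num.min 1 (e / (2 * B ^+ 2)).
  have t0 : 0 < t by rewrite lt_min ltr01 divr_gt0 // mulr_gt0 // exprn_gt0 //; lra.
  have t1 : t <= 1 by rewrite ge_min lexx.
  have te : t * B ^+ 2 <= e / 2.
    have : t <= e / (2 * B ^+ 2) by rewrite ge_min lexx orbT.
    rewrite ler_pdivlMr; last by rewrite mulr_gt0 // exprn_gt0 //; lra.
    by lra.
  have [N1 hN1] := @invS_small (t * e / 4) ltac:(rewrite divr_gt0 ?mulr_gt0 //).
  pose dl := Num.min 1 (t * e / (16 * B)).
  have dl0 : 0 < dl by rewrite lt_min ltr01 divr_gt0 ?mulr_gt0 //; lra.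
  have [N2 hN2] := hs dl dl0.
  pose n := maxn N1 N2; pose a := u n - s.
  have an : nrm a <= dl by apply: hN2; rewrite leq_maxr.
  have ain := hN1 n (leq_maxl _ _).
  have [Cn hn] := hu n.
  have := dle _ (cvx (u n) c t Cn Cc ltac:(rewrite ltW)).
  have -> : x - (u n + t%:C *: (c - u n)) = (x - u n) - t%:C *: ((c - s) - a).
    by rewrite /a opprD addrA; congr (_ - _ *: _); rewrite opprB addrA subrK.
  have -> : x - u n = (x - s) - a by rewrite /a opprB addrA subrK.
  rewrite [rp (_ - t%:C *: _) _]rpBl !(rpBr _ (t%:C *: _)) !rpZl !rpZr.
  rewrite (rpC (c - s - a)) => hd.
  have {}hd := hd t1 t0.
  have hd2 : rp (x - s - a) (x - s - a) <= d + t * e / 4.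
    have -> : x - s - a = x - u n by rewrite /a opprB addrA subrK.
    by apply: le_trans hn _; rewrite lerD2l.
  set P := rp (x - s - a) (c - s - a) in hd.
  set Q := rp (c - s - a) (c - s - a) in hd.
  have dl1 : dl <= 1 by rewrite ge_min lexx.
  have Qle : Q <= B ^+ 2.
    apply: sq_le_nrm; apply: le_trans (nrmB _ _) _; rewrite /B.
    have := nrm_ge0 (x - s); lra.
  have Ple : rp (x - s) (c - s) <= P + dl * (2 * B).
    rewrite /P (rpBl (x - s) a) !(rpBr (c - s) a).
    have := rp_le' (x - s) a; have := rp_le' a (c - s); have := rp_ge0 a.
    have h1 : nrm (x - s) * nrm a <= B * dl.
      apply: ler_pM; rewrite ?nrm_ge0 // /B; have := nrm_ge0 (c - s); lra.
    have h2 : nrm a * nrm (c - s) <= dl * B.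
      apply: ler_pM; rewrite ?nrm_ge0 // /B; have := nrm_ge0 (x - s); lra.
    by lra.
  have dle' : dl * (16 * B) <= t * e.
    have : dl <= t * e / (16 * B) by rewrite ge_min lexx orbT.
    by rewrite ler_pdivlMr //; lra.
  have tP : 2 * t * P <= t * e / 4 + t * (t * B ^+ 2).
    have : t * (t * Q) <= t * (t * B ^+ 2).
      by rewrite !ler_pM2l.
    by lra.
  have : t * (2 * P) <= t * (e / 4 + e / 2).
    have : t * (t * B ^+ 2) <= t * (e / 2) by rewrite ler_pM2l.
    by lra.
  rewrite ler_pM2l // => hP.
  have tee : t * e <= e by rewrite ger_pMl.
  have : dl * (2 * B) <= e / 8 by lra.
  lra.
move=> c hc; apply: small0 => e e0.
have B0 : 0 < 1 + nrm (x - s) by have := nrm_ge0 (x - s); lra.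
have [|c' Cc' cc'] := hc (e / (1 + nrm (x - s))); first by rewrite divr_gt0.
have -> : c - s = (c - c') + (c' - s) by rewrite addrA subrK.
rewrite rpDr; have := main _ Cc'; have := rp_le' (x - s) (c - c').
move: cc'; rewrite ler_pdivlMr // => cc'.
have : nrm (x - s) * nrm (c - c') <= (1 + nrm (x - s)) * nrm (c - c').
  by rewrite ler_wpM2r ?nrm_ge0 //; lra.
by lra.
Qed.

End HilbertBasics.

Section Operators.
Context {R : realType} {H : hilbertType R}.
Implicit Types (xi eta zeta : H) (k : R[i]) (r : R) (C : set H) (x y z p q u v w : bop H).

Lemma bopP x y : (forall xi, x xi = y xi) -> x = y.
Proof. by move=> h; apply/val_inj/funext. Qed.

Lemma bop_rpP x y : (forall xi eta, rp (x xi) eta = rp (y xi) eta) -> x = y.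
Proof.
by move=> h; apply: bopP => xi; apply/subr0_eq/rp_eq0; rewrite rpBl h subrr.
Qed.

Lemma bop_lin x k xi eta : x (k *: xi + eta) = k *: x xi + x eta.
Proof. by case: x => f /= /asboolP[lf _]; rewrite lf. Qed.
Lemma bopD x xi eta : x (xi + eta) = x xi + x eta.
Proof. by rewrite -{1}(scale1r xi) bop_lin scale1r. Qed.
Lemma bop0 x : x 0 = 0.
Proof. by apply: (addrI (x 0)); rewrite -bopD !addr0. Qed.
Lemma bopZ x k xi : x (k *: xi) = k *: x xi.
Proof. by rewrite -(addr0 (k *: xi)) bop_lin bop0 addr0. Qed.
Lemma bopN x xi : x (- xi) = - x xi.
Proof. by rewrite -scaleN1r bopZ scaleN1r. Qed.
Lemma bopB x xi eta : x (xi - eta) = x xi - x eta.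
Proof. by rewrite bopD bopN. Qed.

Lemma addbE x y xi : (x + y) xi = x xi + y xi. Proof. by []. Qed.
Lemma oppbE x xi : (- x) xi = - x xi. Proof. by []. Qed.
Lemma subbE x y xi : (x - y) xi = x xi - y xi. Proof. by []. Qed.
Lemma mulbE x y xi : (x * y) xi = x (y xi). Proof. by []. Qed.
Lemma onebE xi : (1 : bop H) xi = xi. Proof. by []. Qed.
Lemma zerobE xi : (0 : bop H) xi = 0. Proof. by []. Qed.
Lemma scalebE k x xi : (k *: x) xi = k *: x xi. Proof. by []. Qed.
Definition bE := (addbE, oppbE, subbE, mulbE, onebE, zerobE, scalebE).

Lemma scalebAl k x y : k *: (x * y) = (k *: x) * y.
Proof. exact: bopP. Qed.
Lemma scalebAr k x y : k *: (x * y) = x * (k *: y).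
Proof. by apply: bopP => xi; rewrite !bE bopZ. Qed.

Lemma bop_bound x : exists2 M : R, 0 < M & forall xi, nrm (x xi) <= M * nrm xi.
Proof.
have : continuous x by case: x => f /= /asboolP[].
move=> /(_ 0) /cvgrPdist_lt /(_ 1 ltr01) /nbhs_ballP[e /= e0 he].
have [er ei] : 0 < complex.Re e /\ complex.Im e = 0.
  by move: e0; rewrite ltcE => /andP[/eqP/= ? ?].
exists (2 / complex.Re e) => [|xi]; first by rewrite divr_gt0.
have [/nrm_eq0->|x0] := eqVneq (nrm xi) 0.
  by rewrite bop0 nrm0 mulr0.
have xp : 0 < nrm xi by rewrite lt_def x0 nrm_ge0.
pose c := complex.Re e / (2 * nrm xi).
have c0 : 0 < c by rewrite divr_gt0 // mulr_gt0.
have := he (c%:C *: xi); rewrite -ball_normE /= sub0r normrN !normE nrmZr.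
rewrite bop0 sub0r nrmN bopZ nrmZr !ltcE /= ei eqxx /= (gtr0_norm c0).
have cx : c * nrm xi = complex.Re e / 2 by rewrite /c; field.
rewrite cx => /(_ ltac:(lra)) h.
rewrite -(ler_pM2l c0) mulrCA cx; apply: le_trans (ltW h) _.
by rewrite le_eqVlt; apply/orP; left; apply/eqP; field; rewrite gt_eqF.
Qed.

Lemma mkbop (f : H -> H) (M : R) :
  (forall k xi eta, f (k *: xi + eta) = k *: f xi + f eta) ->
  (forall xi, nrm (f xi) <= M * nrm xi) -> {T : bop H | forall xi, T xi = f xi}.
Proof.
move=> lf bf.
have cf : f \in @bounded_linear R H.
  apply/asboolP; split=> // xi; apply/cvgrPdist_lt => e.
  rewrite ltcE => /andP[/eqP/= ei er].
  have fB a b : f (a - b) = f a - f b.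
    have := lf (-1) b a; rewrite !scaleN1r => h.
    by rewrite addrC h addrC.
  have M1 : 0 < 1 + `|M| by have := normr_ge0 M; lra.
  near=> t; rewrite -fB normE ltcE /= ei eqxx /=.
  apply: le_lt_trans (bf _) _.
  apply: (@le_lt_trans _ _ ((1 + `|M|) * nrm (xi - t))).
    by rewrite ler_wpM2r ?nrm_ge0 //; have := ler_norm M; lra.
  rewrite mulrC -ltr_pdivlMr //.
  have : `|xi - t| < (complex.Re e / (1 + `|M|))%:C.
    near: t; apply/nbhs_ballP; exists (complex.Re e / (1 + `|M|))%:C.
      by rewrite /= ltcR divr_gt0.
    by move=> t /=; rewrite -ball_normE.
  by rewrite normE ltcR.
by exists (Bop cf).
Unshelve. all: by end_near. Qed.

Definition subsp C : Prop := C 0 /\ forall k xi eta, C xi -> C eta -> C (k *: xi + eta).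

Lemma subspD C xi eta : subsp C -> C xi -> C eta -> C (xi + eta).
Proof. by move=> [_ h] hx hy; rewrite -(scale1r xi); apply: h. Qed.
Lemma subspZ C k xi : subsp C -> C xi -> C (k *: xi).
Proof. by move=> [h0 h] hx; rewrite -(addr0 (_ *: _)); apply: h. Qed.
Lemma subspN C xi : subsp C -> C xi -> C (- xi).
Proof. by move=> h hx; rewrite -scaleN1r; exact: subspZ. Qed.
Lemma subspB C xi eta : subsp C -> C xi -> C eta -> C (xi - eta).
Proof. by move=> h hx hy; apply: subspD => //; exact: subspN. Qed.

Lemma approx_subsp C : subsp C -> subsp (approx C).
Proof.
move=> sC; split; first by apply: approx_sub; case: sC.
move=> k x y hx hy e e0.
have k0 : 0 <= complex.Re `|k| by have := normr_ge0 k; rewrite lecE => /andP[].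
have [|c Cc hc] := hx (e / (2 * (1 + complex.Re `|k|))).
  by rewrite divr_gt0 // mulr_gt0 //; lra.
have [d Cd hd] := hy (e / 2) ltac:(lra).
exists (k *: c + d); first by case: sC => _; exact.
rewrite opprD addrACA -scalerBr; apply: le_trans (nrmD _ _) _; rewrite nrmZ.
move: hc; rewrite ler_pdivlMr; last by rewrite mulr_gt0 //; lra.
have := nrm_ge0 (x - c); nra.
Qed.

Lemma orth_decomp C xi : subsp C ->
  exists2 s, approx C s & forall c, C c -> rp (xi - s) c = 0.
Proof.
move=> sC; have [||s hs hs'] := @nearest R H C xi; first by exists 0; case: sC.
  by move=> a b t Ca Cb _; apply: subspD => //; apply: subspZ => //; exact: subspB.
exists s => // c Cc.
have h d : C d -> rp (xi - s) d <= 0.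
  move=> Cd; have := hs' (d + s); rewrite addrK; apply.
  by apply: (subspD (approx_subsp sC)) => //; exact: approx_sub.
have := h c Cc; have := h (- c) (subspN sC Cc); rewrite rpNr; lra.
Qed.

Lemma orth_ip C xi : subsp C -> (forall c, C c -> rp xi c = 0) ->
  forall c, C c -> <|xi, c|> = 0.
Proof.
move=> sC h c Cc; rewrite ipE h // h //; exact: subspZ.
Qed.

Lemma orth_approx C xi c : approx C c -> (forall c, C c -> rp xi c = 0) -> rp xi c = 0.
Proof.
move=> hc h; suff : `|rp xi c| <= 0 by rewrite normr_le0 => /eqP.
apply: small0 => e e0.
have x0 : 0 < 1 + nrm xi by have := nrm_ge0 xi; lra.
have [|d Cd hd] := hc (e / (1 + nrm xi)); first by rewrite divr_gt0.
rewrite -(subrK d c) rpDr (h d) // addr0; apply: le_trans (rp_le _ _) _.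
move: hd; rewrite ler_pdivlMr // => hd; have := nrm_ge0 (c - d); lra.
Qed.

(** Orthogonality of the residue characterises the nearest point ([uniq]), and this uniqueness
    yields linearity and idempotence. *)
Lemma orth_proj C : subsp C -> exists p, [/\ projection p,
  forall xi, approx C (p xi) & forall xi c, approx C c -> rp (xi - p xi) c = 0].
Proof.
move=> sC; have [f hf] := choice (fun xi => let: ex_intro2 s a b := orth_decomp xi sC in
   ex_intro (fun s => approx C s /\ forall c, C c -> rp (xi - s) c = 0) s (conj a b)).
have fa xi : approx C (f xi) by case: (hf xi).
have fo xi c : approx C c -> rp (xi - f xi) c = 0.
  by move=> Cc; apply: (orth_approx Cc); case: (hf xi).
have aC := approx_subsp sC.
have uniq xi s : approx C s -> (forall c, approx C c -> rp (xi - s) c = 0) -> s = f xi.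
  move=> Cs hs; apply/subr0_eq/rp_eq0.
  have Cd : approx C (s - f xi) by apply: (subspB aC).
  have := hs _ Cd; have := fo xi _ Cd; rewrite !rpBl; lra.
have flin k xi eta : f (k *: xi + eta) = k *: f xi + f eta.
  apply/esym/uniq; first by case: aC => _; exact.
  move=> c Cc; rewrite opprD addrACA -scalerBr rpDl (fo eta) // addr0.
  have -> : rp (k *: (xi - f xi)) c = complex.Re (k * <|xi - f xi, c|>) by rewrite /rp ipZl.
  by rewrite (orth_ip aC (fo xi)) // mulr0.
have fb xi : nrm (f xi) <= 1 * nrm xi.
  rewrite mul1r; apply: nrm_le_sq; first exact: nrm_ge0.
  have := fo xi (f xi) (fa xi); have := rp_ge0 (xi - f xi).
  by rewrite nrm2 !rpE (rpC (f xi) xi); lra.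
have [p hp] := mkbop flin fb.
have sa xi eta : <|p xi, eta|> = <|xi, p eta|>.
  apply/eqP; rewrite -subr_eq0; apply/eqP.
  have h1 : <|eta - p eta, p xi|> = 0.
    by rewrite hp (orth_ip aC (fo _)) // hp.
  have h2 : <|xi - p xi, p eta|> = 0.
    by rewrite hp (orth_ip aC (fo _)) // hp.
  move: h1; rewrite ipC => /eqP; rewrite conjC_eq0 => /eqP h1.
  move: h1 h2; rewrite -(scaleN1r (p eta)) ipDr ipZr -(scaleN1r (p xi)) ipDl ipZl.
  rewrite rmorphN1 !mulN1r => /eqP; rewrite subr_eq0 => /eqP -> /eqP.
  by rewrite subr_eq0 => /eqP ->; rewrite subrr.
exists p; split; first split=> //.
- apply: bopP => xi; rewrite mulbE !hp; apply/esym/uniq => // c Cc.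
  by rewrite subrr rp0l.
- by move=> xi; rewrite hp.
- by move=> xi c Cc; rewrite hp fo.
Qed.

Lemma rp_xi xi : rp xi ('i%C *: xi) = 0.
Proof. have := rpi xi xi; rewrite rpC; lra. Qed.

Lemma rp_ii xi eta : rp ('i%C *: xi) ('i%C *: eta) = rp xi eta.
Proof. by rewrite rpi scalerA -expr2 sqr_i scaleN1r rpNr opprK. Qed.

Lemma ip_le xi eta : complex.Re `|<|xi, eta|>| <= nrm xi * nrm eta.
Proof.
rewrite normc_def /=; set a := complex.Re _; set b := complex.Im _.
have -> : nrm xi * nrm eta = Num.sqrt (rp xi xi * rp eta eta).
  by rewrite -!nrm2 -exprMn sqrtr_sqr ger0_norm // mulr_ge0 ?nrm_ge0.
rewrite ler_sqrt ?mulr_ge0 ?rp_ge0 //.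
have ha : a = rp xi eta by [].
have hb : b = rp xi ('i%C *: eta) by rewrite /b ipE.
have [->|ab0] := eqVneq (a ^+ 2 + b ^+ 2) 0; first by rewrite mulr_ge0 ?rp_ge0.
have abp : 0 < a ^+ 2 + b ^+ 2 by rewrite lt_def ab0 addr_ge0 ?sqr_ge0.
have := rp_sq xi (a%:C *: eta + b%:C *: ('i%C *: eta)).
have h0 := rp_xi eta; have h1 := rp_ii eta eta.
have h2 : rp ('i%C *: eta) eta = 0 by rewrite rpC.
rewrite !rpE h0 h1 h2 -ha -hb => h.
rewrite -(ler_pM2l abp); lra.
Qed.

Lemma riesz (f : H -> R[i]) (M : R) :
  (forall k xi eta, f (k *: xi + eta) = k * f xi + f eta) ->
  (forall xi, complex.Re `|f xi| <= M * nrm xi) ->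
  exists v : H, forall xi, f xi = <|xi, v|>.
Proof.
move=> flin fb.
have f0 : f 0 = 0.
  by have := flin 1 0 0; rewrite scale1r addr0 mul1r => /eqP; rewrite -subr_eq subrr => /eqP.
have fD xi eta : f (xi + eta) = f xi + f eta by have := flin 1 xi eta; rewrite scale1r mul1r.
have fZ k xi : f (k *: xi) = k * f xi by have := flin k xi 0; rewrite !addr0 f0 addr0.
pose K := [set xi | f xi = 0].
have sK : subsp K.
  by split => // k x y; rewrite /K /= => hx hy; rewrite flin hx hy mulr0 addr0.
have cK xi : approx K xi -> f xi = 0.
  move=> h; apply/normr0_eq0.
  have n0 : 0 <= complex.Re `|f xi| by have := normr_ge0 (f xi); rewrite lecE => /andP[].
  suff e0 : complex.Re `|f xi| <= 0.
    by apply/eqP; rewrite eq_complex /=; move: (normr_ge0 (f xi)); rewrite lecE => /andP[-> _]; rewrite andbT eq_le e0.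
  apply: small0 => e e0.
  have M1 : 0 < 1 + `|M| by have := normr_ge0 M; lra.
  have [|c Cc hc] := h (e / (1 + `|M|)); first by rewrite divr_gt0.
  rewrite -(subrK c xi) fD Cc addr0; apply: le_trans (fb _) _.
  move: hc; rewrite ler_pdivlMr // => hc.
  have : M * nrm (xi - c) <= (1 + `|M|) * nrm (xi - c).
    by rewrite ler_wpM2r ?nrm_ge0 //; have := ler_norm M; lra.
  lra.
have [[x0 fx0]|h] := pselect (exists xi, f xi != 0); last first.
  exists 0 => xi; rewrite ipE scaler0 !rp0r.
  by have [//|/eqP n] := eqVneq (f xi) 0; case: h; exists xi; apply/eqP.
have [p [_ pK po]] := orth_proj sK.
pose z := x0 - p x0.
have fz : f z = f x0.
  by rewrite /z -scaleN1r fD fZ (cK _ (pK _)) mulr0 addr0.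
have fz0 : f z != 0 by rewrite fz.
have zz0 : <|z, z|> != 0.
  apply: contraNneq fz0; rewrite ipxx => /(congr1 (@complex.Re R)) /= /rp_eq0 ->.
  by rewrite f0.
have hz xi : <|xi, z|> = f xi / f z * <|z, z|>.
  have hK : K (xi - (f xi / f z) *: z).
    by rewrite /K /= -scaleNr addrC flin mulNr divfK // addNr.
  have o c : K c -> rp z c = 0 by move=> Kc; apply: po; exact: approx_sub.
  have := orth_ip sK o hK; rewrite ipC => /eqP; rewrite conjC_eq0 => /eqP.
  by rewrite -scaleNr ipDl ipZl mulNr => /eqP; rewrite subr_eq0 => /eqP.
exists ((Num.conj (f z) / <|z, z|>) *: z) => xi.
rewrite ipZr rmorphM fmorphV /= conjCK -(ipC z z) (hz xi).
by move: (f xi) (f z) (<|z, z|>) fz0 zz0 => a b c b0 c0; field; rewrite b0 c0.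
Qed.

Lemma adjoint_ex x : exists y, adjoint_of x y.
Proof.
have [M M0 hM] := bop_bound x.
have h eta : exists v : H, forall xi, <|x xi, eta|> = <|xi, v|>.
  apply: (@riesz _ (M * nrm eta)) => [k a b|xi].
    by rewrite bop_lin ipDl ipZl.
  apply: le_trans (ip_le _ _) _; rewrite mulrAC; apply: ler_wpM2r => //.
  exact: nrm_ge0.
have [f hf] := choice h.
have inj a b : (forall xi, <|xi, a|> = <|xi, b|>) -> a = b.
  by move=> E; apply/subr0_eq/rp_eq0; rewrite rpBr /rp E subrr.
have flin k a b : f (k *: a + b) = k *: f a + f b.
  by apply: inj => xi; rewrite -hf !ipDr !ipZr !hf.
have fb a : nrm (f a) <= M * nrm a.
  have [->|n0] := eqVneq (nrm (f a)) 0; first by rewrite mulr_ge0 ?nrm_ge0 // ltW.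
  have np : 0 < nrm (f a) by rewrite lt_def n0 nrm_ge0.
  rewrite -(ler_pM2l np) -expr2 nrm2 /rp -hf.
  apply: le_trans (rp_le' _ _) _.
  by rewrite mulrA [_ * M]mulrC; apply: ler_wpM2r; rewrite ?nrm_ge0.
have [y hy] := mkbop flin fb.
by exists y => xi eta; rewrite hf hy.
Qed.

Definition adj x : bop H := xget 0 [set y | adjoint_of x y].

Lemma adjP x : adjoint_of x (adj x).
Proof. by rewrite /adj; case: xgetP => [y _ //|n]; have [y /n] := adjoint_ex x. Qed.

Lemma adj_unique x y : adjoint_of x y -> y = adj x.
Proof.
move=> h; apply: bopP => eta; apply/subr0_eq/rp_eq0.
by rewrite rpBr /rp -h -adjP subrr.
Qed.

Lemma rp_adj x xi eta : rp (x xi) eta = rp xi (adj x eta).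
Proof. by rewrite /rp adjP. Qed.

Lemma adj_of_rp x y : (forall xi eta, rp (x xi) eta = rp xi (y eta)) -> adj x = y.
Proof.
move=> h; apply/esym/adj_unique => xi eta; rewrite !ipE h; congr Complex.
by rewrite -bopZ -h.
Qed.

Lemma adjK x : adj (adj x) = x.
Proof. by apply: adj_of_rp => xi eta; rewrite rpC -rp_adj rpC. Qed.
Lemma adjM x y : adj (x * y) = adj y * adj x.
Proof. by apply: adj_of_rp => xi eta; rewrite !bE !rp_adj. Qed.
Lemma adjD x y : adj (x + y) = adj x + adj y.
Proof. by apply: adj_of_rp => xi eta; rewrite !bE rpDl rpDr !rp_adj. Qed.
Lemma adjN x : adj (- x) = - adj x.
Proof. by apply: adj_of_rp => xi eta; rewrite !bE rpNl rpNr !rp_adj. Qed.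
Lemma adjB x y : adj (x - y) = adj x - adj y.
Proof. by rewrite adjD adjN. Qed.
Lemma adj1 : adj 1 = 1 :> bop H.
Proof. exact: adj_of_rp. Qed.
Lemma adj0 : adj 0 = 0 :> bop H.
Proof. by apply: adj_of_rp => xi eta; rewrite !bE rp0l rp0r. Qed.
Lemma adjZ k x : adj (k *: x) = Num.conj k *: adj x.
Proof.
by apply/esym/adj_unique => xi eta; rewrite !bE ipZl ipZr conjCK adjP.
Qed.
Lemma adjZr r x : adj (r%:C *: x) = r%:C *: adj x.
Proof. by rewrite adjZ conjCE conjc_real. Qed.

Definition sa x : Prop := adj x = x.

Lemma sa_rp x xi eta : sa x -> rp (x xi) eta = rp xi (x eta).
Proof. by move=> h; rewrite rp_adj h. Qed.

Lemma saP x : sa x <-> adjoint_of x x.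
Proof. by split=> [h|/adj_unique/esym //]; rewrite -{2}h; exact: adjP. Qed.

(** [F] is the graph of a bounded operator on a subspace; it is extended by continuity to the
    closure and by zero on the orthogonal complement. The last clause is how such extensions are
    placed in a von Neumann algebra: an operator that preserves [F] together with its adjoint
    commutes with [T]. *)
Lemma extend (F : set (H * H)) (M : R) :
  F (0, 0) ->
  (forall k xi xi' eta eta', F (xi, xi') -> F (eta, eta') ->
     F (k *: xi + eta, k *: xi' + eta')) ->
  (forall xi xi', F (xi, xi') -> nrm xi' <= M * nrm xi) ->
  exists T : bop H, [/\ forall xi xi', F (xi, xi') -> T xi = xi',
    forall xi, (forall eta eta', F (eta, eta') -> rp xi eta = 0) -> T xi = 0,
    (forall C, (forall xi xi', F (xi, xi') -> C xi') -> forall xi, approx C (T xi)) &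
    forall u, (forall xi xi', F (xi, xi') -> F (u xi, u xi')) ->
      (forall xi xi', F (xi, xi') -> F (adj u xi, adj u xi')) -> u * T = T * u].
Proof.
move=> F0 Flin Fb.
pose D := [set xi | exists xi', F (xi, xi')].
have sD : subsp D.
  by split; [exists 0|move=> k a b [a' ha] [b' hb]; exists (k *: a' + b'); exact: Flin].
have [p [[pp psa] pD po]] := orth_proj sD.
have {}psa : sa p by apply/saP.
have pid xi : approx D xi -> p xi = xi.
  move=> h; apply/esym/subr0_eq/rp_eq0; apply: po.
  by apply: (subspB (approx_subsp sD)).
have pn xi : nrm (p xi) <= nrm xi.
  apply: nrm_le_sq; first exact: nrm_ge0.
  have := po xi (p xi) (pD xi); have := rp_ge0 (xi - p xi).
  by rewrite nrm2 !rpE (rpC (p xi) xi); lra.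
pose K : R := 1 + `|M|.
have K1 : 1 <= K by rewrite /K; have := normr_ge0 M; lra.
have FbK xi xi' : F (xi, xi') -> nrm xi' <= K * nrm xi.
  move=> /Fb h; apply: le_trans h _; rewrite ler_wpM2r ?nrm_ge0 //.
  by rewrite /K; have := ler_norm M; lra.
have FB a a' b b' : F (a, a') -> F (b, b') -> F (a - b, a' - b').
  move=> ha hb; have := Flin (-1) _ _ _ _ hb ha.
  by rewrite !scaleN1r ![- _ + _]addrC.
(* [G xi eta] says that [(p xi, eta)] is a limit of points of [F]; the extension is the function
   with graph [G]. *)
pose G xi eta := forall e : R, 0 < e ->
  exists d d', [/\ F (d, d'), nrm (p xi - d) <= e & nrm (eta - d') <= e].
have Gex xi : exists eta, G xi eta.
  have [u [Du ul]] := approx_seq (pD xi).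
  have [u' hu'] := choice Du.
  have [l hl] : exists l, hcvg u' l.
    apply: hcauchy => e e0.
    have [|N hN] := ul (e / (2 * K)); first by rewrite divr_gt0 //; lra.
    exists N => m n Nm Nn.
    have := FbK _ _ (FB _ _ _ _ (hu' m) (hu' n)).
    have := hN _ Nm; have := hN _ Nn; rewrite !ler_pdivlMr; try lra.
    have := nrm_tri (p xi) (u m) (u n); rewrite (nrmBC (p xi) (u n)).
    set a := nrm (u m - p xi); set b := nrm (u n - p xi); set c := nrm (u m - u n).
    move=> h h1 h2 h3; apply: le_trans h3 _.
    have : K * c <= K * (a + b) by rewrite ler_wpM2l //; lra.
    lra.
  exists l => e e0; have [N hN] := ul e e0; have [N' hN'] := hl e e0.
  exists (u (maxn N N')), (u' (maxn N N')); split; first exact: hu'.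
    by rewrite nrmBC hN // leq_maxl.
  by rewrite nrmBC hN' // leq_maxr.
have [f hf] := choice Gex.
have Guniq xi eta : G xi eta -> eta = f xi.
  move=> h; apply: small_eq => e e0.
  have [|d [d' [Fd h1 h2]]] := h (e / (4 * K)); first by rewrite divr_gt0 //; lra.
  have [|c [c' [Fc h3 h4]]] := hf xi (e / (4 * K)); first by rewrite divr_gt0 //; lra.
  have := FbK _ _ (FB _ _ _ _ Fd Fc).
  have := nrm_tri d' eta (f xi); have := nrm_tri c' d' (f xi).
  have := nrm_tri (p xi) d c; rewrite (nrmBC d) (nrmBC c').
  move: h1 h2 h3 h4; rewrite !ler_pdivlMr; try lra.
  have := nrm_ge0 (eta - d'); have := nrm_ge0 (f xi - c').
  set a := nrm (eta - d'); set b := nrm (f xi - c').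
  have aK (t : R) : 0 <= t -> t * (4 * K) <= e -> t <= e / 4.
    by move=> t0 ht; have : t * 1 <= t * K by [rewrite ler_wpM2l]; lra.
  move=> b0 a0 h1 /(aK _ a0) h2 h3 /(aK _ b0) h4.
  set x := nrm (c - d); set y := nrm (d - p xi); move=> h5 h6 h7 h8.
  have : K * x <= K * (nrm (p xi - d) + nrm (p xi - c)).
    by rewrite ler_wpM2l //; [lra|rewrite /x nrmBC; move: h5; rewrite /y nrmBC (nrmBC d)].
  lra.
have Gb xi eta : G xi eta -> nrm eta <= K * nrm xi.
  move=> h; suff : nrm eta - K * nrm xi <= 0 by lra.
  apply: small0 => e e0.
  have [|d [d' [Fd h1 h2]]] := h (e / (2 * K)); first by rewrite divr_gt0 //; lra.
  have := FbK _ _ Fd; have := nrm_tri d' eta 0; have := nrm_tri (p xi) d 0.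
  have := pn xi; rewrite !subr0 (nrmBC d); move: h1 h2.
  rewrite !ler_pdivlMr; try lra; have := nrm_ge0 (eta - d').
  set a := nrm (eta - d'); set b := nrm (p xi - d) => a0 h1 h2.
  have h3 : a * 1 <= a * K by rewrite ler_wpM2l.
  move=> h4 h5 h6 h7.
  have : K * nrm d <= K * (b + nrm xi) by rewrite ler_wpM2l //; lra.
  lra.
have Glin k xi eta xi' eta' : G xi xi' -> G eta eta' -> G (k *: xi + eta) (k *: xi' + eta').
  move=> h1 h2 e e0; pose L := 1 + complex.Re `|k|.
  have k0 : 0 <= complex.Re `|k| by have := normr_ge0 k; rewrite lecE => /andP[].
  have [|d [d' [Fd h3 h4]]] := h1 (e / (2 * L)); first by rewrite divr_gt0 // /L; lra.
  have [c [c' [Fc h5 h6]]] := h2 (e / 2) ltac:(lra).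
  have hk (a b : H) : nrm (a - b) <= e / (2 * L) -> nrm (k *: (a - b)) <= e / 2.
    rewrite nrmZ ler_pdivlMr /L; last by lra.
    by have := nrm_ge0 (a - b); nra.
  exists (k *: d + c), (k *: d' + c'); split; first exact: Flin.
    rewrite bop_lin opprD addrACA -scalerBr; apply: le_trans (nrmD _ _) _.
    by have := hk _ _ h3; lra.
  rewrite opprD addrACA -scalerBr; apply: le_trans (nrmD _ _) _.
  by have := hk _ _ h4; lra.
have [T hT] : {T : bop H | forall xi, T xi = f xi}.
  apply: (@mkbop _ K) => [k xi eta|xi]; last exact: Gb.
  by apply/esym/Guniq/Glin.
have GT xi : G xi (T xi) by rewrite hT.
have TG xi eta : G xi eta -> T xi = eta by move=> h; rewrite hT -(Guniq _ _ h).
exists T; split.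
- move=> xi xi' Fx; apply: TG => e e0; exists xi, xi'; split=> //.
    by rewrite pid ?subrr ?nrm0 ?ltW //; apply: approx_sub; exists xi'.
  by rewrite subrr nrm0 ltW.
- move=> xi h; apply: TG => e e0; exists 0, 0; split=> //; last by rewrite subrr nrm0 ltW.
  suff -> : p xi = 0 by rewrite subrr nrm0 ltW.
  have h' c : D c -> rp xi c = 0 by move=> [c' /h].
  by apply/rp_eq0; rewrite rp_adj psa -mulbE pp; exact: (orth_approx (pD xi) h').
- move=> C hC xi e e0; have [d [d' [Fd h1 h2]]] := GT xi e e0.
  by exists d' => //; exact: hC Fd.
- move=> u hu hu'.
  have up xi : u (p xi) = p (u xi).
    have uD : approx D (u (p xi)).
      move=> e e0; have [M' M0 hM] := bop_bound u.
      have [|c [c' Fc] hc] := pD xi (e / M'); first by rewrite divr_gt0.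
      exists (u c); first by exists (u c'); exact: hu.
      rewrite -bopB; apply: le_trans (hM _) _.
      by rewrite mulrC -ler_pdivlMr.
    rewrite -(pid _ uD); apply/subr0_eq/rp_eq0; rewrite -bopB -bopB.
    set w := u (p xi - xi).
    rewrite rp_adj psa -mulbE pp rp_adj.
    have -> : p xi - xi = - (xi - p xi) by rewrite opprB.
    rewrite rpNl po ?oppr0 // => e e0.
    have [M' M0 hM] := bop_bound (adj u).
    have [|c [c' Fc] hc] := pD w (e / M'); first by rewrite divr_gt0.
    exists (adj u c); first by exists (adj u c'); exact: hu'.
    rewrite -bopB; apply: le_trans (hM _) _.
    by rewrite mulrC -ler_pdivlMr.
  apply: bopP => xi; rewrite !bE; apply/esym/TG => e e0.
  have [M' M0 hM] := bop_bound u.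
  have [|d [d' [Fd h1 h2]]] := GT xi (e / M'); first by rewrite divr_gt0.
  exists (u d), (u d'); split; first exact: hu.
    by rewrite -up -bopB; apply: le_trans (hM _) _; rewrite mulrC -ler_pdivlMr.
  by rewrite -bopB; apply: le_trans (hM _) _; rewrite mulrC -ler_pdivlMr.
Qed.

End Operators.

(** * Positive operators and spectral projections *)

Ltac nc := apply: bop_rpP => ? ?; rewrite ?bE ?(bopD, bopN, bopZ, bop0)
  ?(rpDl, rpBl, rpNl, rpZl, rp0l); try ring.

Section Positive.
Context {R : realType} {H : hilbertType R}.
Implicit Types (xi eta zeta : H) (k : R[i]) (r t : R) (C : set H) (x y z p q u v w a b h e s : bop H).

Definition qf x xi : R := rp (x xi) xi.
(** Only quadratic forms are compared; self-adjointness travels separately, in [sa] and [pos]. *)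
Definition ple x y : Prop := forall xi, qf x xi <= qf y xi.
Definition cst (r : R) : bop H := r%:C *: (1 : bop H).
Definition pos x : Prop := sa x /\ ple 0 x.

Lemma qfD x y xi : qf (x + y) xi = qf x xi + qf y xi.
Proof. by rewrite /qf !bE rpDl. Qed.
Lemma qfN x xi : qf (- x) xi = - qf x xi.
Proof. by rewrite /qf !bE rpNl. Qed.
Lemma qfB x y xi : qf (x - y) xi = qf x xi - qf y xi.
Proof. by rewrite qfD qfN. Qed.
Lemma qfZ r x xi : qf (r%:C *: x) xi = r * qf x xi.
Proof. by rewrite /qf !bE rpZl. Qed.
Lemma qf1 xi : qf 1 xi = rp xi xi.
Proof. by []. Qed.
Lemma qf_cst r xi : qf (cst r) xi = r * rp xi xi.
Proof. by rewrite qfZ qf1. Qed.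
Lemma qf0 xi : qf 0 xi = 0.
Proof. by rewrite /qf !bE rp0l. Qed.
Lemma qfJ x y xi : qf (adj y * x * y) xi = qf x (y xi).
Proof. by rewrite /qf !bE rpC -rp_adj rpC. Qed.
Lemma qfA y xi : qf (adj y * y) xi = rp (y xi) (y xi).
Proof. by rewrite /qf !bE [LHS]rpC -rp_adj. Qed.
Definition qfE := (qfD, qfN, qfB, qfZ, qf_cst, qf1, qf0).

Lemma sa1 : sa (1 : bop H). Proof. exact: adj1. Qed.
Lemma sa0 : sa (0 : bop H). Proof. exact: adj0. Qed.
Lemma saD x y : sa x -> sa y -> sa (x + y).
Proof. by rewrite /sa adjD => -> ->. Qed.
Lemma saN x : sa x -> sa (- x).
Proof. by rewrite /sa adjN => ->. Qed.
Lemma saB x y : sa x -> sa y -> sa (x - y).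
Proof. by rewrite /sa adjB => -> ->. Qed.
Lemma saZ r x : sa x -> sa (r%:C *: x).
Proof. by rewrite /sa adjZr => ->. Qed.
Lemma saJ x y : sa x -> sa (adj y * x * y).
Proof. by rewrite /sa !adjM adjK => ->; rewrite mulrA. Qed.
Lemma saA y : sa (adj y * y).
Proof. by rewrite /sa adjM adjK. Qed.
Lemma saA' y : sa (y * adj y).
Proof. by rewrite /sa adjM adjK. Qed.
Lemma saM x y : sa x -> sa y -> x * y = y * x -> sa (x * y).
Proof. by rewrite /sa adjM => -> -> ->. Qed.

Lemma pos0 : pos 0. Proof. by split; [exact: sa0|move=> xi]. Qed.
Lemma pos1 : pos 1. Proof. by split; [exact: sa1|move=> xi; rewrite qf0 qf1 rp_ge0]. Qed.
Lemma posD x y : pos x -> pos y -> pos (x + y).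
Proof.
move=> [sx px] [sy py]; split; first exact: saD.
by move=> xi; rewrite !qfE; have := px xi; have := py xi; rewrite !qfE; lra.
Qed.
Lemma posZ r x : 0 <= r -> pos x -> pos (r%:C *: x).
Proof.
move=> r0 [sx px]; split; first exact: saZ.
by move=> xi; rewrite !qfE; have := px xi; rewrite !qfE; nra.
Qed.
Lemma posJ x y : pos x -> pos (adj y * x * y).
Proof.
move=> [sx px]; split; first exact: saJ.
by move=> xi; rewrite qfJ; have := px (y xi); rewrite !qfE.
Qed.
Lemma posA y : pos (adj y * y).
Proof. by split; [exact: saA|move=> xi; rewrite qfA qf0 rp_ge0]. Qed.
Lemma posA' y : pos (y * adj y).
Proof. by have := posA (adj y); rewrite adjK. Qed.
Lemma pos_sq x : sa x -> pos (x * x).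
Proof. by move=> sx; have := posA x; rewrite sx. Qed.
Lemma posB x y : sa x -> sa y -> ple x y -> pos (y - x).
Proof.
by move=> sx sy h; split; [exact: saB|move=> xi; rewrite !qfE; have := h xi; lra].
Qed.
Lemma ple_trans y x z : ple x y -> ple y z -> ple x z.
Proof. by move=> h1 h2 xi; exact: le_trans (h1 xi) (h2 xi). Qed.
Lemma pleJ x y z : ple x y -> ple (adj z * x * z) (adj z * y * z).
Proof. by move=> h xi; rewrite !qfJ. Qed.

Lemma posP x : bpositive x <-> pos x.
Proof.
split=> [hx|[sx px] xi]; last first.
  rewrite ipE lecE /=; have -> : rp (x xi) ('i%C *: xi) = 0.
    have h := rpi xi (x xi); rewrite (sa_rp _ _ sx) bopZ in h *.
    rewrite (rpC xi) rpi; have := sa_rp xi ('i%C *: xi) sx.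
    by rewrite bopZ (rpC xi) rpi; lra.
  by rewrite eqxx; have := px xi; rewrite qf0.
have h1 xi : 0 <= qf x xi by have := hx xi; rewrite lecE => /andP[].
have h2 xi : rp (x xi) ('i%C *: xi) = 0.
  by have := hx xi; rewrite ipE lecE /= => /andP[/eqP].
split; last by move=> xi; rewrite qf0.
apply: adj_of_rp => xi eta.
(* A form that is real on the diagonal is symmetric: polarise at [xi + i eta]. *)
have := h2 (xi + 'i%C *: eta).
rewrite bopD scalerDr bopZ !rpE h2 scalerA -expr2 sqr_i scaleN1r rpNr rp_ii.
by rewrite rpNr rpi h2 oppr0 oppr0 (rpC (x eta) xi); lra.
Qed.

Lemma pos_cs x xi eta : pos x -> rp (x xi) eta ^+ 2 <= qf x xi * qf x eta.
Proof.
move=> [sx px].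
have p c : 0 <= qf x c by have := px c; rewrite qf0.
have e1 (a b : R) : qf x (a%:C *: xi + b%:C *: eta) =
    a ^+ 2 * qf x xi + 2 * a * b * rp (x xi) eta + b ^+ 2 * qf x eta.
  rewrite /qf bopD !bopZ !rpE (sa_rp eta xi sx) (rpC eta (x xi)); ring.
have [e0|e0] := eqVneq (qf x eta) 0.
  have [->|a0] := eqVneq (rp (x xi) eta) 0; first by rewrite expr0n /= mulr_ge0.
  (* If the form vanishes at [eta], this combination has form value -1, so the mixed term must be
     0. *)
  have := p ((1 : R)%:C *: xi + (- (qf x xi + 1) / (2 * rp (x xi) eta))%:C *: eta).
  have c2 : 2 * (- (qf x xi + 1) / (2 * rp (x xi) eta)) * rp (x xi) eta = - (qf x xi + 1) by field.
  by rewrite e1 e0 mulr0 addr0 expr1n mul1r mulr1 c2; lra.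
have ep : 0 < qf x eta by rewrite lt_def e0 p.
have := p ((qf x eta)%:C *: xi + (- rp (x xi) eta)%:C *: eta).
rewrite e1 => h0.
rewrite -(ler_pM2l ep); lra.
Qed.

Lemma pos_ge0 x xi : pos x -> 0 <= qf x xi.
Proof. by move=> [_ h]; have := h xi; rewrite qf0. Qed.

Lemma pos_ker x xi : pos x -> qf x xi = 0 -> x xi = 0.
Proof.
move=> px h; apply/rp_eq0; have := pos_cs xi (x xi) px; rewrite h mul0r => h1.
by apply/eqP; rewrite -sqrf_eq0 eq_le h1 sqr_ge0.
Qed.

Lemma sa_qf0 x : sa x -> (forall xi, qf x xi = 0) -> x = 0.
Proof.
by move=> sx h; apply: bopP => xi; rewrite bE; apply: pos_ker => //; split=> // eta; rewrite h qf0.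
Qed.

Lemma sa_qf_eq x y : sa x -> sa y -> (forall xi, qf x xi = qf y xi) -> x = y.
Proof.
move=> sx sy h; apply/subr0_eq/sa_qf0; first exact: saB.
by move=> xi; rewrite qfB h subrr.
Qed.

Lemma pos_bound x : exists2 M : R, 0 < M & ple x (cst M).
Proof.
have [M M0 hM] := bop_bound x; exists M => // xi; rewrite !qfE.
apply: le_trans (rp_le' _ _) _; rewrite -nrm2 expr2 mulrA.
by rewrite ler_wpM2r ?nrm_ge0.
Qed.

(** The operator inequality [x * x <= M x]: Cauchy-Schwarz for the form of [x], at [xi] and
    [x xi]. *)
Lemma pos_sqbound x M xi : 0 <= M -> pos x -> ple x (cst M) ->
  rp (x xi) (x xi) <= M * qf x xi.
Proof.
move=> M0 px hx; have [->|n0] := eqVneq (rp (x xi) (x xi)) 0.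
  by rewrite mulr_ge0 // pos_ge0.
have np : 0 < rp (x xi) (x xi) by rewrite lt_def n0 rp_ge0.
have := pos_cs xi (x xi) px; have := hx (x xi); rewrite !qfE => h1 h2.
rewrite -(ler_pM2l np) -expr2; apply: le_trans h2 _.
have := pos_ge0 xi px; nra.
Qed.

Definition contr x : Prop := forall xi, rp (x xi) (x xi) <= rp xi xi.

Lemma contr_nrm x xi : contr x -> nrm (x xi) <= nrm xi.
Proof. by move=> h; apply: nrm_le_sq; rewrite ?nrm_ge0 // nrm2. Qed.

Lemma contrM x y : contr x -> contr y -> contr (x * y).
Proof. by move=> h1 h2 xi; rewrite bE; exact: le_trans (h1 _) (h2 _). Qed.

Lemma contr_adj x : contr x -> contr (adj x).
Proof.
move=> h xi; set e := adj x xi.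
have h1 : rp e e = rp (x e) xi by rewrite rp_adj.
have := rp_sq (x e) xi; have := h e; rewrite -h1 => h2 h3.
have [->|n0] := eqVneq (rp e e) 0; first exact: rp_ge0.
have np : 0 < rp e e by rewrite lt_def n0 rp_ge0.
rewrite -(ler_pM2l np) -expr2; apply: le_trans h3 _.
by rewrite ler_wpM2r ?rp_ge0.
Qed.

Lemma contrP x : contr x <-> ple (adj x * x) 1.
Proof. by split=> h xi; have := h xi; rewrite qfA qf1. Qed.

Lemma pos_contr x : pos x -> ple x 1 -> contr x.
Proof.
move=> px h xi; have := @pos_sqbound x 1 xi ler01 px.
rewrite mul1r => h1; apply: le_trans (h1 _) _; last by have := h xi; rewrite qf1.
by move=> eta; rewrite qf_cst mul1r; have := h eta.
Qed.

Lemma contr1 : contr 1. Proof. by move=> xi. Qed.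

Lemma hcvg_rp_eq (f g : nat -> H) l m xi eta : hcvg f l -> hcvg g m ->
  (forall n, rp (f n) eta = rp xi (g n)) -> rp l eta = rp xi m.
Proof.
move=> hf hg E; apply/eqP; rewrite -subr_eq0 -normr_le0; apply: small0 => c c0.
pose B := 1 + nrm xi + nrm eta.
have B1 : 0 < B by rewrite /B; have := nrm_ge0 xi; have := nrm_ge0 eta; lra.
have [|N hN] := hf (c / B); first by rewrite divr_gt0.
have [|N' hN'] := hg (c / B); first by rewrite divr_gt0.
pose n := maxn N N'.
have := hN n (leq_maxl _ _); have := hN' n (leq_maxr _ _); rewrite !ler_pdivlMr //.
have -> : rp l eta - rp xi m = rp xi (g n - m) - rp (f n - l) eta.
  by rewrite !rpE -E; lra.
move=> h1 h2; apply: le_trans (ler_normB _ _) _.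
have := rp_le xi (g n - m); have := rp_le (f n - l) eta.
move: h1 h2; rewrite /B; set x := nrm xi; set y := nrm eta; set u := nrm (g n - m); set v := nrm (f n - l).
have := nrm_ge0 xi; have := nrm_ge0 eta; have := nrm_ge0 (g n - m); have := nrm_ge0 (f n - l).
rewrite -/u -/v -/x -/y => v0 u0 y0 x0 h1 h2 h3 h4.
have : 0 <= u * y by rewrite mulr_ge0.
have : 0 <= v * x by rewrite mulr_ge0.
have [uv|vu] := leP u v.
  have : u * x <= v * x by rewrite ler_wpM2r.
  by lra.
have : v * y <= u * y by rewrite ler_wpM2r // ltW.
by lra.
Qed.

Lemma hcvg_lin f g (l m : H) k : hcvg f l -> hcvg g m ->
  hcvg (fun n => k *: f n + g n) (k *: l + m).
Proof.
move=> hf hg c c0; pose L := 1 + complex.Re `|k|.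
have k0 : 0 <= complex.Re `|k| by have := normr_ge0 k; rewrite lecE => /andP[].
have [|N hN] := hf (c / (2 * L)); first by rewrite divr_gt0 // /L; lra.
have [|N' hN'] := hg (c / 2); first lra.
exists (maxn N N') => n; rewrite geq_max => /andP[/hN h1 /hN' h2].
rewrite opprD addrACA -scalerBr; apply: le_trans (nrmD _ _) _; rewrite nrmZ.
move: h1; rewrite ler_pdivlMr /L; last by lra.
have := nrm_ge0 (f n - l); nra.
Qed.

Lemma hcvg_nrm_le (f : nat -> H) l r : hcvg f l -> (forall n, nrm (f n) <= r) -> nrm l <= r.
Proof.
move=> hf h; suff : nrm l - r <= 0 by lra.
apply: small0 => c c0; have [N hN] := hf c c0.
have := hN N (leqnn _); have := h N; have := nrm_tri (f N) l 0.
by rewrite !subr0 (nrmBC l); lra.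
Qed.

Lemma strong_limit (f : nat -> bop H) M :
  (forall n xi, nrm (f n xi) <= M * nrm xi) ->
  (forall xi, exists l, hcvg (fun n => f n xi) l) ->
  exists x, forall xi, hcvg (fun n => f n xi) (x xi).
Proof.
move=> bf ex; have [g hg] := choice ex.
have [||x hx] := @mkbop R H g M.
- move=> k xi eta; apply: hcvg_unique (hg _) _.
  have := hcvg_lin k (hg xi) (hg eta); congr hcvg; apply/funext => n.
  by rewrite bop_lin.
- by move=> xi; apply: hcvg_nrm_le (hg xi) _ => n.
by exists x => xi; rewrite hx.
Qed.

Lemma hcvg_bop x (f : nat -> H) l : hcvg f l -> hcvg (fun n => x (f n)) (x l).
Proof.
move=> hf c c0; have [M M0 hM] := bop_bound x.
have [|N hN] := hf (c / M); first by rewrite divr_gt0.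
exists N => n /hN h; rewrite -bopB; apply: le_trans (hM _) _.
by rewrite mulrC -ler_pdivlMr.
Qed.

Lemma strong_sa (f : nat -> bop H) x : (forall n, sa (f n)) ->
  (forall xi, hcvg (fun n => f n xi) (x xi)) -> sa x.
Proof.
move=> sf hx; apply: adj_of_rp => xi eta.
by apply: (hcvg_rp_eq (hx xi) (hx eta)) => n; rewrite (sa_rp _ _ (sf n)).
Qed.

Lemma strong_comm (f : nat -> bop H) x y : (forall n, f n * y = y * f n) ->
  (forall xi, hcvg (fun n => f n xi) (x xi)) -> x * y = y * x.
Proof.
move=> cf hx; apply: bopP => xi; rewrite !bE.
have h2 := hcvg_bop y (hx xi).
apply: hcvg_unique (hx (y xi)) _; move: h2; congr hcvg; apply/funext => n.
by rewrite -[LHS]mulbE -cf.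
Qed.

Lemma strong_qf (f : nat -> bop H) x xi : (forall xi, hcvg (fun n => f n xi) (x xi)) ->
  forall c : R, 0 < c -> exists N, forall n, (N <= n)%N -> `|qf (f n) xi - qf x xi| <= c.
Proof.
move=> hx c c0; have x0 : 0 < 1 + nrm xi by have := nrm_ge0 xi; lra.
have [|N hN] := hx xi (c / (1 + nrm xi)); first by rewrite divr_gt0.
exists N => n /hN; rewrite ler_pdivlMr // => h.
rewrite /qf -rpBl; apply: le_trans (rp_le _ _) _.
have := nrm_ge0 (f n xi - x xi); lra.
Qed.

Lemma strong_qf_le (f : nat -> bop H) x xi c : (forall xi, hcvg (fun n => f n xi) (x xi)) ->
  (forall n, qf (f n) xi <= c) -> qf x xi <= c.
Proof.
move=> hx h; suff : qf x xi - c <= 0 by lra.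
apply: small0 => d d0; have [N hN] := strong_qf xi hx d0.
by have := hN N (leqnn _); have := h N; rewrite ler_norml => h1 /andP[h2 h3]; lra.
Qed.

(** Increments [d] satisfy [0 <= d <= K], hence [|d xi|^2 <= K <d xi, xi>]; convergence of the
    increasing bounded numbers [qf (f n) xi] thus forces norm convergence of the vectors
    [f n xi]. *)
Lemma monotone_limit (f : nat -> bop H) M : (forall n, sa (f n)) ->
  (forall n, ple (f n) (f n.+1)) -> (forall n, ple (f n) (cst M)) ->
  exists x, [/\ sa x, forall xi, hcvg (fun n => f n xi) (x xi) & forall n, ple (f n) x].
Proof.
move=> sf mf bf.
have mf' m n : (m <= n)%N -> ple (f m) (f n).
  elim: n => [|n IH]; first by rewrite leqn0 => /eqP->.
  rewrite leq_eqVlt => /orP[/eqP->//|]; rewrite ltnS => /IH h.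
  exact: ple_trans h (mf n).
have [M0 M0p hM0] := pos_bound (- f 0%N).
have [B B0 hB] := bop_bound (f 0%N).
pose K := `|M| + M0.
have K0 : 0 < K by rewrite /K; have := normr_ge0 M; lra.
have dK m n : (m <= n)%N -> ple (f n - f m) (cst K).
  move=> mn eta; rewrite !qfE; have := bf n eta; have := hM0 eta; have := mf' 0%N m (leq0n _) eta.
  rewrite !qfE /K => h1 h2 h3; have : M * rp eta eta <= `|M| * rp eta eta.
    by rewrite ler_wpM2r ?rp_ge0 // ler_norm.
  by lra.
have dif m n xi : (m <= n)%N ->
    rp (f n xi - f m xi) (f n xi - f m xi) <= K * (qf (f n) xi - qf (f m) xi).
  move=> mn; have pd : pos (f n - f m) by apply: posB => //; exact: mf'.
  by have := @pos_sqbound _ K xi (ltW K0) pd (dK _ _ mn); rewrite !bE qfB.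
have cvq xi : exists l : R, forall c : R, 0 < c -> exists N, forall n, (N <= n)%N ->
    qf (f n) xi <= l /\ l <= qf (f n) xi + c.
  pose S := [set qf (f n) xi | n in [set: nat]].
  have Sb : has_sup S.
    split; first by exists (qf (f 0%N) xi); exists 0%N.
    by exists (M * rp xi xi) => _ [n _ <-]; have := bf n xi; rewrite !qfE.
  exists (sup S) => c c0; have [_ [N _ <-] hN] := sup_adherent c0 Sb.
  exists N => n Nn; split; first by apply: ub_le_sup; [case: Sb|exists n].
  by have := mf' _ _ Nn xi; lra.
have ex xi : exists l, hcvg (fun n => f n xi) l.
  apply: hcauchy => c c0; have [l hl] := cvq xi.
  have [|N hN] := hl (c ^+ 2 / K); first by rewrite divr_gt0 // exprn_gt0.
  have main m n : (N <= m)%N -> (m <= n)%N -> nrm (f n xi - f m xi) <= c.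
    move=> Nm mn; apply: nrm_le_sq; first exact: ltW.
    apply: le_trans (dif _ _ _ mn) _.
    have [h1 h2] := hN m Nm; have [h3 _] := hN n (leq_trans Nm mn).
    by rewrite mulrC -ler_pdivlMr //; lra.
  exists N => m n Nm Nn; have [mn|nm] := leqP m n; first by rewrite nrmBC main.
  by rewrite main // ltnW.
have [|x hx] := @strong_limit f (K + B) _ ex.
  move=> n xi; have h1 : nrm (f n xi - f 0%N xi) <= K * nrm xi.
    apply: nrm_le_sq; first by rewrite mulr_ge0 ?nrm_ge0 // ltW.
    apply: le_trans (dif _ _ _ (leq0n n)) _; rewrite exprMn nrm2 expr2 -mulrA.
    by rewrite ler_pM2l //; have := dK 0%N n (leq0n _) xi; rewrite qfB qf_cst.
  have := nrm_tri (f 0%N xi) (f n xi) 0; rewrite !subr0.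
  by have := hB xi; rewrite mulrDl; lra.
exists x; split=> //; first exact: strong_sa hx.
move=> n xi; suff : qf (f n) xi - qf x xi <= 0 by lra.
apply: small0 => c c0; have [N hN] := strong_qf xi hx c0.
have := hN (maxn n N) (leq_maxr _ _); have := mf' _ _ (leq_maxl n N) xi.
by rewrite ler_norml => h1 /andP[h2 h3]; lra.
Qed.

(* The cone generated by the powers of [a]; the square root of [1 - a] is the
   limit of [1 - w n] where [w n] belongs to this cone. *)
Inductive powcone a : bop H -> Prop :=
| powcone1 : powcone a 1
| powconeM y : powcone a y -> powcone a (a * y)
| powconeD y z : powcone a y -> powcone a z -> powcone a (y + z)
| powconeZ r y : 0 <= r -> powcone a y -> powcone a (r%:C *: y).

Lemma powcone_mul a y z : powcone a y -> powcone a z -> powcone a (y * z).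
Proof.
move=> py pz; elim: py => [|u _ IH|u v _ IHu _ IHv|r u r0 _ IH].
- by rewrite mul1r.
- by rewrite -mulrA; exact: powconeM.
- by rewrite mulrDl; exact: powconeD.
- by rewrite -scalebAl; exact: powconeZ.
Qed.

Lemma powcone_comm a y u : powcone a y -> a * u = u * a -> y * u = u * y.
Proof.
move=> py au; elim: py => [|v _ IH|v w _ IHu _ IHv|r v r0 _ IH].
- by rewrite mul1r mulr1.
- by rewrite -mulrA IH !mulrA au.
- by rewrite mulrDl mulrDr IHu IHv.
- by rewrite -scalebAl -scalebAr IH.
Qed.

(** The induction carries [pos (a * y)] along: [a * (a * y)] equals [a * y * a], which is positive
    because [y] is. *)
Lemma powcone_pos a y : pos a -> powcone a y -> pos y.
Proof.
move=> pa py; suff [] : pos y /\ pos (a * y) by [].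
elim: py => [|u hu [pu pau]|u v _ [pu pau] _ [pv pav]|r u r0 _ [pu pau]].
- by split; [exact: pos1|rewrite mulr1].
- split=> //; have := posJ a pu; case: pa => -> _.
  by rewrite -mulrA (powcone_comm hu).
- by rewrite mulrDr; split; exact: posD.
- by rewrite -scalebAr; split; exact: posZ.
Qed.

(** With [a = 1 - x], the iteration [w -> (a + w^2) / 2] has a limit [W] satisfying [2 W = a + W^2],
    that is [(1 - W)^2 = x]. Squaring is not operator monotone, so the sequence is shown to increase
    by keeping its differences among the polynomials in [a] with nonnegative coefficients. *)
Lemma sqrt1_ex x : pos x -> ple x 1 ->
  exists s, [/\ pos s, s * s = x & forall y, x * y = y * x -> s * y = y * s].
Proof.
move=> px x1; pose a := 1 - x.
have pa : pos a by apply: posB => //; [case: px|exact: sa1].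
have a1 : ple a 1 by move=> xi; rewrite !qfE; have := pos_ge0 xi px; lra.
pose step y : bop H := (2^-1 : R)%:C *: (a + y * y).
pose w n := iter n step 0.
have wS n : w n.+1 = step (w n) by [].
have wc n : powcone a (w n).
  elim: n => [|n IH].
    by rewrite /w /= -(scale0r (1 : bop H)); apply: (@powconeZ a 0) => //; exact: powcone1.
  rewrite wS; apply: powconeZ; first by rewrite invr_ge0.
  apply: powconeD; last exact: powcone_mul.
  by rewrite -[a in powcone _ a]mulr1; apply: powconeM; exact: powcone1.
have wp n := powcone_pos pa (wc n).
have wcom n y : a * y = y * a -> w n * y = y * w n by move=> ?; exact: powcone_comm (wc n) _.
have wa n : a * w n = w n * a by apply/esym/wcom.
have wd n : powcone a (w n.+1 - w n).
  elim: n => [|n IH].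
    rewrite wS /step mulr0 addr0 subr0; apply: powconeZ; first by rewrite invr_ge0.
    by rewrite -[a in powcone _ a]mulr1; apply: powconeM; exact: powcone1.
  have -> : w n.+2 - w n.+1 = (2^-1 : R)%:C *: ((w n.+1 - w n) * (w n.+1 + w n)).
    rewrite [in LHS]wS [X in _ - X]wS /step -scalerBr opprD addrACA subrr add0r.
    congr (_ *: _); rewrite mulrDr !mulrBl (wcom n (w n.+1) (wa _)).
    by rewrite addrA subrK.
  apply: powconeZ; first by rewrite invr_ge0.
  by apply: powcone_mul => //; exact: powconeD.
have w1 n : ple (w n) 1.
  elim: n => [|n IH] xi; first by rewrite /w /= !qfE rp_ge0.
  rewrite wS /step qfZ qfD; have := a1 xi.
  have := pos_contr (wp n) IH xi; rewrite /contr -qfA (proj1 (wp n)) !qf1.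
  by lra.
have [||| W [sW hW Wle]] := @monotone_limit w 1.
- by move=> n; case: (wp n).
- by move=> n xi; have := pos_ge0 xi (powcone_pos pa (wd n)); rewrite qfB; lra.
- by move=> n xi; have := w1 n xi; rewrite !qfE mul1r.
have W1 : ple W 1 by move=> xi; apply: (strong_qf_le hW) => n; exact: w1.
have Wcom y : x * y = y * x -> W * y = y * W.
  move=> xy; apply: strong_comm hW => n; apply: wcom.
  by rewrite mulrBl mulrBr mul1r mulr1 xy.
have Wfix : W + W = a + W * W.
  apply: bopP => xi; rewrite addbE.
  have h1 := hcvg_lin 1 (hW xi) (hW xi); rewrite scale1r in h1.
  have h2 : hcvg (fun n => w n.+1 xi + w n.+1 xi) (W xi + W xi).
    by move=> c c0; have [N hN] := h1 c c0; exists N => n /leqW /hN; rewrite scale1r.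
  apply: hcvg_unique h2 _ => c c0.
  have [|N hN] := hW xi (c / 2); first lra.
  have [|N' hN'] := hW (W xi) (c / 2); first lra.
  exists (maxn N N') => n; rewrite geq_max => /andP[/hN h3 /hN' h4].
  have -> : w n.+1 xi + w n.+1 xi = a xi + w n (w n xi).
    rewrite wS /step scalebE addbE mulbE -scalerDl -rmorphD.
    by have -> : 2^-1 + 2^-1 = 1 :> R by [lra]; rewrite scale1r.
  have -> : (a + W * W) xi = a xi + W (W xi) by [].
  rewrite opprD addrACA subrr add0r.
  apply: le_trans (nrm_tri (w n (W xi)) _ _) _; rewrite -bopB.
  have := contr_nrm (w n xi - W xi) (pos_contr (wp n) (w1 n)); lra.
exists (1 - W); split.
- by apply: posB => //; exact: sa1.
- have -> : (1 - W) * (1 - W) = 1 - (W + W - W * W) by nc.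
  by rewrite Wfix addrK /a opprB addrC subrK.
- by move=> y xy; rewrite mulrBl mulrBr mul1r mulr1 Wcom.
Qed.

Lemma sqrt_ex x : pos x ->
  exists s, [/\ pos s, s * s = x & forall y, x * y = y * x -> s * y = y * s].
Proof.
move=> px; have [M M0 hM] := pos_bound x.
have [||s [ps ss sc]] := @sqrt1_ex (M^-1%:C *: x).
- by apply: posZ => //; rewrite invr_ge0 ltW.
- move=> xi; rewrite qfZ qf1 mulrC ler_pdivrMr // mulrC; have := hM xi.
  by rewrite qf_cst.
exists ((Num.sqrt M)%:C *: s); split.
- by apply: posZ => //; exact: sqrtr_ge0.
- rewrite -scalebAl -scalebAr scalerA ss scalerA -!rmorphM.
  by rewrite -expr2 sqr_sqrtr ?ltW // divff ?gt_eqF // scale1r.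
- move=> y xy; rewrite -scalebAl -scalebAr sc //.
  by rewrite -scalebAl -scalebAr xy.
Qed.

Definition bsqrt x : bop H := xget 0
  [set s | [/\ pos s, s * s = x & forall y, x * y = y * x -> s * y = y * s]].

Lemma bsqrtP x : pos x -> [/\ pos (bsqrt x), bsqrt x * bsqrt x = x &
  forall y, x * y = y * x -> bsqrt x * y = y * bsqrt x].
Proof.
by move=> px; rewrite /bsqrt; case: xgetP => [s _ //|h]; have [s /h] := sqrt_ex px.
Qed.

End Positive.

(** * Spectral projections, resolvents and polar decomposition *)

Section Spectral.
Context {R : realType} {H : hilbertType R}.
Implicit Types (xi eta zeta : H) (k : R[i]) (r t : R) (C : set H) (x y z p q u v w a b h e s : bop H).

Definition prj p : Prop := p * p = p /\ sa p.

Lemma prjP p : projection p <-> prj p.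
Proof. by split=> -[h1 /saP h2]. Qed.

Lemma prj_idem p xi : prj p -> p (p xi) = p xi.
Proof. by move=> [pp _]; rewrite -mulbE pp. Qed.

Lemma prj_qf p xi : prj p -> qf p xi = rp (p xi) (p xi).
Proof. by move=> pp; rewrite /qf rp_adj (proj2 pp) [LHS]rpC -{1}(prj_idem xi pp) rp_adj (proj2 pp). Qed.

Lemma prj_pos p : prj p -> pos p.
Proof. by move=> pp; split; [case: pp|move=> xi; rewrite qf0 prj_qf ?rp_ge0]. Qed.

Lemma prjC p : prj p -> prj (1 - p).
Proof.
move=> [pp sp]; split; last by apply: saB => //; exact: sa1.
by rewrite mulrBl mul1r mulrBr mulr1 pp subrr subr0.
Qed.

Lemma prj0 : prj 0. Proof. by split; [rewrite mulr0|exact: sa0]. Qed.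
Lemma prj1 : prj 1. Proof. by split; [rewrite mulr1|exact: sa1]. Qed.

Lemma prj_le1 p : prj p -> ple p 1.
Proof. by move=> /prjC/prj_pos h xi; have := pos_ge0 xi h; rewrite qfB; lra. Qed.

Lemma prj_contr p : prj p -> contr p.
Proof. by move=> h; apply: pos_contr; [exact: prj_pos|exact: prj_le1]. Qed.

Lemma prj_mul_le p q : prj p -> prj q -> q * p = p -> ple p q.
Proof.
move=> pp qq E xi; rewrite !prj_qf //.
have -> : p xi = p (q xi).
  by have := congr1 adj E; rewrite adjM (proj2 pp) (proj2 qq) => {1}<-.
exact: prj_contr.
Qed.

Lemma prjB p q : prj p -> prj q -> q * p = p -> prj (q - p).
Proof.
move=> pp qq E; have E' : p * q = p by have := congr1 adj E; rewrite adjM (proj2 pp) (proj2 qq).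
split; last by apply: saB; [case: qq|case: pp].
by rewrite mulrBl !mulrBr (proj1 pp) (proj1 qq) E E' subrr subr0.
Qed.

Lemma prj_approx C : subsp C -> exists p, [/\ prj p,
  forall xi, approx C (p xi), forall xi, approx C xi -> p xi = xi &
  forall xi, (forall c, C c -> rp xi c = 0) -> p xi = 0].
Proof.
move=> sC; have [p [/prjP pp pa po]] := orth_proj sC.
exists p; split=> // xi h.
  apply/esym/subr0_eq/rp_eq0; apply: po.
  exact: (subspB (approx_subsp sC)).
by apply/rp_eq0; rewrite rp_adj (proj2 pp) prj_idem //; exact: (orth_approx (pa xi) h).
Qed.

Lemma prj_approx_comm C p u : subsp C -> prj p -> (forall xi, approx C (p xi)) ->
  (forall xi, approx C xi -> p xi = xi) ->
  (forall xi, C xi -> C (u xi)) -> (forall xi, C xi -> C (adj u xi)) -> p * u = u * p.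
Proof.
move=> sC pp pa pid hu hu'.
have aux v : (forall xi, C xi -> C (v xi)) -> p * v * p = v * p.
  move=> hv; apply: bopP => xi; rewrite !mulbE; apply: pid => c c0.
  have [M M0 hM] := bop_bound v.
  have [|d Cd hd] := pa xi (c / M); first by rewrite divr_gt0.
  exists (v d); first exact: hv.
  by rewrite -bopB; apply: le_trans (hM _) _; rewrite mulrC -ler_pdivlMr.
have h1 := aux _ hu; have := congr1 adj (aux _ hu').
by rewrite !adjM adjK (proj2 pp) mulrA => <-.
Qed.

Lemma ker_prj x : exists p, [/\ prj p, x * p = 0, forall xi, x xi = 0 -> p xi = xi &
  forall y, x * y = y * x -> x * adj y = adj y * x -> p * y = y * p].
Proof.
pose C := [set xi | x xi = 0].
have sC : subsp C by split=> [|k a b]; rewrite /C /= ?bop0 // bop_lin => -> ->; rewrite scaler0 addr0.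
have cC xi : approx C xi -> C xi.
  move=> h; apply: small_eq => c c0; have [M M0 hM] := bop_bound x.
  have [|d Cd hd] := h (c / M); first by rewrite divr_gt0.
  by rewrite -[X in _ - X]Cd -bopB; apply: le_trans (hM _) _; rewrite mulrC -ler_pdivlMr.
have [p [pp pa pid po]] := prj_approx sC.
exists p; split=> //.
- by apply: bopP => xi; rewrite mulbE; apply: cC.
- by move=> xi hx; apply: pid; exact: approx_sub.
- move=> y xy xy'; apply: prj_approx_comm pa pid _ _ => // xi; rewrite /C /= => hx.
    by rewrite -mulbE xy mulbE hx bop0.
  by rewrite -mulbE xy' mulbE hx bop0.
Qed.

Lemma comm_adj x y : sa x -> x * y = y * x -> x * adj y = adj y * x.
Proof. by move=> sx h; have := congr1 adj h; rewrite !adjM sx. Qed.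

(** With [g = h - t] and [m = |g|], the kernel of [m + g], which is twice the positive part of [g],
    is the spectral subspace of [h] for [(-oo, t]]; [e] projects onto its complement. This replaces
    a functional calculus. *)
Lemma spec_ex h t : sa h -> exists e, [/\ prj e, forall y, h * y = y * h -> e * y = y * e,
  forall xi, t * rp (e xi) (e xi) <= qf h (e xi) &
  forall xi, qf h ((1 - e) xi) <= t * rp ((1 - e) xi) ((1 - e) xi)].
Proof.
move=> sh; pose g : bop H := h - cst t.
have sg : sa g by apply: saB => //; apply: saZ; exact: sa1.
have cg y : h * y = y * h -> g * y = y * g.
  by move=> E; rewrite /g /cst mulrBl mulrBr -scalebAl -scalebAr mul1r mulr1 E.
have [pm mm cm] := bsqrtP (pos_sq sg).
have qg xi : qf g xi = qf h xi - t * rp xi xi by rewrite /g qfB qf_cst.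
move: (bsqrt _) pm mm cm => m pm mm cm; clearbody g.
have mg : m * g = g * m by apply: cm; rewrite mulrA.
have [k [pk kk kid kc]] := ker_prj (m + g).
have sm : sa m by case: pm.
have smg : sa (m + g) by exact: saD.
have kg : k * g = g * k.
  apply: kc; first by rewrite mulrDl mulrDr mg.
  by rewrite sg mulrDl mulrDr mg.
have km : k * m = m * k.
  apply: kc; first by rewrite mulrDl mulrDr mg.
  by rewrite sm mulrDl mulrDr mg.
have gk xi : g (k xi) = - m (k xi).
  by have := congr1 (fun z => z xi) kk; rewrite !bE => /eqP; rewrite addrC addr_eq0 => /eqP.
exists (1 - k); split.
- exact: prjC.
- move=> y hy; rewrite mulrBl mulrBr mul1r mulr1; congr (_ - _); apply: kc.
    have gy := cg _ hy; rewrite mulrDl mulrDr gy; congr (_ + _).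
    by apply: cm; rewrite -mulrA gy mulrA gy mulrA.
  have gy := cg _ (comm_adj sh hy); rewrite mulrDl mulrDr gy; congr (_ + _).
  by apply: cm; rewrite -mulrA gy mulrA gy mulrA.
- (* (m + g)(m - g) = 0 on the range of 1 - k, so (m - g) xi lies in the kernel. *)
  move=> xi; set eta := (1 - k) xi.
  have h0 : (m + g) ((m - g) eta) = 0.
    rewrite -mulbE mulrDl !mulrBr mm mg.
    by rewrite addrA subrK subrr.
  have h1 : k ((m - g) eta) = 0.
    rewrite -mulbE mulrBr km kg -mulrBl mulbE.
    have -> : k eta = 0 by rewrite /eta -mulbE mulrBr mulr1 (proj1 pk) subrr.
    by rewrite bop0.
  have h2 : g eta = m eta.
    by apply/esym/eqP; rewrite -subr_eq0; apply/eqP; have := kid _ h0; rewrite h1.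
  have : qf g eta = qf m eta by rewrite /qf h2.
  by rewrite qg; have := pos_ge0 eta pm; lra.
- move=> xi; rewrite opprB addrC subrK.
  have : qf g (k xi) = - qf m (k xi) by rewrite /qf gk rpNl.
  by rewrite qg; have := pos_ge0 (k xi) pm; lra.
Qed.

(** The listed properties leave open whether an eigenvalue [t] is included; monotonicity is
    accordingly stated for distinct thresholds. *)
Definition spec h t : bop H := xget 0 [set e | [/\ prj e, forall y, h * y = y * h -> e * y = y * e,
  forall xi, t * rp (e xi) (e xi) <= qf h (e xi) &
  forall xi, qf h ((1 - e) xi) <= t * rp ((1 - e) xi) ((1 - e) xi)]].

Lemma specP h t : sa h -> [/\ prj (spec h t), forall y, h * y = y * h -> spec h t * y = y * spec h t,
  forall xi, t * rp (spec h t xi) (spec h t xi) <= qf h (spec h t xi) &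
  forall xi, qf h ((1 - spec h t) xi) <= t * rp ((1 - spec h t) xi) ((1 - spec h t) xi)].
Proof.
by move=> sh; rewrite /spec; case: xgetP => [e _ //|n]; have [e /n] := spec_ex t sh.
Qed.

Lemma spec_prj h t : sa h -> prj (spec h t).
Proof. by move=> /(specP t)[]. Qed.

Lemma spec_comm h t y : sa h -> h * y = y * h -> spec h t * y = y * spec h t.
Proof. by move=> /(specP t)[_ c _ _]; exact: c. Qed.

(** A vector [eta] in the range of [spec h s'] and killed by [spec h t] would satisfy
    [s' |eta|^2 <= qf h eta <= t |eta|^2]. *)
Lemma spec_mono h t (s' : R) : sa h -> t < s' -> spec h t * spec h s' = spec h s'.
Proof.
move=> sh ts; have [pt ct lt' ut] := specP t sh; have [ps cs ls us] := specP s' sh.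
have C : spec h t * spec h s' = spec h s' * spec h t by apply: ct; rewrite cs.
apply/eqP; rewrite -subr_eq0 -opprB oppr_eq0; apply/eqP.
rewrite -{1}(mul1r (spec h s')) -mulrBl.
apply: bopP => xi; rewrite mulbE zerobE.
set eta := (1 - spec h t) _.
have h1 : (1 - spec h t) eta = eta by rewrite prj_idem //; exact: prjC.
have h2 : spec h s' eta = eta.
  have Cx (z : H) : spec h t (spec h s' z) = spec h s' (spec h t z) by rewrite -!mulbE C.
  by rewrite /eta subbE onebE bopB -!Cx prj_idem.
have := ls eta; have := ut eta; rewrite h1 h2 => h3 h4.
apply/rp_eq0/le_anti; rewrite rp_ge0 andbT; have := rp_ge0 eta; nra.
Qed.

(** Positivity makes the inverse of [1 + X] a contraction. A vector [eta] orthogonal to the range of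
    [1 + X] satisfies [X (eta, - eta)] by self-adjointness, hence is 0; so the range is dense, and
    closedness of the graph carries the inverse to all of [H]. *)
Lemma resolvent (X : set (H * H)) : linear_graph X ->
  (forall a b : H, (forall c : R, 0 < c -> exists z : H * H, [/\ X z, nrm (a - z.1) <= c & nrm (b - z.2) <= c]) -> X (a, b)) ->
  gpositive X ->
  exists r : bop H, [/\ pos r, ple r 1, forall xi, X (r xi, xi - r xi) &
    forall a b : H, X (a, b) -> r (a + b) = a].
Proof.
move=> [X0 Xlin Xf] Xc [Xs Xp].
have Xq (a b : H) : X (a, b) -> 0 <= rp b a.
  by move=> /Xp; rewrite lecE => /andP[].
pose F := [set z : H * H | X (z.2, z.1 - z.2)].
have nb (a b : H) : X (a, b) -> nrm a <= nrm (a + b).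
  move=> /Xq h; apply: nrm_le_sq; first exact: nrm_ge0.
  by rewrite nrm2 !rpE (rpC a b); have := rp_ge0 b; lra.
have [||| r [rF _ _ _]] := @extend R H F 1.
- by rewrite /F /= subrr.
- move=> k a a' b b'; rewrite /F /= => h1 h2.
  by rewrite opprD addrACA -scalerBr; exact: Xlin.
- by move=> a a'; rewrite /F /= mul1r => /nb; rewrite addrC subrK.
have rX (a b : H) : X (a, b) -> r (a + b) = a by move=> h; apply: rF; rewrite /F /= addrC addKr.
pose D := [set d | exists a : H, X (a, d - a)].
have sD : subsp D.
  split; first by exists 0; rewrite subrr.
  move=> k x y [a ha] [b hb]; exists (k *: a + b).
  by rewrite opprD addrACA -scalerBr; exact: Xlin.
have De eta : (forall d, D d -> rp eta d = 0) -> eta = 0.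
  move=> h; have h' := orth_ip sD h.
  have : X (eta, - eta).
    rewrite -Xs => -[a b] /= Xab.
    have : <|eta, a + b|> = 0 by apply: h'; exists a; rewrite addrC addKr.
    rewrite ipC => /eqP; rewrite conjC_eq0 => /eqP; rewrite ipDl => /eqP.
    by rewrite addrC addr_eq0 => /eqP ->; rewrite -[- eta]scaleN1r ipZr rmorphN1 mulN1r.
  by move=> /Xq; rewrite rpNl => h1; apply/rp_eq0; have := rp_ge0 eta; lra.
have Da xi : approx D xi.
  have [s hs ho] := orth_decomp xi sD.
  by have /subr0_eq -> := De _ ho.
have [M M0 hM] := bop_bound r.
have rr xi : X (r xi, xi - r xi).
  apply: Xc => c c0.
  have [|d [a Xa] hd] := Da xi (c / (1 + M)); first by rewrite divr_gt0 //; lra.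
  have ra : r d = a by have := rX _ _ Xa; rewrite addrC subrK.
  move: hd; rewrite ler_pdivlMr; last lra.
  move=> hd; have h1 := hM (xi - d); have n0 := nrm_ge0 (xi - d).
  exists (a, d - a); split=> //=; first by rewrite -ra -bopB; lra.
  have -> : xi - r xi - (d - a) = (xi - d) - r (xi - d).
    by rewrite bopB ra !opprB [a - d]addrC addrACA [- r xi + _]addrC.
  have := nrmB (xi - d) (r (xi - d)); lra.
exists r; split=> //.
- split; last first.
    move=> xi; rewrite qf0 /qf; have := Xq _ _ (rr xi).
    by rewrite rpBl (rpC _ (r xi)); have := rp_ge0 (r xi); lra.
  apply: adj_of_rp => xi eta.
  have := rr xi; rewrite -{1}Xs => /(_ _ (rr eta)) /= /(congr1 (@complex.Re R)).
  rewrite -/(rp (eta - r eta) (r xi)) -/(rp (r eta) (xi - r xi)) !rpE.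
  have := rpC xi (r eta); have := rpC eta (r xi); lra.
- move=> xi; rewrite qf1 /qf; have := Xq _ _ (rr xi); rewrite rpBl.
  have := rp_ge0 (xi - r xi); rewrite !rpE (rpC xi (r xi)); lra.
Qed.

Lemma graph_linear x : linear_graph (graph x).
Proof.
split; rewrite /graph /=; first by rewrite bop0.
  by move=> c a b a' b' -> ->; rewrite bop_lin.
by move=> a b b' -> ->.
Qed.

Lemma graph_closed x (a b : H) : (forall c : R, 0 < c -> exists z : H * H,
  [/\ graph x z, nrm (a - z.1) <= c & nrm (b - z.2) <= c]) -> graph x (a, b).
Proof.
move=> h; apply: small_eq => c c0 /=; have [M M0 hM] := bop_bound x.
have [|z [zx h1 h2]] := h (c / (1 + M)); first by rewrite divr_gt0 //; lra.
apply: le_trans (nrm_tri z.2 _ _) _; rewrite zx -bopB.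
move: h1 h2; rewrite zx !ler_pdivlMr; try lra.
have := hM (z.1 - a); rewrite (nrmBC z.1); have := nrm_ge0 (a - z.1); have := nrm_ge0 (b - x z.1).
by nra.
Qed.

Lemma graph_positive x : pos x -> gpositive (graph x).
Proof.
move=> px; split; last by move=> z ->; exact: (proj2 (posP x) px).
apply/seteqP; split=> -[a b] /= h.
  have : forall c, rp c b = rp c (x a).
    move=> c; have := h (c, x c) erefl => /= /(congr1 (@complex.Re R)).
    by rewrite -![complex.Re _]/(rp _ _) (sa_rp _ _ (proj1 px)).
  by move=> E; apply/subr0_eq/rp_eq0; rewrite rpBr E subrr.
move=> [c d]; rewrite /graph /= in h * => ->; rewrite h.
by have /saP := proj1 px; exact.
Qed.

Lemma inv_ex x t : pos x -> 0 < t -> exists i, [/\ pos i, (x + cst t) * i = 1,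
  i * (x + cst t) = 1, forall y, x * y = y * x -> i * y = y * i & ple i (cst t^-1)].
Proof.
move=> px t0; have pt : pos (t^-1%:C *: x) by apply: posZ => //; rewrite invr_ge0 ltW.
have [r [pr r1 h1 h2]] := resolvent (graph_linear _) (@graph_closed _) (graph_positive pt).
have tt : t%:C * (t^-1)%:C = 1 :> R[i] by rewrite -rmorphM divff ?gt_eqF.
have e1 : (x + cst t) * (t^-1%:C *: r) = 1.
  apply: bopP => xi; have := h1 xi; rewrite /graph /= => E.
  rewrite -[LHS]/(x (t^-1%:C *: r xi) + t%:C *: (t^-1%:C *: r xi)) bopZ.
  have {}E : t^-1%:C *: x (r xi) = xi - r xi := esym E.
  by rewrite E scalerA tt scale1r subrK.
have e2 : (t^-1%:C *: r) * (x + cst t) = 1.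
  apply: bopP => xi; have := h2 xi ((t^-1%:C *: x) xi) erefl => E.
  rewrite -[LHS]/(t^-1%:C *: r (x xi + t%:C *: xi)) -bopZ scalerDr scalerA mulrC tt.
  by rewrite scale1r addrC.
exists (t^-1%:C *: r); split=> //.
- by apply: posZ => //; rewrite invr_ge0 ltW.
- move=> y xy; rewrite -[_ * y]mulr1 -e1.
  have c1 : y * (x + cst t) = (x + cst t) * y.
    by rewrite mulrDl mulrDr xy /cst -scalebAl -scalebAr mulr1 mul1r.
  rewrite [LHS]mulrA -(mulrA _ y) c1 (mulrA _ _ y) e2 mul1r.
  by [].
- move=> xi; rewrite qfZ qf_cst; apply: ler_wpM2l; first by rewrite invr_ge0 ltW.
  by have := r1 xi; rewrite qf1.
Qed.

Lemma qf_eq_nrm x y xi : adj x * x = adj y * y -> rp (x xi) (x xi) = rp (y xi) (y xi).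
Proof. by move=> E; rewrite -!qfA E. Qed.

(** In the isometric case the extension by zero is a partial isometry whose initial projection is
    the projection onto the closure of the domain. *)
Lemma extend_iso (F : set (H * H)) : F (0, 0) ->
  (forall k xi xi' eta eta', F (xi, xi') -> F (eta, eta') ->
     F (k *: xi + eta, k *: xi' + eta')) ->
  (forall xi xi', F (xi, xi') -> rp xi' xi' = rp xi xi) ->
  exists w, [/\ prj (adj w * w),
    forall xi xi', F (xi, xi') -> w xi = xi' /\ adj w (w xi) = xi,
    forall xi, (forall eta eta', F (eta, eta') -> rp xi eta = 0) -> w xi = 0,
    (forall p, prj p -> (forall xi xi', F (xi, xi') -> p xi' = xi') -> p * w = w) &
    forall u, (forall xi xi', F (xi, xi') -> F (u xi, u xi')) ->
      (forall xi xi', F (xi, xi') -> F (adj u xi, adj u xi')) -> u * w = w * u].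
Proof.
move=> F0 Flin Fiso.
have [|w [wF w0 wC wu]] := @extend R H F 1 F0 Flin.
  by move=> a a' /Fiso E; rewrite mul1r; apply: nrm_le_sq; rewrite ?nrm_ge0 // nrm2 E.
pose D := [set eta | exists eta', F (eta, eta')].
have sD : subsp D.
  split; first by exists 0.
  by move=> k a b [a' ha] [b' hb]; exists (k *: a' + b'); exact: Flin.
have [q [pq qa qid qo]] := prj_approx sD.
have qD xi c : D c -> rp ((1 - q) xi) c = 0.
  move=> Dc; have := qid c (approx_sub Dc) => <-.
  by rewrite rpC rp_adj (proj2 pq) -mulbE mulrBr mulr1 (proj1 pq) subrr rp0r.
have wq : w * q = w.
  apply/eqP; rewrite eq_sym -subr_eq0; apply/eqP; rewrite -[X in X - _]mulr1 -mulrBr.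
  by apply: bopP => xi; rewrite mulbE w0 // => eta eta' h; apply: qD; exists eta'.
have wiso xi : nrm (w (q xi)) = nrm (q xi).
  have [M M0 hM] := bop_bound w.
  apply/eqP; rewrite -subr_eq0 -normr_le0; apply: small0 => c c0.
  have [|d [d' Fd] hd] := qa xi (c / (1 + M)); first by rewrite divr_gt0 //; lra.
  have E : nrm (w d) = nrm d.
    by apply/eqP; rewrite (wF _ _ Fd) -(@eqrXn2 _ 2) ?nrm_ge0 // !nrm2 (Fiso _ _ Fd).
  have h1 : nrm (w (q xi) - w d) <= M * nrm (q xi - d) by rewrite -bopB.
  move: hd; rewrite ler_pdivlMr; last by lra.
  have := nrm_tri (w d) (w (q xi)) 0; have := nrm_tri d (q xi) 0.
  have := nrm_tri (w (q xi)) (w d) 0; have := nrm_tri (q xi) d 0.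
  rewrite !subr0 (nrmBC (w d)) (nrmBC d) E ler_norml => h2 h3 h4 h5 h6.
  by apply/andP; split; lra.
have ww : adj w * w = q.
  apply: sa_qf_eq; [exact: saA|by case: pq|move=> xi].
  by rewrite qfA prj_qf // -{1 2}wq -!nrm2 mulbE wiso.
exists w; split=> //; first by rewrite ww.
- move=> a a' Fa; split; first exact: wF.
  by rewrite -mulbE ww; apply: qid; apply: approx_sub; exists a'.
- move=> p pp h; apply: bopP => xi; rewrite mulbE.
  have pC : approx [set xi | p xi = xi] (w xi) by exact: wC.
  apply: small_eq => c c0.
  have [|d /= pd hd] := pC (c / 2); first lra.
  have := nrm_tri d (p (w xi)) (w xi); rewrite -{1}pd -bopB (nrmBC d).
  by have := contr_nrm (w xi - d) (prj_contr pp); lra.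
Qed.

Lemma prj_ker_le p q : prj p -> prj q -> (forall xi, p xi = 0 -> q xi = 0) -> q * p = q.
Proof.
move=> pp qq h; apply/eqP; rewrite eq_sym -subr_eq0; apply/eqP.
rewrite -[X in X - _]mulr1 -mulrBr; apply: bopP => xi; rewrite mulbE; apply: h.
by rewrite -mulbE mulrBr mulr1 (proj1 pp) subrr.
Qed.

Lemma prj_ker_eq p q : prj p -> prj q -> (forall xi, p xi = 0 <-> q xi = 0) -> p = q.
Proof.
move=> pp qq h; have h1 := prj_ker_le pp qq (fun xi => proj1 (h xi)).
have h2 := prj_ker_le qq pp (fun xi => proj2 (h xi)).
by have := congr1 adj h1; rewrite adjM (proj2 pp) (proj2 qq) h2.
Qed.

(** [w] is the isometric extension of [|y| xi -> y xi]. Its initial projection has the kernel of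
    [y], and this is how equivalences of projections are read off later. *)
Lemma polar y : exists w, [/\ prj (adj w * w), w * (adj w * w) = w,
  (forall xi, adj w (w xi) = 0 <-> y xi = 0),
  (forall p, prj p -> (p * y = y -> p * w = w) /\ (y * p = y -> w * p = w)) &
  (forall u, u * y = y * u -> u * adj y = adj y * u -> u * w = w * u)].
Proof.
have [pm mm mc] := bsqrtP (posA y); set m := bsqrt _ in pm mm mc.
have sm := proj1 pm; have my xi : rp (m xi) (m xi) = rp (y xi) (y xi).
  by apply: qf_eq_nrm; rewrite sm.
clearbody m.
pose F := [set z : H * H | exists xi, z = (m xi, y xi)].
have [||| w [wp wF w0 wC wu]] := @extend_iso F.
- by exists 0; rewrite !bop0.
- by move=> k a a' b b' [xi [-> ->]] [eta [-> ->]]; exists (k *: xi + eta); rewrite !bop_lin.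
- by move=> a a' [xi [-> ->]]; rewrite my.
have Fm xi : F (m xi, y xi) by exists xi.
have wm : w * m = y by apply: bopP => xi; rewrite mulbE (proj1 (wF _ _ (Fm xi))).
have ker xi : adj w (w xi) = 0 <-> y xi = 0.
  split=> h.
    suff : m xi = 0 by rewrite -wm mulbE => ->; rewrite bop0.
    apply/rp_eq0; rewrite rp_adj sm -(proj2 (wF _ _ (Fm (m xi)))).
    by rewrite -rp_adj rpC rp_adj h rp0r.
  rewrite w0 ?bop0 // => _ _ [eta [-> _]].
  have m0 : m xi = 0 by apply: rp_eq0; rewrite my h rp0l.
  by rewrite rpC rp_adj sm m0 rp0r.
have kw xi : y xi = 0 -> w xi = 0.
  move=> /ker h; apply/rp_eq0; by rewrite rp_adj h rp0r.
exists w; split=> //.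
- apply/eqP; rewrite eq_sym -subr_eq0; apply/eqP; rewrite -[X in X - _]mulr1 -mulrBr.
  apply: bopP => xi; rewrite mulbE; apply/kw/ker; rewrite -mulbE -mulbE mulrBr mulr1 (proj1 wp).
  by rewrite subrr.
- move=> p pp; split=> [py|yp].
    by apply: wC => // _ _ [xi [_ ->]]; rewrite -mulbE py.
  apply/eqP; rewrite eq_sym -subr_eq0; apply/eqP; rewrite -[X in X - _]mulr1 -mulrBr.
  by apply: bopP => xi; rewrite mulbE; apply/kw; rewrite -mulbE mulrBr mulr1 yp subrr.
- move=> u uy uy'; apply: wu.
    move=> _ _ [xi [-> ->]]; exists (u xi); rewrite -!mulbE uy mc //.
    by rewrite -mulrA -uy mulrA -uy' mulrA.
  move=> _ _ [xi [-> ->]]; exists (adj u xi); rewrite -!mulbE.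
  have h1 : adj u * y = y * adj u by have := congr1 adj uy'; rewrite !adjM !adjK => ->.
  have h2 : adj u * adj y = adj y * adj u by have := congr1 adj uy; rewrite !adjM => ->.
  rewrite h1 mc //.
  by rewrite -mulrA -h1 mulrA -h2 mulrA.
Qed.

End Spectral.

(** * Von Neumann algebras and traces *)

Section VonNeumann.
Context {R : realType} {H : hilbertType R}.
Implicit Types (xi eta zeta : H) (k : R[i]) (r t : R) (C : set H) (x y z p q u v w a b h e s g : bop H).
Implicit Types (A M : set (bop H)).

Lemma commutant_adj M : (forall x, M x -> M (adj x)) ->
  forall y, commutant M y -> commutant M (adj y).
Proof.
move=> hM y hy x Mx; have := congr1 adj (hy _ (hM _ Mx)).
by rewrite !adjM adjK => ->.
Qed.

Lemma vN_adj M x : von_neumann_algebra M -> M x -> M (adj x).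
Proof. by move=> [h _] Mx; apply: h Mx _; exact: adjP. Qed.

Lemma vN_comm_adj M y : von_neumann_algebra M -> commutant M y -> commutant M (adj y).
Proof. by move=> vM; apply: commutant_adj => x; exact: vN_adj. Qed.

Lemma vN_in M x : von_neumann_algebra M -> (forall y, commutant M y -> y * x = x * y) -> M x.
Proof. by move=> [_ E] h; rewrite -E => y hy; exact: h. Qed.

Lemma vN_commute M x y : M x -> commutant M y -> x * y = y * x.
Proof. by move=> Mx My; exact: My. Qed.

Lemma vN_commutant M : von_neumann_algebra M -> von_neumann_algebra (commutant M).
Proof.
move=> vM; split; first by move=> x y hx /adj_unique ->; exact: vN_comm_adj.
by case: vM => _ ->.
Qed.

Lemma vN1 M : von_neumann_algebra M -> M 1.
Proof. by move=> vM; apply: vN_in => // y _; rewrite mulr1 mul1r. Qed.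
Lemma vN0 M : von_neumann_algebra M -> M 0.
Proof. by move=> vM; apply: vN_in => // y _; rewrite mulr0 mul0r. Qed.
Lemma vND M x y : von_neumann_algebra M -> M x -> M y -> M (x + y).
Proof.
by move=> vM Mx My; apply: vN_in => // z hz; rewrite mulrDl mulrDr (hz _ Mx) (hz _ My).
Qed.
Lemma vNN M x : von_neumann_algebra M -> M x -> M (- x).
Proof. by move=> vM Mx; apply: vN_in => // z hz; rewrite mulrN mulNr (hz _ Mx). Qed.
Lemma vNB M x y : von_neumann_algebra M -> M x -> M y -> M (x - y).
Proof. by move=> vM Mx My; apply: vND => //; exact: vNN. Qed.
Lemma vNM M x y : von_neumann_algebra M -> M x -> M y -> M (x * y).
Proof.
by move=> vM Mx My; apply: vN_in => // z hz; rewrite mulrA -(hz _ Mx) -mulrA -(hz _ My) mulrA.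
Qed.
Lemma vNZ M k x : von_neumann_algebra M -> M x -> M (k *: x).
Proof.
by move=> vM Mx; apply: vN_in => // z hz; rewrite -scalebAr -scalebAl (hz _ Mx).
Qed.
Lemma vN_cst M r : von_neumann_algebra M -> M (cst r).
Proof. by move=> vM; apply: vNZ => //; exact: vN1. Qed.
Lemma vN_fc M x s : von_neumann_algebra M -> M x ->
  (forall y, x * y = y * x -> s * y = y * s) -> M s.
Proof. by move=> vM Mx h; apply: vN_in => // y hy; rewrite h // (hy _ Mx). Qed.
Lemma vN_sqrt M x : von_neumann_algebra M -> M x -> pos x -> M (bsqrt x).
Proof. by move=> vM Mx px; apply: vN_fc Mx _ => //; case: (bsqrtP px). Qed.
Lemma vN_spec M h t : von_neumann_algebra M -> M h -> sa h -> M (spec h t).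
Proof. by move=> vM Mx sh; apply: vN_fc Mx _ => //; case: (specP t sh). Qed.
Lemma vN_J M x y : von_neumann_algebra M -> M x -> M y -> M (adj y * x * y).
Proof. by move=> vM Mx My; do 2?[apply: vNM => //]; exact: vN_adj. Qed.

Lemma vN_strong M (f : nat -> bop H) x : von_neumann_algebra M -> (forall n, M (f n)) ->
  (forall xi, hcvg (fun n => f n xi) (x xi)) -> M x.
Proof.
move=> vM Mf hx; apply: vN_in => // y hy; apply/esym; apply: strong_comm hx => n.
exact: hy.
Qed.

Lemma vN_prj M C : von_neumann_algebra M -> subsp C ->
  (forall u xi, commutant M u -> C xi -> C (u xi)) -> exists p, [/\ prj p, M p,
  forall xi, approx C (p xi), forall xi, approx C xi -> p xi = xi &
  forall xi, (forall c, C c -> rp xi c = 0) -> p xi = 0].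
Proof.
move=> vM sC hC; have [p [pp pa pid po]] := prj_approx sC.
exists p; split=> //; apply: vN_in => // u hu; apply/esym.
apply: (prj_approx_comm sC pp pa pid) => xi; apply: hC => //.
exact: vN_comm_adj.
Qed.

Lemma vN_polar M y : von_neumann_algebra M -> M y -> exists w, [/\ M w, prj (adj w * w),
  w * (adj w * w) = w, (forall xi, adj w (w xi) = 0 <-> y xi = 0) &
  (forall p, prj p -> (p * y = y -> p * w = w) /\ (y * p = y -> w * p = w))].
Proof.
move=> vM My; have [w [pw ww kw cw wu]] := polar y.
exists w; split=> //; apply: vN_in => // u hu; apply: wu.
  by rewrite (hu _ My).
by rewrite (hu _ (vN_adj vM My)).
Qed.

Lemma comm_app x y xi : x * y = y * x -> x (y xi) = y (x xi).
Proof. by move=> E; rewrite -!mulbE E. Qed.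

Definition factor M : Prop := forall z, M z -> commutant M z -> exists c : R[i], z = c *: (1 : bop H).

Lemma factor_commutant M : von_neumann_algebra M -> factor M -> factor (commutant M).
Proof.
move=> vM fM z hz; rewrite (proj2 vM) => Mz.
exact: fM.
Qed.

Lemma scalar_prj p k : prj p -> p = k *: (1 : bop H) -> p = 0 \/ p = 1.
Proof.
move=> [pp _] E; have [->|p0] := eqVneq p 0; [by left|right].
have kp : k *: p = p by have := pp; rewrite {1}E -scalebAl mul1r.
have h : k *: (1 - p) = 0 by rewrite scalerBr -E kp subrr.
have [k0|k0] := eqVneq k 0; first by move: p0; rewrite E k0 scale0r eqxx.
have := congr1 (fun x => k^-1 *: x) h; rewrite scalerA mulVf // scale1r scaler0.
by move/eqP; rewrite subr_eq0 => /eqP.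
Qed.

(** Otherwise the vectors killed by all [g * x], [x] in [M], form a closed subspace invariant under
    [M] and under its commutant. Its projection is central, hence 0 or 1; it contains the range of
    the nonzero [e], and it is not 1 because [g] is nonzero. *)
Lemma factor_link M e g : von_neumann_algebra M -> factor M -> M e -> M g -> prj e -> prj g ->
  e != 0 -> g != 0 -> exists2 x, M x & g * x * e != 0.
Proof.
move=> vM fM Me Mg pe pg e0 g0; apply: contrapT => hn.
have h x : M x -> g * x * e = 0.
  by move=> Mx; apply/eqP/negPn/negP => hx; apply: hn; exists x.
pose C := [set xi | forall x, M x -> g (x xi) = 0].
have sC : subsp C.
  split=> [x _|k a b ha hb x Mx]; first by rewrite !bop0.
  by rewrite !bop_lin (ha _ Mx) (hb _ Mx) scaler0 addr0.
have [p [pp Mp pa pid po]] := vN_prj (vN_commutant vM) sC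
  (fun u xi (hu : commutant (commutant M) u) hxi => let Mu : M u := eq_ind _ (fun S => S u) hu _ (proj2 vM) in
     fun x Mx => hxi (x * u) (vNM vM Mx Mu)).
have Cp : commutant (commutant M) p.
  move=> u hu; apply/esym; apply: (prj_approx_comm sC pp pa pid) => xi hxi x Mx.
    by rewrite (comm_app xi (hu _ Mx)) (comm_app _ (hu _ Mg)) hxi // bop0.
  have hu' := vN_comm_adj vM hu.
  by rewrite (comm_app xi (hu' _ Mx)) (comm_app _ (hu' _ Mg)) hxi // bop0.
have [c pc] := factor_commutant vM fM Mp Cp.
have Ce xi : C (e xi) by move=> x Mx; rewrite -!mulbE h.
case: (scalar_prj pp pc) => p01.
  move/eqP: e0; apply; apply: bopP => xi.
  by rewrite -(pid _ (approx_sub (Ce xi))) p01.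
move/eqP: g0; apply; apply: bopP => xi; rewrite zerobE.
apply: small_eq => d d0; rewrite subr0.
have [K K0 hK] := bop_bound g.
have := pa xi; rewrite p01 onebE => /(_ (d / K)) [|c' Cc' hc']; first by rewrite divr_gt0.
have : g c' = 0 by apply: (Cc' 1); exact: vN1.
move=> gc; rewrite -(subr0 (g xi)) -gc -bopB; apply: le_trans (hK _) _.
by rewrite mulrC -ler_pdivlMr.
Qed.

Lemma factor_pisom M e g : von_neumann_algebra M -> factor M -> M e -> M g -> prj e -> prj g ->
  e != 0 -> g != 0 -> exists w, [/\ M w, w != 0, prj (adj w * w), w * e = w & g * w = w].
Proof.
move=> vM fM Me Mg pe pg e0 g0; have [x Mx y0] := factor_link vM fM Me Mg pe pg e0 g0.
have My : M (g * x * e) by do 2?[apply: vNM => //].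
have [w [Mw pw ww kw cw]] := vN_polar vM My.
exists w; split=> //.
- apply: contraNneq y0 => w0; apply/eqP; apply: bopP => xi; rewrite zerobE.
  by apply/kw; rewrite w0 bop0.
- by apply: (proj2 (cw e pe)); rewrite -mulrA (proj1 pe).
- by apply: (proj1 (cw g pg)); rewrite !mulrA (proj1 pg).
Qed.

Lemma pisom_adj w : prj (adj w * w) -> w * (adj w * w) = w.
Proof.
move=> pw; apply/eqP; rewrite eq_sym -subr_eq0; apply/eqP.
rewrite -[X in X - _]mulr1 -mulrBr; set v := _ * _.
suff h : adj v * v = 0.
  by apply: bopP => xi; apply/rp_eq0; rewrite -qfA h qf0.
rewrite /v adjM (proj2 (prjC pw)) !mulrA -(mulrA _ (adj w)).
by rewrite mulrBl mul1r (proj1 pw) subrr mul0r.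
Qed.

Lemma pisom_prj w : prj (adj w * w) -> prj (w * adj w).
Proof.
move=> pw; split; last exact: saA'.
by rewrite mulrA -(mulrA w) pisom_adj.
Qed.

Lemma prj_zero_anti p q : prj p -> prj q -> p * q = 0 -> q * p = 0.
Proof. by move=> pp qq E; have := congr1 adj E; rewrite adjM (proj2 pp) (proj2 qq) adj0. Qed.

(** Zorn's lemma on partial isometries [w] in [M] from a part of [e] to a part of [g], ordered by
    extension. If [e - adj w * w] and [g - w * adj w] were both nonzero, [factor_pisom] would link
    parts of them, and adding this link would extend a maximal [w]. *)
Lemma compare M e g : von_neumann_algebra M -> factor M -> M e -> M g -> prj e -> prj g ->
  exists w, [/\ M w, prj (adj w * w), w * e = w, g * w = w &
    adj w * w = e \/ w * adj w = g].
Proof.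
move=> vM fM Me Mg pe pg.
pose W w := [/\ M w, prj (adj w * w), w * e = w & g * w = w].
pose T := {w | W w}.
pose le (a b : T) := `[< sval b * (adj (sval a) * sval a) = sval a >].
have leP (a b : T) : le a b <-> sval b * (adj (sval a) * sval a) = sval a by split=> /asboolP.
have le_prj (a b : T) : le a b -> (adj (sval b) * sval b) * (adj (sval a) * sval a) = adj (sval a) * sval a.
  move=> /leP ab; have [_ pb _ _] := svalP b; have [_ pa _ _] := svalP a.
  set pA := adj (sval a) * sval a in pa ab *; set pB := adj (sval b) * sval b in pb *.
  have : adj (sval a) * sval a = pA * pB * pA by rewrite -{1 2}ab adjM (proj2 pa) !mulrA.
  rewrite -/pA => E.
  have h : adj ((1 - pB) * pA) * ((1 - pB) * pA) = 0.
    rewrite adjM (proj2 pa) (proj2 (prjC pb)) mulrA -(mulrA pA) (proj1 (prjC pb)).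
    by rewrite mulrBr mulr1 mulrBl (proj1 pa) -E subrr.
  apply/eqP; rewrite eq_sym -subr_eq0 -{1}(mul1r pA) -mulrBl; apply/eqP.
  by apply: bopP => xi; apply/rp_eq0; rewrite -qfA h qf0.
have [| | | |w0 hw0] := @Zorn T le.
- by move=> a; apply/leP; apply: pisom_adj; case: (svalP a).
- move=> a b c ab bc; apply/leP; rewrite -(le_prj _ _ ab) mulrA.
  by move/leP: bc => ->; apply/leP.
- move=> a b ab ba; have h1 := le_prj _ _ ab; have h2 := le_prj _ _ ba.
  have [_ pa _ _] := svalP a; have [_ pb _ _] := svalP b.
  have E : adj (sval a) * sval a = adj (sval b) * sval b.
    by rewrite -h1; have := congr1 adj h2; rewrite adjM (proj2 pa) (proj2 pb).
  apply: eq_sig_hprop => [? ? ?|]; first exact: Prop_irrelevance.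
  by move/leP: ab => <-; rewrite E; exact: pisom_adj.
- move=> Ch tot.
  (* The upper bound of a chain is the isometry given by the union of the graphs; the pair [(0, 0)]
     covers the empty chain. *)
  pose F := [set z : H * H | z = (0, 0) \/ exists2 a : T, Ch a & exists xi, z = (adj (sval a) (sval a xi), sval a xi)].
  have Fa (a : T) xi : Ch a -> F (adj (sval a) (sval a xi), sval a xi) by move=> ha; right; exists a => //; exists xi.
  have F' (a b : T) xi : le a b -> Ch b -> exists xi', adj (sval a) (sval a xi) = adj (sval b) (sval b xi') /\ sval a xi = sval b xi'.
    move=> ab hb; exists (adj (sval a) (sval a xi)).
    have := congr1 (fun x : bop H => x xi) (le_prj _ _ ab); rewrite !mulbE => ->.
    by move/leP: ab => /(congr1 (fun x : bop H => x xi)); rewrite !mulbE => ->.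
  have comb k (b : T) xi eta : Ch b -> F (k *: adj (sval b) (sval b xi) + adj (sval b) (sval b eta), k *: sval b xi + sval b eta).
    by move=> hb; rewrite -!bop_lin; exact: Fa.
  have [| | |w [pw wF w00 wC wu]] := @extend_iso R H F.
  + by left.
  + move=> k a a' b b' [[-> ->]|[f hf [xi [-> ->]]]] [[-> ->]|[f' hf' [eta [-> ->]]]].
    * by left; rewrite scaler0 addr0.
    * by rewrite scaler0 !add0r; exact: Fa.
    * by rewrite !addr0 -!bopZ; exact: Fa.
    * have [ff|ff] := tot _ _ hf hf'.
        by have [xi' [-> ->]] := F' _ _ xi ff hf'; exact: comb.
      by have [eta' [-> ->]] := F' _ _ eta ff hf; exact: comb.
  + move=> a a' [[-> ->]|[f hf [xi [-> ->]]]] //.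
    have [_ pf _ _] := svalP f.
    by rewrite -[LHS]qfA prj_qf.
  have Mw : M w.
    apply: vN_in => // u hu.
    have key v : commutant M v -> forall xi xi', F (xi, xi') -> F (v xi, v xi').
      move=> hv a a' [[-> ->]|[f hf [xi [-> ->]]]]; first by rewrite bop0; left.
      have [Mf _ _ _] := svalP f; right; exists f => //; exists (v xi).
      by rewrite (comm_app _ (hv _ Mf)) (comm_app _ (hv _ (vN_adj vM Mf))).
    by apply: wu; apply: key => //; exact: vN_comm_adj.
  have Ww : W w.
    split=> //.
      apply/eqP; rewrite eq_sym -subr_eq0; apply/eqP; rewrite -[X in X - _]mulr1 -mulrBr.
      apply: bopP => xi; rewrite mulbE w00 // => a a' [[-> _]|[f hf [eta [-> _]]]]; first by rewrite rp0r.
      have [_ _ fe _] := svalP f.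
      have ef : e * adj (sval f) = adj (sval f) by have := congr1 adj fe; rewrite adjM (proj2 pe).
      rewrite rp_adj (proj2 (prjC pe)) -mulbE mulrBl mul1r ef subrr.
      by rewrite rp0r.
    apply: wC => // a a' [[_ ->]|[f hf [eta [_ ->]]]]; first by rewrite bop0.
    by have [_ _ _ gf] := svalP f; rewrite -mulbE gf.
  exists (exist _ w Ww) => f hf; apply/leP => /=; apply: bopP => xi; rewrite !mulbE.
  by case: (wF _ _ (Fa f xi hf)).
case: w0 hw0 => w [Mw pw we gw] hmax; exists w; split=> //.
have pw' := pisom_prj pw.
have ew : e * (adj w * w) = adj w * w.
  by rewrite mulrA; congr (_ * _); have := congr1 adj we; rewrite adjM (proj2 pe).
have gw' : g * (w * adj w) = w * adj w by rewrite mulrA gw.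
have [E1|n1] := eqVneq (e - adj w * w) 0.
  by left; apply/esym/eqP; rewrite -subr_eq0 E1.
have [E2|n2] := eqVneq (g - w * adj w) 0.
  by right; apply/esym/eqP; rewrite -subr_eq0 E2.
have p1 := prjB pw pe ew; have p2 := prjB pw' pg gw'.
have M1 : M (e - adj w * w) by apply: vNB => //; apply: vNM => //; exact: vN_adj.
have M2 : M (g - w * adj w) by apply: vNB => //; apply: vNM => //; exact: vN_adj.
have [v [Mv v0 pv ve gv]] := factor_pisom vM fM M1 M2 p1 p2 n1 n2.
have z1 : v * (adj w * w) = 0.
  rewrite -ve -mulrA mulrBl ew (proj1 pw) subrr mulr0 //.
have z2 : adj w * v = 0.
  rewrite -gv mulrA mulrBr -[adj w * g](_ : adj w = _); last first.
    by have := congr1 adj gw; rewrite adjM (proj2 pg).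
  have -> : adj w * (w * adj w) = adj w by have := congr1 adj (pisom_adj pw); rewrite !adjM adjK mulrA.
  by rewrite subrr mul0r.
have z2' : adj v * w = 0 by have := congr1 adj z2; rewrite adjM adjK adj0.
have z3 : (adj w * w) * (adj v * v) = 0.
  have := congr1 adj z1; rewrite !adjM adjK adj0 => z1'.
  by rewrite mulrA z1' mul0r.
have E : adj (w + v) * (w + v) = adj w * w + adj v * v.
  by rewrite adjD mulrDl !mulrDr z2 z2' addr0 add0r.
have Ww' : W (w + v).
  split; first exact: vND.
  - rewrite E; split; last by apply: saD; [exact: (proj2 pw)|exact: (proj2 pv)].
    by rewrite mulrDl !mulrDr (proj1 pw) (proj1 pv) z3 (prj_zero_anti pw pv z3) addr0 add0r.
  - rewrite mulrDl we; congr (_ + _); rewrite -ve -mulrA mulrBl (proj1 pe); congr (_ * _); congr (_ - _).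
    by rewrite -mulrA we.
  - rewrite mulrDr gw; congr (_ + _); rewrite -gv mulrA mulrBr (proj1 pg) gw'.
    by [].
have : le (exist _ w (And4 Mw pw we gw)) (exist _ (w + v) Ww').
  by apply/leP => /=; rewrite mulrDl z1 addr0 pisom_adj.
move=> /hmax /(congr1 sval) /= E'.
by move: v0; rewrite -(addKr w v) E' addNr eqxx.
Qed.

End VonNeumann.

(** * Traces of projections and compressions *)

Section Trace.
Context {R : realType} {H : hilbertType R}.
Implicit Types (xi eta zeta : H) (k : R[i]) (r t : R) (C : set H) (x y z p q u v w a b h e s g : bop H).
Context (A : set (bop H)) (tau : bop H -> \bar R).
Context (vA : von_neumann_algebra A) (T : nsf_trace A tau).

Lemma sqrt_sq x : pos x -> bsqrt x * bsqrt x = x.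
Proof. by move=> /bsqrtP[]. Qed.
Lemma sqrt_pos x : pos x -> pos (bsqrt x).
Proof. by move=> /bsqrtP[]. Qed.
Lemma sqrt_sa x : pos x -> sa (bsqrt x).
Proof. by move=> /sqrt_pos[]. Qed.
Lemma sqrt_comm x y : pos x -> x * y = y * x -> bsqrt x * y = y * bsqrt x.
Proof. by move=> /bsqrtP[_ _ h]; exact: h. Qed.
Lemma sqrt_rp x xi : pos x -> rp (bsqrt x xi) (bsqrt x xi) = qf x xi.
Proof. by move=> px; rewrite -qfA (sqrt_sa px) sqrt_sq. Qed.
Lemma pos_conj x y : pos x -> pos (y * x * adj y).
Proof. by move=> px; have := posJ (adj y) px; rewrite adjK. Qed.
Lemma vN_conj x y : A x -> A y -> A (y * x * adj y).
Proof. by move=> Ax Ay; have := vN_J vA Ax (vN_adj vA Ay); rewrite adjK. Qed.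
Lemma pos_sqJ x y : pos x -> pos y -> pos (bsqrt x * y * bsqrt x).
Proof. by move=> px py; have := posJ (bsqrt x) py; rewrite (sqrt_sa px). Qed.
Lemma vN_sqJ x y : A x -> pos x -> A y -> A (bsqrt x * y * bsqrt x).
Proof. by move=> Ax px Ay; have := vN_J vA Ay (vN_sqrt vA Ax px); rewrite (sqrt_sa px). Qed.

Lemma pin x : A x -> pos x -> pos_part A x.
Proof. by move=> Ax /posP px; split. Qed.

Lemma tau_ge0 x : A x -> pos x -> (0 <= tau x)%E.
Proof. by move=> Ax px; case: T => -[h _ _ _] _ _ _; apply: h; exact: pin. Qed.
Lemma tauD x y : A x -> pos x -> A y -> pos y -> tau (x + y) = (tau x + tau y)%E.
Proof. by move=> Ax px Ay py; case: T => -[_ h _ _] _ _ _; apply: h; exact: pin. Qed.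
Lemma tauZ r x : 0 <= r -> A x -> pos x -> tau (r%:C *: x) = (r%:E * tau x)%E.
Proof. by move=> r0 Ax px; case: T => -[_ _ h _] _ _ _; apply: h => //; exact: pin. Qed.
Lemma tau_adj x : A x -> tau (adj x * x) = tau (x * adj x).
Proof. by move=> Ax; case: T => -[_ _ _ h] _ _ _; apply: h => //; exact: adjP. Qed.
Lemma tau_faithful x : A x -> pos x -> tau x = 0%E -> x = 0.
Proof. by move=> Ax px h; case: T => _ _ _; apply => //; exact: pin. Qed.
Lemma tau0 : tau 0 = 0%E.
Proof.
have := @tauZ 0 0 (lexx _) (vN0 vA) pos0; rewrite scaler0 => ->.
by rewrite mul0e.
Qed.
Lemma tau_mono x y : A x -> pos x -> A y -> pos y -> ple x y -> (tau x <= tau y)%E.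
Proof.
move=> Ax px Ay py xy.
have pd : pos (y - x) by apply: posB => //; [case: px|case: py].
have Ad : A (y - x) by exact: vNB.
by rewrite -(subrK x y) tauD // leeDr // tau_ge0.
Qed.

(** The trace identity for [bsqrt y * bsqrt x]. As [tau] is meaningful on positive elements only,
    [tau (bsqrt x * y * bsqrt x)] stands for [tau (x * y)] everywhere below. *)
Lemma tau_swap x y : A x -> pos x -> A y -> pos y ->
  tau (bsqrt x * y * bsqrt x) = tau (bsqrt y * x * bsqrt y).
Proof.
move=> Ax px Ay py; have Asx := vN_sqrt vA Ax px; have Asy := vN_sqrt vA Ay py.
have := tau_adj (vNM vA Asy Asx); rewrite adjM (sqrt_sa px) (sqrt_sa py).
by rewrite !mulrA -(mulrA (bsqrt x)) sqrt_sq // -(mulrA (bsqrt y) (bsqrt x)) sqrt_sq.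
Qed.

Lemma tau_conj u x : A u -> A x -> pos x ->
  tau (u * x * adj u) = tau (bsqrt x * (adj u * u) * bsqrt x).
Proof.
move=> Au Ax px; have Asx := vN_sqrt vA Ax px.
have := tau_adj (vNM vA Au Asx); rewrite adjM (sqrt_sa px) !mulrA => ->.
by rewrite -(mulrA u (bsqrt x)) sqrt_sq.
Qed.

Lemma ple_sqJ x y z : pos x -> ple y z -> ple (bsqrt x * y * bsqrt x) (bsqrt x * z * bsqrt x).
Proof. by move=> px h; have := pleJ (bsqrt x) h; rewrite (sqrt_sa px). Qed.

Lemma ple_conj u y z : ple y z -> ple (u * y * adj u) (u * z * adj u).
Proof. by move=> h; have := pleJ (adj u) h; rewrite adjK. Qed.

Lemma tau_contr u x : A u -> contr u -> A x -> pos x -> (tau (u * x * adj u)%R <= tau x)%E.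
Proof.
move=> Au cu Ax px; rewrite tau_conj //; apply: tau_mono => //.
- by apply: vN_sqJ => //; apply: vNM => //; exact: vN_adj.
- by apply: pos_sqJ => //; exact: posA.
- have := ple_sqJ px (proj1 (contrP u) cu); rewrite mulr1 sqrt_sq //.
Qed.

(** The hypothesis makes [g] injective on the range of [e], so the polar part of [g * e] carries [e]
    onto a subprojection of [g]. *)
Lemma tau_inj e g : A e -> A g -> prj e -> prj g ->
  (forall xi, e xi = xi -> g xi = 0 -> xi = 0) -> (tau e <= tau g)%E.
Proof.
move=> Ae Ag pe pg h.
have [w [Aw pw ww kw cw]] := vN_polar vA (vNM vA Ag Ae).
have E : (adj w * w) = e.
  apply: prj_ker_eq => // xi; rewrite mulbE kw mulbE; split=> [h1|->]; last by rewrite bop0.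
  by apply: h => //; rewrite prj_idem.
have gw : (g * w) = w by apply: (proj1 (cw g pg)); rewrite mulrA (proj1 pg).
rewrite -E tau_adj //; apply: tau_mono => //.
- by apply: vNM => //; exact: vN_adj.
- exact: posA'.
- exact: prj_pos.
- by apply: prj_mul_le => //; [exact: pisom_prj|rewrite mulrA gw].
Qed.

(** The meet is the kernel projection [q] of [(1 - e) + (1 - g)]. A vector of [e - q] killed by
    [1 - g] lies in both ranges, hence in that of [q], so [tau_inj] bounds [tau (e - q)] by
    [tau (1 - g)]. *)
Lemma meet_prj e g : A e -> A g -> prj e -> prj g -> exists q, [/\ A q, prj q,
  (e * q = q), (g * q = q) & (tau (1 - q)%R <= tau (1 - e)%R + tau (1 - g)%R)%E].
Proof.
move=> Ae Ag pe pg; pose x := ((1 - e) + (1 - g)).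
have pe' := prjC pe; have pg' := prjC pg.
have A1 := vN1 vA; have Ae' : A (1 - e) by exact: vNB.
have Ag' : A (1 - g) by exact: vNB.
have px : pos x by apply: posD; exact: prj_pos.
have [q [pq xq qid qc]] := ker_prj x.
have sx := proj1 px.
have Aq : A q by apply: (vN_fc vA (vND vA Ae' Ag')) => y xy; apply: qc => //; exact: comm_adj.
have xk xi : x xi = 0 -> e xi = xi /\ g xi = xi.
  move=> hx; have : qf x xi = 0 by rewrite /qf hx rp0l.
  have h1 := pos_ge0 xi (prj_pos pe'); have h2 := pos_ge0 xi (prj_pos pg').
  rewrite /x qfD => h3.
  have k1 : (1 - e) xi = 0 by apply: pos_ker; [exact: prj_pos|lra].
  have k2 : (1 - g) xi = 0 by apply: pos_ker; [exact: prj_pos|lra].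
  by split; apply/esym/eqP; rewrite -subr_eq0; apply/eqP.
have eq : (e * q = q).
  by apply: bopP => xi; rewrite mulbE; apply: (proj1 (xk _ _)); rewrite -mulbE xq.
have gq : (g * q = q).
  by apply: bopP => xi; rewrite mulbE; apply: (proj2 (xk _ _)); rewrite -mulbE xq.
exists q; split=> //.
have pf := prjB pq pe eq.
have -> : (1 - q = (1 - e) + (e - q)) by rewrite addrA subrK.
rewrite tauD //; try exact: prj_pos; last exact: vNB.
apply: leeD => //; apply: tau_inj => //; first exact: vNB.
move=> xi h1 h2.
have ee : e xi = xi by rewrite -h1 -mulbE mulrBr (proj1 pe) eq.
have xx : x xi = 0 by rewrite /x addbE h2 addr0 subbE ee subrr.
by rewrite -h1 subbE ee qid // subrr.
Qed.

(** If comparison embeds [g] in [e] instead, finiteness of [tau g] forces the trace of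
    [e - adj w * w] to be 0, and faithfulness turns the embedding into an equivalence. *)
Lemma compare_tau e g : factor A -> A e -> A g -> prj e -> prj g ->
  (tau e <= tau g)%E -> (tau g < +oo)%E -> exists w, [/\ A w, (adj w * w = e) & (g * w = w)].
Proof.
move=> fA Ae Ag pe pg eg gf; have [w [Aw pw we gw [E|E]]] := compare vA fA Ae Ag pe pg.
  by exists w.
exists w; split=> //; have Aww : A (adj w * w) by apply: vNM => //; exact: vN_adj.
have ew : (e * (adj w * w) = adj w * w).
  by rewrite mulrA; congr (_ * _); have := congr1 adj we; rewrite adjM (proj2 pe).
have pd := prjB pw pe ew.
have Ad : A (e - adj w * w) by exact: vNB.
have h : tau e = (tau (e - adj w * w)%R + tau g)%E.
  by rewrite -E -tau_adj // -tauD ?subrK //; exact: prj_pos.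
have d0 : tau (e - adj w * w) = 0%E.
  have g0 := tau_ge0 Ag (prj_pos pg); have d0 := tau_ge0 Ad (prj_pos pd).
  move: eg gf g0 d0; rewrite h; case: (tau g) => [c| |] //; case: (tau _) => [d| |] //.
  by rewrite !lee_fin => h1 _ h2 h3; congr (_%:E); lra.
by apply/esym/eqP; rewrite -subr_eq0; apply/eqP; apply: tau_faithful => //; exact: prj_pos.
Qed.

End Trace.

(** * Vector functionals with bounded density, and trace vectors *)

Section TraceVector.
Context {R : realType} {H : hilbertType R}.
Implicit Types (xi eta zeta : H) (k : R[i]) (r t : R) (C : set H) (x y z p q u v w a b h e s g d m : bop H).
Context (A : set (bop H)) (tau : bop H -> \bar R).
Context (vA : von_neumann_algebra A) (T : nsf_trace A tau).

(* [x] is the density of the vector functional of [eta] on [A]; testing on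
   [adj z * z] keeps the trace on positive elements. *)
Definition dens eta x : Prop := [/\ A x, pos x &
  forall z, A z -> tau (z * x * adj z) = (rp (z eta) (z eta))%:E].

Lemma dens_act eta x z : dens eta x -> A z -> dens (z eta) (z * x * adj z).
Proof.
move=> [Ax px h] Az; split; [exact: vN_conj|exact: pos_conj|move=> u Au].
by rewrite -mulbE -h ?adjM ?mulrA //; exact: vNM.
Qed.

Lemma dens_qf eta x a : dens eta x -> A a -> pos a ->
  tau (bsqrt x * a * bsqrt x) = (qf a eta)%:E.
Proof.
move=> [Ax px h] Aa pa; rewrite (tau_swap vA T) //.
have := h _ (vN_sqrt vA Aa pa); rewrite (sqrt_sa pa) => ->.
by rewrite sqrt_rp.
Qed.

Lemma dens_add eta x eta' x' : dens eta x -> dens eta' x' ->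
  (forall u, A u -> rp (u eta) (u eta') = 0) -> dens (eta + eta') (x + x').
Proof.
move=> [Ax px h] [Ax' px' h'] o; split; [exact: vND|exact: posD|move=> u Au].
rewrite mulrDr mulrDl (tauD T); try exact: vN_conj; try exact: pos_conj.
by rewrite h // h' // bopD !rpE (rpC (u eta')) o // addr0 add0r EFinD.
Qed.

Lemma dens0 : dens 0 0.
Proof.
split; [exact: vN0|exact: pos0|move=> z Az].
by rewrite mulr0 mul0r (tau0 vA T) bop0 rp0l.
Qed.

Section Fixed.
Context (zeta : H) (p : bop H) (pp : prj p) (dz : dens zeta p).

Lemma tv_A : A p. Proof. by case: dz. Qed.

Lemma tv_fix : p zeta = zeta.
Proof.
have Ap := tv_A; case: dz => _ _ /(_ (1 - p)).
rewrite (proj2 (prjC pp)) mulrBl mul1r (proj1 pp) subrr mul0r (tau0 vA T).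
move=> /(_ (vNB vA (vN1 vA) Ap)) E.
have h : rp ((1 - p) zeta) ((1 - p) zeta) = 0 by case: E.
move: (rp_eq0 h); rewrite subbE => /eqP.
by rewrite subr_eq0 => /eqP.
Qed.

Lemma tv_nrm u : A u -> u * p = u -> tau (u * adj u) = (rp (u zeta) (u zeta))%:E.
Proof. by move=> Au up; case: dz => _ _ /(_ u Au) <-; rewrite up. Qed.

Definition corner m : Prop := [/\ A m, m * p = m & p * m = m].

Lemma corner_adj m : corner m -> corner (adj m).
Proof.
move=> [Am mp pm]; split; first exact: vN_adj.
  by have := congr1 adj pm; rewrite adjM (proj2 pp).
by have := congr1 adj mp; rewrite adjM (proj2 pp).
Qed.
Lemma cornerD m d : corner m -> corner d -> corner (m + d).
Proof. by move=> [Am mp pm] [Ad dp pd]; split; [exact: vND|rewrite mulrDl mp dp|rewrite mulrDr pm pd]. Qed.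
Lemma cornerZ k m : corner m -> corner (k *: m).
Proof. by move=> [Am mp pm]; split; [exact: vNZ|rewrite -scalebAl mp|rewrite -scalebAr pm]. Qed.
Lemma cornerN m : corner m -> corner (- m).
Proof. by move=> [Am mp pm]; split; [exact: vNN|rewrite mulNr mp|rewrite mulrN pm]. Qed.
Lemma cornerB m d : corner m -> corner d -> corner (m - d).
Proof. by move=> hm hd; apply: cornerD => //; exact: cornerN. Qed.
Lemma cornerM m d : corner m -> corner d -> corner (m * d).
Proof.
move=> [Am mp pm] [Ad dp pd].
by split; [exact: vNM|rewrite -mulrA dp|rewrite mulrA pm].
Qed.
Lemma corner_cut m : A m -> corner (p * m * p).
Proof.
move=> Am; have Ap := tv_A; split; first by apply: vNM => //; exact: vNM.
  by rewrite -mulrA (proj1 pp).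
by rewrite !mulrA (proj1 pp).
Qed.

Lemma corner_sqrt m : pos m -> corner m -> corner (bsqrt m).
Proof.
move=> pm [Am mp pmm]; have c : bsqrt m * p = p * bsqrt m by apply: sqrt_comm => //; rewrite mp pmm.
have E : bsqrt m * p = bsqrt m.
  apply/eqP; rewrite eq_sym -subr_eq0; apply/eqP; rewrite -[X in X - _]mulr1 -mulrBr.
  apply: bopP => xi; apply/rp_eq0; rewrite mulbE sqrt_rp //.
  by rewrite /qf -mulbE mulrBr mulr1 mp subrr rp0l.
by split; [exact: vN_sqrt|exact: E|rewrite -c].
Qed.

(** On the corner [p A p] the vector functional of [zeta] is the trace, so [|w zeta| = |adj w zeta|]
    there; this is the polarised form. *)
Lemma tv_swap u v : corner u -> corner v ->
  rp (u zeta) (v zeta) = rp (adj u zeta) (adj v zeta).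
Proof.
have nn w : corner w -> rp (w zeta) (w zeta) = rp (adj w zeta) (adj w zeta).
  move=> cw; have [Aw wp _] := cw; have [Aw' wp' _] := corner_adj cw.
  have := tv_nrm Aw wp; have := tv_nrm Aw' wp'.
  by rewrite adjK (tau_adj T) // => -> [].
move=> cu cv; have := nn _ (cornerD cu cv); have := nn _ cu; have := nn _ cv.
rewrite adjD !addbE !rpE (rpC (v zeta)) (rpC (adj v zeta)); lra.
Qed.

(** The projection [e] onto the closure of [A' zeta] lies in [A], is below [p] and fixes [zeta]; so
    [tau (p - e) = |(p - e) zeta|^2 = 0], and faithfulness gives [e = p]. *)
Lemma tv_dense xi : approx [set eta | exists2 c, commutant A c & eta = c zeta] (p xi).
Proof.
set C := [set eta | _].
have vB := vN_commutant vA.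
have sC : subsp C.
  split; first by exists 0 => //; exact: vN0.
  move=> k _ _ [c hc ->] [c' hc' ->]; exists (k *: c + c') => //.
  by apply: (vND vB) => //; exact: (vNZ k vB).
have [|e [pe Ae ea eid eo]] := @vN_prj R H A C vA sC.
  by move=> u _ hu [c hc ->]; exists (u * c) => //; exact: (vNM vB).
have Ap := tv_A.
have pe' : p * e = e.
  apply: bopP => eta; rewrite mulbE; apply: small_eq => r r0.
  have [|_ [c hc ->] hd] := ea eta (r / 2); first lra.
  have pc : p (c zeta) = c zeta by rewrite (comm_app _ (hc _ Ap)) tv_fix.
  have := nrm_tri (c zeta) (p (e eta)) (e eta); rewrite -{1}pc -bopB (nrmBC (c zeta)).
  by have := contr_nrm (e eta - c zeta) (prj_contr pp); lra.
have ez : e zeta = zeta.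
  by apply: eid; apply: approx_sub; exists 1 => //; exact: (vN1 vB).
have pd := prjB pe pp pe'.
have Ad : A (p - e) by exact: vNB.
have dp : (p - e) * p = p - e.
  rewrite mulrBl (proj1 pp); congr (_ - _).
  by have := congr1 adj pe'; rewrite adjM (proj2 pp) (proj2 pe).
have : tau (p - e) = 0%E.
  rewrite -{1}(proj1 pd) -{2}(proj2 pd) tv_nrm // subbE tv_fix ez subrr rp0l //.
move=> /(tau_faithful T Ad (prj_pos pd)) /eqP; rewrite subr_eq0 => /eqP ->.
exact: ea.
Qed.

Lemma sa_rp_i x xi : sa x -> rp (x xi) ('i%C *: xi) = 0.
Proof.
move=> sx; have h1 := rpi xi (x xi); have h2 := sa_rp xi ('i%C *: xi) sx.
by move: h1 h2; rewrite bopZ (rpC (x xi)) => ->; lra.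
Qed.

Lemma tv_real d m : corner d -> corner m -> sa d -> sa m -> rp (d zeta) ('i%C *: m zeta) = 0.
Proof.
move=> cd cm sd sm; have := tv_swap cd (cornerZ 'i%C cm).
rewrite adjZ sd sm !scalebE conjCE.
have -> : ('i%C^* : R[i])%C = - 'i%C by simpc.
by rewrite scaleNr rpNr; lra.
Qed.

(** Convergence at [zeta] spreads to [A' zeta] because the [f n] commute with [A']; as this set is
    dense in the range of [p], the uniform bound gives strong convergence. *)
Lemma tv_closed (f : nat -> bop H) (s0 : H) : (forall n, corner (f n)) -> (forall n, pos (f n)) ->
  (forall n, ple (f n) p) -> hcvg (fun n => f n zeta) s0 ->
  exists d : bop H, [/\ corner d, pos d, ple d p & d zeta = s0].
Proof.
move=> cf pf fp hs.
have fc n : contr (f n) by apply: pos_contr => //; apply: ple_trans (fp n) (prj_le1 pp).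
have ex xi : exists l, hcvg (fun n => f n xi) l.
  apply: hcauchy => r r0.
  have [|_ [c hc ->] hd] := @tv_dense xi (r / 4); first lra.
  have [l hl] : exists l, hcvg (fun n => f n (c zeta)) l.
    exists (c s0); have := hcvg_bop c hs; congr hcvg; apply/funext => n.
    by have [Af _ _] := cf n; rewrite (comm_app _ (hc _ Af)).
  have [|N hN] := hl (r / 4); first lra.
  have fx n : nrm (f n xi - f n (c zeta)) <= r / 4.
    have [_ fpn _] := cf n; rewrite -{1}fpn mulbE -bopB.
    exact: le_trans (contr_nrm _ (fc n)) hd.
  exists N => a b Na Nb.
  have := nrm_tri (f a (c zeta)) (f a xi) (f b xi); have := nrm_tri (f b (c zeta)) (f a (c zeta)) (f b xi).
  have := nrm_tri l (f a (c zeta)) (f b (c zeta)).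
  have := fx a; have := fx b; have := hN a Na; have := hN b Nb.
  by rewrite (nrmBC (f b xi)) (nrmBC l); lra.
have [|d hd] := @strong_limit R H f 1 _ ex.
  by move=> n xi; rewrite mul1r; exact: contr_nrm.
have sd : sa d by apply: strong_sa hd => n; case: (pf n).
exists d; split.
- split.
  + by apply: (vN_strong vA _ hd) => n; case: (cf n).
  + apply: bopP => xi; rewrite mulbE; apply: hcvg_unique (hd (p xi)) _.
    have := hd xi; congr hcvg; apply/funext => n.
    by have [_ fpn _] := cf n; rewrite -{1}fpn.
  + apply: bopP => xi; rewrite mulbE; apply: hcvg_unique (hcvg_bop p (hd xi)) _.
    have := hd xi; congr hcvg; apply/funext => n.
    by have [_ _ fpn] := cf n; rewrite -{1}fpn.
- split=> // xi; rewrite qf0; suff : - qf d xi <= 0 by lra.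
  apply: small0 => r r0; have [N hN] := strong_qf xi hd r0.
  have := hN N (leqnn _); have := pos_ge0 xi (pf N); rewrite ler_norml => h1 /andP[h2 h3]; lra.
- move=> xi; apply: strong_qf_le hd _ => n; exact: fp.
- exact: hcvg_unique (hd zeta) hs.
Qed.

(* A functional dominated by the trace on the corner has a bounded density:
   the point [w] obtained from [b zeta] is in the closed convex set
   [{d zeta | 0 <= d <= p}], for otherwise the spectral projection of the
   separating direction would separate [b] from this set. *)
Lemma tv_radon_nikodym b : commutant A b -> pos b -> ple b 1 ->
  exists d, [/\ corner d, pos d, ple d p &
    forall m, A m -> rp (m (b zeta)) zeta = rp (m (d zeta)) zeta].
Proof.
move=> hb pb b1.
(* A real subspace only. Self-adjoint elements see [b zeta] through its component [w] in the closure
   of [K], and it is [w] that is compared with [S]. *)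
pose K := [set eta | exists2 m, corner m /\ sa m & eta = m zeta].
pose S := [set eta | exists2 d, [/\ corner d, pos d & ple d p] & eta = d zeta].
have KD (a c : H) (t : R) : K a -> K c -> K (a + t%:C *: c).
  move=> [m [cm sm] ->] [m' [cm' sm'] ->]; exists (m + t%:C *: m') => //.
  by split; [apply: cornerD => //; exact: cornerZ|apply: saD => //; exact: saZ].
have S0 : S 0.
  exists 0 => //; split; [|exact: pos0|exact: (proj2 (prj_pos pp))].
  by split; [exact: vN0|rewrite mul0r|rewrite mulr0].
have SK (a : H) : S a -> K a by move=> [d [cd [sd _] _] ->]; exists d.
have [w Kw hw] : exists2 w : H, approx K w & forall c : H, K c -> rp (b zeta - w) c = 0.
  have [||w Kw hw] := @nearest R H K (b zeta).
  - by exists 0; exact: SK.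
  - move=> a c t Ka Kc _; apply: (KD) => //; have := KD c a (-1) Kc Ka.
    by rewrite rmorphN1 scaleN1r.
  exists w => // c Kc; have aux (t : R) : rp (b zeta - w) (t%:C *: c) <= 0.
    have := hw (t%:C *: c + w); rewrite addrK; apply => e e0.
    have [a Ka ha] := Kw e e0; exists (t%:C *: c + a); first by rewrite addrC; exact: KD.
    by rewrite opprD addrACA subrr add0r.
  by have := aux 1; have := aux (-1); rewrite !rpZr; lra.
have Scvx (a c : H) (t : R) : S a -> S c -> 0 <= t <= 1 -> S (a + t%:C *: (c - a)).
  move=> [d [cd pd dp] ->] [d' [cd' pd' dp'] ->] /andP[t0 t1].
  have E : d + t%:C *: (d' - d) = (1 - t)%:C *: d + t%:C *: d'.
    by rewrite scalerBr rmorphB scalerBl scale1r addrA addrAC.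
  exists (d + t%:C *: (d' - d)) => //; split.
  - by apply: cornerD => //; apply: cornerZ; exact: cornerB.
  - by rewrite E; apply: posD; apply: posZ => //; lra.
  - by move=> xi; rewrite E !qfE; have := dp xi; have := dp' xi; nra.
have [s0 Ss0 hs0] := @nearest R H S w (ex_intro _ 0 S0) Scvx.
have Sn (a : H) : S a -> nrm a <= nrm zeta.
  move=> [d [cd pd dp] ->]; apply: contr_nrm; apply: pos_contr => //.
  exact: ple_trans dp (prj_le1 pp).
have s0n : nrm s0 <= nrm zeta.
  have [f [Sf fs]] := approx_seq Ss0; apply: (hcvg_nrm_le fs) => n; exact: Sn.
have Kh : approx K (w - s0).
  move=> e e0; have [a Ka ha] := Kw (e / 2) ltac:(lra).
  have [c Sc hc] := Ss0 (e / 2) ltac:(lra).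
  exists (a - c); first by have := KD a c (-1) Ka (SK _ Sc); rewrite rmorphN1 scaleN1r.
  have -> : w - s0 - (a - c) = (w - a) - (s0 - c).
    by rewrite !opprB !addrA [w - s0 + c]addrAC [w - a + c]addrAC addrAC.
  by apply: le_trans (nrmB _ _) _; lra.
(* No self-adjoint [m] separates [w] from [S]. With [c] the square root of [b], the form of [m] at
   [c zeta] is at most that of the positive part of [m] at [zeta], because [c] is a contraction of
   the commutant; and the latter is the pairing of [m zeta] with the point [(e * p) zeta] of [S]. *)
have key m : corner m -> sa m -> exists2 s : H, S s & rp w (m zeta) <= rp s (m zeta).
  move=> cm sm; have [Am mp pm] := cm.
  have [pe ec e1 e2] := specP 0 sm; set e := spec m 0 in pe ec e1 e2.
  have Ae : A e by exact: vN_spec.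
  have ep : e * p = p * e by apply: ec; rewrite mp pm.
  have pep : prj (e * p).
    split; last by apply: saM => //; [exact: (proj2 pe)|exact: (proj2 pp)].
    by rewrite mulrA -(mulrA e p) -ep mulrA (proj1 pe) -mulrA (proj1 pp).
  have me : m * e = e * m by rewrite ec.
  have Cep : corner (e * p).
    by split; [apply: vNM => //; exact: tv_A|rewrite -mulrA (proj1 pp)|rewrite mulrA -ep -mulrA (proj1 pp)].
  exists ((e * p) zeta).
    exists (e * p) => //; split=> //; first exact: prj_pos.
    by apply: prj_mul_le => //; rewrite mulrA -ep -mulrA (proj1 pp).
  have Km : K (m zeta) by exists m.
  have -> : rp w (m zeta) = rp (b zeta) (m zeta) by have := hw _ Km; rewrite rpBl; lra.
  have [psb ssb csb] := bsqrtP pb.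
  have Bsb : commutant A (bsqrt b) by apply: (vN_sqrt (vN_commutant vA)).
  set c := bsqrt b in psb ssb csb Bsb.
  have sc : sa c by case: psb.
  have cc : contr c by apply/contrP; rewrite sc ssb.
  have -> : rp (b zeta) (m zeta) = qf m (c zeta).
    by rewrite -ssb mulbE (sa_rp _ _ sc) /qf (comm_app _ (Bsb _ Am)) rpC.
  have pm' : pos (adj e * m * e).
    split; first exact: saJ.
    by move=> xi; rewrite qf0 qfJ; have := e1 xi; rewrite mul0r.
  have Am' : A (adj e * m * e) by exact: vN_J.
  have mle xi : qf m xi <= qf (adj e * m * e) xi.
    rewrite qfJ; have := e2 xi; rewrite mul0r.
    have -> : qf m ((1 - e) xi) = qf m xi - qf m (e xi).
      rewrite /qf subbE onebE bopB !rpE.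
      have -> : rp (m (e xi)) xi = rp (m (e xi)) (e xi).
        by rewrite (comm_app _ me) -(sa_rp _ _ (proj2 pe)) prj_idem.
      have -> : rp (m xi) (e xi) = rp (m (e xi)) (e xi).
        by rewrite -(sa_rp _ _ (proj2 pe)) -(comm_app _ me) -(sa_rp _ _ (proj2 pe)) (comm_app _ me) prj_idem.
      by lra.
    by lra.
  apply: le_trans (mle _) _.
  have -> : qf (adj e * m * e) (c zeta) = rp (c (bsqrt (adj e * m * e) zeta)) (c (bsqrt (adj e * m * e) zeta)).
    rewrite -sqrt_rp //; congr rp; apply: comm_app; apply: Bsb; exact: vN_sqrt.
  apply: le_trans (cc _) _; rewrite sqrt_rp // qfJ /qf.
  rewrite mulbE (tv_fix) (comm_app _ me) (sa_rp _ _ (proj2 pe)) prj_idem //.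
  by rewrite rpC.
have h0 : w - s0 = 0.
  apply/rp_eq0/le_anti; rewrite rp_ge0 andbT; apply: small0 => e e0.
  pose B := 1 + 2 * nrm zeta + nrm (w - s0).
  have B1 : 0 < B by rewrite /B; have := nrm_ge0 zeta; have := nrm_ge0 (w - s0); lra.
  have [|_ [m [cm sm] ->] hm] := Kh (e / B); first by rewrite divr_gt0.
  have [s Ss hs] := key m cm sm.
  have := hs0 s (approx_sub Ss); set hh := w - s0 in hm *.
  have -> : rp hh hh = rp hh (m zeta) + rp hh (hh - m zeta) by rewrite -rpDr addrC subrK.
  have -> : rp hh (s - s0) = rp (s - s0) (m zeta) + rp (s - s0) (hh - m zeta).
    by rewrite -rpDr [m zeta + _]addrC subrK rpC.
  have := rp_le (s - s0) (hh - m zeta); have := rp_le' hh (hh - m zeta).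
  have := nrmB s s0; have := Sn _ Ss; move: hm; rewrite ler_pdivlMr // -/hh.
  have : rp hh (m zeta) <= rp (s - s0) (m zeta) by rewrite /hh !rpBl; lra.
  have := nrm_ge0 (hh - m zeta); set D := nrm (hh - m zeta).
  move=> D0 h1 h2 h3 h4 h5; rewrite ler_norml => /andP[h6 h7] h8.
  have : nrm (s - s0) * D <= (2 * nrm zeta) * D by rewrite ler_wpM2r //; lra.
  by move: h2; rewrite /B -/hh; lra.
have ws : w = s0 by apply/subr0_eq.
have [f [Sf fs]] := approx_seq Ss0.
have hh n : exists d : bop H, [/\ corner d, pos d, ple d p & f n = d zeta].
  by have [d [cd pd dp] ->] := Sf n; exists d.
have [F hF] := choice hh.
have [||||d [cd pd dp dz0]] := @tv_closed F s0.
- by move=> n; case: (hF n).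
- by move=> n; case: (hF n).
- by move=> n; case: (hF n).
- by move: fs; congr hcvg; apply/funext => n; case: (hF n).
exists d; split=> // m Am.
have Ap := tv_A.
have L0 (y : bop H) : p (y zeta) = y zeta -> rp (m (y zeta)) zeta = rp (y zeta) (adj (p * m * p) zeta).
  move=> py; rewrite -rp_adj !mulbE py (sa_rp _ _ (proj2 pp)) tv_fix.
  by [].
have cm := corner_adj (corner_cut Am).
rewrite !L0; first last.
- by rewrite (comm_app _ (hb _ Ap)) tv_fix.
- by have [_ _ pd'] := cd; rewrite -mulbE pd'.
set n := adj _ in cm *.
pose n1 := 2^-1%:C *: (n + adj n); pose n2 := (2^-1%:C * - 'i%C) *: (n - adj n).
have s1 : sa n1 by apply: saZ; rewrite /sa adjD adjK addrC.
have s2 : sa n2.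
  rewrite /sa /n2 adjZ adjB adjK -opprB scalerN -scaleNr; congr (_ *: _).
  by rewrite conjCE; apply/eqP; rewrite eq_complex /=; apply/andP; split; apply/eqP; ring.
have c1 : corner n1 by apply: cornerZ; apply: cornerD => //; exact: corner_adj.
have c2 : corner n2 by apply: cornerZ; apply: cornerB => //; exact: corner_adj.
have En : n zeta = n1 zeta + 'i%C *: n2 zeta.
  rewrite /n1 /n2 !scalebE addbE subbE scalerA.
  have -> : 'i%C * (2^-1%:C * - 'i%C) = 2^-1%:C :> R[i] by apply/eqP; rewrite eq_complex /=; apply/andP; split; apply/eqP; ring.
  rewrite -scalerDr addrACA subrr addr0 -mulr2n -(scaler_nat 2 (n zeta)) scalerA.
  have -> : 2^-1%:C * 2%:R = 1 :> R[i] by rewrite -(rmorph_nat (real_complex R)) -rmorphM mulVf ?pnatr_eq0.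
  by rewrite scale1r.
rewrite En !rpDr; congr (_ + _).
  have Kn : K (n1 zeta) by exists n1.
  by have := hw _ Kn; rewrite ws -dz0 rpBl; lra.
(* Both imaginary contributions vanish: for [d] by traciality, for [b] because [b] commutes with
   [n2]. *)
rewrite (tv_real cd c2 (proj1 pd) s2).
have [A2 _ _] := c2.
rewrite -bopZ -(sa_rp _ _ s2) -mulbE.
apply: sa_rp_i; apply: saM => //; first by case: pb.
exact: hb.
Qed.

(** As [w] commutes with [A], the number [|w (v zeta)|^2] is the pairing of [adj w * w] with
    [adj v * v]; the Radon-Nikodym density [d] of [adj w * w] represents it inside the corner, where
    traciality turns it into the trace of [v * d * adj v]. *)
Lemma dens_cyclic w : commutant A w -> contr w ->
  exists2 d, A d /\ pos d & forall z, A z -> dens (w (z zeta)) (z * d * adj z).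
Proof.
move=> hw cw; have vB := vN_commutant vA.
have hb : commutant A (adj w * w) by apply: (vNM vB) => //; exact: vN_comm_adj.
have [d [cd pd dp hd]] := tv_radon_nikodym hb (posA w) (proj1 (contrP w) cw).
have [Ad dp' pd'] := cd.
exists d => // z Az; split; [exact: vN_conj|exact: pos_conj|move=> u Au].
have Auz : A (u * z) by exact: vNM.
have -> : u * (z * d * adj z) * adj u = (u * z) * d * adj (u * z) by rewrite adjM !mulrA.
have -> : u (w (z zeta)) = w ((u * z) zeta) by rewrite mulbE (comm_app _ (hw _ Au)).
move: (u * z) Auz => v Av.
have Avv : A (adj v * v) by apply: vNM => //; exact: vN_adj.
have -> : rp (w (v zeta)) (w (v zeta)) = rp ((adj v * v) ((adj w * w) zeta)) zeta.
  by rewrite -[LHS]qfA /qf -(comm_app _ (hb _ Av)) [in RHS]mulbE [RHS]rp_adj adjK.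
rewrite hd //.
have cs := corner_sqrt pd cd; have ss := sqrt_sa pd; have sd := sqrt_sq pd.
move: (bsqrt d) cs ss sd => c cs ss sd; have [Ac cp pc] := cs.
have c2 : corner (p * (adj v * v) * p) := corner_cut Avv.
have s2 : sa (p * (adj v * v) * p) by have := saJ p (saA v); rewrite (proj2 pp).
have Avc : A (v * c) by exact: vNM.
have -> : v * d * adj v = (v * c) * adj (v * c) by rewrite adjM ss -sd !mulrA.
rewrite tv_nrm //; last by rewrite -mulrA cp.
congr (_%:E).
have := tv_swap cs (cornerM cs c2); rewrite adjM ss s2 !mulbE tv_fix.
have -> : p (c zeta) = c zeta by rewrite -mulbE pc.
rewrite [X in X = _]rpC [in X in X = _]rp_adj ss (sa_rp _ _ (proj2 pp)).
have -> : p (c (c zeta)) = d zeta by rewrite -mulbE pc -mulbE sd.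
rewrite (rp_adj (adj v)) adjK -(sa_rp _ _ (proj2 pp)) -[p (c zeta)]mulbE pc -rp_adj rpC => E.
by rewrite (rp_adj (adj v)) adjK -E.
Qed.

End Fixed.

(** Zorn's lemma on projections [r] of the commutant whose range is filled by vectors with a
    density. If a maximal [r] is not 1, factoriality of the commutant gives a partial isometry [w]
    from part of the cyclic subspace of [zeta] into [1 - r]; the vectors [w (z zeta)] have densities
    by [dens_cyclic], so [r + w * adj w] is larger. *)
Lemma dens_dense zeta p : factor A -> prj p -> p != 0 -> dens zeta p ->
  forall xi, approx [set eta | exists x, dens eta x] xi.
Proof.
move=> fA pp p0 dz; have vB := vN_commutant vA; have fB := factor_commutant vA fA.
pose N (r : bop H) := [set eta | r eta = eta /\ exists x, dens eta x].
pose W (r : bop H) := [/\ commutant A r, prj r & forall xi, approx (N r) (r xi)].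
pose S := {r | W r}.
pose le (a b : S) := `[< sval b * sval a = sval a >].
have leP (a b : S) : le a b <-> sval b * sval a = sval a by split=> /asboolP.
have [| | | |r0 hr0] := @Zorn S le.
- by move=> a; apply/leP; case: (svalP a) => _ [].
- by move=> b a c /leP ab /leP bc; apply/leP; rewrite -ab mulrA bc.
- move=> a b /leP ab /leP ba; apply: eq_sig_hprop => [? ? ?|]; first exact: Prop_irrelevance.
  have [_ pa _] := svalP a; have [_ pb _] := svalP b.
  by have := congr1 adj ab; rewrite adjM (proj2 pa) (proj2 pb) ba.
- move=> Ch tot.
  pose C := [set xi | xi = 0 \/ exists2 a : S, Ch a & sval a xi = xi].
  have sC : subsp C.
    split; first by left.
    move=> k x y [->|[a ha ax]] [->|[b hb hy]].
    + by left; rewrite scaler0 addr0.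
    + by right; exists b => //; rewrite scaler0 add0r.
    + by right; exists a => //; rewrite addr0 bopZ ax.
    + have [/leP ab|/leP ba] := tot _ _ ha hb; right.
        by exists b => //; rewrite bop_lin hy -ax -mulbE ab.
      by exists a => //; rewrite bop_lin ax -hy -mulbE ba.
  have [|q [pq Bq qa qid qo]] := @vN_prj R H (commutant A) C vB sC.
    move=> u xi hu [->|[a ha ax]]; first by left; rewrite bop0.
    right; exists a => //; have [Ba _ _] := svalP a.
    by rewrite (comm_app _ (hu _ Ba)) ax.
  have Wq : W q.
    split=> // xi e e0; have [c Cc hc] := qa xi (e / 2) ltac:(lra).
    case: Cc => [c0|[a ha ac]].
      exists 0; last by move: hc; rewrite c0; lra.
      by split; [rewrite bop0|exists 0; exact: dens0].
    have [_ pa /(_ c)] := svalP a; rewrite ac => /(_ (e / 2)) [|eta [ae de] he]; first lra.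
    exists eta; last by have := nrm_tri c (q xi) eta; lra.
    by split=> //; apply: qid; apply: approx_sub; right; exists a.
  exists (exist _ q Wq) => a ha; apply/leP => /=.
  have [_ pa _] := svalP a; apply: bopP => xi; rewrite mulbE; apply: qid; apply: approx_sub.
  by right; exists a => //; rewrite prj_idem.
case: r0 hr0 => r [Br pr dr] hmax.
suff r1 : r = 1 by move=> xi e e0; have [eta [_ h1] h2] := dr xi e e0; exists eta => //; move: h2; rewrite r1.
apply/esym/eqP; rewrite -subr_eq0; apply/negPn/negP => n1.
pose C := [set eta | exists2 z, A z & eta = z zeta].
have sC : subsp C.
  split; first by exists 0; [exact: vN0|].
  move=> k _ _ [c hc ->] [c' hc' ->]; exists (k *: c + c') => //.
  by apply: (vND vA) => //; exact: (vNZ k vA).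
have [|q [pq Bq qa qid qo]] := @vN_prj R H (commutant A) C vB sC.
  move=> u _ hu [c hc ->]; have Au : A u by move: hu; rewrite (proj2 vA).
  by exists (u * c) => //; exact: vNM.
have q0 : q != 0.
  apply: contraNneq p0 => q0; apply/eqP.
  have z0 : zeta = 0.
    by rewrite -(qid zeta) ?q0 //; apply: approx_sub; exists 1 => //; exact: vN1.
  have [Ap _ /(_ p Ap)] := dz; rewrite (proj2 pp) !(proj1 pp) z0 bop0 rp0l.
  exact: (tau_faithful T Ap (prj_pos pp)).
have B1 := vN1 vB; have Br' := vNB vB B1 Br.
have [w [Bw w0 pw wq rw]] := factor_pisom vB fB Bq Br' pq (prjC pr) q0 n1.
have rw0 : r * w = 0 by rewrite -rw mulrA mulrBr mulr1 (proj1 pr) subrr mul0r.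
have pw' := pisom_prj pw.
have cw : contr w by apply/contrP; exact: prj_le1.
have [d [Ad pd] hd] := dens_cyclic pp dz Bw cw.
have rww : r * (w * adj w) = 0 by rewrite mulrA rw0 mul0r.
have pr' : prj (r + w * adj w).
  split; last by apply: saD; [exact: (proj2 pr)|exact: (proj2 pw')].
  by rewrite mulrDl !mulrDr (proj1 pr) (proj1 pw') rww (prj_zero_anti pr pw' rww) addr0 add0r.
have Wr' : W (r + w * adj w).
  split=> //; first by apply: (vND vB) => //; apply: (vNM vB) => //; exact: vN_comm_adj.
  move=> xi e e0; have [eta [re [x dx]] he] := dr xi (e / 2) ltac:(lra).
  have [_ [z Az ->] hz] := qa (adj w xi) (e / 2) ltac:(lra).
  have qw : q (adj w xi) = adj w xi.
    by rewrite -mulbE; have := congr1 adj wq; rewrite adjM (proj2 pq) => ->.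
  rewrite qw in hz.
  exists (eta + w (z zeta)); last first.
    rewrite addbE mulbE opprD addrACA -bopB; apply: le_trans (nrmD _ _) _.
    by have := contr_nrm (adj w xi - z zeta) cw; lra.
  split.
    rewrite addbE !bopD re -(mulbE r) rw0 zerobE addr0; congr (_ + _).
    rewrite -{1}re -[X in X + _](mulbE _ r) (prj_zero_anti pr pw' rww) zerobE add0r.
    by rewrite -mulbE -mulrA pisom_adj.
  exists (x + z * d * adj z); apply: dens_add => //; first exact: hd.
  move=> u Au; rewrite -re (comm_app _ (Br _ Au)) (sa_rp _ _ (proj2 pr)).
  by rewrite -(comm_app _ (Br _ Au)) -(mulbE r) rw0 zerobE bop0 rp0r.
have : le (exist _ r (And3 Br pr dr)) (exist _ (r + w * adj w) Wr').
  by apply/leP => /=; rewrite mulrDl (proj1 pr) (prj_zero_anti pr pw' rww) addr0.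
move=> /hmax /(congr1 sval) /= E.
have ww0 : w * adj w = 0 by rewrite -(addKr r (w * adj w)) E addNr.
by move: w0; rewrite -(pisom_adj pw) mulrA ww0 mul0r eqxx.
Qed.

End TraceVector.

(** * Ky Fan functionals and their symmetry *)

Section KyFan.
Context {R : realType} {H : hilbertType R}.
Implicit Types (xi eta zeta : H) (k : R[i]) (r s t : R) (C : set H) (x y z p q u v w a b h e g d m : bop H).
Context (A : set (bop H)) (tau : bop H -> \bar R).
Context (vA : von_neumann_algebra A) (T : nsf_trace A tau).

Definition effects s := [set a : bop H | [/\ A a, pos a, ple a 1 & (tau a <= s%:E)%E]].
Definition kyfan s xi : R := sup [set qf a xi | a in effects s].

Lemma effects0 s : 0 <= s -> effects s 0.
Proof.
move=> s0; split; [exact: vN0|exact: pos0|exact: (proj2 pos1)|].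
by rewrite (tau0 vA T) lee_fin.
Qed.

Lemma kyfan_has_sup s xi : 0 <= s -> has_sup [set qf a xi | a in effects s].
Proof.
move=> s0; split; first by exists (qf 0 xi), 0 => //; exact: effects0.
by exists (rp xi xi) => _ [a [_ _ a1 _] <-]; have := a1 xi; rewrite qf1.
Qed.

Lemma kyfan_ub s xi a : 0 <= s -> effects s a -> qf a xi <= kyfan s xi.
Proof. by move=> s0 ha; apply: (sup_upper_bound (kyfan_has_sup xi s0)); exists a. Qed.

Lemma kyfan_le s xi (c : R) : 0 <= s -> (forall a, effects s a -> qf a xi <= c) -> kyfan s xi <= c.
Proof.
move=> s0 h; apply: ge_sup; first by have [] := kyfan_has_sup xi s0.
by move=> _ [a ha <-]; exact: h.
Qed.

Lemma kyfan_ge0 s xi : 0 <= s -> 0 <= kyfan s xi.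
Proof. by move=> s0; have := kyfan_ub xi s0 (effects0 s0); rewrite qf0. Qed.

Lemma kyfan_le1 s xi : 0 <= s -> kyfan s xi <= rp xi xi.
Proof. by move=> s0; apply: kyfan_le => // a [_ _ h _]; have := h xi; rewrite qf1. Qed.

Lemma qf_lip a xi eta : pos a -> ple a 1 ->
  qf a xi <= qf a eta + (nrm xi + nrm eta) * nrm (xi - eta).
Proof.
move=> pa a1; have ca := pos_contr pa a1.
have -> : qf a xi = qf a eta + rp (a xi) (xi - eta) + rp (a (xi - eta)) eta.
  rewrite /qf bopB !rpE (rpC (a eta) eta) (sa_rp xi eta (proj1 pa)) (rpC xi).
  by rewrite (rpC (a eta)); lra.
have := rp_le' (a xi) (xi - eta); have := rp_le' (a (xi - eta)) eta.
have := contr_nrm xi ca; have := contr_nrm (xi - eta) ca.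
have := nrm_ge0 (xi - eta); have := nrm_ge0 eta; nra.
Qed.

Lemma kyfan_lip s xi eta : 0 <= s ->
  kyfan s xi <= kyfan s eta + (nrm xi + nrm eta) * nrm (xi - eta).
Proof.
move=> s0; apply: kyfan_le => // a ha; have [_ pa a1 _] := ha.
by apply: le_trans (qf_lip xi eta pa a1) _; have := kyfan_ub eta s0 ha; lra.
Qed.

(** The domination makes [z eta -> z zeta] a well-defined contraction; it commutes with [A] because
    left multiplication preserves its graph. *)
Lemma commutant_extend eta zeta : (forall z, A z -> nrm (z zeta) <= nrm (z eta)) ->
  exists v, [/\ commutant A v, v eta = zeta &
    forall xi, (forall z, A z -> rp xi (z eta) = 0) -> v xi = 0].
Proof.
move=> h; pose F := [set w : H * H | exists2 z, A z & w = (z eta, z zeta)].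
have Fin z : A z -> F (z eta, z zeta) by move=> Az; exists z.
have [| | |v [vF v0 _ vu]] := @extend R H F 1.
- by exists 0; [exact: vN0|].
- move=> k a a' b b' [z Az [-> ->]] [z' Az' [-> ->]].
  exists (k *: z + z'); first by apply: (vND vA) => //; exact: vNZ.
  by rewrite !bE.
- by move=> a a' [z Az [-> ->]]; rewrite mul1r; exact: h.
have keyF u (a a' : H) : A u -> F (a, a') -> F (u a, u a').
  by move=> Au [z Az [-> ->]]; exists (u * z) => //; exact: vNM.
exists v; split.
- move=> u Au; apply: vu => a a'; apply: keyF => //; exact: vN_adj.
- by have := vF _ _ (Fin 1 (vN1 vA)).
- by move=> xi h'; apply: v0 => a a' [z Az [-> _]]; exact: h'.
Qed.

Lemma cyclic_prj eta : exists e, [/\ prj e, commutant A e,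
  forall xi, approx [set w | exists2 z, A z & w = z eta] (e xi) &
  forall xi z, A z -> rp ((1 - e) xi) (z eta) = 0].
Proof.
have vB := vN_commutant vA; set C := [set w | _].
have sC : subsp C.
  split; first by exists 0; [exact: vN0|].
  move=> k _ _ [c hc ->] [c' hc' ->]; exists (k *: c + c') => //.
  by apply: (vND vA) => //; exact: (vNZ k vA).
have [|q [pq Bq qa qid qo]] := @vN_prj R H (commutant A) C vB sC.
  move=> u _ hu [c hc ->]; have Au : A u by move: hu; rewrite (proj2 vA).
  by exists (u * c) => //; exact: vNM.
exists q; split=> // xi z Az; rewrite (sa_rp _ _ (proj2 (prjC pq))) subbE onebE qid ?subrr ?rp0r //.
by apply: approx_sub; exists z.
Qed.

Lemma kyfan_compress s xi e : 0 <= s -> prj e -> commutant A e -> kyfan s (e xi) <= kyfan s xi.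
Proof.
move=> s0 pe Be; apply: kyfan_le => // a ha; apply: le_trans (kyfan_ub xi s0 ha).
have [Aa pa _ _] := ha; rewrite -(sqrt_rp _ pa) -(sqrt_rp xi pa).
rewrite (comm_app _ (Be _ (vN_sqrt vA Aa pa))); exact: prj_contr.
Qed.

(* [u a u'] is compared with [u' (v a v') u], where [v = u (u' u + c)^{-1/2}]
   regularises the polar part of [u] (primes are adjoints). *)
Lemma effects_conj u a s (c : R) : 0 <= s -> 0 < c -> A u -> effects s a ->
  exists2 a' : bop H, effects s a' & (tau (u * a * adj u)%R <= tau (adj u * a' * u)%R + (c * s)%:E)%E.
Proof.
move=> s0 c0 Au [Aa pa a1 ta]; have pq := posA u; set q := adj u * u in pq *.
have Aq : A q by apply: vNM => //; exact: vN_adj.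
have [i [pi i1 i2 ci _]] := inv_ex pq c0.
have Ai : A i by apply: (vN_fc vA Aq).
have qi : q * i = i * q by rewrite ci.
set r := bsqrt i; have rr : r * r = i := sqrt_sq pi.
have sr : sa r := sqrt_sa pi; have sq := proj1 pq; have Ar : A r by exact: vN_sqrt.
have rq : r * q = q * r by apply: sqrt_comm.
have ri : r * i = i * r by apply: sqrt_comm.
have qi1 : q * i = 1 - c%:C *: i.
  by apply/eqP; rewrite eq_sym subr_eq -i1 mulrDl /cst -scalebAl mul1r.
have i_pos := pi; have pci : pos (c%:C *: i) by apply: posZ => //; lra.
pose v := u * r.
have vv : adj v * v = q * i.
  by rewrite /v adjM sr !mulrA -(mulrA r) -/q rq -mulrA rr.
have cv : contr v.
  by apply/contrP => xi; rewrite vv qi1 qfB; have := pos_ge0 xi pci; lra.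
have Av : A v by exact: vNM.
exists (v * a * adj v).
  split; [exact: vN_conj|exact: pos_conj| |].
    apply: ple_trans (ple_conj v a1) _; rewrite mulr1.
    by have /contrP := contr_adj cv; rewrite adjK.
  exact: le_trans (tau_contr vA T Av cv Aa pa) ta.
pose g := adj v * u; have gE : g = r * q by rewrite /g /v adjM sr -mulrA.
have sg : sa g by rewrite gE; apply: saM.
have Ag : A g by apply: vNM => //; exact: vN_adj.
have -> : adj u * (v * a * adj v) * u = g * a * adj g.
  have -> : adj u * (v * a * adj v) * u = (adj u * v) * a * g by rewrite /g !mulrA.
  by rewrite sg; congr (_ * _ * _); rewrite -sg /g adjM adjK.
(* Here [adj g * g = q^2 (q + c)^{-1}], which falls short of [q] by [c q (q + c)^{-1} <= c]; this is
   the source of the error [c * s]. *)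
have gg : adj g * g = q - c%:C *: (q * i).
  have -> : adj g * g = q * (q * i).
    by rewrite sg gE -mulrA (mulrA q) -rq (mulrA r) (mulrA r r) rr -qi -mulrA -qi.
  by rewrite {1}qi1 mulrBr mulr1 -scalebAr.
rewrite !(tau_conj vA T) // gg -/q.
have psa := sqrt_sa pa; have saa := sqrt_sq pa; have Asa := vN_sqrt vA Aa pa.
set w := bsqrt a in psa saa Asa *.
have A1 : A (w * (q - c%:C *: (q * i)) * w).
  by have := vN_J vA (vNB vA Aq (vNZ c%:C vA (vNM vA Aq Ai))) Asa; rewrite psa.
have p1 : pos (w * (q - c%:C *: (q * i)) * w).
  by rewrite -gg; have := posJ w (posA g); rewrite psa.
have pca : pos (c%:C *: a) by apply: posZ => //; lra.
have Aca : A (c%:C *: a) by exact: vNZ.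
apply: (@le_trans _ _ (tau (w * (q - c%:C *: (q * i)) * w + c%:C *: a))).
  apply: (tau_mono vA T) => //.
  - by have := vN_J vA Aq Asa; rewrite psa.
  - by have := posJ w pq; rewrite psa.
  - exact: vND.
  - exact: posD.
  - move=> xi; rewrite qfD; have := qfJ (q - c%:C *: (q * i)) w xi; rewrite psa => ->.
    have := qfJ q w xi; rewrite psa => ->.
    have -> : qf (c%:C *: a) xi = c * rp (w xi) (w xi) by rewrite qfZ sqrt_rp.
    rewrite qfB qi1 qfZ qfB qf1; have := pos_ge0 (w xi) pci; nra.
rewrite (tauD T) // (tauZ T) //; last by lra.
by rewrite leeD2l // EFinM lee_wpmul2l // lee_fin ltW.
Qed.

Lemma qf_split x e xi : prj e -> x * e = e * x -> qf x xi = qf x (e xi) + qf x ((1 - e) xi).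
Proof.
move=> pe xe; have h : rp (x (e xi)) ((1 - e) xi) = 0.
  rewrite (comm_app _ xe) (sa_rp _ _ (proj2 pe)) -mulbE mulrBr mulr1 (proj1 pe) subrr.
  by rewrite rp0r.
have h' : rp (x ((1 - e) xi)) (e xi) = 0.
  have xe' : x * (1 - e) = (1 - e) * x by rewrite mulrBl mulrBr mul1r mulr1 xe.
  rewrite (comm_app _ xe') (sa_rp _ _ (proj2 (prjC pe))) -mulbE mulrBl mul1r (proj1 pe) subrr.
  by rewrite rp0r.
have {1}-> : xi = e xi + (1 - e) xi by rewrite subbE addrC subrK.
move: h h'; rewrite /qf bopD; move: (e xi) ((1 - e) xi) => v w h h'.
by rewrite !rpE h h' addr0 add0r.
Qed.

Lemma spec_lower x t d : pos x -> prj d -> x * d = d * x -> spec x t * d = d ->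
  ple (t%:C *: d) (bsqrt x * d * bsqrt x).
Proof.
move=> px pd xd ed xi; have := qfJ d (bsqrt x) xi; rewrite (sqrt_sa px) => ->.
rewrite qfZ !prj_qf //; have := sqrt_comm px xd => /esym /comm_app ->.
rewrite sqrt_rp // -ed mulbE; have [_ _ h _] := specP t (proj1 px).
by have := h (d xi); rewrite -mulbE.
Qed.

(** The inequality [x <= t + (x - t)_+], with the positive part written through the spectral
    projection. *)
Lemma spec_upper x t : pos x -> let e := spec x t in
  ple x (cst t + (bsqrt x * e * bsqrt x - t%:C *: e)).
Proof.
move=> px e xi; have [pe ec _ eu] := specP t (proj1 px); rewrite -/e in pe ec eu.
have xe : x * e = e * x by rewrite ec.
rewrite (qf_split xi pe xe) qfD qf_cst qfB qfZ.
have := qfJ e (bsqrt x) xi; rewrite (sqrt_sa px) => ->.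
rewrite !(prj_qf _ pe); have := sqrt_comm px xe => /esym /comm_app ->.
rewrite sqrt_rp //; have := eu xi; have := prj_qf xi (prjC pe).
by rewrite qfB qf1 prj_qf // => <-; lra.
Qed.

Lemma tau_fin x (M : R) : A x -> pos x -> (tau x <= M%:E)%E -> exists2 r : R, 0 <= r & tau x = r%:E.
Proof.
move=> Ax px; have := tau_ge0 T Ax px; case: (tau x) => // r.
by rewrite !lee_fin => r0 _; exists r.
Qed.

(** A near-optimal effect is a function of the density [x]: all of the spectral part above a
    threshold, plus the fraction of the next layer that brings the trace up to [s]. Commutation with
    [x] is what [dens_coeffect] needs. *)
Lemma commuting_effect eta x s (c : R) : dens A tau eta x -> 0 < s -> 0 < c ->
  exists a, [/\ effects s a, a * x = x * a & kyfan s eta <= qf a eta + c].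
Proof.
move=> dx s0 c0; have [Ax px _] := dx; have sx := proj1 px.
(* Thresholds are multiples of [c / s]: missing the exact quantile by one spacing costs at most
   [k0 * s = c]. *)
pose k0 := c / s; have k_gt0 : 0 < k0 by rewrite divr_gt0.
pose t (n : nat) : R := n.+1%:R * k0; pose e n := spec x (t n).
have t_gt0 n : 0 < t n by rewrite mulr_gt0 // ltr0n.
have pe n : prj (e n) := spec_prj _ sx.
have Ae n : A (e n) by exact: vN_spec.
have xe n : x * e n = e n * x by rewrite spec_comm.
have dl d n : A d -> prj d -> x * d = d * x -> e n * d = d ->
    exists2 r : R, 0 <= r & tau d = r%:E /\ t n * r <= qf d eta.
  move=> Ad pd xd ed; have h := spec_lower px pd xd ed.
  have pd' := prj_pos pd; have ptd : pos ((t n)%:C *: d) by apply: posZ => //; exact: ltW.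
  have := tau_mono vA T (vNZ _ vA Ad) ptd (vN_sqJ vA Ax px Ad) (pos_sqJ px pd') h.
  rewrite (dens_qf vA T dx) // (tauZ T) //; last exact: ltW.
  have := tau_ge0 T Ad pd'; case: (tau d) => [r| |] //.
    by rewrite -EFinM !lee_fin => r0 h'; exists r.
  by rewrite gt0_muley ?lte_fin.
have en n : exists2 r : R, 0 <= r & tau (e n) = r%:E /\ t n * r <= qf (e n) eta.
  by apply: (dl _ n) => //; exact: (proj1 (pe n)).
have ex : exists n, (tau (e n) < s%:E)%E.
  pose B := rp eta eta / (k0 * s).
  have B0 : 0 <= B by apply: divr_ge0; [exact: rp_ge0|apply: mulr_ge0; exact: ltW].
  have [N hN] : exists N : nat, B < N%:R by exists (Num.bound B); exact: archi_boundP.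
  exists N; have [r r0 [-> h]] := en N.
  have := prj_le1 (pe N) eta; rewrite qf1 lte_fin => h1.
  rewrite ltNge; apply/negP => sr.
  have k0s : 0 < k0 * s by rewrite mulr_gt0.
  move: hN; rewrite /B ltr_pdivrMr // => h2.
  have : t N * s <= t N * r by rewrite ler_wpM2l // ltW.
  have : N%:R * (k0 * s) < t N * s.
    by rewrite /t -[_ * k0 * s]mulrA ltr_pM2r ?ltr_nat.
  lra.
case: (ex_minnP ex) => m hm mmin.
have [r r0 [tr hr]] := en m; move: (hm); rewrite tr lte_fin => rs.
(* For every effect [a], [tau (a x) <= t tau a + tau ((x - t)_+)]; this is used at the first
   threshold whose spectral projection has trace below [s]. *)
have ub : kyfan s eta <= t m * s + qf (e m) eta - t m * r.
  apply: kyfan_le => [|a [Aa pa a1 ta]]; first exact: ltW.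
  have hsu := spec_upper (t m) px; rewrite /= -/(e m) in hsu.
  set y := bsqrt x * e m * bsqrt x - (t m)%:C *: e m in hsu.
  have Ay : A y by apply: vNB => //; [exact: vN_sqJ|exact: vNZ].
  have py : pos y.
    apply: posB; [|by case: (pos_sqJ px (prj_pos (pe m)))|].
      by apply: saZ; case: (pe m).
    by apply: spec_lower => //; exact: (proj1 (pe m)).
  have ty : tau y = (qf (e m) eta - t m * r)%:E.
    have pte : pos ((t m)%:C *: e m) by apply: posZ; [exact: ltW|exact: prj_pos].
    have := tauD T Ay py (vNZ _ vA (Ae m)) pte.
    rewrite subrK (dens_qf vA T dx) //; last exact: prj_pos.
    rewrite (tauZ T) // ?tr; [|exact: ltW|exact: prj_pos].
    case: (tau y) => [w| |] //= [->]; congr (_%:E); lra.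
  have [ra ra0 era] := tau_fin Aa pa ta; move: ta; rewrite era lee_fin => ras.
  have pta : pos ((t m)%:C *: a) by apply: posZ => //; exact: ltW.
  have sA := sqrt_sa pa.
  rewrite -lee_fin -(dens_qf vA T dx) // (tau_swap vA T) //.
  apply: (@le_trans _ _ (tau ((t m)%:C *: a + bsqrt a * y * bsqrt a))).
    apply: (tau_mono vA T); [exact: vN_sqJ|exact: pos_sqJ| | |].
    - by apply: vND => //; [exact: vNZ|exact: vN_sqJ].
    - by apply: posD => //; exact: pos_sqJ.
    - apply: ple_trans (ple_sqJ pa hsu) _ => xi.
      rewrite mulrDr mulrDl qfD qfD /cst -scalebAr -scalebAl mulr1 sqrt_sq //.
  rewrite (tauD T) //; [|exact: vNZ|exact: vN_sqJ|exact: pos_sqJ].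
  rewrite (tauZ T) // ?era; last exact: ltW.
  have := tau_contr vA T (vN_sqrt vA Aa pa) (_ : contr (bsqrt a)) Ay py.
  rewrite sA ty => h.
  have {}h : (tau (bsqrt a * y * bsqrt a)%R <= (qf (e m) eta - t m * r)%:E)%E.
    by apply: h; apply/contrP => xi; rewrite sA sqrt_sq.
  apply: le_trans (leeD2l _ h) _.
  rewrite -EFinM -EFinD lee_fin; have := t_gt0 m; nra.
have tk : k0 * s = c by rewrite /k0 divfK // gt_eqF.
have tkr : k0 * (s - r) <= c by rewrite -tk ler_wpM2l ?(ltW k_gt0) //; lra.
(* If already the lowest spectral projection has trace below [s], it is good enough on its own. *)
case: m hm mmin r0 tr hr rs ub => [|m] hm mmin r0 tr hr rs ub.
  exists (e 0%N); split; last by move: ub; rewrite /t mul1r; lra.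
    by split; [exact: Ae|exact: prj_pos|exact: prj_le1|rewrite tr lee_fin ltW].
  by rewrite xe.
set f := e m; set g := e m.+1 in tr hr ub.
have [q q0 [tq hq]] := en m; rewrite -/f in tq hq.
have sq : s <= q.
  have := mmin m; rewrite -/f tq lte_fin ltnn => h.
  by rewrite leNgt; apply/negP => /h.
have fg : f * g = g by apply: spec_mono => //; rewrite /t ltr_pM2r // ltr_nat.
have pd := prjB (pe m.+1) (pe m) fg; rewrite -/f -/g in pd.
have Ad : A (f - g) := vNB vA (Ae m) (Ae m.+1).
have xd : x * (f - g) = (f - g) * x by rewrite mulrBr mulrBl /f /g !xe.
have [|r' r'0 [tr' hr']] := dl (f - g) m Ad pd xd.
  by rewrite -/f mulrBr fg (proj1 (pe m)).
have qr : q = r + r'.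
  have := tauD T (Ae m.+1) (prj_pos (pe m.+1)) Ad (prj_pos pd).
  by rewrite -/g addrC subrK tq tr tr' => -[].
pose th := (s - r) / r'.
have r'_gt0 : 0 < r' by lra.
have thr : th * r' = s - r by rewrite /th divfK // gt_eqF.
have th0 : 0 <= th by rewrite /th divr_ge0 //; lra.
have th1 : th <= 1 by rewrite /th ler_pdivrMr //; lra.
have ptd : pos (th%:C *: (f - g)) by apply: posZ => //; exact: prj_pos.
exists (g + th%:C *: (f - g)); split.
- split.
  + by apply: (vND vA) => //; [exact: Ae|exact: vNZ].
  + by apply: posD => //; apply: prj_pos; exact: pe.
  + move=> xi; have := prj_le1 (pe m) xi; have := pos_ge0 xi (prj_pos pd).
    by move=> h1 h2; have := qfB f g xi; rewrite [qf (g + _) xi]qfD qfZ; move: h1 h2; rewrite -/f; nra.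
  + rewrite (tauD T) //; [|exact: Ae|apply: prj_pos; exact: pe|exact: vNZ].
    rewrite (tauZ T) //; last exact: prj_pos.
    by rewrite tr tr' -EFinM -EFinD lee_fin thr; lra.
- by rewrite mulrDl mulrDr -scalebAl -scalebAr xd /g xe.
- apply: le_trans ub _; rewrite [qf (g + _) _]qfD [qf (th%:C *: _) _]qfZ.
  have h1 : th * (t m * r') <= th * qf (f - g) eta by rewrite ler_wpM2l.
  have h2 : th * (t m * r') = t m * (s - r) by rewrite mulrCA thr.
  have h3 : t m.+1 = t m + k0 by rewrite /t -[m.+2]addn1 natrD; ring.
  by rewrite h3; lra.
Qed.

(* The counterpart of [effects] in the commutant, defined without a trace there. *)
Definition coeffects s := [set b : bop H | [/\ commutant A b, pos b & forall xi, qf b xi <= kyfan s xi]].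

Lemma coeffects_le1 s b : 0 <= s -> coeffects s b -> ple b 1.
Proof. by move=> s0 [_ _ h] xi; apply: le_trans (h xi) _; rewrite qf1 kyfan_le1. Qed.

(** Take [v] in the commutant with [v eta = bsqrt a eta] and [b = adj v * v]. For [z] in [A],
    [qf b (z eta)] is the trace of [u a adj u] with [u = z y], [y] the root of the density; up to an
    arbitrarily small error, [effects_conj] bounds it by [qf a' (z eta)] for another effect [a'].
    Continuity of [kyfan] carries the bound to the cyclic subspace of [eta], outside which [v]
    vanishes. *)
Lemma dens_coeffect eta x a s : dens A tau eta x -> 0 <= s -> effects s a -> a * x = x * a ->
  exists2 b : bop H, coeffects s b & qf b eta = qf a eta.
Proof.
move=> dx s0 ha ax; have [Ax px hx] := dx; have [Aa pa a1 _] := ha.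
have Asa := vN_sqrt vA Aa pa; have ssa := sqrt_sa pa; have qsa := sqrt_sq pa.
have sx := sqrt_sa px; have Asx := vN_sqrt vA Ax px.
set c := bsqrt a in Asa ssa qsa; set y := bsqrt x in sx Asx.
have cx : c * x = x * c by apply: sqrt_comm.
have cy : y * c = c * y by apply: sqrt_comm.
have yy : y * y = x := sqrt_sq px.
have key z : A z -> (rp (z (c eta)) (z (c eta)))%:E = tau ((z * y) * a * adj (z * y)).
  move=> Az; rewrite -mulbE -hx; last exact: vNM.
  congr tau; rewrite !adjM ssa sx -!mulrA; congr (_ * _).
  have cy' w : y * (c * w) = c * (y * w) by rewrite mulrA cy mulrA.
  by rewrite -yy -qsa -!mulrA !cy'.
have [|v [Bv vc v0]] := @commutant_extend eta (c eta).
  move=> z Az; apply: nrm_le_sq; first exact: nrm_ge0.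
  rewrite nrm2 -lee_fin key // -hx //; apply: (tau_mono vA T).
  - by apply: vN_conj => //; exact: vNM.
  - exact: pos_conj.
  - exact: vN_conj.
  - exact: pos_conj.
  - apply: ple_trans (ple_conj _ a1) _ => xi.
    by rewrite mulr1 adjM sx !mulrA -(mulrA z y y) yy.
have vB := vN_commutant vA.
exists (adj v * v); last by rewrite qfA vc -qfA ssa qsa.
split; [by apply: (vNM vB) => //; exact: vN_comm_adj|exact: posA|move=> xi].
have [e [pe Be ea eo]] := cyclic_prj eta.
apply: le_trans (kyfan_compress xi s0 pe Be).
have -> : qf (adj v * v) xi = qf (adj v * v) (e xi).
  have h : v ((1 - e) xi) = 0 by apply: v0 => z; exact: eo.
  by rewrite !qfA; have {1 2}-> : xi = e xi + (1 - e) xi by [rewrite subbE addrC subrK]; rewrite bopD h addr0.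
move: (e xi) (ea xi) => zt hz.
have onA z : A z -> qf (adj v * v) (z eta) <= kyfan s (z eta).
  move=> Az; have -> : qf (adj v * v) (z eta) = rp (z (c eta)) (z (c eta)).
    by rewrite qfA -vc (comm_app _ (Bv _ Az)).
  suff : rp (z (c eta)) (z (c eta)) - kyfan s (z eta) <= 0 by lra.
  apply: small0 => d d0; have Azy : A (z * y) by exact: vNM.
  pose cc := d / (1 + s); have cc0 : 0 < cc by rewrite divr_gt0 //; lra.
  have cs : cc * s <= d by rewrite /cc mulrAC ler_pdivrMr; [nra|lra].
  have [a' ha'] := effects_conj s0 cc0 Azy ha.
  have [Aa' pa' _ _] := ha'.
  have -> : tau (adj (z * y) * a' * (z * y)) = (qf a' (z eta))%:E.
    rewrite -(dens_qf vA T (dens_act vA dx Az)) //; have [Azz pzz _] := dens_act vA dx Az.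
    rewrite (tau_swap vA T) //.
    have := tau_adj T (vNM vA (vN_sqrt vA Aa' pa') Azy); rewrite !adjM (sqrt_sa pa') sx.
    rewrite !mulrA -(mulrA (y * adj z)) (sqrt_sq pa') => ->; congr tau.
    by rewrite -(mulrA (bsqrt a' * z) y y) yy.
  rewrite -key // -EFinD lee_fin; have := kyfan_ub (z eta) s0 ha'; lra.
suff : qf (adj v * v) zt - kyfan s zt <= 0 by lra.
apply: small0 => d d0; have [M M0 hM] := bop_bound (adj v * v).
pose L := (2 * nrm zt + 1) * (1 + M).
have L0 : 0 < L by rewrite mulr_gt0 //; have := nrm_ge0 zt; lra.
have [|_ [z Az ->] hd] := hz (Num.min 1 (d / L)).
  by rewrite lt_min ltr01 divr_gt0.
have [h1 h2] : nrm (zt - z eta) <= 1 /\ nrm (zt - z eta) * L <= d.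
  by move: hd; rewrite le_min => /andP[-> ]; rewrite ler_pdivlMr.
move: (z eta) (onA z Az) h1 h2 => w hw h1 h2.
have hk := kyfan_lip w zt s0; rewrite (nrmBC w) in hk.
have hv : qf (adj v * v) zt - qf (adj v * v) w <= M * (nrm zt + nrm w) * nrm (zt - w).
  have -> : qf (adj v * v) zt - qf (adj v * v) w =
     rp ((adj v * v) zt) (zt - w) + rp ((adj v * v) (zt - w)) w.
    rewrite /qf bopB !rpE (sa_rp zt w (saA v)) (rpC zt).
    by rewrite (rpC _ zt); lra.
  have := rp_le' ((adj v * v) zt) (zt - w); have := rp_le' ((adj v * v) (zt - w)) w.
  have := hM zt; have := hM (zt - w); have := nrm_ge0 (zt - w); have := nrm_ge0 w.
  move: (nrm _) (nrm ((adj v * v) zt)) (nrm w) => n1 n2 n3 n30.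
  nra.
have : nrm w <= nrm zt + 1 by have := nrm_tri zt w 0; rewrite !subr0 (nrmBC w); lra.
have := nrm_ge0 zt; have := nrm_ge0 (zt - w); have := nrm_ge0 w.
rewrite /L in h2; move: (nrm zt) (nrm w) (nrm (zt - w)) h2 hv hk => n1 n2 n3 h2 hv hk n20 n30 n10 h3.
have : (M * (n1 + n2) + (n2 + n1)) * n3 <= ((2 * n1 + 1) * (1 + M)) * n3.
  rewrite ler_wpM2r //; nra.
lra.
Qed.

(** The symmetry of [kyfan] between [A] and its commutant. For vectors with a bounded density it
    comes from [commuting_effect] and [dens_coeffect]; the Lipschitz estimates extend it to all
    vectors. *)
Lemma coeffect_near (fA : factor A) zeta p xi s (c : R) : prj p -> p != 0 -> dens A tau zeta p ->
  0 < s -> 0 < c -> exists2 b : bop H, coeffects s b & kyfan s xi <= qf b xi + c.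
Proof.
move=> pp p0 dz s0 c0; have s0' := ltW s0.
pose L := 4 * (2 * nrm xi + 1); have L0 : 0 < L by have := nrm_ge0 xi; rewrite /L; lra.
have [|eta [x dx] hd] := dens_dense vA T fA pp p0 dz xi (e := Num.min 1 (c / L)).
  by rewrite lt_min ltr01 divr_gt0.
have [h1 h2] : nrm (xi - eta) <= 1 /\ nrm (xi - eta) * L <= c.
  by move: hd; rewrite le_min => /andP[-> ]; rewrite ler_pdivlMr.
have c2 : 0 < c / 2 by lra.
have [a [ha ax hk]] := commuting_effect dx s0 c2.
have [b hb ba] := dens_coeffect dx s0' ha ax.
exists b => //; have := kyfan_lip xi eta s0'; have [_ pb _] := hb.
have := qf_lip eta xi pb (coeffects_le1 s0' hb); rewrite (nrmBC eta) ba.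
have : nrm eta <= nrm xi + 1 by have := nrm_tri xi eta 0; rewrite !subr0 (nrmBC eta); lra.
have := nrm_ge0 xi; have := nrm_ge0 (xi - eta); have := nrm_ge0 eta.
rewrite /L in h2; move: (nrm xi) (nrm eta) (nrm (xi - eta)) h2 h1 => n1 n2 n3 h2 h1; nra.
Qed.

End KyFan.

(** * LOCC maps increase Ky Fan functionals *)

Section ComplexModulus.
Context {R : realType}.
Implicit Types (k l : R[i]).

Definition cabs k : R := complex.Re `|k|.

Lemma cabsE k : `|k| = (cabs k)%:C.
Proof. by rewrite /cabs normc_def. Qed.
Lemma cabsD k l : cabs (k + l) <= cabs k + cabs l.
Proof. by have := ler_normD k l; rewrite !cabsE -rmorphD lecR. Qed.
Lemma cabsN k : cabs (- k) = cabs k.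
Proof. by rewrite /cabs normrN. Qed.
Lemma cabsB k l : cabs (k - l) = cabs (l - k).
Proof. by rewrite -cabsN opprB. Qed.
Lemma cabs0 : cabs 0 = 0.
Proof. by rewrite /cabs normr0. Qed.
Lemma cabsM k l : cabs (k * l) = cabs k * cabs l.
Proof. by rewrite {1}/cabs normrM !cabsE -rmorphM. Qed.
Lemma cabs_real (r : R) : cabs r%:C = `|r|.
Proof. by rewrite /cabs normc_def /= expr0n /= addr0 sqrtr_sqr. Qed.
Lemma Re_cabs k : `|complex.Re k| <= cabs k.
Proof.
rewrite /cabs normc_def /= -(@sqrtr_sqr _ (complex.Re k)); apply: ler_wsqrtr.
by rewrite lerDl sqr_ge0.
Qed.
Lemma cabs_sum (u : nat -> R[i]) (m n : nat) :
  cabs (\sum_(m <= i < n) u i) <= \sum_(m <= i < n) cabs (u i).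
Proof.
elim/big_ind2: _ => [|k r l s h1 h2|//]; first by rewrite cabs0.
by apply: le_trans (cabsD _ _) _; exact: lerD.
Qed.

Lemma ccvgP (F : nat -> R[i]) l : F @ \oo --> (l : R[i]^o) <->
  forall e : R, 0 < e -> exists N, forall n, (N <= n)%N -> cabs (F n - l) <= e.
Proof.
have E := @cvgrPdist_lt _ R[i]^o nat \oo _ F l.
split=> [/E h e e0|h].
  have [|N _ hN] := h e%:C; first by rewrite ltcR.
  by exists N => n /hN /=; rewrite cabsE ltcR cabsB => /ltW.
apply/E => e; rewrite ltcE => /andP[/= /eqP ei er].
have [|N hN] := h (complex.Re e / 2); first by rewrite divr_gt0.
exists N => // n /hN hn; rewrite /= [`|_|]cabsE ltcE /= ei eqxx /= cabsB.
by apply: le_lt_trans hn _; move: er; rewrite /= => er; lra.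
Qed.

Lemma rcvgP (F : nat -> R) (l : R) : F @ \oo --> l <->
  forall e : R, 0 < e -> exists N, forall n, (N <= n)%N -> `|F n - l| <= e.
Proof.
split=> [/cvgrPdist_le h e e0|h].
  by have [N _ hN] := h e e0; exists N => n /hN /=; rewrite distrC.
apply/cvgrPdist_le => e e0; have [N hN] := h e e0.
by exists N => // n /hN hn /=; rewrite distrC.
Qed.
End ComplexModulus.

(** * Weak-star convergence *)

Section WeakStarFacts.
Context {R : realType} {H : hilbertType R}.
Implicit Types (xi eta zeta : H) (k : R[i]) (r s t : R) (C : set H) (x y z p q u v w a b h e g d m : bop H).

Lemma wkP (F : set_system (bop H)) {FF : Filter F} x :
  F --> (x : weakstar H) <-> forall w : predual H, (fun y => sval w y) @ F --> (sval w x : R[i]^o).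
Proof.
split=> [h w|h].
  have c1 := @initial_continuous _ _ (@predual_eval R H) x.
  have h1 : @predual_eval R H @ F --> (predual_eval x : prod_topology _) by apply: cvg_trans c1; exact: cvg_app.
  have FF' : Filter (@predual_eval R H @ F) by exact: fmap_filter.
  have h2 := proj1 (@cvg_sup _ _ _ (@predual_eval R H @ F) _ FF') h1 w.
  have c2 := @initial_continuous _ _ (fun f : predual H -> R[i]^o => f w) (predual_eval x).
  by apply: cvg_trans c2; exact: (cvg_app _ h2).
move=> U [/= _ [[W oW <-] Wx WU]]; apply: filterS WU _.
suff : @predual_eval R H @ F --> (predual_eval x : prod_topology _).
  by apply; exact: open_nbhs_nbhs.
apply/(@cvg_sup _ _ _ (@predual_eval R H @ F)) => w V [/= _ [[B oB <-] Bx BV]].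
apply: filterS BV _; apply: (h w); exact: open_nbhs_nbhs.
Qed.

Lemma normal_functional_add (w : bop H -> R[i]) : normal_functional w -> forall x y, w (x - y) = w x - w y :> R[i].
Proof.
move=> [xi [eta [_ _ h]]] x y.
have hp (v v' : H) : <| (x - y) v, v' |> = <| x v, v'|> - <| y v, v'|>.
  by rewrite subbE ipDl -scaleN1r ipZl mulN1r.
have h1 : series (fun n => <| (x - y) (xi n), eta n |>) @ \oo --> (w x - w y : R[i]^o).
  have -> : series (fun n => <| (x - y) (xi n), eta n |>) =
    series (fun n => <| x (xi n), eta n |>) - series (fun n => <| y (xi n), eta n |>).
    apply/funext => n; rewrite /series /= fctE -sumrB; apply: eq_bigr => i _.
    exact: hp.
  by apply: cvgB; exact: h.
exact: (cvg_unique _ (h (x - y)) h1).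
Qed.

Lemma vector_normal xi eta : normal_functional (fun x => <| x xi, eta |>).
Proof.
pose f (v : H) (n : nat) : H := if n == 0%N then v else 0.
have sf (v : H) : square_summable (f v).
  apply/cvg_ex; exists (nrm v ^+ 2); apply/rcvgP => e e0; exists 1%N => n n0.
  have -> : series (fun n0 => hnorm (f v n0) ^+ 2) n = nrm v ^+ 2.
    case: n n0 => // n _; rewrite /series /= big_nat_recl // big1 ?addr0 // => i _.
    by rewrite /f /= -/(nrm 0) nrm0 expr0n.
  by rewrite subrr normr0 ltW.
exists (f xi), (f eta); split=> // x; apply/ccvgP => e e0; exists 1%N => n n0.
suff -> : series (fun n0 => <| x (f xi n0), f eta n0 |>) n = <|x xi, eta|>.
  by rewrite subrr cabs0 ltW.
case: n n0 => // n _; rewrite /series /= big_nat_recl // big1 ?addr0 // => i _.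
by rewrite /f /= bop0 ipE !rp0l.
Qed.

Lemma wk_rp (f : nat -> bop H) x : f @ \oo --> (x : weakstar H) ->
  forall xi eta (e : R), 0 < e -> exists N, forall n, (N <= n)%N -> `|rp (f n xi) eta - rp (x xi) eta| <= e.
Proof.
move=> h xi eta e e0.
have FF : Filter (f @ \oo) by exact: fmap_filter.
have := proj1 (@wkP (f @ \oo) FF x) h (exist _ _ (vector_normal xi eta)).
move=> /(ccvgP _ _) /(_ e e0) [N hN]; exists N => n /hN /= hn.
by apply: le_trans hn; apply: le_trans (Re_cabs _); rewrite ReD ReN.
Qed.

(** In a normal functional, a sum of rank one terms, strong convergence handles finitely many terms,
    and square summability with the uniform bound handles the tail. *)
Lemma wk_strong (f : nat -> bop H) x (M : R) : (forall n xi, nrm (f n xi) <= M * nrm xi) ->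
  (forall xi, hcvg (fun n => f n xi) (x xi)) -> f @ \oo --> (x : weakstar H).
Proof.
move=> fM hf; apply/wkP => -[w nw] /=; apply/ccvgP => e e0.
have [xi [eta [sxi seta hw]]] := nw.
have M0 : 0 <= 1 + `|M| by have := normr_ge0 M; lra.
pose L := 1 + `|M|.
have fL n (v : H) : nrm (f n v) <= L * nrm v.
  apply: le_trans (fM n v) _; rewrite ler_wpM2r ?nrm_ge0 // /L.
  by have := ler_norm M; lra.
have xL (v : H) : nrm (x v) <= L * nrm v by apply: hcvg_nrm_le (hf v) _ => n; exact: fL.
have zL n (v : H) : nrm ((f n - x) v) <= 2 * L * nrm v.
  rewrite subbE; apply: le_trans (nrmB _ _) _; have := fL n v; have := xL v; lra.
have tail (u : nat -> H) : square_summable u -> forall c : R, 0 < c -> exists N, forall n,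
    \sum_(N <= i < n) nrm (u i) ^+ 2 <= c.
  move=> /cvg_ex[l /rcvgP hl] c c0; have [N hN] := hl (c / 2) ltac:(lra).
  exists N => n; have [nN|Nn] := leqP n N; first by rewrite big_geq // ltW.
  have := hN n (ltnW Nn); have := hN N (leqnn N); rewrite !ler_norml => /andP[h1 h2] /andP[h3 h4].
  have := @big_cat_nat R 0 +%R N 0 n (fun _ => true) (fun i => hnorm (u i) ^+ 2) (leq0n _) (ltnW Nn).
  rewrite /series /= in h1 h2 h3 h4 *; move=> E; rewrite E in h3 h4.
  by move: h1 h2 h3 h4; rewrite /nrm; lra.
(* By [2 a b <= a^2 + b^2] the tail is then at most [2 * L * c = e / 4]. *)
pose c := e / (8 * L); have L0 : 0 < L by rewrite /L; have := normr_ge0 M; lra.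
have c0 : 0 < c by rewrite divr_gt0 // mulr_gt0.
have cL : c * L = e / 8 by rewrite /c; field; rewrite gt_eqF.
have [N1 h1] := tail _ sxi c c0; have [N2 h2] := tail _ seta c c0.
pose N0 := maxn N1 N2.
have hb (u : nat -> H) (a b n : nat) (d : R) : (a <= b)%N -> \sum_(a <= i < n) nrm (u i) ^+ 2 <= d -> 0 <= d ->
    \sum_(b <= i < n) nrm (u i) ^+ 2 <= d.
  move=> ab hd d0; have [nb|bn] := leqP n b; first by rewrite big_geq.
  apply: le_trans hd; rewrite (@big_cat_nat _ _ _ b a n) //=; last exact: ltnW.
  by rewrite lerDr; apply: sumr_ge0 => i _; exact: sqr_ge0.
have head (K : nat) : forall d : R, 0 < d -> exists N, forall n, (N <= n)%N ->
    cabs (\sum_(0 <= i < K) <| (f n - x) (xi i), eta i |>) <= d.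
  elim: K => [|K IH] d d0; first by exists 0%N => n _; rewrite big_geq // cabs0 ltW.
  have [N hN] := IH (d / 2) ltac:(lra).
  have B0 : 0 < 1 + nrm (eta K) by have := nrm_ge0 (eta K); lra.
  have [|N' hN'] := hf (xi K) (d / 2 / (1 + nrm (eta K))); first by rewrite divr_gt0 //; lra.
  exists (maxn N N') => n; rewrite geq_max => /andP[Nn Nn'].
  rewrite big_nat_recr //=; apply: le_trans (cabsD _ _) _.
  have := hN n Nn; have := ip_le ((f n - x) (xi K)) (eta K); rewrite -/(cabs _).
  have := hN' n Nn'; rewrite ler_pdivlMr // -subbE.
  have := nrm_ge0 ((f n - x) (xi K)); have := nrm_ge0 (eta K).
  move: (cabs _) (cabs _) (nrm _) (nrm _) => n1 n2 n3 n4; nra.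
have [N hN] := head N0 (e / 4) ltac:(lra).
exists N => n Nn; rewrite -(normal_functional_add nw).
have [K hK] := (ccvgP _ _).1 (hw (f n - x)) (e / 4) ltac:(lra).
pose m := maxn N0 K.
have := hK m (leq_maxr _ _); rewrite /series /=.
have -> : \sum_(0 <= i < m) <|(f n - x) (xi i), eta i|> = \sum_(0 <= i < N0) <|(f n - x) (xi i), eta i|> +
   \sum_(N0 <= i < m) <|(f n - x) (xi i), eta i|>.
  by rewrite -big_cat_nat //= leq_maxl.
have := hN n Nn; set S1 := \sum_(0 <= i < N0) _; set S2 := \sum_(N0 <= i < m) _ => k1 k2.
have k3 : cabs S2 <= e / 4.
  apply: le_trans (cabs_sum _ _ _) _.
  apply: (@le_trans _ _ (\sum_(N0 <= i < m) (L * nrm (xi i) ^+ 2 + L * nrm (eta i) ^+ 2))).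
    apply: ler_sum => i _; apply: le_trans (ip_le _ _) _.
    have := zL n (xi i); have := nrm_ge0 (eta i); have := nrm_ge0 (xi i).
    move: (nrm _) (nrm (xi i)) (nrm (eta i)) => n1 n2 n3 n20 n30 h.
    have : n1 * n3 <= (2 * L * n2) * n3 by rewrite ler_wpM2r.
    have : 0 <= L * (n2 - n3) ^+ 2 by rewrite mulr_ge0 ?sqr_ge0 // ltW.
    rewrite sqrrB; lra.
  rewrite big_split /= -!mulr_sumr.
  have j1 := hb xi N1 N0 m c (leq_maxl _ _) (h1 m) (ltW c0).
  have j2 := hb eta N2 N0 m c (leq_maxr _ _) (h2 m) (ltW c0).
  have i1 : L * \sum_(N0 <= i < m) nrm (xi i) ^+ 2 <= L * c by rewrite ler_wpM2l // ltW.
  have i2 : L * \sum_(N0 <= i < m) nrm (eta i) ^+ 2 <= L * c by rewrite ler_wpM2l // ltW.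
  lra.
have -> : w (f n - x) = S1 + S2 - (S1 + S2 - w (f n - x)) by rewrite opprB addrCA subrr addr0.
apply: le_trans (cabsD _ _) _; rewrite cabsN; have := cabsD S1 S2; lra.
Qed.

End WeakStarFacts.

(** * Completely positive maps and infinite sums *)

Section CompletelyPositive.
Context {R : realType} {H : hilbertType R}.
Implicit Types (xi eta zeta : H) (k : nat) (r s t : R) (C : set (bop H)) (x y z p q u v w a b h e g d m : bop H).
Implicit Types (Phi Psi Theta : bop H -> bop H) (I : nat -> bop H -> bop H).

Lemma lin_mapD Phi x y : linear Phi -> Phi (x + y) = Phi x + Phi y.
Proof. by move=> h; have := h 1 x y; rewrite !scale1r. Qed.
Lemma lin_map0 Phi : linear Phi -> Phi 0 = 0.
Proof. by move=> h; have := h (-1) 0 0; rewrite scaler0 addr0 scaleN1r addNr. Qed.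
Lemma lin_mapN Phi x : linear Phi -> Phi (- x) = - Phi x.
Proof. by move=> h; have := h (-1) x 0; rewrite (lin_map0 h) !addr0 !scaleN1r. Qed.
Lemma lin_mapB Phi x y : linear Phi -> Phi (x - y) = Phi x - Phi y.
Proof. by move=> h; rewrite (lin_mapD _ _ h) (lin_mapN _ h). Qed.
Lemma lin_mapZ Phi (k : R[i]) x : linear Phi -> Phi (k *: x) = k *: Phi x.
Proof. by move=> h; have := h k x 0; rewrite (lin_map0 h) !addr0. Qed.
Lemma lin_map_sum Phi (f : nat -> bop H) n : linear Phi -> Phi (\sum_(i < n) f i) = \sum_(i < n) Phi (f i).
Proof.
move=> h; elim: n => [|n IH]; first by rewrite !big_ord0 (lin_map0 h).
by rewrite !big_ord_recr /= (lin_mapD _ _ h) IH.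
Qed.

Lemma qf_sum (f : nat -> bop H) n xi : qf (\sum_(i < n) f i) xi = \sum_(i < n) qf (f i) xi.
Proof.
elim: n => [|n IH]; first by rewrite !big_ord0 qf0.
by rewrite !big_ord_recr /= qfD IH.
Qed.

Lemma sum_app (f : nat -> bop H) n xi : (\sum_(i < n) f i) xi = \sum_(i < n) f i xi.
Proof.
elim: n => [|n IH]; first by rewrite !big_ord0.
by rewrite !big_ord_recr /= -IH.
Qed.

Lemma cp_pos Phi x : completely_positive Phi -> pos x -> pos (Phi x).
Proof.
move=> [_ h] px; apply/posP => xi.
have := h 1%N (const_mx x); rewrite /mx_positive => /(_ _ (fun=> xi)).
rewrite !big_ord1 !mxE; apply => f; rewrite !big_ord1 !mxE.
exact: (proj2 (posP x) px).
Qed.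

Lemma cp_mono Phi x y : completely_positive Phi -> sa x -> sa y -> ple x y -> ple (Phi x) (Phi y).
Proof.
move=> cp sx sy xy xi; have := pos_ge0 xi (cp_pos cp (posB sx sy xy)).
have [linP _] := cp; rewrite (lin_mapB _ _ linP) qfB; lra.
Qed.

Lemma cp_sa Phi x : completely_positive Phi -> sa x -> sa (Phi x).
Proof.
move=> cp sx; have [M M0 hM] := pos_bound x; have [linP _] := cp.
have pM : pos (cst M - x) by apply: posB => //; apply: saZ; exact: sa1.
have pM' : pos (cst M : bop H) by apply: posZ; [exact: ltW|exact: pos1].
have -> : Phi x = Phi (cst M) - Phi (cst M - x).
  by rewrite -(lin_mapB _ _ linP) opprB addrCA subrr addr0.
apply: saB.
  by case: (cp_pos cp pM').
by case: (cp_pos cp pM).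
Qed.

Lemma sums_to_qf (S : set nat) I Theta y xi (e : R) : sums_to S I Theta -> 0 < e ->
  exists N, forall n, (N <= n)%N -> `|\sum_(k < n | (k : nat) \in S) qf (I k y) xi - qf (Theta y) xi| <= e.
Proof.
move=> h e0; have [N hN] := wk_rp (h y) xi xi e0; exists N => n /hN.
rewrite big_mkcond /= -/(qf (Theta y) xi) -/(qf (\sum_(k < n) _) xi).
rewrite (@qf_sum (fun k => if k \in S then I k y else 0)) [in X in _ -> X]big_mkcond /=.
by under eq_bigr do rewrite (fun_if (fun x => qf x xi)) qf0.
Qed.

Lemma sums_to_ge (S : set nat) I Theta y xi (r : seq nat) : sums_to S I Theta ->
  (forall k, completely_positive (I k)) -> pos y -> uniq r -> (forall k, k \in r -> S k) ->
  \sum_(k <- r) qf (I k y) xi <= qf (Theta y) xi.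
Proof.
move=> h cI py ur rS; suff : \sum_(k <- r) qf (I k y) xi - qf (Theta y) xi <= 0 by lra.
apply: small0 => e e0; have [N hN] := sums_to_qf y xi h e0.
pose n := maxn N (\max_(k <- r) k.+1)%N; have := hN n (leq_maxl _ _).
have F0 k : 0 <= qf (I k y) xi by apply: pos_ge0; exact: cp_pos.
have -> : \sum_(k < n | (k : nat) \in S) qf (I k y) xi = \sum_(k <- [seq k <- iota 0 n | k \in S]) qf (I k y) xi.
  by rewrite big_filter -(big_mkord (fun k => k \in S) (fun k => qf (I k y) xi)) /index_iota subn0.
rewrite ler_norml => /andP[_]; suff : \sum_(k <- r) qf (I k y) xi <= \sum_(k <- [seq k <- iota 0 n | k \in S]) qf (I k y) xi by lra.
have sub : {subset r <= [seq k <- iota 0 n | k \in S]}.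
  move=> k kr; rewrite mem_filter mem_iota /= add0n; apply/andP; split; first by apply/mem_set; exact: rS.
  rewrite /n leq_max; apply/orP; right.
  by rewrite (big_rem k kr) /= leq_max leqnn.
rewrite (perm_big ([seq k <- [seq k <- iota 0 n | k \in S] | k \in r])); last first.
  apply: uniq_perm => //; first by rewrite !filter_uniq // iota_uniq.
  by move=> k; rewrite [RHS]mem_filter; case kr : (k \in r) => //=; rewrite (sub _ kr).
rewrite big_filter [leRHS](bigID (mem r)) /= lerDl; exact: sumr_ge0.
Qed.

End CompletelyPositive.

Section PositiveNorm.
Context {R : realType} {H : hilbertType R}.

Lemma pos_nrm (x : bop H) (M : R) v : 0 <= M -> pos x -> ple x (cst M) -> nrm (x v) <= M * nrm v.
Proof.
move=> M0 px h; apply: nrm_le_sq; first by rewrite mulr_ge0 ?nrm_ge0.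
apply: le_trans (pos_sqbound v M0 px h) _; rewrite exprMn nrm2 expr2 -mulrA ler_wpM2l //.
by have := h v; rewrite qf_cst.
Qed.

End PositiveNorm.

(** * Preservation of dominating operators under LOCC *)

Section Forward.
Context {R : realType} {H : hilbertType R}.
Implicit Types (xi eta zeta : H) (k : nat) (r s t : R) (C : set (bop H)) (x y z p q u v w a b h e g d m : bop H).
Implicit Types (Phi Psi Theta : bop H -> bop H) (I : nat -> bop H -> bop H).
Context (A : set (bop H)) (tau : bop H -> \bar R).
Context (vA : von_neumann_algebra A) (T : nsf_trace A tau) (s : R) (s0 : 0 < s).
Local Notation D := (effects A tau s).
Local Notation D' := (coeffects A tau s).
Local Notation K := (kyfan A tau s).
Context (sym : forall xi (c : R), 0 < c -> exists2 b : bop H, D' b & K xi <= qf b xi + c).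

Definition dominating y : Prop := sa y /\ forall a, D a -> ple a y.

Lemma dominating_kyfan y xi : dominating y -> K xi <= qf y xi.
Proof. by move=> [_ h]; apply: kyfan_le; [exact: vA|exact: T|exact: ltW|move=> a /h]. Qed.

(** A consequence of symmetry: bounds verified against the commutant family pass to the functional,
    and thereby to the effects of [A]. *)
Lemma coeffects_kyfan_le xi (c : R) : (forall b, D' b -> qf b xi <= c) -> K xi <= c.
Proof.
move=> h; suff : K xi - c <= 0 by lra.
by apply: small0 => e e0; have [b /h hb] := sym xi e0; lra.
Qed.

Lemma dominating_pos y : dominating y -> pos y.
Proof. by move=> [sy h]; split=> //; apply: h; apply: effects0; [exact: vA|exact: T|exact: ltW]. Qed.

(* Different elements may be fed to the different outcomes, which is what
   induction along linked instruments needs. *)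
Definition preserving I : Prop := forall (M : R) (f : nat -> bop H),
  (forall k, dominating (f k) /\ ple (f k) (cst M)) ->
  forall a xi (c : R), D a -> 0 < c -> exists l : seq nat, uniq l /\ qf a xi - c <= \sum_(k <- l) qf (I k (f k)) xi.

Lemma instrument_ge1 I xi (c : R) : instrument I -> 0 < c ->
  exists n, rp xi xi - c <= \sum_(k < n) qf (I k 1) xi.
Proof.
move=> [_ [Th [h [_ T1]]]] c0; have [N hN] := sums_to_qf 1 xi h c0.
exists N; have := hN N (leqnn _); rewrite T1 qf1 ler_norml => /andP[h1 _].
have -> : \sum_(k < N) qf (I k 1) xi = \sum_(k < N | (k : nat) \in [set: nat]) qf (I k 1) xi.
  by apply: eq_bigl => k; rewrite in_setT.
by lra.
Qed.

Lemma UCP_over_id C Phi x : UCP_over C Phi -> von_neumann_algebra C -> C x -> Phi x = x.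
Proof.
move=> [[_ h] h1] vC Cx; have := h x 1 1 Cx (vN1 vC).
by rewrite !mulr1 h1 mulr1.
Qed.

Lemma CP_over_sqrt C Phi x xi : CP_over C Phi -> von_neumann_algebra C -> C x -> pos x ->
  qf (Phi x) xi = qf (Phi 1) (bsqrt x xi).
Proof.
move=> [_ h] vC Cx px; have Cs := vN_sqrt vC Cx px.
have := h _ 1 _ Cs Cs; rewrite mulr1 sqrt_sq // => ->.
by rewrite -qfJ (sqrt_sa px).
Qed.

(** In [Phi \o Psi] each factor is a bimodule map over one of the two algebras: it maps a positive
    element [y] of that algebra to the compression of its value at 1 by [bsqrt y], and fixes [y] if
    it is unital. Each factor is therefore tested on effects or on coeffects, whichever lie in its
    algebra, and symmetry switches between the families. *)
Lemma one_way_preserving I : one_way_instrument A I -> preserving I.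
Proof.
move=> [iI ow] M f hf a xi c Da c0; have vB := vN_commutant vA.
have [Aa pa _ _] := Da; have s0' := ltW s0.
have conv x eta (F : nat -> R) (d : R) : pos x -> 0 < d -> rp eta eta = qf x xi -> (forall k, qf (I k 1) eta <= F k) ->
    exists l : seq nat, uniq l /\ qf x xi - d <= \sum_(k <- l) F k.
  move=> px d0 ex hF; have [n hn] := instrument_ge1 eta iI d0.
  exists (iota 0 n); split; first exact: iota_uniq.
  rewrite -ex; apply: le_trans hn _; rewrite -(big_mkord (fun=> true) (fun k => qf (I k 1) eta)) /index_iota subn0.
  by apply: ler_sum => i _; exact: hF.
case: ow => ow.
  (* Right case: the weights are collected on a near-optimal coeffect [b] for [xi]; this works
     because [Psi 1] lies in [A] and so commutes with [b]. *)
  have [|b Db hb] := sym xi (c := c / 2); first lra.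
  have [Bb pb _] := Db.
  suff hF k : qf (I k 1) (bsqrt b xi) <= qf (I k (f k)) xi.
    have [|l [ul hl]] := conv b (bsqrt b xi) (fun k => qf (I k (f k)) xi) (c / 2) pb _ (sqrt_rp xi pb) hF; first lra.
    by exists l; split=> //; have := kyfan_ub vA T xi s0' Da; lra.
  have [Phi [Psi [UPhi CPsi E]]] := ow k.
  have [[[[_ cPhi] _] Phi1] [[_ cPsi] bPsi]] := (UPhi, CPsi).
  have ph : pos (Psi 1) by apply: cp_pos => //; exact: pos1.
  have Ah : A (Psi 1).
    apply: vN_in => // z Bz.
    have := bPsi z 1 1 Bz (vN1 vB); have := bPsi 1 1 z (vN1 vB) Bz.
    by rewrite !mulr1 !mul1r => <- <-.
  have Ash := vN_sqrt vA Ah ph.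
  have [[sf hfk] _] := hf k.
  (* [Psi (f k)] lies above [Psi b'] for every coeffect [b'], and the form of [Psi b'] is that of
     [b'] at [bsqrt (Psi 1) eta]. *)
  have key eta : K (bsqrt (Psi 1) eta) <= qf (Psi (f k)) eta.
    apply: coeffects_kyfan_le => b' Db'; have [Bb' pb' _] := Db'.
    have -> : qf b' (bsqrt (Psi 1) eta) = qf (Psi b') eta.
      rewrite (CP_over_sqrt _ CPsi) // -(sqrt_rp _ ph) -(sqrt_rp _ pb').
      rewrite (comm_app (x := bsqrt b') (y := bsqrt (Psi 1))) //.
      by have /(_ _ Ash) -> := vN_sqrt vB Bb' pb'.
    apply: cp_mono => //; first by case: pb'.
    move=> z; have [_ _ h] := Db'; apply: le_trans (h z) _.
    by apply: dominating_kyfan.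
  have key2 eta : K (bsqrt (Psi 1) eta) <= qf (I k (f k)) eta.
    apply: kyfan_le => // a' Da'; have [Aa' pa' _ _] := Da'.
    have := qfJ a' (bsqrt (Psi 1)) eta; rewrite (sqrt_sa ph) => <-.
    rewrite -[X in qf X _](UCP_over_id UPhi) //; last exact: vN_sqJ.
    rewrite E; apply: cp_mono => //.
    - by case: (pos_sqJ ph pa').
    - exact: cp_sa.
    - move=> z; have := qfJ a' (bsqrt (Psi 1)) z; rewrite (sqrt_sa ph) => ->.
      by apply: le_trans (key z); apply: kyfan_ub.
  have -> : I k 1 = Psi 1 by rewrite E /= (UCP_over_id UPhi).
  apply: le_trans (key2 xi).
  have [_ _ h] := Db; apply: le_trans (h _); rewrite -(sqrt_rp _ ph) -(sqrt_rp _ pb).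
  rewrite (comm_app (x := bsqrt b) (y := bsqrt (Psi 1))) //.
  by have /(_ _ Ash) -> := vN_sqrt vB Bb pb.
(* Left case: [Psi] fixes the coeffects, so [Psi (f k)] still lies above them and hence above [a];
   and [Phi a] is [Phi 1] compressed by [bsqrt a]. *)
apply: (conv a (bsqrt a xi)) => //; first exact: sqrt_rp.
move=> k; have [Phi [Psi [CPhi UPsi E]]] := ow k.
have [[[_ cPhi] _] [[[_ cPsi] _] Psi1]] := (CPhi, UPsi).
have [[sf hfk] _] := hf k.
have -> : I k 1 = Phi 1 by rewrite E /= Psi1.
rewrite -(CP_over_sqrt _ CPhi) // E; apply: cp_mono => //; first by case: pa.
  exact: cp_sa.
move=> z; apply: le_trans (kyfan_ub vA T z s0' Da) _.
apply: coeffects_kyfan_le => b Db; have [Bb pb h] := Db.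
rewrite -[b in leLHS](UCP_over_id UPsi) //; apply: cp_mono => //; first by case: pb.
by move=> z'; apply: le_trans (h z') _; exact: dominating_kyfan.
Qed.

(** Outcome [k] of [I] is fed with [z k], the sum over [i] of [L k i] applied to the operator [f] of
    the block containing [(k, i)]; [z k] is dominating by the one-way case. Normality of [I k]
    allows these sums to be truncated, and positivity allows the remaining terms of each block to be
    dropped. *)
Lemma linked_preserving I J : instrument I -> linked A J I -> preserving I -> preserving J.
Proof.
move=> [cI _] [L [oL [e [[e' ee' e'e] [iJ iC [S [tS cS hS]]]]]]] gI M f hf a xi c Da c0.
have hj' (m : nat) : exists i, S i m.
  have : (\bigcup_j S j) m by rewrite cS.
  by move=> [i _ Si]; exists i.
have [j hj] := choice hj'.
pose B := `|M|; have B0 : 0 <= B by exact: normr_ge0.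
have fB k : ple (f k) (cst B).
  move=> z; have [_ h] := hf k; apply: le_trans (h z) _; rewrite !qf_cst.
  by rewrite ler_wpM2r ?rp_ge0 // ler_norm.
have fpos k : pos (f k) by apply: dominating_pos; case: (hf k).
have cLp k i : completely_positive (L k i) by have [[/(_ i)[_ h] _] _] := oL k.
pose g k i := f (j (e' (k, i))).
pose Z k n := \sum_(i < n) L k i (g k i).
have Zpos k n : pos (Z k n).
  rewrite /Z; elim: n => [|n IH]; first by rewrite big_ord0; exact: pos0.
  by rewrite big_ord_recr /=; apply: posD => //; apply: cp_pos; [exact: cLp|exact: fpos].
have Zle k n : ple (Z k n) (cst B).
  move=> z; rewrite /Z (@qf_sum _ _ (fun i => L k i (g k i))).
  have [[_ [Th [hTh [_ Th1]]]] _] := oL k.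
  have h1 : \sum_(i <- iota 0 n) qf (L k i 1) z <= rp z z.
    have := sums_to_ge z hTh (cLp k) pos1 (iota_uniq 0 n) (fun _ _ => Logic.I).
    by rewrite Th1 qf1.
  rewrite qf_cst; apply: (@le_trans _ _ (B * \sum_(i <- iota 0 n) qf (L k i 1) z)); last first.
    by rewrite ler_wpM2l.
  rewrite mulr_sumr -(big_mkord (fun=> true) (fun i => qf (L k i (g k i)) z)) /index_iota subn0.
  apply: ler_sum => i _.
  rewrite -qfZ -(lin_mapZ _ _ (proj1 (cLp k i))); apply: cp_mono => //; last exact: fB.
    by case: (fpos (j (e' (k, i)))).
  by apply: saZ; exact: sa1.
have hz k : exists z, [/\ sa z, forall xi, hcvg (fun n => Z k n xi) (z xi) & forall n, ple (Z k n) z].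
  apply: (@monotone_limit _ _ _ B); first by move=> n; case: (Zpos k n).
    move=> n z; rewrite {2}/Z big_ord_recr /= qfD lerDl; apply: pos_ge0.
    apply: cp_pos; [exact: cLp|exact: fpos].
  exact: Zle.
have [z hzz] := choice hz.
have zB k : ple (z k) (cst B).
  by move=> w; have [_ h _] := hzz k; apply: strong_qf_le h _ => n; exact: Zle.
have zdom k : dominating (z k).
  have [sz _ zZ] := hzz k; split=> // a' Da' w.
  suff : qf a' w - qf (z k) w <= 0 by lra.
  apply: small0 => d d0.
  have [l [ul hl]] := one_way_preserving (oL k) (fun i => hf (j (e' (k, i)))) w Da' d0.
  have hN := zZ (\max_(i <- l) i.+1)%N w.
  set N := (\max_(i <- l) i.+1)%N in hN.
  suff : \sum_(i <- l) qf (L k i (g k i)) w <= qf (Z k N) w by move: hl; rewrite /g; lra.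
  rewrite /Z (@qf_sum _ _ (fun i => L k i (g k i))) -(big_mkord (fun=> true) (fun i => qf (L k i (g k i)) w)) /index_iota subn0.
  rewrite (perm_big [seq i <- iota 0 N | i \in l]); last first.
    apply: uniq_perm => //; first by rewrite filter_uniq // iota_uniq.
    move=> i; rewrite mem_filter mem_iota /= add0n; case il : (i \in l) => //=.
    by apply/esym; rewrite /N (big_rem i il) /= leq_max leqnn.
  rewrite big_filter [leRHS](bigID (mem l)) /= lerDl; apply: sumr_ge0 => i _.
  by apply: pos_ge0; apply: cp_pos; [exact: cLp|exact: fpos].
have [l [ul hl]] := gI B z (fun k => conj (zdom k) (zB k)) a xi (c / 2) Da ltac:(lra).
(* The error is shared among the finitely many [k] in [l]; the successor covers the empty list. *)
pose d := c / 2 / (size l).+1%:R.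
have d0 : 0 < d by rewrite !divr_gt0.
have conv k : exists N, forall n, (N <= n)%N -> qf (I k (z k)) xi - d <= qf (I k (Z k n)) xi.
  have wZ : Z k @ \oo --> (z k : weakstar H).
    have [_ h _] := hzz k; apply: (@wk_strong _ _ _ _ B) h => n v.
    exact: pos_nrm.
  have nI : I k (Z k n) @[n --> \oo] --> (I k (z k) : weakstar H).
    have [nI _] := cI k; exact: (cvg_comp _ _ wZ (nI (z k))).
  have [N hN] := wk_rp nI xi xi d0.
  by exists N => n /hN; rewrite ler_norml -!/(qf _ _) => /andP[]; lra.
have [N0 hN0] := choice conv.
pose N := (\max_(k <- l) N0 k)%N.
(* A finite rectangle of pairs, listed through [e'], to be regrouped according to the blocks. *)
pose l2 := [seq e' (k, i) | k <- l, i <- iota 0 N].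
have ul2 : uniq l2.
  apply: allpairs_uniq => //; first exact: iota_uniq.
  by move=> [k i] [k' i'] _ _ /= /(can_inj e'e).
have sl2 : qf a xi - c <= \sum_(m <- l2) qf (I (e m).1 (L (e m).1 (e m).2 (f (j m)))) xi.
  rewrite big_allpairs_dep /=.
  apply: (@le_trans _ _ (\sum_(k <- l) (qf (I k (z k)) xi - d))).
    rewrite big_split /= big_const_seq count_predT iter_addr addr0 /=.
    suff : d *+ size l <= c / 2 by rewrite mulNrn; lra.
    rewrite -mulr_natr /d mulrAC ler_pdivrMr ?ltr0n // ler_wpM2l //; first lra.
    by rewrite ler_nat.
  rewrite big_seq [leRHS]big_seq; apply: ler_sum => k kl.
  have kN : (N0 k <= N)%N by rewrite /N (big_rem k kl) /= leq_maxl.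
  apply: le_trans (hN0 k N kN) _; have [_ [linI _]] := cI k.
  rewrite /Z (lin_map_sum (fun i => L k i (g k i)) _ linI).
  rewrite (@qf_sum _ _ (fun i => I k (L k i (g k i)))) -(big_mkord (fun=> true) (fun i => qf (I k (L k i (g k i))) xi)).
  by rewrite /index_iota subn0; apply: ler_sum => i _; rewrite e'e.
pose n := (\max_(m <- l2) (j m).+1)%N.
exists (iota 0 n); split; first exact: iota_uniq.
apply: le_trans sl2 _.
pose F (m : nat) := qf (I (e m).1 (L (e m).1 (e m).2 (f (j m)))) xi.
have -> : \sum_(m <- l2) qf (I (e m).1 (L (e m).1 (e m).2 (f (j m)))) xi = \sum_(k <- iota 0 n) \sum_(m <- l2 | j m == k) F m.
  rewrite (exchange_big_dep xpredT) //= big_seq [RHS]big_seq; apply: eq_bigr => m ml.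
  rewrite (eq_bigl (pred1 (j m))); last by move=> k; rewrite /= eq_sym.
  rewrite -big_filter filter_pred1_uniq ?iota_uniq ?big_seq1 // mem_iota /= add0n.
  by rewrite /n (big_rem m ml) /= leq_max leqnn.
apply: ler_sum => k _; rewrite -big_filter.
set l3 := [seq i <- l2 | j i == k].
have ul3 : uniq l3 by rewrite filter_uniq.
have cL3 (m : nat) : completely_positive (I (e m).1 \o L (e m).1 (e m).2) by case: iC => /(_ m)[_ h'] _.
have Sl3 (m : nat) : m \in l3 -> S k m by rewrite mem_filter => /andP[/eqP <- _]; exact: hj.
apply: le_trans (sums_to_ge xi (hS k) cL3 (fpos k) ul3 Sl3).
rewrite le_eqVlt; apply/orP; left; apply/eqP; rewrite big_seq [RHS]big_seq; apply: eq_bigr => m.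
by rewrite mem_filter => /andP[/eqP jk _]; rewrite /F jk.
Qed.

Lemma LOCC_dominating Theta y : LOCC A Theta -> dominating y -> dominating (Theta y).
Proof.
move=> [n [I [I0 Il [IT [[_ cT] _]]]]] dy; have [sy hy] := dy.
have h l : (l <= n)%N -> instrument (I l) /\ preserving (I l).
  elim: l => [_|l IH ln]; first by split; [case: I0|exact: one_way_preserving].
  have [i1 p1] := IH (ltnW ln); have := Il l ln => li.
  split; last exact: linked_preserving p1.
  by have [K [_ [e [_ []]]]] := li.
have [[cI _] pI] := h n (leqnn n).
have [M M0 hM] := pos_bound y.
split; first exact: cp_sa.
move=> a Da xi; suff : qf a xi - qf (Theta y) xi <= 0 by lra.
apply: small0 => c c0; have [l [ul hl]] := pI M (fun=> y) (fun=> conj dy hM) a xi c Da c0.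
have := sums_to_ge xi IT (fun k => proj2 (cI k)) (dominating_pos dy) ul (fun _ _ => Logic.I).
lra.
Qed.

Lemma rpZZ (k : R[i]) xi eta : rp (k *: xi) (k *: eta) = cabs k ^+ 2 * rp xi eta.
Proof.
by rewrite /rp ipZl ipZr mulrA -normCK cabsE -rmorphXn /= ReM_real.
Qed.

Lemma rank_one_ex eta : rp eta eta = 1 -> exists p, prj p /\ forall xi, p xi = <|xi, eta|> *: eta.
Proof.
move=> e1; have n1 : nrm eta = 1 by apply/eqP; rewrite -(@eqrXn2 _ 2) ?nrm_ge0 // nrm2 e1 expr1n.
have [| |p hp] := @mkbop R H (fun xi => <|xi, eta|> *: eta) 1.
- by move=> k a b; rewrite ipDl ipZl scalerDl scalerA.
- move=> xi; rewrite nrmZ n1 mulr1 mul1r; have := ip_le xi eta.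
  by rewrite n1 mulr1.
have sp : sa p.
  apply: adj_of_rp => a b; rewrite !hp /rp ipZl ipZr (ipC b eta) conjCK mulrC.
  by [].
exists p; split=> //; split=> //.
by apply: bopP => xi; rewrite mulbE !hp ipZl ipxx e1 mulr1.
Qed.

Lemma qf_amgm a xi eta t : 0 < t -> pos a ->
  qf a (xi + eta) <= (1 + t) * qf a xi + (1 + t^-1) * qf a eta.
Proof.
move=> t0 pa; have := pos_ge0 (t%:C *: xi - eta) pa; have sx := proj1 pa.
rewrite /qf bopB bopD bopZ !rpE (sa_rp eta xi sx) (rpC eta (a xi)) => h.
rewrite -subr_ge0 -(pmulr_rge0 _ t0).
have -> : t * ((1 + t) * rp (a xi) xi + (1 + t^-1) * rp (a eta) eta -
   (rp (a xi) xi + rp (a xi) eta + (rp (a xi) eta + rp (a eta) eta))) =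
   t * (t * rp (a xi) xi) - t * rp (a xi) eta - (t * rp (a xi) eta - rp (a eta) eta).
  by field; rewrite gt_eqF.
lra.
Qed.

Lemma opnorm_le1 x : contr x -> (opnorm x <= 1)%E.
Proof.
move=> cx; apply: ereal_inf_lbound; exists 1 => //; split=> // xi.
by exists (x xi) => //; rewrite mul1r; exact: contr_nrm.
Qed.

Lemma functional_norm_lt (w : bop H -> R[i]) (c : R) x : (functional_norm w < c%:E)%E -> contr x -> cabs (w x) < c.
Proof.
move=> h cx; rewrite -lte_fin; apply: le_lt_trans h; apply: ereal_sup_ubound.
by exists x => //; exact: opnorm_le1.
Qed.

Lemma convertible_kyfan psi phi : rp psi psi = 1 -> rp phi phi = 1 ->
  approx_convertible A psi phi -> K psi <= K phi.
Proof.
move=> n1 n2 h; have [p [pp hp]] := rank_one_ex n2; have s0' := ltW s0.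
have pphi : p phi = phi by rewrite hp ipxx n2 scale1r.
have K1 : K phi <= 1 by rewrite -n2; exact: kyfan_le1.
have K0 : 0 <= K phi by exact: kyfan_ge0.
suff hs t : 0 < t -> K psi <= (1 + t) * K phi.
  suff : K psi - K phi <= 0 by lra.
  by apply: small0 => e e0; have := hs e e0; nra.
(* [qf_amgm] splits [xi] along [phi]: an effect has form at most [K phi] on the line and at most 1
   off it, at the price of the factors [1 + t] and [1 + t^-1]. Only the first factor survives at
   [phi], and [t] tends to 0. *)
move=> t0; pose y : bop H := ((1 + t) * K phi)%:C *: p + (1 + t^-1)%:C *: (1 - p).
have ti : 0 < t^-1 by rewrite invr_gt0.
have dy : dominating y.
  split; first by apply: saD; apply: saZ; [case: pp|case: (prjC pp)].
  move=> a Da xi; have [_ pa a1 _] := Da.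
  rewrite qfD !qfZ (prj_qf _ pp) (prj_qf _ (prjC pp)).
  have {1}-> : xi = p xi + (1 - p) xi by rewrite subbE addrC subrK.
  apply: le_trans (qf_amgm _ _ t0 pa) _.
  have h1 := a1 ((1 - p) xi); rewrite qf1 in h1.
  have h2 : qf a (p xi) <= K phi * rp (p xi) (p xi).
    rewrite hp {1}/qf bopZ !rpZZ n2 mulr1 mulrC ler_wpM2r ?sqr_ge0 //.
    exact: kyfan_ub Da.
  rewrite -mulrA; apply: lerD; rewrite ler_wpM2l //; lra.
have yphi : qf y phi = (1 + t) * K phi.
  by rewrite qfD !qfZ (prj_qf _ pp) pphi n2 /qf subbE pphi subrr rp0l; lra.
clearbody y; have [M M0 hM] := bop_bound y.
suff : K psi - (1 + t) * K phi <= 0 by lra.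
(* [y / M] is a contraction, so a norm distance below [e / M] controls the value of [y] up to
   [e]. *)
apply: small0 => e e0; have eM : 0 < e / M by rewrite divr_gt0.
have [Th LTh hTh] := h _ eM.
have cy : contr (M^-1%:C *: y).
  move=> xi; rewrite scalebE -!nrm2 nrmZr ger0_norm ?invr_ge0 ?(ltW M0) //.
  rewrite ler_pXn2r ?nnegrE ?nrm_ge0 ?mulr_ge0 ?invr_ge0 ?nrm_ge0 ?(ltW M0) //.
  by rewrite mulrC ler_pdivrMr // mulrC.
have := functional_norm_lt hTh cy.
have linT : linear Th by have [n [I [_ _ [_ [[_ [l _]] _]]]]] := LTh.
rewrite /predual_map /vector_functional /= (lin_mapZ _ _ linT) !scalebE !ipZl -mulrBr cabsM.
rewrite cabs_real gtr0_norm ?invr_gt0 // mulrC ltr_pM2r ?invr_gt0 // => hc.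
have := le_lt_trans (Re_cabs _) hc; rewrite ReD ReN -/(rp _ _) -/(rp _ _) -!/(qf _ _) yphi.
rewrite ltr_norml => /andP[_ h2].
have := dominating_kyfan psi (LOCC_dominating LTh dy); lra.
Qed.

End Forward.

(** * Densities *)

Section Unbounded.
Context {R : realType} {H : hilbertType R}.
Implicit Types (xi eta zeta : H) (k : R[i]) (s t l c : R) (x y z p q r u v w a b h e g d m f : bop H).
Implicit Types (X Y : set (H * H)).

Lemma closureHH X xi eta : closure X (xi, eta) <-> forall c, 0 < c ->
  exists z : H * H, [/\ X z, nrm (xi - z.1) <= c & nrm (eta - z.2) <= c].
Proof.
split=> [h c c0|h B /nbhs_ballP[e /= e0 hB]].
  have cc : 0 < c%:C :> R[i] by rewrite ltcR.
  have [|z [Xz hz]] := h (ball (xi, eta) c%:C); first exact: nbhsx_ballx.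
  exists z; split=> //; move: hz => [/= h1 h2].
    by move: h1; rewrite -ball_normE /= normE ltcR => /ltW.
  by move: h2; rewrite -ball_normE /= normE ltcR => /ltW.
move: (e0); rewrite ltcE => /andP[/= /eqP ei er].
have [|z [Xz h1 h2]] := h (complex.Re e / 2); first by rewrite divr_gt0.
exists z; split=> //; apply: hB; rewrite /= in er; split; rewrite -ball_normE /= normE ltcE /= ei eqxx /=.
  by apply: le_lt_trans h1 _; lra.
by apply: le_lt_trans h2 _; lra.
Qed.

Lemma graph_closed_top x : closed (graph x).
Proof. by move=> [a b] /closureHH h; exact: graph_closed. Qed.

Lemma closure_graph x : closure (graph x) = graph x.
Proof. by apply/esym/closure_id; exact: graph_closed_top. Qed.

Lemma cartesian (M : set (bop H)) y : von_neumann_algebra M -> M y ->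
  exists n1 n2, [/\ M n1, M n2, sa n1, sa n2 & y = n1 + 'i%C *: n2].
Proof.
move=> vM My; have My' := vN_adj vM My.
exists (2^-1%:C *: (y + adj y)), ((2^-1%:C * - 'i%C) *: (y - adj y)); split.
- by apply: vNZ => //; exact: vND.
- by apply: vNZ => //; exact: vNB.
- by apply: saZ; rewrite /sa adjD adjK addrC.
- rewrite /sa adjZ adjB adjK -opprB scalerN -scaleNr; congr (_ *: _).
  by rewrite conjCE; apply/eqP; rewrite eq_complex /=; apply/andP; split; apply/eqP; ring.
rewrite scalerA.
have -> : 'i%C * (2^-1%:C * - 'i%C) = 2^-1%:C :> R[i] by apply/eqP; rewrite eq_complex /=; apply/andP; split; apply/eqP; ring.
rewrite -scalerDr addrACA subrr addr0 -mulr2n -(scaler_nat 2 y) scalerA.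
have -> : 2^-1%:C * 2%:R = 1 :> R[i] by rewrite -(rmorph_nat (real_complex R)) -rmorphM mulVf ?pnatr_eq0.
by rewrite scale1r.
Qed.

Lemma sa_cartesian (n1 n2 : bop H) : sa n1 -> sa n2 -> sa (n1 + 'i%C *: n2) -> n2 = 0.
Proof.
move=> s1 s2; rewrite /sa adjD adjZ s1 s2 => /addrI E.
have ii : Num.conj ('i%C : R[i]) = - 'i%C.
  by rewrite conjCE; apply/eqP; rewrite eq_complex /=; apply/andP; split; apply/eqP; ring.
move: E; rewrite ii scaleNr => /eqP; rewrite eq_sym -subr_eq0 opprK -scalerDr => /eqP E.
have := congr1 (fun x => (- 'i%C) *: x) E; rewrite scalerA scaler0.
have -> : - 'i%C * 'i%C = 1 :> R[i] by apply/eqP; rewrite eq_complex /=; apply/andP; split; apply/eqP; ring.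
rewrite scale1r -mulr2n -(scaler_nat 2 n2) => /eqP; rewrite scaler_eq0 => /orP[|/eqP //].
by rewrite pnatr_eq0.
Qed.

(** * Spectral cuts of affiliated operators and the trace of integrable ones *)

Section Affiliated.
Context (A : set (bop H)) (tau : bop H -> \bar R).
Context (vA : von_neumann_algebra A) (T : nsf_trace A tau).

(* A selfadjoint contraction [x] is the mean of the unitary
   [x + i sqrt (1 - x^2)] and its adjoint. *)
Lemma commute_unitary r : (forall u, commutant A u -> unitary u -> r * u = u * r) -> A r.
Proof.
move=> hu; have vB := vN_commutant vA.
have h1 x : commutant A x -> sa x -> contr x -> r * x = x * r.
  move=> Bx sx cx; have px : pos (1 - x * x).
    apply: posB; [exact: saM|exact: sa1|].
    by rewrite -{1}sx; apply/contrP.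
  have B1 : commutant A (1 - x * x) by apply: (vNB vB); [exact: (vN1 vB)|exact: (vNM vB)].
  have [pc cc comc] := bsqrtP px; have Bc : commutant A (bsqrt (1 - x * x)) by exact: (vN_sqrt vB).
  set c := bsqrt _ in pc cc comc Bc; have sc := proj1 pc.
  have cx' : c * x = x * c by apply: comc; rewrite mulrBl mulrBr mul1r mulr1 mulrA.
  pose u := x + 'i%C *: c; pose v := x - 'i%C *: c.
  have uv : adj u = v.
    rewrite /u adjD adjZ sx sc /v -scaleNr; congr (_ + _ *: _).
    by rewrite conjCE; apply/eqP; rewrite eq_complex /=; apply/andP; split; apply/eqP; ring.
  have ii : 'i%C * 'i%C = - 1 :> R[i] by apply/eqP; rewrite eq_complex /=; apply/andP; split; apply/eqP; ring.
  have e1 : u * v = 1.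
    rewrite /u /v mulrBr !mulrDl -!scalebAl -!scalebAr cx' scalerA ii scaleN1r cc opprD opprK.
    by rewrite addrA addrK addrC subrK.
  have e2 : v * u = 1.
    rewrite /u /v mulrDr !mulrBl -!scalebAl -!scalebAr cx' scalerA ii scaleN1r cc opprK.
    by rewrite addrA subrK addrC subrK.
  have Bu : commutant A u by apply: (vND vB) => //; exact: (vNZ _ vB).
  have Bv : commutant A v by rewrite -uv; exact: vN_comm_adj.
  have uu : unitary u by exists v; split=> //; rewrite -uv; exact: adjP.
  have uv' : unitary v by exists u; split=> //; rewrite -[u]adjK uv; exact: adjP.
  have xE : x = 2^-1%:C *: (u + v).
    rewrite /u /v addrACA subrr addr0 -mulr2n -(scaler_nat 2 x) scalerA.
    by rewrite -(rmorph_nat (real_complex R)) -rmorphM mulVf ?pnatr_eq0 // scale1r.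
  by rewrite xE -scalebAl -scalebAr mulrDl mulrDr !hu.
have h2 x : commutant A x -> sa x -> r * x = x * r.
  move=> Bx sx; have [M M0 hM] := bop_bound x.
  have := h1 (M^-1%:C *: x) (vNZ _ vB Bx) (saZ _ sx).
  rewrite -scalebAl -scalebAr => h.
  have {}h : M^-1%:C *: (r * x) = M^-1%:C *: (x * r).
    apply: h => xi; rewrite scalebE -!nrm2 nrmZr ger0_norm ?invr_ge0 ?(ltW M0) //.
    rewrite ler_pXn2r ?nnegrE ?nrm_ge0 ?mulr_ge0 ?invr_ge0 ?nrm_ge0 ?(ltW M0) //.
    by rewrite mulrC ler_pdivrMr // mulrC.
  have := congr1 (fun y => M%:C *: y) h.
  by rewrite !scalerA -rmorphM mulfV ?gt_eqF // !scale1r.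
apply: vN_in => // y By; have [n1 [n2 [B1 B2 s1 s2 ->]]] := cartesian vB By.
by rewrite mulrDl mulrDr -scalebAl -scalebAr !h2.
Qed.

Lemma affiliated_resolvent X r : affiliated A X -> (forall xi, X (r xi, xi - r xi)) ->
  (forall a b : H, X (a, b) -> r (a + b) = a) -> A r.
Proof.
move=> aX h1 h2; apply: commute_unitary => u Bu uu; apply: bopP => xi.
have := h2 _ _ (aX u Bu uu _ (h1 xi)); rewrite /= -bopD addrC subrK.
by [].
Qed.

(* The witnesses are the spectral projection [f] of [X] for [[0, l]] and
   [x = X f]. *)
Lemma spectral_cut X r l : 0 < l -> A r -> pos r -> ple r 1 -> (forall xi, X (r xi, xi - r xi)) ->
  (forall a b : H, X (a, b) -> r (a + b) = a) ->
  exists e x, [/\ [/\ A e, prj e, r * e = e * r & e = spec (- r) (- (1 + l)^-1)], [/\ A x, pos x, x * (1 - e) = x & (1 - e) * x = x],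
    (forall y, r * y = y * r -> e * y = y * e /\ x * y = y * x),
    (forall xi, X ((1 - e) xi, x xi)) &
    [/\ ple x (cst l), forall xi, (1 + l) * qf r (e xi) <= rp (e xi) (e xi),
      forall xi, rp ((1 - e) xi) ((1 - e) xi) <= (1 + l) * qf r ((1 - e) xi) &
      forall z : H * H, X z -> qf x z.1 + l * qf e z.1 <= rp z.2 z.1]].
Proof.
move=> l0 Ar pr r1 h1 h2; have sr := proj1 pr.
pose t := (1 + l)^-1; have t0 : 0 < t by rewrite invr_gt0; lra.
have tl : (1 + l) * t = 1 by rewrite mulfV // gt_eqF //; lra.
have snr : sa (- r) by exact: saN.
(* [X > l] means [r < (1 + l)^-1]: the spectral projection [e] of [X] above [l] is obtained from
   [- r]. *)
have [pe ec0 el0 eu0] := specP (- t) snr; have [e eE] : exists e, e = spec (- r) (- t) by eexists.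
rewrite -eE in pe ec0 el0 eu0.
have ec y : r * y = y * r -> e * y = y * e by move=> ry; apply: ec0; rewrite mulNr mulrN ry.
have el xi : qf r (e xi) <= t * rp (e xi) (e xi) by have := el0 xi; rewrite qfN; lra.
have eu xi : t * rp ((1 - e) xi) ((1 - e) xi) <= qf r ((1 - e) xi) by have := eu0 xi; rewrite qfN; lra.
have re : r * e = e * r by rewrite ec.
have Ae : A e by apply: (vN_fc vA Ar ec).
have pf := prjC pe; have Af : A (1 - e) by exact: (vNB vA (vN1 vA) Ae).
set f := 1 - e in eu pf Af *.
have rf : r * f = f * r by rewrite /f mulrBl mulrBr mul1r mulr1 re.
have ff := proj1 pf; have fe : f * e = 0 by rewrite /f mulrBl mul1r (proj1 pe) subrr.
have ef : e * f = 0 by rewrite /f mulrBr mulr1 (proj1 pe) subrr.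
have srf : sa (r * f) by apply: saM => //; case: pf.
have nrmef xi : rp xi xi = rp (e xi) (e xi) + rp (f xi) (f xi).
  by rewrite -!prj_qf // /f qfB qf1; lra.
have fE : 1 - e = f by []; clearbody f.
(* [w + t] is [r] on the range of [f] and 1 on the range of [e], hence invertible; its inverse [i]
   is [1 + X] on the range of [f], so [(i - 1) * f] is [X f]. *)
pose w := r * f + e - cst t.
have pw : pos w.
  split; first by apply: saB; [apply: saD => //; case: pe|apply: saZ; exact: sa1].
  move=> xi; rewrite qf0 qfB qfD qf_cst (prj_qf _ pe).
  have -> : qf (r * f) xi = qf r (f xi).
    by rewrite -qfJ (proj2 pf) -rf -mulrA ff.
  rewrite (nrmef xi); have := eu xi; have := rp_ge0 (e xi).
  have : t <= 1 by rewrite invf_le1 //; lra.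
  nra.
have [i [pi i1 i2 ic il]] := inv_ex pw t0; rewrite /w subrK in i1 i2.
have fw : w * f = f * w.
  rewrite /w mulrBl mulrBr mulrDl mulrDr ef fe -mulrA ff mulrA -rf -mulrA ff.
  by rewrite /cst -scalebAl -scalebAr mul1r mulr1.
have fi : i * f = f * i by exact: ic.
have rfi : r * f * i = f.
  have := congr1 (fun y => f * y) i1; rewrite mulr1 mulrDl mulrDr (mulrA f e) fe mul0r addr0.
  by rewrite mulrA (mulrA f r) -rf -(mulrA r f f) ff.
have Ai : A i.
  apply: (vN_fc vA _ ic); rewrite /w; apply: (vNB vA) => //; last exact: vN_cst.
  by apply: (vND vA) => //; exact: (vNM vA).
pose x := (i - 1) * f.
have rif xi : r (i (f xi)) = f xi.
  by rewrite -!mulbE -mulrA fi mulrA rfi.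
have xE xi : x xi = i (f xi) - f xi by rewrite /x mulbE subbE.
have Xx xi : X (f xi, x xi) by have := h1 (i (f xi)); rewrite rif xE.
have sx : sa x.
  apply: saM; [by apply: saB; [case: pi|exact: sa1]|by case: pf|].
  by rewrite mulrBl mulrBr mul1r mulr1 fi.
have fx : f * x = x by rewrite /x mulrA mulrBr mulr1 -fi -[X in _ - X]mul1r -mulrBl -mulrA ff.
have xf : x * f = x by rewrite /x -mulrA ff.
have qx xi : qf x xi = rp (i (f xi) - f xi) (f xi).
  have -> : qf x xi = rp (f (x xi)) xi by rewrite -mulbE fx.
  by rewrite (sa_rp _ _ (proj2 pf)) xE.
have qr xi : qf (r - r * r) xi = rp (xi - r xi) (r xi).
  rewrite qfB !rpE /qf mulbE (sa_rp (r xi) _ sr) (rpC (r xi) xi).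
  by [].
have rr0 xi : 0 <= qf (r - r * r) xi.
  rewrite qfB -{2}sr qfA; have := @pos_sqbound _ _ r 1 xi ler01 pr.
  by rewrite mul1r => h; have := h ltac:(by move=> z; rewrite qf_cst mul1r; exact: r1); lra.
have px : pos x.
  by split=> // xi; rewrite qf0 qx; have := rr0 (i (f xi)); rewrite qr rif.
have xcomm y : r * y = y * r -> x * y = y * x.
  move=> ry; have ey := ec _ ry; have fy : f * y = y * f by rewrite -fE mulrBl mulrBr mul1r mulr1 ey.
  have iy : i * y = y * i.
    apply: ic; rewrite /w mulrBl mulrBr mulrDl mulrDr ey -mulrA fy (mulrA r) ry mulrA.
    by rewrite /cst -scalebAl -scalebAr mul1r mulr1.
  by rewrite /x -mulrA fy mulrA mulrBl mul1r iy mulrA mulrBr mulr1.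
exists e, x; rewrite fE; split=> //.
- by split=> //; apply: (vNM vA) => //; apply: (vNB vA) => //; exact: (vN1 vA).
- by move=> y ry; split; [exact: ec|exact: xcomm].
split=> [xi|xi|xi|[a b] /= Xab].
- rewrite qx rpBl qf_cst; have := il (f xi); rewrite qf_cst invrK /qf.
  have := prj_contr pf xi; have := rp_ge0 (f xi); nra.
- by have := el xi; rewrite -(ler_pM2l (_ : 0 < 1 + l)) ?mulrA ?tl ?mul1r //; lra.
- by have := eu xi; rewrite -(ler_pM2l (_ : 0 < 1 + l)) ?mulrA ?tl ?mul1r //; lra.
(* The point of the graph is [(r zt, zt - r zt)]; the form of [X] there is that of [r - r * r] at
   [zt], which splits along [e] and [f]. *)
have ra := h2 _ _ Xab; pose zt := a + b.
have {ra}aE : a = r zt by rewrite ra.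
have bE' : b = zt - r zt by rewrite -aE /zt addrC addKr.
have ge : (r - r * r) * e = e * (r - r * r).
  by rewrite mulrBl mulrBr re -mulrA re (mulrA r e) re mulrA.
rewrite bE' aE -qr (qf_split zt pe ge) fE addrC; apply: lerD.
  rewrite (prj_qf _ pe) (comm_app _ (esym re)) qfB -[X in qf (X * r)]sr qfA.
  have [ps ss sc] := bsqrtP pr.
  have -> : rp (r (e zt)) (r (e zt)) = qf r (e (bsqrt r zt)).
    have e1 : e (bsqrt r zt) = bsqrt r (e zt) by apply: comm_app; rewrite sc.
    have rc : r * bsqrt r = bsqrt r * r by rewrite sc.
    by rewrite e1 /qf (comm_app _ rc) (sa_rp _ _ (proj1 ps)) -(mulbE (bsqrt r)) ss.
  have := el (bsqrt r zt).
  have -> : e (bsqrt r zt) = bsqrt r (e zt) by apply: comm_app; rewrite sc.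
  rewrite (sqrt_rp (e zt) pr) => h.
  have : (1 + l) * qf r (bsqrt r (e zt)) <= qf r (e zt).
    by have := ler_wpM2l (_ : 0 <= 1 + l) h; rewrite mulrA tl mul1r; apply; lra.
  lra.
have -> : qf x (r zt) = qf (r - r * r) (f zt); last by [].
rewrite qx qr; have -> : f (r zt) = r (f zt) by apply: comm_app.
congr rp; rewrite -!mulbE; congr (_ - _); congr (bop_fun _ zt).
by rewrite -[RHS]mul1r -i2 -[RHS]mulrA mulrDl ef addr0 -(mulrA r f f) ff mulrA.
Qed.

Lemma L1_resolvent Y : L1_pos A tau Y -> exists r, [/\ A r, pos r, ple r 1,
  forall xi, Y (r xi, xi - r xi) & forall a b : H, Y (a, b) -> r (a + b) = a].
Proof.
move=> [[lY cY dY aY _] gY _]; have [|r [pr r1 h1 h2]] := resolvent lY _ gY.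
  by move=> a b h; apply: cY; apply/closureHH.
by exists r; split=> //; exact: affiliated_resolvent h1 h2.
Qed.

Lemma form_le Y y (a b : H) : pos y -> gpositive Y -> Y (a, b) ->
  (<| y a, a |> <= <| b, a |>) = (qf y a <= rp b a).
Proof.
move=> py [_ gY] Yab; rewrite lecE; have := proj2 (posP y) py a; rewrite lecE => /andP[/eqP /= -> _].
by have := gY _ Yab; rewrite /= lecE => /andP[/eqP /= -> _]; rewrite eqxx.
Qed.

Lemma tau_ext_ub Y y : gpositive Y -> A y -> pos y -> (forall z : H * H, Y z -> qf y z.1 <= rp z.2 z.1) ->
  (tau y <= tau_ext A tau Y)%E.
Proof.
move=> gY Ay py h; apply: ereal_sup_ubound; exists y => //; split; first exact: pin.
by move=> [a b] Yz; rewrite (form_le py gY Yz); exact: h Yz.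
Qed.

Lemma L1_fin Y : L1_pos A tau Y -> exists2 t : R, 0 <= t & tau_ext A tau Y = t%:E.
Proof.
move=> [_ gY h]; have h0 : (0 <= tau_ext A tau Y)%E.
  rewrite -(tau0 vA T); apply: tau_ext_ub => //; [exact: vN0|exact: pos0|].
  move=> z Yz; rewrite qf0; have [_ /(_ z Yz)] := gY; rewrite lecE => /andP[_].
  by [].
by move: h0 h; case: (tau_ext A tau Y) => // t; rewrite lee_fin => t0 _; exists t.
Qed.

(** Markov's inequality: the spectral projection of [Y] above [l] has trace at most the trace of [Y]
    divided by [l]. *)
Lemma L1_cut Y s : L1_pos A tau Y -> 0 < s -> exists f x, [/\ A f, prj f, (tau (1 - f)%R <= s%:E)%E, A x & pos x] /\
  (forall xi, Y (f xi, x xi)) /\ (tau x <= tau_ext A tau Y)%E.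
Proof.
move=> hY s0; have [r [Ar pr r1 h1 h2]] := L1_resolvent hY.
have [t t0 tE] := L1_fin hY; have [_ gY _] := hY.
pose l := (t + 1) / s; have l0 : 0 < l by rewrite divr_gt0 //; lra.
have [e [x [[Ae pe re _] [Ax px xf fx] _ Yf [_ _ _ h]]]] := spectral_cut l0 Ar pr r1 h1 h2.
have pe' := prj_pos pe.
have ple' : pos (l%:C *: e) by apply: posZ => //; exact: ltW.
have Ale : A (l%:C *: e) by exact: vNZ.
have hform (w : H * H) : Y w -> qf (x + l%:C *: e) w.1 <= rp w.2 w.1.
  by move=> Yw; rewrite qfD qfZ; exact: h.
have := tau_ext_ub gY (vND vA Ax Ale) (posD px ple') hform.
rewrite (tauD T Ax px Ale ple') (tauZ T (ltW l0) Ae pe') => hh.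
exists (1 - e), x; split; last first.
  split=> //; apply: le_trans hh; rewrite leeDl //; apply: mule_ge0; first by rewrite lee_fin ltW.
  exact: (tau_ge0 T Ae pe').
split=> //; [by apply: (vNB vA) => //; exact: (vN1 vA)|exact: prjC|].
rewrite opprB addrCA subrr addr0.
have h0 : (l%:E * tau e <= t%:E)%E.
  by rewrite -tE; apply: le_trans hh; rewrite leeDr //; exact: (tau_ge0 T Ax px).
have := tau_ge0 T Ae pe'; move: h0; case: (tau e) => [q| |] //.
  rewrite -EFinM !lee_fin => h0 q0; rewrite -(ler_pM2l l0); apply: le_trans h0 _.
  by rewrite /l divfK ?gt_eqF //; lra.
by rewrite gt0_muley ?lte_fin.
Qed.

Lemma tau_compress y q : A y -> pos y -> A q -> prj q ->
  tau y = (tau (q * y * q)%R + tau ((1 - q) * y * (1 - q))%R)%E.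
Proof.
move=> Ay py Aq pq; have pq' := prjC pq; have Aq' : A (1 - q) by exact: (vNB vA (vN1 vA) Aq).
have aux g : A g -> prj g -> tau (g * y * g) = tau (bsqrt y * g * bsqrt y).
  by move=> Ag pg; have := tau_conj vA T Ag Ay py; rewrite (proj2 pg) (proj1 pg).
rewrite !aux // -(tauD T); try exact: vN_sqJ; try by apply: pos_sqJ => //; exact: prj_pos.
by rewrite -mulrDl -mulrDr addrC subrK mulr1 sqrt_sq.
Qed.

Lemma tau_corner y q M : A y -> pos y -> A q -> prj q -> 0 <= M -> ple y (cst M) ->
  (tau (q * y * q)%R <= M%:E * tau q)%E.
Proof.
move=> Ay py Aq pq M0 yM.
have pM : pos (M%:C *: q) by apply: posZ => //; exact: prj_pos.
rewrite -(tauZ T) //; last exact: prj_pos.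
have qE (z : bop H) : q * z * q = q * z * adj q by rewrite (proj2 pq).
apply: (tau_mono vA T); [rewrite qE; exact: vN_conj|rewrite qE; exact: pos_conj|exact: vNZ|by []|].
move=> xi; have := ple_conj q yM xi; rewrite -qE => h; apply: le_trans h _.
by rewrite (proj2 pq) /cst -scalebAr mulr1 -scalebAl (proj1 pq).
Qed.

(** A bounded [y <= M] nearly attains the supremum defining [tau_ext A tau Y], and compressing it to
    [q] loses at most [M * tau (1 - q)]. *)
Lemma cut_lower Y c : L1_pos A tau Y -> 0 < c -> exists2 s : R, 0 < s & forall q x, A q -> prj q ->
  (tau (1 - q)%R <= s%:E)%E -> A x -> pos (q * x * q) -> (forall xi, Y (q xi, x (q xi))) ->
  (tau_ext A tau Y <= tau (q * x * q)%R + c%:E)%E.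
Proof.
move=> hY c0; have [t t0 tE] := L1_fin hY; have [_ gY _] := hY.
have [_ [y [[Ay by0] hy] <-] hty] : exists2 w : \bar R, [set tau y | y in [set y | pos_part A y /\
    forall z : H * H, Y z -> (<| y z.1, z.1 |> <= <| z.2, z.1 |>)%R]] w & ((t - c / 2)%:E < w)%E.
  have := @ereal_sup_gt R _ (t - c / 2)%:E (_ : (_ < tau_ext A tau Y)%E).
  by apply; rewrite tE lte_fin; lra.
have py : pos y by apply/posP.
have [M M0 hM] := pos_bound y.
exists (c / 2 / M); first by rewrite !divr_gt0.
move=> q x Aq pq hq Ax px hx.
have hqy : (tau (q * y * q)%R <= tau (q * x * q)%R)%E.
  have qE (z : bop H) : q * z * q = adj q * z * q by rewrite (proj2 pq).
  apply: (tau_mono vA T) => //; [by rewrite qE; exact: vN_J|by rewrite qE; exact: posJ|by rewrite qE; exact: vN_J|].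
  move=> xi; rewrite !qE !qfJ; have := hy _ (hx xi); rewrite (form_le py gY (hx xi)).
  by [].
have pq' := prjC pq; have Aq' : A (1 - q) by exact: (vNB vA (vN1 vA) Aq).
have := tau_corner Ay py Aq' pq' (ltW M0) hM.
have : (M%:E * tau (1 - q)%R <= (c / 2)%:E)%E.
  apply: (@le_trans _ _ (M%:E * (c / 2 / M)%:E)%E).
    by apply: lee_wpmul2l => //; rewrite lee_fin ltW.
  by rewrite -EFinM lee_fin mulrC divfK // gt_eqF.
move=> h1 h2; have h3 := le_trans h2 h1.
rewrite tE; apply: (@le_trans _ _ (tau y + (c / 2)%:E)%E).
  move: hty; case: (tau y) => [w| |] //; last by rewrite addye // leey.
  by rewrite lte_fin -EFinD lee_fin => hw; clear - c0 hw; lra.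
rewrite (tau_compress Ay py Aq pq) -addeA.
apply: leeD => //; apply: le_trans (leeD2r _ h3) _; by rewrite -EFinD lee_fin -splitr.
Qed.

Lemma meet_cuts n (F : nat -> bop H) s : (forall i, A (F i)) -> (forall i, prj (F i)) ->
  (forall i, (tau (1 - F i)%R <= s%:E)%E) -> exists q, [/\ A q, prj q, forall i, (i < n)%N -> F i * q = q &
    (tau (1 - q)%R <= (n%:R * s)%:E)%E].
Proof.
move=> AF pF tF; elim: n => [|n [q [Aq pq Fq tq]]].
  exists 1; split; [exact: vN1|exact: prj1|by []|].
  by rewrite subrr (tau0 vA T) mul0r.
have [g [Ag pg qg Fg tg]] := meet_prj vA T Aq (AF n) pq (pF n).
exists g; split=> //.
  move=> i; rewrite ltnS leq_eqVlt => /orP[/eqP -> //|/Fq h].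
  by rewrite -qg mulrA h.
apply: le_trans tg _; apply: le_trans (leeD tq (tF n)) _.
by rewrite -EFinD lee_fin -[n.+1]addn1 natrD mulrDl mul1r.
Qed.

(** The value [k] does not depend on the decomposition. All five operators are bounded on the range
    of a common projection [q] with [tau (1 - q)] small; there the decomposition is an identity
    between bounded operators, whose traces differ from those of the uncut ones by at most [c / 3]
    each. *)
Lemma L1_trace_tau Y k : L1_pos A tau Y -> L1_trace A tau Y k -> k = (fine (tau_ext A tau Y))%:C.
Proof.
move=> hY [X1 [X2 [X3 [X4 [[L1 L2] [L3 L4] E ->]]]]].
have [t0 t00 E0] := L1_fin hY; have [t1 t10 E1] := L1_fin L1; have [t2 t20 E2] := L1_fin L2.
have [t3 t30 E3] := L1_fin L3; have [t4 t40 E4] := L1_fin L4.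
rewrite E0 E1 E2 E3 E4 /=.
suff key c : 0 < c -> `|t0 + t2 - t1| <= c /\ `|t3 - t4| <= c.
  have e1 : t0 + t2 - t1 = 0.
    by apply/eqP; rewrite -normr_le0; apply: small0 => c /key[].
  have e2 : t3 - t4 = 0.
    by apply/eqP; rewrite -normr_le0; apply: small0 => c /key[].
  by apply/eqP; rewrite eq_complex /=; apply/andP; split; apply/eqP; lra.
(* Packed as a sequence, constant from 4 on, so that one use of choice yields all cuts. *)
move=> c0; pose G (i : nat) := match i with 0 => Y | 1 => X1 | 2 => X2 | 3 => X3 | _ => X4 end.
have LG i : L1_pos A tau (G i) by case: i => [|[|[|[|i]]]].
have lows i : exists s : R, 0 < s /\ forall q x, A q -> prj q ->
  (tau (1 - q)%R <= s%:E)%E -> A x -> pos (q * x * q) -> (forall xi, G i (q xi, x (q xi))) ->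
  (tau_ext A tau (G i) <= tau (q * x * q)%R + (c / 3)%:E)%E.
  by have [|s s0 hs] := @cut_lower (G i) (c / 3) (LG i); [lra|exists s].
have [S hS] := choice lows.
pose s := Num.min (S 0%N) (Num.min (S 1%N) (Num.min (S 2%N) (Num.min (S 3%N) (S 4%N)))).
have s0 : 0 < s.
  by rewrite !lt_min (proj1 (hS 0%N)) (proj1 (hS 1%N)) (proj1 (hS 2%N)) (proj1 (hS 3%N)) (proj1 (hS 4%N)).
have sS i : (i < 5)%N -> s <= S i.
  by case: i => [|[|[|[|[|i]]]]] //= _; rewrite /s !ge_min lexx ?orbT.
have cuts i : exists w : bop H * bop H, [/\ A w.1, prj w.1, (tau (1 - w.1)%R <= (s / 5)%:E)%E, A w.2 & pos w.2] /\
  (forall xi, G i (w.1 xi, w.2 xi)) /\ (tau w.2 <= tau_ext A tau (G i))%E.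
  by have [|f [x h]] := @L1_cut (G i) (s / 5) (LG i); [lra|exists (f, x)].
have [W hW] := choice cuts.
have [|||q [Aq pq Fq tq]] := @meet_cuts 5 (fun i => (W i).1) (s / 5).
- by move=> i; case: (hW i) => [[]].
- by move=> i; case: (hW i) => [[]].
- by move=> i; case: (hW i) => [[]].
have tq' : (tau (1 - q)%R <= s%:E)%E by move: tq; rewrite mulrC divfK.
pose x i := (W i).2.
have Gx i xi : (i < 5)%N -> G i (q xi, x i (q xi)).
  by move=> /Fq h; have [_ [/(_ (q xi)) + _]] := hW i; rewrite -[(W i).1 _]mulbE h.
have qE (z : bop H) : q * z * q = adj q * z * q by rewrite (proj2 pq).
have px i : pos (q * x i * q) by rewrite qE; apply: posJ; case: (hW i) => [[]].
have Ax i : A (q * x i * q) by rewrite qE; apply: vN_J => //; case: (hW i) => [[]].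
have up i : (tau (q * x i * q)%R <= tau_ext A tau (G i))%E.
  have [[_ _ _ Axi pxi] [_ h]] := hW i; apply: le_trans h.
  by have := tau_contr vA T Aq (prj_contr pq) Axi pxi; rewrite (proj2 pq).
have lo i : (i < 5)%N -> (tau_ext A tau (G i) <= tau (q * x i * q)%R + (c / 3)%:E)%E.
  move=> i5; have [_ h] := hS i; have [[_ _ _ Axi pxi] _] := hW i; apply: h => //.
    by apply: le_trans tq' _; rewrite lee_fin sS.
  by move=> xi; exact: Gx.
have vals i : exists r : R, tau (q * x i * q) = r%:E.
  have [t _ Et] := L1_fin (LG i); have := up i; rewrite Et => /(tau_fin T (Ax i) (px i))[r _ ->].
  by exists r.
have [V hV] := choice vals.
have [_ _ Yf] : linear_graph Y by have [[]] := hY.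
have eqq : q * x 0%N * q + q * x 2%N * q = q * x 1%N * q + 'i%C *: (q * x 3%N * q - q * x 4%N * q).
  have hq xi : x 0%N (q xi) = x 1%N (q xi) - x 2%N (q xi) + 'i%C *: (x 3%N (q xi) - x 4%N (q xi)).
    apply: (Yf (q xi)); first exact: (Gx 0%N).
    rewrite E; apply: subset_closure.
    exists (x 1%N (q xi) - x 2%N (q xi)), ('i%C *: (x 3%N (q xi) - x 4%N (q xi))); split=> //=.
      exists (x 1%N (q xi)), (- x 2%N (q xi)); split=> //=; first exact: (Gx 1%N).
      by exists (x 2%N (q xi)); [exact: (Gx 2%N)|rewrite scaleN1r].
    exists ('i%C *: x 3%N (q xi)), (- 'i%C *: x 4%N (q xi)); split=> /=.
    - by exists (x 3%N (q xi)) => //; exact: (Gx 3%N).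
    - by exists (x 4%N (q xi)) => //; exact: (Gx 4%N).
    - by rewrite scalerBr scaleNr.
  apply: bopP => xi; rewrite !addbE scalebE subbE !mulbE hq !bopD bopZ !bopN.
  by rewrite addrAC subrK bopB.
have sx i : sa (q * x i * q) by case: (px i).
have im0 : q * x 3%N * q - q * x 4%N * q = 0.
  apply: (@sa_cartesian (q * x 1%N * q)); [exact: sx|by apply: saB; exact: sx|].
  by rewrite -eqq; apply: saD; exact: sx.
have ta : (V 0%N) + (V 2%N) = V 1%N.
  have := congr1 tau eqq; rewrite im0 scaler0 addr0 (tauD T) // !hV => -[].
  by [].
have tb : V 3%N = V 4%N.
  by have /eqP := im0; rewrite subr_eq0 => /eqP /(congr1 tau); rewrite !hV => -[].
have fin i t : (i < 5)%N -> tau_ext A tau (G i) = t%:E -> V i <= t <= V i + c / 3.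
  by move=> i5 Et; have := lo i i5; have := up i; rewrite Et hV -EFinD !lee_fin => -> ->.
have /andP[l0 u0] := fin 0%N _ isT E0; have /andP[l1 u1] := fin 1%N _ isT E1; have /andP[l2 u2] := fin 2%N _ isT E2.
have /andP[l3 u3] := fin 3%N _ isT E3; have /andP[l4 u4] := fin 4%N _ isT E4.
rewrite !ler_norml; clear - ta tb c0 l0 l1 l2 l3 l4 u0 u1 u2 u3 u4; split; apply/andP; split; lra.
Qed.

Lemma graph_L1 d t : A d -> pos d -> tau d = t%:E -> L1_pos A tau (graph d) /\ tau_ext A tau (graph d) = t%:E.
Proof.
move=> Ad pd td; have gp := graph_positive pd.
have E : tau_ext A tau (graph d) = t%:E.
  apply/le_anti/andP; split; last by rewrite -td; apply: tau_ext_ub => // -[a b] ->.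
  apply: ge_ereal_sup => _ [y [[Ay /posP py] hy] <-]; rewrite -td; apply: (tau_mono vA T) => // xi.
  have gx : graph d (xi, d xi) by [].
  by have := hy _ gx; rewrite (form_le py gp gx).
split=> //; split=> //; last by rewrite E ltry.
split; [exact: graph_linear|exact: graph_closed_top| | |].
- by move=> O [xi Oxi] _; exists xi; split=> //; exists (d xi).
- by move=> u Bu _ [a b]; rewrite /graph /= => ->; rewrite (comm_app _ (Bu _ Ad)).
- move=> s s0; exists 1; last by move=> xi; exists (d xi).
  split; [exact: vN1|exact/prjP/prj1|].
  by rewrite subrr (tau0 vA T) lee_fin ltW.
Qed.

Lemma range_approx r xi : sa r -> (forall v : H, r v = 0 -> rp xi v = 0) ->
  approx [set eta | exists zeta, eta = r zeta] xi.
Proof.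
move=> sr h; set C := [set eta | _].
have sC : subsp C.
  split; first by exists 0; rewrite bop0.
  by move=> k a b [a' ->] [b' ->]; exists (k *: a' + b'); rewrite bop_lin.
have [w Cw hw] := orth_decomp xi sC.
suff : xi - w = 0 by move/subr0_eq ->.
have rv : r (xi - w) = 0.
  by apply/rp_eq0; rewrite rp_adj sr; apply: hw; exists (r (xi - w)).
apply/rp_eq0; rewrite rpBl h // (rpC w) (orth_approx Cw hw).
by rewrite subrr.
Qed.

(** Scalar part of a polarisation: a linear functional that is tracial at [u + adj v] and at
    [u + i adj v], as well as at [u] and [adj v], agrees on [v * u] and [u * v]. *)
Lemma swap_alg (a b c d e f : R[i]) :
  a + 'i%C * b + (('i^*)%C * c + ('i^*)%C * ('i%C * d)) = a + ('i^*)%C * e + ('i%C * f + 'i%C * (('i^*)%C * d)) ->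
  a + b + (c + d) = a + e + (f + d) -> c = e.
Proof.
case: a b c d e f => [a1 a2] [b1 b2] [c1 c2] [d1 d2] [e1 e2] [f1 f2].
move=> /eqP; rewrite eq_complex /= => /andP[/eqP h1 /eqP h2] /eqP.
rewrite eq_complex /= => /andP[/eqP h3 /eqP h4].
by apply/eqP; rewrite eq_complex /=; apply/andP; split; apply/eqP; lra.
Qed.

(** * Bounded cuts of a density operator *)

Section Density.
Context (psi : H) (X : set (H * H)) (hD : density_operator A tau psi X).

(** The defining identity of the density, read at an [a] for which [X a] is the bounded operator
    [d]; [L1_trace_tau] then pins down the value. *)
Lemma density_act a d t : A a -> A d -> pos d -> tau d = t%:E -> (forall xi, X (a xi, d xi)) ->
  <| a psi, psi |> = t%:C.
Proof.
move=> Aa Ad pd td hX; have [[[lX _ _ _ _] _ _] hL] := hD; have [_ _ Xf] := lX.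
have E : gcomp X (graph a) = graph d.
  apply/seteqP; split=> -[v w] /=.
    by move=> [m]; rewrite /graph /= => -> Xm; exact: Xf Xm (hX v).
  by rewrite /graph /= => ->; exists (a v).
have := hL a Aa; rewrite E closure_graph; have [L1 tE] := graph_L1 Ad pd td.
by move/(L1_trace_tau L1); rewrite tE.
Qed.

Lemma density_tau_ext : tau_ext A tau X = (rp psi psi)%:E.
Proof.
have [L1 hL] := hD; have [[_ cX _ _ _] _ _] := L1.
have E : gcomp X (graph 1) = X.
  by apply/seteqP; split=> -[v w] /= => [[m]|h]; [rewrite /graph /= => ->|exists v].
have := hL 1 (vN1 vA); rewrite E -(closure_id _).1 // => /(L1_trace_tau L1).
have [t t0 ->] := L1_fin L1; rewrite onebE ipxx => -[->].
by [].
Qed.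

(** [p] is the spectral projection of [X] between [c] and [l], so [x = X p] is bounded and
    invertible in the corner. The last estimate splits [psi - p psi] into the part above [l], where
    [r] is at most [1 / (1 + l)], and the part below [c], where [1 - r] is at most [c r]; it is
    useful when [psi] is close to the ranges of [r] and of [1 - r]. *)
Lemma density_cut l c : 0 < c -> 0 < l -> exists p x zeta (r : bop H), [/\ [/\ A p, prj p, dens A tau zeta p & dens A tau (p psi) x],
  [/\ sa r, ple r 1, (forall xi, X (r xi, xi - r xi)) & pos r],
  [/\ ple (c%:C *: p) x, (forall xi, X (p xi, x xi)), x * p = x & p * x = x] & forall eta eta', nrm (psi - p psi) <= nrm (psi - r eta) + nrm (psi - (eta' - r eta')) +
    Num.sqrt (1 + l)^-1 * nrm eta + Num.sqrt c * nrm eta' ].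
Proof.
move=> c0 l0; have [L1 hL] := hD; have [[lX cX _ _ _] gX _] := L1.
have [r [Ar pr r1 h1 h2]] := L1_resolvent L1; have sr := proj1 pr.
have [e [xl [[Ae pe re _] [Axl pxl xlf flx] ec Xf [xll el _ hform]]]] := spectral_cut l0 Ar pr r1 h1 h2.
have [g [xc [[Ag pg rg _] [Axc pxc _ _] gc _ [_ _ gu hform']]]] := spectral_cut c0 Ar pr r1 h1 h2.
have eg : e * g = g * e by case: (ec g rg).
have xlg : xl * g = g * xl by case: (ec g rg).
pose p := g * (1 - e).
have ge : g * (1 - e) = (1 - e) * g by rewrite mulrBr mulrBl mul1r mulr1 eg.
have pp : prj p.
  split; last by apply: saM => //; [case: pg|case: (prjC pe)].
  by rewrite /p -mulrA (mulrA (1 - e)) -ge -mulrA (proj1 (prjC pe)) mulrA (proj1 pg).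
have Ap : A p by apply: (vNM vA) => //; apply: (vNB vA) => //; exact: (vN1 vA).
have ep : (1 - e) * p = p by rewrite /p ge mulrA (proj1 (prjC pe)).
have gp : g * p = p by rewrite /p mulrA (proj1 pg).
have pxlE : p * xl = xl * p by rewrite /p -mulrA flx ge mulrA xlf xlg.
have Xp xi : X (p xi, xl (p xi)) by have := Xf (p xi); rewrite -(mulbE (1 - e)) ep.
have pE : p = g * (1 - e) by [].
clearbody p.
pose x := xl * p.
have xp : x * p = x by rewrite /x -mulrA (proj1 pp).
have px : p * x = x by rewrite /x mulrA pxlE -mulrA (proj1 pp).
have pX : pos x.
  have := posJ p pxl; rewrite (proj2 pp) pxlE -mulrA (proj1 pp).
  by [].
have Ax : A x by exact: vNM.
have low : ple (c%:C *: p) x.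
  move=> xi; have := hform' _ (Xp xi) => /= h; rewrite qfZ (prj_qf _ pp).
  have -> : qf x xi = rp (xl (p xi)) (p xi).
    by rewrite /qf -{1}px mulbE (sa_rp _ _ (proj2 pp)).
  apply: le_trans h; rewrite (prj_qf _ pg) -(mulbE g p) gp lerDr.
  exact: pos_ge0.
have cp0 : pos (c%:C *: p) by apply: posZ; [exact: ltW|exact: prj_pos].
have tx : (tau x <= tau_ext A tau X)%E.
  apply: (@le_trans _ _ (tau xl)).
    have := tau_contr vA T Ap (prj_contr pp) Axl pxl; rewrite (proj2 pp) pxlE -mulrA (proj1 pp).
    by [].
  apply: tau_ext_ub => // w Xw; apply: le_trans (hform w Xw); rewrite lerDl.
  by apply: mulr_ge0; [exact: ltW|apply: pos_ge0; exact: prj_pos].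
have [tX tX0 EX] := L1_fin L1; rewrite EX in tx.
have [q q0 tp] : exists2 q : R, 0 <= q & tau p = q%:E.
  have := tau_mono vA T (vNZ _ vA Ap) cp0 Ax pX low.
  rewrite (tauZ T (ltW c0) Ap (prj_pos pp)) => h; have {}h := le_trans h tx.
  have := tau_ge0 T Ap (prj_pos pp); move: h; case: (tau p) => [q| |] //.
    by rewrite lee_fin => _ q0; exists q.
  by rewrite gt0_muley ?lte_fin.
have cornT d : A d -> pos d -> d * p = d -> p * d = d -> exists t : R, tau d = t%:E.
  move=> Ad pd dp pdE; have [M M0 hM] := pos_bound d.
  have := tau_corner Ad pd Ap pp (ltW M0) hM; rewrite pdE dp tp -EFinM => /(tau_fin T Ad pd)[t _ ->].
  by exists t.
(* [x + c (1 - p)] is invertible; its inverse cut by [p] is [G], the inverse of [x] in the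
   corner. *)
have [i [pi i1 i2 ic _]] := inv_ex (posB (proj1 cp0) (proj1 pX) low) c0.
pose G := i * p.
have xcp : (x - c%:C *: p) * p = p * (x - c%:C *: p).
  by rewrite mulrBl mulrBr xp px -scalebAl -scalebAr.
have ip : i * p = p * i by exact: ic.
have Gx : G * x = p.
  have := congr1 (fun y => y * p) i2; rewrite mul1r -mulrA mulrDl mulrBl xp -scalebAl (proj1 pp).
  by rewrite /cst -scalebAl mul1r subrK /G -mulrA px.
have AG : A G.
  apply: (vNM vA) => //; apply: (vN_fc vA _ ic); apply: (vNB vA) => //; exact: vNZ.
have Gp : G * p = G by rewrite /G -mulrA (proj1 pp).
have pG : p * G = G by rewrite /G mulrA -ip -mulrA (proj1 pp).
have sG : sa G by apply: saM => //; [case: pi|case: pp].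
have xG : x * G = p by have := congr1 adj Gx; rewrite adjM sG (proj1 pX) (proj2 pp).
have Gxc : x * G = G * x by rewrite Gx xG.
clearbody G.
have F0 d t : A d -> pos d -> d * p = d -> p * d = d -> tau d = t%:E -> <| (G * d) psi, psi|> = t%:C.
  move=> Ad pd dp pdE td; apply: (density_act (vNM vA AG Ad) Ad pd td) => xi.
  have := Xp ((G * d) xi); rewrite -(mulbE p) mulrA pG -(mulbE xl).
  have -> : xl * (G * d) = d by rewrite mulrA -{1}pG mulrA -/x xG.
  by [].
(* [F m = <x^{-1} m psi, psi>] is the trace of the corner: by [F0] it agrees with [tau] on positive
   elements, and polarised traciality ([Fcomm]) moves a factor [x^{-1/2}] to the other side, which
   makes [x^{-1/2} psi] a trace vector. *)
pose F m : R[i] := <| (G * m) psi, psi|>.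
have FD m m' : F (m + m') = F m + F m' by rewrite /F mulrDr addbE ipDl.
have FZ k m : F (k *: m) = k * F m by rewrite /F -scalebAr scalebE ipZl.
have Fsw u : corner A p u -> F (adj u * u) = F (u * adj u).
  move=> cu; have cu' := corner_adj vA pp cu; have [Au up pu] := cu; have [Au' up' pu'] := cu'.
  have [c1A c1p pc1] := cornerM vA cu' cu; have [c2A c2p pc2] := cornerM vA cu cu'.
  have [t et] := cornT _ c1A (posA u) c1p pc1.
  rewrite /F (F0 _ t c1A (posA u) c1p pc1 et).
  by rewrite (F0 _ t c2A (posA' u) c2p pc2) // -(tau_adj T Au).
have Fcomm u v : corner A p u -> corner A p v -> F (v * u) = F (u * v).
  move=> cu cv; have cv' := corner_adj vA pp cv.
  have := Fsw _ (cornerD vA cu cv'); have := Fsw _ (cornerD vA cu (cornerZ vA 'i%C cv')).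
  have := Fsw _ cu; have := Fsw _ cv'.
  rewrite !adjD adjZ adjK !mulrDl !mulrDr !FD -!scalebAl -!scalebAr !FZ conjCE => -> ->.
  exact: swap_alg.
have cx : corner A p x by split.
have cs := corner_sqrt vA pX cx; have ssx := sqrt_sq pX; have sas := sqrt_sa pX.
have sGs : bsqrt x * G = G * bsqrt x by apply: sqrt_comm.
set w := bsqrt x in cs ssx sas sGs; have [Aw wp pw] := cs.
have cG : corner A p G by split.
pose h := G * w; have ch : corner A p h by exact: cornerM.
have sh : sa h by apply: saM.
have hw : h * w = p by rewrite /h -mulrA ssx Gx.
have wh : w * h = p by rewrite /h mulrA sGs -mulrA ssx Gx.
have [Ah hp ph] := ch.
have dz : dens A tau (h psi) p.
  split=> //; first exact: prj_pos.
  move=> z Az; pose m := adj (z * p) * (z * p).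
  have cm : corner A p m.
    split; [by apply: (vNM vA); [apply: (vN_adj vA)|]; exact: vNM|by rewrite /m -!mulrA (proj1 pp)|].
    by rewrite /m adjM (proj2 pp) !mulrA (proj1 pp).
  have [Am mp pm] := cm; have [t et] := cornT m Am (posA _) mp pm.
  have -> : tau (z * p * adj z) = t%:E.
    rewrite -et /m (tau_adj T); last exact: vNM.
    by rewrite adjM (proj2 pp) mulrA -(mulrA z p p) (proj1 pp).
  congr (_%:E).
  have e1 : F (w * (m * h)) = t%:C.
    by rewrite (Fcomm (m * h) w) //; [rewrite -mulrA hw mp; exact: (F0 m t Am (posA _) mp pm et)|exact: cornerM].
  have -> : rp (z (h psi)) (z (h psi)) = rp ((G * (w * (m * h))) psi) psi.
    rewrite mulrA -/h /m -!mulrA adjM (proj2 pp) !mulrA hp -!mulrA ph !mulbE.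
    by rewrite (sa_rp _ _ sh) (rp_adj (adj z)) adjK.
  by have := congr1 (@complex.Re R) e1.
exists p, x, (h psi), r; split=> //.
- split=> //.
  have := dens_act vA dz Aw; rewrite sas wp ssx -(mulbE w) wh.
  by [].
move=> eta eta'.
have -> : psi - p psi = (1 - g) psi + g (e psi).
  rewrite pE mulbE !subbE onebE bopB; rewrite opprB addrA.
  by rewrite [X in _ = X]addrAC -addrA.
apply: le_trans (nrmD _ _) _.
have n1 : nrm (g (e psi)) <= nrm (psi - r eta) + Num.sqrt (1 + l)^-1 * nrm eta.
  apply: le_trans (contr_nrm _ (prj_contr pg)) _.
  have -> : e psi = e (psi - r eta) + r (e eta).
    by rewrite (comm_app _ re) -bopD subrK.
  apply: le_trans (nrmD _ _) _; apply: lerD; first exact: contr_nrm (prj_contr pe).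
  apply: nrm_le_sq; first by rewrite mulr_ge0 ?nrm_ge0 ?sqrtr_ge0.
  have l1 : 0 < 1 + l by lra.
  rewrite exprMn sqr_sqrtr ?invr_ge0 ?(ltW l1) // nrm2.
  have := @pos_sqbound _ _ r 1 (e eta) ler01 pr; rewrite mul1r => hh.
  apply: le_trans (hh _) _; first by move=> xi; rewrite qf_cst mul1r; exact: r1.
  have := el eta; have := prj_contr pe eta => h3 h4.
  rewrite mulrC ler_pdivlMr // mulrC.
  exact: le_trans h4 h3.
have n2 : nrm ((1 - g) psi) <= nrm (psi - (eta' - r eta')) + Num.sqrt c * nrm eta'.
  have pg' := prjC pg.
  have rg' : r * (1 - g) = (1 - g) * r by rewrite mulrBr mulrBl mul1r mulr1 rg.
  have -> : (1 - g) psi = (1 - g) (psi - (eta' - r eta')) + ((1 - g) eta' - r ((1 - g) eta')).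
    by rewrite (comm_app _ rg') -bopB -bopD subrK.
  apply: le_trans (nrmD _ _) _; apply: lerD; first exact: contr_nrm (prj_contr pg').
  apply: nrm_le_sq; first by rewrite mulr_ge0 ?nrm_ge0 ?sqrtr_ge0.
  rewrite exprMn sqr_sqrtr ?(ltW c0) // nrm2.
  have p1r : pos (1 - r) by apply: posB => //; exact: sa1.
  have := @pos_sqbound _ _ (1 - r) 1 ((1 - g) eta') ler01 p1r; rewrite mul1r subbE => hh.
  apply: le_trans (hh _) _; first by move=> xi; rewrite qf_cst mul1r qfB qf1 gerBl; exact: pos_ge0.
  have := gu eta'; have := prj_contr pg' eta'; have := r1 ((1 - g) eta').
  rewrite qfB !qf1; set a := rp ((1 - g) eta') _; set q' := qf r _ => h3 h4 h5.
  have : c * q' <= c * rp eta' eta' by rewrite ler_wpM2l ?(ltW c0) // (le_trans h3).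
  clear - h5; lra.
by apply: le_trans (lerD n2 n1) _; clear - c0; lra.
Qed.

(** [r v = v] means [X v = 0]. The projection [k0] onto these vectors satisfies [X k0 = 0], so
    [density_act] gives [|k0 psi|^2 = tau 0 = 0]. *)
Lemma density_ker r (v : H) : sa r -> (forall xi, X (r xi, xi - r xi)) -> A r -> r v = v -> rp psi v = 0.
Proof.
move=> sr h1 Ar rv; have [k0 [pk rk kid kc]] := ker_prj (1 - r).
have s1 : sa (1 - r) by apply: saB => //; exact: sa1.
have Ak : A k0.
  apply: (vN_fc vA (vNB vA (vN1 vA) Ar)) => y ry; apply: kc => //; exact: comm_adj.
have kv : k0 v = v by apply: kid; rewrite subbE rv subrr.
have h := density_act Ak (vN0 vA) pos0 (tau0 vA T).
have {}h : <| k0 psi, psi |> = 0.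
  rewrite h // => xi.
  have rk' : r (k0 xi) = k0 xi.
    have := congr1 (fun y : bop H => y xi) rk; rewrite mulbE subbE zerobE => /subr0_eq.
    by [].
  by have := h1 (k0 xi); rewrite rk' subrr.
have k0psi : k0 psi = 0.
  by apply/rp_eq0; rewrite -prj_qf // /qf /rp h.
by rewrite -kv -(sa_rp _ _ (proj2 pk)) k0psi rp0l.
Qed.

(* Bounded cut-offs [x = X p] of the density; [zeta] is the vector
   [(X p)^{-1/2} psi], which implements the trace on the corner of [p]. *)
Lemma density_approx (e : R) : 0 < e -> exists p x zeta (c : R), [/\ A p, prj p, dens A tau zeta p, dens A tau (p psi) x &
  nrm (psi - p psi) <= e] /\ [/\ 0 < c, ple (c%:C *: p) x, (forall xi, X (p xi, x xi)), x * p = x & p * x = x].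
Proof.
move=> e0; have [L1 hL] := hD; have [[lX _ _ _ _] _ _] := L1; have [X0 _ Xf] := lX.
have [r [Ar pr r1 h1 h2]] := L1_resolvent L1; have sr := proj1 pr.
have Cr : approx [set eta | exists zeta, eta = r zeta] psi.
  apply: range_approx => // v rv; have := h1 v; rewrite rv subr0 => Xv.
  by rewrite (Xf _ _ _ Xv X0) rp0r.
have Cr' : approx [set eta | exists zeta, eta = (1 - r) zeta] psi.
  apply: range_approx => [|v rv]; first by apply: saB => //; exact: sa1.
  apply: (density_ker sr h1 Ar); move: rv; rewrite subbE onebE => /subr0_eq.
  by [].
have e4 : 0 < e / 4 by lra.
have [_ [eta ->] he] := Cr _ e4; have [_ [eta' ->] he'] := Cr' _ e4; rewrite subbE onebE in he'.
(* Taking [c = a'^2] and [l = a^-2] makes the coefficients of [|eta'|] and [|eta|] at most [a'] and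
   [a], hence each product at most [e / 4]. *)
pose a := e / 4 / (1 + nrm eta); pose a' := e / 4 / (1 + nrm eta').
have n1 : 0 < 1 + nrm eta by have := nrm_ge0 eta; lra.
have n2 : 0 < 1 + nrm eta' by have := nrm_ge0 eta'; lra.
have a0 : 0 < a by rewrite divr_gt0.
have a'0 : 0 < a' by rewrite divr_gt0.
have l0 : 0 < a^-1 ^+ 2 by rewrite exprn_gt0 // invr_gt0.
have c0 : 0 < a' ^+ 2 by rewrite exprn_gt0.
have [p [x [zeta [r' [[Ap pp dz dx] [sr' _ h1' pr'] [low Xpx xp px] hn]]]]] := density_cut c0 l0.
have rr : r' = r.
  apply: bopP => xi; have := h2 _ _ (h1' xi); rewrite addrC subrK => ->.
  by [].
exists p, x, zeta, (a' ^+ 2); split; last by [].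
split=> //.
apply: le_trans (hn eta eta') _; rewrite rr (sqrtr_sqr a') gtr0_norm //.
have k1 : a' * nrm eta' <= e / 4.
  by rewrite /a' mulrAC ler_pdivrMr // ler_wpM2l //; lra.
have k2 : Num.sqrt (1 + a^-1 ^+ 2)^-1 * nrm eta <= e / 4.
  apply: (@le_trans _ _ (a * nrm eta)).
    rewrite ler_wpM2r ?nrm_ge0 // -[leRHS]gtr0_norm // -sqrtr_sqr ler_wsqrtr //.
    rewrite -[leRHS]invrK lef_pV2 ?posrE ?invr_gt0 ?exprn_gt0 //; last by lra.
    by rewrite -exprVn; lra.
  by rewrite /a mulrAC ler_pdivrMr // ler_wpM2l //; lra.
lra.
Qed.

End Density.
End Affiliated.
End Unbounded.

(** * Singular numbers *)

Section LayerCake.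
Context {R : realType}.
Implicit Types (f : R -> \bar R) (s t c : R) (v : nat -> R).
Local Notation leb := (@lebesgue_measure R).
Local Notation cut s := [set t : R | 0 < t /\ (t%:E <= s)%E].

Lemma cutE s : cut s%:E = [set` `]0, s]].
Proof. by apply/seteqP; split=> t /=; rewrite lee_fin in_itv /= => /andP. Qed.

Lemma measurable_cut (s : \bar R) : measurable (cut s).
Proof.
apply: is_interval_measurable => x y /= [x0 xs] [y0 ys] z /andP[xz zy].
by split; [exact: lt_le_trans xz|apply: le_trans ys; rewrite lee_fin].
Qed.

Lemma nonincreasing_emeasurable (D : set R) f : is_interval D ->
  (forall x y, D x -> D y -> x <= y -> (f y <= f x)%E) -> measurable_fun D f.
Proof.
move=> iD nf mD; apply: (measurability _ (ErealGenOInfty.measurableE R)) => // _ [_ [x ->] <-].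
apply: is_interval_measurable => a b [/= Da ha] [/= Db hb] z zab.
have Dz : D z by exact: (iD a b).
split=> //=; move: hb; rewrite /= !in_itv /= !andbT => hb.
by apply: lt_le_trans hb _; apply: nf => //; case/andP: zab.
Qed.

Lemma integral_below s t c : 0 < s -> 0 <= t -> 0 <= c ->
  (\int[leb]_(x in cut s%:E) (c * \1_(`]-oo, t[%classic : set R) x)%:E = (c * Num.min s t)%:E)%E.
Proof.
move=> s0 t0 c0.
have mB : measurable (`]-oo, t[%classic : set R) by [].
have mD := measurable_cut s%:E.
under eq_integral do rewrite EFinM.
rewrite ge0_integralZl //; last by apply/measurable_EFinP; exact: measurable_indic.
rewrite integral_indic // EFinM; congr (_ * _)%E.
have [st|ts] := ltP s t.
  have -> : `]-oo, t[%classic `&` cut s%:E = [set` `]0, s]].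
    rewrite cutE; apply/seteqP; split=> x /=; rewrite !in_itv /=; first by move=> [].
    by move=> /andP[x0 xs]; rewrite x0 xs (le_lt_trans xs st).
  by have := @lebesgue_measure_itv R `]0, s]; rewrite /= lte_fin s0 sube0.
have -> : `]-oo, t[%classic `&` cut s%:E = [set` `]0, t[].
  rewrite cutE; apply/seteqP; split=> x /=; rewrite !in_itv /=; first by move=> [-> /andP[->]].
  by move=> /andP[x0 xt]; rewrite x0 xt (le_trans (ltW xt) ts).
have := @lebesgue_measure_itv R `]0, t[; rewrite /= lte_fin => ->; case: ifPn => [_|]; first by rewrite sube0.
by rewrite -leNgt => t1; congr (_%:E); apply/le_anti; rewrite t0 t1.
Qed.

(** [v k] marks where [f] falls below the height [(k + 1) c]. The steps of height [c] on [(0, v k)]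
    add up to a staircase under [f] that misses it by at most [c]; hence the error [c * s]. *)
Lemma layer_cake f s c v : 0 < s -> 0 < c -> measurable_fun (cut s%:E) f ->
  (forall t, 0 < t -> (0 <= f t)%E) -> (forall k, 0 <= v k) ->
  (forall k t, 0 < t -> v k <= t -> (f t <= (k.+1%:R * c)%:E)%E) ->
  (forall k t, 0 < t -> t < v k -> ((k.+1%:R * c)%:E <= f t)%E) ->
  (forall t, 0 < t -> exists k, v k <= t) ->
  (forall n, ((\sum_(k < n) c * Num.min s (v k))%:E <= \int[leb]_(t in cut s%:E) f t)%E) /\
  forall C, (forall n, \sum_(k < n) c * Num.min s (v k) <= C) ->
    (\int[leb]_(t in cut s%:E) f t <= (c * s + C)%:E)%E.
Proof.
move=> s0 c0 mf f0 v0 up lo small.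
pose B k : set R := `]-oo, v k[%classic.
pose g k t : \bar R := (c * \1_(B k) t)%:E.
have mB k : measurable (B k) by exact: measurable_itv.
have mD := measurable_cut s%:E.
have g0 k t : (0 <= g k t)%E by rewrite lee_fin mulr_ge0 // ltW.
have mg k : measurable_fun (cut s%:E) (g k).
  by apply/measurable_EFinP; apply: measurable_funM => //; exact: measurable_indic.
have gint k : (\int[leb]_(t in cut s%:E) g k t = (c * Num.min s (v k))%:E)%E.
  by apply: integral_below => //; exact: ltW.
have g1 k t : t < v k -> g k t = c%:E.
  by move=> h; rewrite /g indicE mem_set ?mulr1 //= in_itv.
have gz k t : v k <= t -> g k t = 0%E.
  move=> h; rewrite /g indicE memNset ?mulr0 // /B /= in_itv /=.
  by apply/negP; rewrite -leNgt.
have gle k t : (g k t <= c%:E)%E.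
  by have [h|h] := ltP t (v k); [rewrite g1|rewrite gz // lee_fin ltW].
split=> [n|C hC].
  have -> : ((\sum_(k < n) c * Num.min s (v k))%:E = \int[leb]_(t in cut s%:E) (\sum_(k < n) g k t))%E.
    rewrite ge0_integral_sum //; last by move=> k; exact: mg.
    by rewrite -sumEFin; apply: eq_bigr => k _; rewrite gint.
  apply: ge0_le_integral => //.
  - by move=> t _; apply: sume_ge0 => k _.
  - by apply: emeasurable_sum => k; exact: mg.
  - move=> t [t0 _]; elim: n => [|n IH]; first by rewrite big_ord0; exact: f0.
    have [h|h] := ltP t (v n).
      apply: le_trans (lo n t t0 h).
      apply: (@le_trans _ _ (\sum_(k < n.+1) c%:E)%E).
        by apply: lee_sum => k _; exact: gle.
      by rewrite sumEFin sumr_const card_ord lee_fin mulr_natl.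
    by rewrite big_ord_recr /= gz // adde0.
have h1 : (\int[leb]_(t in cut s%:E) f t <= \int[leb]_(t in cut s%:E) (c%:E + \sum_(k <oo) g k t))%E.
  apply: ge0_le_integral => //.
  - by move=> t [t0 _]; exact: f0.
  - apply: emeasurable_funD => //; apply: ge0_emeasurable_sum => // k _; exact: mg.
  (* With [m] the first index such that [v m <= t], the [m] earlier steps are all active at [t] and
     add up to [m c], while [f t <= (m + 1) c]. *)
  - move=> t [t0 _]; have ex := small t t0; case: (ex_minnP ex) => m hm mmin.
    apply: le_trans (up m t t0 hm) _.
    have : (\sum_(k < m) g k t <= \sum_(k <oo) g k t)%E.
      rewrite -(big_mkord xpredT (fun k => g k t)).
      by apply: nneseries_lim_ge => k _ _.
    rewrite -[m.+1]addn1 natrD mulrDl mul1r addrC EFinD => hm'; apply: leeD2l.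
    apply: le_trans hm'; rewrite (eq_bigr (fun=> c%:E)).
      by rewrite sumEFin sumr_const card_ord lee_fin mulr_natl.
    move=> [k km] _ /=; apply: g1; rewrite ltNge; apply/negP => h.
    by have := mmin k h; rewrite leqNgt km.
apply: le_trans h1 _; rewrite ge0_integralD //; last first.
- by apply: ge0_emeasurable_sum => // k _; exact: mg.
- by move=> t _; apply: nneseries_ge0.
- by move=> t _; rewrite lee_fin ltW.
rewrite integral_cst // integral_nneseries // EFinD; apply: leeD.
  by have := @lebesgue_measure_itv R `]0, s]; rewrite cutE /= lte_fin s0 sube0 EFinM => ->.
apply: lime_le; first by apply: is_cvg_nneseries => k _ _; rewrite integral_ge0.
apply: nearW => n; rewrite big_mkord (eq_bigr (fun k : 'I_n => (c * Num.min s (v k))%:E)) => [|k _]; last exact: gint.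
by rewrite sumEFin lee_fin; exact: hC.
Qed.

End LayerCake.

(** * Ky Fan functionals as integrals of singular numbers *)

Section KyFanIntegral.
Context {R : realType} {H : hilbertType R}.
Implicit Types (xi eta zeta : H) (s t l c : R) (x y z p q r u v w a b h e g d f : bop H).
Implicit Types (X Y : set (H * H)).
Context (A : set (bop H)) (tau : bop H -> \bar R).
Context (vA : von_neumann_algebra A) (T : nsf_trace A tau).

Lemma tau_sum (F : nat -> bop H) (v : nat -> R) n : (forall k, A (F k)) -> (forall k, pos (F k)) ->
  (forall k, tau (F k) = (v k)%:E) ->
  [/\ A (\sum_(k < n) F k), pos (\sum_(k < n) F k) & tau (\sum_(k < n) F k) = (\sum_(k < n) v k)%:E].
Proof.
move=> AF pF tF; elim: n => [|n [IA Ip It]].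
  by rewrite !big_ord0; split; [exact: vN0|exact: pos0|exact: (tau0 vA T)].
rewrite !big_ord_recr /=; split; [exact: vND|exact: posD|].
by rewrite (tauD T) // It tF.
Qed.

Lemma chain_nested (q : nat -> bop H) : (forall k, prj (q k)) -> (forall k, q k * q k.+1 = q k.+1) ->
  forall i k, (i <= k)%N -> q i * q k = q k.
Proof.
move=> pq qq i; elim=> [|k IH]; first by rewrite leqn0 => /eqP ->; exact: (proj1 (pq 0%N)).
rewrite leq_eqVlt => /orP[/eqP ->|]; first exact: (proj1 (pq _)).
by rewrite ltnS => /IH h; rewrite -(qq k) mulrA h.
Qed.

(** One effect is optimal for all projections of a chain at once: it fills the chain from its small
    end until the trace [s] is used up, taking a fraction [th] of the layer where this happens. *)
Lemma chain_effect (q : nat -> bop H) (v : nat -> R) s n : 0 < s -> (forall k, A (q k)) -> (forall k, prj (q k)) ->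
  (forall k, tau (q k) = (v k)%:E) -> (forall k, q k * q k.+1 = q k.+1) ->
  exists a, [/\ effects A tau s a, forall y, (forall k, q k * y = y * q k) -> a * y = y * a &
    forall k, (k < n)%N -> tau (a * q k) = (Num.min s (v k))%:E].
Proof.
move=> s0 Aq pq tq qq.
have nest := chain_nested pq qq.
(* Zero from [n] on, so that a first index with [v' <= s] exists. *)
pose q' k := if (k < n)%N then q k else 0; pose v' k := if (k < n)%N then v k else 0.
have Aq' k : A (q' k) by rewrite /q'; case: ifP => // _; exact: vN0.
have pq' k : prj (q' k) by rewrite /q'; case: ifP => // _; exact: prj0.
have tq' k : tau (q' k) = (v' k)%:E by rewrite /q' /v'; case: ifP => // _; exact: (tau0 vA T).
have nest' i k : (i <= k)%N -> q' i * q' k = q' k.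
  move=> ik; have [kn|nk] := ltnP k n; first by rewrite /q' kn (leq_ltn_trans ik kn) nest.
  by rewrite (_ : q' k = 0) ?mulr0 // /q' ltnNge nk.
have com y k : (forall k, q k * y = y * q k) -> q' k * y = y * q' k.
  by move=> h; rewrite /q'; case: ifP => // _; rewrite mul0r mulr0.
have qn k : (k < n)%N -> q k = q' k /\ v k = v' k by rewrite /q' /v' => ->.
have mono i k : (i <= k)%N -> v' k <= v' i.
  move=> ik; have := tau_mono vA T (Aq' k) (prj_pos (pq' k)) (Aq' i) (prj_pos (pq' i)) (prj_mul_le (pq' k) (pq' i) (nest' i k ik)).
  by rewrite !tq' lee_fin.
have ex : exists m, v' m <= s by exists n; rewrite /v' ltnn ltW.
case: (ex_minnP ex) => -[|j] hm mmin.
  exists (q' 0%N); split.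
  - by split=> //; [exact: prj_pos|exact: prj_le1|rewrite tq' lee_fin].
  - by move=> y; exact: com.
  - move=> k /qn[-> ->]; rewrite nest' // tq'; congr (_%:E); apply/esym/min_idPr.
    exact: le_trans (mono 0%N k _) hm.
have hj : s < v' j by rewrite ltNge; apply/negP => /mmin; rewrite ltnn.
have jn : (j < n)%N by move: hj; rewrite /v'; case: ifP => // _ h; move: s0; rewrite ltNge (ltW h).
set qj := q' j in hj; set qm := q' j.+1 in hm.
have jm : q' j * q' j.+1 = q' j.+1 by exact: nest'.
have pd := prjB (pq' j.+1) (pq' j) jm.
have Ad : A (q' j - q' j.+1) by exact: vNB.
pose th := (s - v' j.+1) / (v' j - v' j.+1).
have dv : 0 < v' j - v' j.+1 by lra.
have thE : th * (v' j - v' j.+1) = s - v' j.+1 by rewrite /th divfK // gt_eqF.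
have th0 : 0 <= th by rewrite divr_ge0 //; lra.
have th1 : th <= 1 by rewrite ler_pdivrMr //; lra.
have td : tau (q' j - q' j.+1) = (v' j - v' j.+1)%:E.
  have := tauD T Ad (prj_pos pd) (Aq' j.+1) (prj_pos (pq' j.+1)); rewrite subrK !tq'.
  by case: (tau _) => [w| |] //= [->]; congr (_%:E); lra.
pose a := q' j.+1 + th%:C *: (q' j - q' j.+1).
have ptd : pos (th%:C *: (q' j - q' j.+1)) by apply: posZ => //; exact: prj_pos.
have ta : tau a = s%:E.
  rewrite /a (tauD T) //; [|exact: prj_pos|exact: vNZ].
  rewrite (tauZ T) //; last exact: prj_pos.
  by rewrite tq' td -EFinM -EFinD thE; congr (_%:E); lra.
have pa : pos a by apply: posD => //; exact: prj_pos.
have qa i : (i <= j)%N -> a * q' i = a.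
  move=> ij; have h1 : q' j * q' i = q' j.
    by have := congr1 adj (nest' i j ij); rewrite adjM (proj2 (pq' i)) (proj2 (pq' j)).
  have h2 : q' j.+1 * q' i = q' j.+1.
    by have := congr1 adj (nest' i j.+1 (leqW ij)); rewrite adjM (proj2 (pq' i)) (proj2 (pq' j.+1)).
  by rewrite /a mulrDl -scalebAl mulrBl h1 h2.
exists a; split.
- split=> //; [by apply: vND => //; exact: vNZ| |by rewrite ta].
  move=> xi; have := prj_le1 (pq' j) xi; have := pos_ge0 xi (prj_pos pd).
  have := qfB (q' j) (q' j.+1) xi; rewrite /a (qfD (q' j.+1)) (qfZ th).
  nra.
- move=> y hy; rewrite /a mulrDl mulrDr -scalebAl -scalebAr mulrBl mulrBr.
  by rewrite !(com _ _ hy).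
- move=> k kn; have [-> ->] := qn k kn; have [kj|jk] := leqP k j.
    by rewrite qa // ta; congr (_%:E); apply/esym/min_idPl; apply: le_trans (ltW hj) _; exact: mono.
  have e1 : q' j * q' k = q' k by apply: nest'; exact: ltnW.
  have e2 : q' j.+1 * q' k = q' k by exact: nest'.
  rewrite /a mulrDl -scalebAl mulrBl e1 e2 subrr scaler0 addr0 tq'.
  by congr (_%:E); apply/esym/min_idPr; apply: le_trans hm; exact: mono.
Qed.

(** Abel summation: on the layer between [q k] and [q k.+1] the form of [x] is at least [(k + 1) c].
    The bracket in [key] is what remains to be distributed after [m] layers. *)
Lemma chain_lower x (q : nat -> bop H) c n xi : 0 <= c -> pos x -> (forall k, prj (q k)) ->
  (forall k, x * q k = q k * x) -> (forall k, q k * q k.+1 = q k.+1) ->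
  (forall k, k.+1%:R * c * rp (q k xi) (q k xi) <= qf x (q k xi)) ->
  (forall k, k.+1%:R * c * rp ((q k - q k.+1) xi) ((q k - q k.+1) xi) <= qf x ((q k - q k.+1) xi)) ->
  c * \sum_(k < n) qf (q k) xi <= qf x xi.
Proof.
move=> c0 px pq xq qq h1 h2.
suff key m : c * \sum_(k < m) qf (q k) xi + (qf x (q m xi) - m%:R * c * rp (q m xi) (q m xi)) <= qf x xi.
  apply: le_trans (key n); rewrite lerDl subr_ge0; apply: le_trans (h1 n).
  by rewrite ler_wpM2r ?rp_ge0 // ler_wpM2r // ler_nat.
elim: m => [|m IH].
  rewrite big_ord0 mulr0 !mul0r add0r subr0 (qf_split xi (pq 0%N) (xq 0%N)) lerDl.
  exact: pos_ge0.
apply: le_trans IH; rewrite big_ord_recr /= mulrDr -addrA lerD2l.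
have qm : q m.+1 (q m xi) = q m.+1 xi.
  by rewrite -mulbE; have := congr1 adj (qq m); rewrite adjM (proj2 (pq m)) (proj2 (pq m.+1)) => ->.
have dm : (1 - q m.+1) (q m xi) = (q m - q m.+1) xi by rewrite !subbE onebE qm.
have := h2 m; have := qf_split (q m xi) (pq m.+1) (xq m.+1); rewrite qm dm.
have pd := prjB (pq m.+1) (pq m) (qq m).
have := prj_qf xi pd; rewrite qfB (prj_qf _ (pq m)) (prj_qf _ (pq m.+1)) -natr1.
set B1 := qf x _; set B2 := qf x _; set B3 := qf x _; set N1 := rp _ _; set N2 := rp _ _; set N3 := rp _ _.
by move=> <- ->; lra.
Qed.

(** The thresholds start at [2 c], one layer higher than necessary for the sum itself. The gap pays
    off when these projections are compared with spectral projections of the unbounded density at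
    level [(k + 1) c]: a unit vector in the former and killed by the latter would have form at least
    [(k + 2) c] and at most [(k + 1) c]. *)
Lemma chain_upper x c n xi : 0 < c -> pos x -> let q k := spec x (k.+2%:R * c) in
  ple x (cst (n.+2%:R * c)) -> qf x xi <= 2 * c * rp xi xi + c * \sum_(k < n) qf (q k) xi.
Proof.
move=> c0 px q xn; have sx := proj1 px.
have pq k : prj (q k) := spec_prj _ sx.
have xq k : x * q k = q k * x by rewrite spec_comm.
have qq k : q k * q k.+1 = q k.+1 by apply: spec_mono => //; rewrite ltr_pM2r // ltr_nat.
suff key m : qf x xi <= 2 * c * rp xi xi + c * \sum_(k < m) qf (q k) xi + (qf x (q m xi) - m.+2%:R * c * rp (q m xi) (q m xi)).
  apply: le_trans (key n) _; rewrite gerDl subr_le0.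
  by have := xn (q n xi); rewrite qf_cst.
have up k eta : qf x ((1 - q k) eta) <= k.+2%:R * c * (rp eta eta - rp (q k eta) (q k eta)).
  have [_ _ _ h] := specP (k.+2%:R * c) sx; apply: le_trans (h eta) _.
  by have := prj_qf eta (prjC (pq k)); rewrite qfB qf1 (prj_qf _ (pq k)) => <-.
elim: m => [|m IH].
  rewrite big_ord0 mulr0 addr0 (qf_split xi (pq 0%N) (xq 0%N)).
  by have := up 0%N xi; lra.
apply: le_trans IH _; rewrite big_ord_recr /= mulrDr.
have qm : q m.+1 (q m xi) = q m.+1 xi.
  by rewrite -mulbE; have := congr1 adj (qq m); rewrite adjM (proj2 (pq m)) (proj2 (pq m.+1)) => ->.
have := up m.+1 (q m xi); have := qf_split (q m xi) (pq m.+1) (xq m.+1); rewrite qm (prj_qf xi (pq m)).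
rewrite -[m.+3%:R]natr1.
set B1 := qf x _; set B2 := qf x _; set B3 := qf x _; set N1 := rp _ _; set N2 := rp _ _; set S := \sum_(k < m) _.
by move=> ->; lra.
Qed.

(** Compressed by [bsqrt a], [chain_upper] leaves the numbers [tau (bsqrt a * q k * bsqrt a)], each
    bounded by [tau a <= s] and by [tau (q k)]. *)
Lemma kyfan_chain_le eta y s c n (v : nat -> R) : dens A tau eta y -> 0 < s -> 0 < c ->
  ple y (cst (n.+2%:R * c)) -> (forall k, (tau (spec y (k.+2%:R * c)) <= (v k)%:E)%E) ->
  kyfan A tau s eta <= 2 * c * s + \sum_(k < n) c * Num.min s (v k).
Proof.
move=> dy s0 c0 yn qv; have [Ay posy _] := dy; have sy := proj1 posy; have s0' := ltW s0.
pose q k := spec y (k.+2%:R * c).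
have pq k : prj (q k) := spec_prj _ sy.
have Aq k : A (q k) by exact: vN_spec.
  apply: (kyfan_le vA T) => // a Da; have [Aa pa a1 tas] := Da.
  have [ta ta0 taE] := tau_fin T Aa pa tas; move: tas; rewrite taE lee_fin => tas.
  have Asa := vN_sqrt vA Aa pa; have ssa := sqrt_sa pa; have qsa := sqrt_sq pa.
  rewrite -lee_fin -(dens_qf vA T dy Aa pa) (tau_swap vA T) //.
  set w := bsqrt a in Asa ssa qsa *.
  pose F k := w * q k * w.
  have AF k : A (F k) by have := vN_J vA (Aq k) Asa; rewrite ssa.
  have pF k : pos (F k) by have := posJ w (prj_pos (pq k)); rewrite ssa.
  have tF k : exists u : R, tau (F k) = u%:E /\ u <= Num.min s (v k).
    have h1 : (tau (F k) <= s%:E)%E.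
      apply: (@le_trans _ _ (tau a)); last by rewrite taE lee_fin.
      apply: (tau_mono vA T) => //; have := pleJ w (prj_le1 (pq k)); rewrite ssa mulr1 qsa.
      by [].
    have h2 : (tau (F k) <= (v k)%:E)%E.
      apply: le_trans (qv k); have cw : contr w by apply/contrP; rewrite ssa qsa.
      by have := tau_contr vA T Asa cw (Aq k) (prj_pos (pq k)); rewrite ssa.
    have [u u0 uE] := tau_fin T (AF k) (pF k) h1; exists u; split=> //.
    by rewrite le_min -!lee_fin -uE h1 h2.
  have [u hu] := choice tF.
  have [AS pS tS] := tau_sum n AF pF (fun k => proj1 (hu k)).
  have pa2 : pos ((2 * c)%:C *: a) by apply: posZ => //; rewrite mulr_ge0 // ltW.
  have pcS : pos (c%:C *: (\sum_(k < n) F k)) by apply: posZ => //; exact: ltW.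
  apply: (@le_trans _ _ (tau ((2 * c)%:C *: a + c%:C *: (\sum_(k < n) F k)))).
    apply: (tau_mono vA T).
    - by have := vN_J vA Ay Asa; rewrite ssa.
    - by have := posJ w posy; rewrite ssa.
    - by apply: (vND vA); exact: vNZ.
    - exact: posD.
    - move=> xi; have := qfJ y w xi; rewrite ssa => ->; rewrite qfD !qfZ qf_sum.
      apply: le_trans (chain_upper (w xi) c0 posy yn) _.
      have -> : qf a xi = rp (w xi) (w xi) by rewrite -qfA ssa qsa.
      rewrite lerD2l ler_wpM2l ?(ltW c0) //; apply: ler_sum => k _.
      by have := qfJ (q k) w xi; rewrite ssa => <-.
  rewrite (tauD T) //; try exact: vNZ.
  rewrite !(tauZ T) //; try exact: ltW; last by rewrite mulr_ge0 // ltW.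
  rewrite taE tS -!EFinM -EFinD lee_fin; apply: lerD.
    by rewrite ler_wpM2l // mulr_ge0 // ltW.
  rewrite mulr_sumr; apply: ler_sum => k _.
  by rewrite ler_wpM2l ?(ltW c0) //; have [] := hu k.
Qed.

Section Cuts.
Context (psi : H) (X : set (H * H)) (hD : density_operator A tau psi X).

Lemma mu_le X' l e x t : 0 <= l -> A e -> prj e -> pos x -> ple x (cst l) -> (forall xi, X' ((1 - e) xi, x xi)) ->
  (tau e <= t%:E)%E -> (mu A tau X' t <= l%:E)%E.
Proof.
move=> l0 Ae pe px xl Xf te.
have h : (mu A tau X' t <= Defs.gnorm (gcomp X' (graph (1 - e)%R)))%E.
  apply: ereal_inf_lbound; exists (1 - e) => //; split.
  - exact: (vNB vA (vN1 vA) Ae).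
  - by apply/prjP; exact: prjC.
  - by rewrite opprB addrCA subrr addr0.
apply: le_trans h _.
apply: ereal_inf_lbound; exists l => //; split=> // xi; exists (x xi); last exact: pos_nrm.
by exists ((1 - e) xi).
Qed.

(** If [tau e > t >= tau (1 - p)], then by [tau_inj] some nonzero vector lies in the ranges of both
    [e] and [p]; the form of [X'] is at least [l] there, so [X' p] cannot have norm below [l]. *)
Lemma mu_ge X' l e x t : linear_graph X' -> A e -> prj e -> pos x ->
  (forall z : H * H, X' z -> qf x z.1 + l * qf e z.1 <= rp z.2 z.1) ->
  (t%:E < tau e)%E -> (l%:E <= mu A tau X' t)%E.
Proof.
move=> [_ _ Xu] Ae pe px hf te; rewrite leNgt; apply/negP => /ereal_inf_lt[_ [p [Ap /prjP pp tp] <-]].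
move=> /ereal_inf_lt[_ [M [M0 hM] <-]]; rewrite lte_fin => Ml.
have pp' := prjC pp; have Ap' := vNB vA (vN1 vA) Ap.
suff : (tau e <= tau (1 - p)%R)%E by move=> h; have := lt_le_trans te (le_trans h tp); rewrite ltxx.
apply: (tau_inj vA T) => // xi exi pxi.
have [eta [m mE Xm] hn] := hM xi; rewrite /graph /= in mE.
have pxi' : p xi = xi by move: pxi; rewrite subbE => /subr0_eq.
rewrite mE pxi' in Xm; have := hf _ Xm; rewrite /= (prj_qf _ pe) exi => h1.
have h2 := pos_ge0 xi px; have := rp_le' eta xi.
have : nrm eta * nrm xi <= M * rp xi xi by rewrite -nrm2 expr2 mulrA ler_wpM2r ?nrm_ge0.
move=> h3 h4; apply/rp_eq0/le_anti; rewrite rp_ge0 andbT.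
have : (l - M) * rp xi xi <= 0 by lra.
by rewrite pmulr_rle0 //; lra.
Qed.

Lemma mu_ge0 X' t : (0 <= mu A tau X' t)%E.
Proof.
apply: le_ereal_inf_tmp => _ [p _ <-]; apply: le_ereal_inf_tmp => _ [M [M0 _] <-].
by rewrite lee_fin.
Qed.

Lemma mu_measurable X' (s : \bar R) : measurable_fun [set t : R | 0 < t /\ (t%:E <= s)%E] (mu A tau X').
Proof.
apply: nonincreasing_emeasurable.
  move=> a b [a0 _] [_ bs] z /andP[az zb]; split; first exact: lt_le_trans az.
  by apply: le_trans bs; rewrite lee_fin.
move=> a b _ _ ab; apply: ereal_inf_le_tmp => _ [p [Ap pp tp] <-].
by exists p => //; split=> //; apply: le_trans tp _; rewrite lee_fin.
Qed.

Lemma spectral_family : exists r, [/\ A r, sa r & forall l, 0 < l ->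
  exists x, let e := spec (- r) (- (1 + l)^-1) in
  [/\ [/\ A e, prj e & r * e = e * r], [/\ A x, pos x, x * (1 - e) = x & (1 - e) * x = x],
    (forall y, r * y = y * r -> e * y = y * e /\ x * y = y * x),
    (forall xi, X ((1 - e) xi, x xi)) &
    [/\ ple x (cst l), forall z : H * H, X z -> qf x z.1 + l * qf e z.1 <= rp z.2 z.1,
       (tau x <= (rp psi psi)%:E)%E & (l%:E * tau e <= (rp psi psi)%:E)%E]]].
Proof.
have [L1 hL] := hD; have [_ gX _] := L1.
have [r [Ar pr r1 h1 h2]] := L1_resolvent vA L1; exists r; split=> //; first by case: pr.
move=> l l0; have [e [x [[Ae pe re eE] [Ax px xf fx] ec Xf [xl _ _ hf]]]] := spectral_cut vA l0 Ar pr r1 h1 h2.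
rewrite eE in Ae pe re xf fx ec Xf hf.
exists x; set f := spec _ _ in Ae pe re xf fx ec Xf hf *; split=> //; split=> //.
  rewrite -(density_tau_ext vA T hD); apply: (tau_ext_ub tau gX Ax px) => z Xz.
  apply: le_trans (hf z Xz); rewrite lerDl; apply: mulr_ge0; first exact: ltW.
  by apply: pos_ge0; exact: prj_pos.
have ple' : pos (l%:C *: f) by apply: posZ; [exact: ltW|exact: prj_pos].
rewrite -(tauZ T (ltW l0) Ae (prj_pos pe)) -(density_tau_ext vA T hD).
apply: (tau_ext_ub tau gX (vNZ _ vA Ae) ple') => z Xz; rewrite qfZ.
by apply: le_trans (hf z Xz); rewrite lerDr; exact: pos_ge0.
Qed.

(** For each layer height [c] both sides are compared with the sums of [c * Num.min s (v k)], where
    [v k] is the trace of the spectral projection of [X] above [(k + 1) c]. That these sums stay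
    below [K] is tested on a [chain_effect] cut off at a high level; that they nearly reach [K]
    follows from bounded cuts of the density and [kyfan_chain_le]. *)
Lemma kyfan_mu s : 0 < s -> (\int[@lebesgue_measure R]_(t in [set t : R | (0 < t)%R /\ (t%:E <= s%:E)%E])
   mu A tau X t)%E = (kyfan A tau s psi)%:E.
Proof.
move=> s0; have [r [Ar sr fam]] := spectral_family; have s0' := ltW s0.
have [L1 hL] := hD; have [[lX _ _ _ _] gX _] := L1; have [X0 _ Xu] := lX.
pose N := rp psi psi; have N0 : 0 <= N by exact: rp_ge0.
set K := kyfan A tau s psi; have K0 : 0 <= K by exact: kyfan_ge0.
have snr : sa (- r) by exact: saN.
set I := (\int[_]_(t in _) _)%E.
suff main c : 0 < c -> exists2 C : R, 0 <= C & (C%:E <= I)%E /\ (I <= (c * s + K)%:E)%E /\ K <= 2 * c * s + C.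
  have [C C0 [CI [IC _]]] := main 1 ltr01.
  have [i iI] : exists i : R, I = i%:E.
    move: CI IC; case: (I) => [i| |] //; by exists i.
  rewrite iI; congr (_%:E); apply/eqP; rewrite -subr_eq0 -normr_le0; apply: small0 => d d0.
  have ds : 0 < d / (2 * s) by rewrite divr_gt0 // mulr_gt0.
  have dss : d / (2 * s) * s = d / 2 by field; rewrite gt_eqF.
  have [C' _ [CI' [IC' KC]]] := main _ ds; move: CI' IC'; rewrite iI !lee_fin => h1 h2.
  rewrite ler_norml; apply/andP; split; lra.
move=> c0; pose lk (k : nat) : R := k.+1%:R * c; have lk0 k : 0 < lk k by rewrite mulr_gt0.
pose E k := spec (- r) (- (1 + lk k)^-1).
have [x hx] := choice (fun k => fam (lk k) (lk0 k)); rewrite /= in hx.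
have AE k : A (E k) by have [[]] := hx k.
have pE k : prj (E k) by have [[]] := hx k.
have finE k : exists v : R, 0 <= v /\ tau (E k) = v%:E /\ lk k * v <= N.
  have [_ _ _ _ [_ _ _]] := hx k; rewrite -/(E k); have := tau_ge0 T (AE k) (prj_pos (pE k)).
  case: (tau (E k)) => [v| |] //; last by rewrite gt0_muley ?lte_fin.
  by rewrite -EFinM !lee_fin => v0 hv; exists v.
have [v hv] := choice finE.
have tE k : tau (E k) = (v k)%:E by have [_ []] := hv k.
have form k (w : H * H) : X w -> qf (x k) w.1 + lk k * qf (E k) w.1 <= rp w.2 w.1.
  by have [_ _ _ _ [_ h _ _]] := hx k; exact: h.
have lkmono k : lk k < lk k.+1 by rewrite /lk ltr_pM2r // ltr_nat.
have EE k : E k * E k.+1 = E k.+1.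
  apply: spec_mono => //; rewrite ltrN2 ltf_pV2 ?posrE; have := lkmono k; have := lk0 k; lra.
have rE k : r * E k = E k * r by have [[]] := hx k.
have claim1 n : \sum_(k < n) c * Num.min s (v k) <= K.
  suff : \sum_(k < n) c * Num.min s (v k) - K <= 0 by lra.
  apply: small0 => d d0.
  (* The cut at level [l] costs at most [tau e <= N / l] in each of the [n] layers of height [c], in
     total at most [d]. *)
  pose l := (n%:R * c * N + 1) / d.
  have ncN : 0 <= n%:R * c * N by rewrite !mulr_ge0 // ltW.
  have l0 : 0 < l by rewrite divr_gt0 //; lra.
  have [xl [[Ae pe re] [Axl pxl xlf flx] ec Xf [xll formx txl te]]] := fam l l0.
  set e := spec _ _ in Ae pe re xlf flx ec Xf formx te.
  have [tev tev0 [teE ted]] : exists2 t : R, 0 <= t & tau e = t%:E /\ n%:R * c * t <= d.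
    have := tau_ge0 T Ae (prj_pos pe); move: te; case: (tau e) => [t| |] //; last by rewrite gt0_muley ?lte_fin.
    rewrite -EFinM !lee_fin => h t0; exists t => //; split=> //.
    rewrite -(ler_pM2l l0); have -> : l * d = n%:R * c * N + 1 by rewrite /l divfK // gt_eqF.
    have hh : n%:R * c * (l * t) <= n%:R * c * N by rewrite ler_wpM2l // mulr_ge0 // ltW.
    by rewrite mulrCA; apply: le_trans hh _; rewrite lerDl.
  have eE k : e * E k = E k * e by have [] := ec (E k) (rE k).
  have xE k : xl * E k = E k * xl by have [] := ec (E k) (rE k).
  have pf := prjC pe; have Af := vNB vA (vN1 vA) Ae.
  have fE k : (1 - e) * E k = E k * (1 - e) by rewrite mulrBl mulrBr mul1r mulr1 eE.
  have fe0 : (1 - e) * e = 0 by rewrite mulrBl mul1r (proj1 pe) subrr.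
  have [a [Da acom ta]] := chain_effect n s0 AE pE tE EE.
  have [Aa pa a1 tas] := Da; have Asa := vN_sqrt vA Aa pa; have ssa := sqrt_sa pa; have qsa := sqrt_sq pa.
  have ae : a * e = e * a by apply: acom => k; rewrite eE.
  have ax : a * xl = xl * a by apply: acom => k; rewrite xE.
  have aE k : a * E k = E k * a.
    by apply: acom => j; have [ij|ji] := leqP j k; [rewrite (chain_nested pE EE ij)|rewrite (chain_nested pE EE (ltnW ji))];
       [have := congr1 adj (chain_nested pE EE ij)|have := congr1 adj (chain_nested pE EE (ltnW ji))];
       rewrite adjM (proj2 (pE _)) (proj2 (pE _)) => ->.
  have sax : bsqrt a * xl = xl * bsqrt a by apply: sqrt_comm.
  have saE k : bsqrt a * E k = E k * bsqrt a by apply: sqrt_comm.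
  have sae : bsqrt a * e = e * bsqrt a by apply: sqrt_comm.
  set w := bsqrt a in Asa ssa qsa sax saE sae.
  set f := 1 - e in pf Af fE fe0 xlf flx Xf.
  pose d' := w * xl * w.
  have d'E : d' = xl * a by rewrite /d' sax -mulrA qsa.
  have Ad' : A d' by have := vN_J vA Axl Asa; rewrite ssa.
  have pd' : pos d' by have := posJ w pxl; rewrite ssa.
  have cw : contr w by apply/contrP; rewrite ssa qsa.
  have td' : (tau d' <= N%:E)%E.
    by apply: le_trans txl; have := tau_contr vA T Asa cw Axl pxl; rewrite ssa.
  have [t t0 tdE] := tau_fin T Ad' pd' td'.
  have af : a * f = f * a by rewrite mulrBl mulrBr mul1r mulr1 ae.
  have tK : t <= K.
    have <- : qf (f * a) psi = t.
      have := density_act vA T hD (vNM vA Af Aa) Ad' pd' tdE.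
      move=> /(_ _)/(congr1 (@complex.Re R)); apply => xi.
      by rewrite d'E !mulbE; exact: Xf.
    apply: (kyfan_ub vA T) => //.
    have -> : f * a = f * a * adj f by rewrite (proj2 pf) -mulrA af mulrA (proj1 pf).
    split; [exact: vN_conj|exact: pos_conj| |].
    - apply: ple_trans (ple_conj f a1) _; rewrite mulr1 (proj2 pf) (proj1 pf).
      exact: prj_le1.
    - exact: le_trans (tau_contr vA T Af (prj_contr pf) Aa pa) tas.
  pose W k := w * (f * E k * f) * w.
  have WJ k : W k = adj (f * w) * E k * (f * w) by rewrite adjM ssa (proj2 pf) /W !mulrA.
  have AW k : A (W k) by rewrite WJ; apply: vN_J => //; exact: vNM.
  have pW k : pos (W k) by rewrite WJ; apply: posJ; exact: prj_pos.
  (* Cutting [E k] by [f = 1 - e] loses at most [tau e] of the trace [Num.min s (v k)] captured by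
     [a]. *)
  have tW k : exists u : R, tau (W k) = u%:E /\ ((k < n)%N -> Num.min s (v k) <= u + tev).
    pose V := w * (e * E k) * w.
    have eEp : e * E k = e * E k * adj e by rewrite (proj2 pe) eE -mulrA (proj1 pe).
    have AV : A V by have := vN_J vA (vNM vA Ae (AE k)) Asa; rewrite ssa.
    have pV : pos V by have := posJ w (pos_conj e (prj_pos (pE k))); rewrite ssa -eEp.
    have tV : (tau V <= tev%:E)%E.
      rewrite -teE; apply: (tau_mono vA T) => //; first exact: prj_pos.
      have := pleJ w (ple_conj e (prj_le1 (pE k))); rewrite ssa -eEp mulr1 (proj2 pe) (proj1 pe) => h.
      apply: ple_trans h _; rewrite sae -mulrA qsa => xi.
      have := ple_conj e a1 xi; rewrite mulr1 (proj2 pe) (proj1 pe) => h; apply: le_trans h.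
      by rewrite -mulrA ae mulrA (proj1 pe).
    have WV : a * E k = W k + V.
      rewrite /W /V -mulrDl -mulrDr fE -(mulrA (E k)) (proj1 pf) eE -mulrDr subrK mulr1.
      by rewrite saE -mulrA qsa aE.
    have [uv uv0 uvE] := tau_fin T AV pV tV; move: tV; rewrite uvE lee_fin => tV.
    have tW' : (tau (W k) <= (v k)%:E)%E.
      rewrite WJ -tE; have := tau_mono vA T; apply.
      - exact: vN_J (AE k) (vNM vA Af Asa).
      - exact: posJ (prj_pos (pE k)).
      - exact: AE.
      - exact: prj_pos.
      - move=> xi; have cfw : contr (f * w) by apply: contrM => //; exact: prj_contr.
        have yE : (f * w) * E k = E k * (f * w) by rewrite -mulrA saE mulrA fE mulrA.
        have yE' := comm_adj (proj2 (pE k)) (esym yE).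
        have sC : adj (f * w) * E k * (f * w) = adj (E k) * (adj (f * w) * (f * w)) * E k.
          rewrite (proj2 (pE k)) (mulrA (E k)) yE' -[RHS]mulrA yE -[RHS]mulrA (mulrA (E k) (E k)) (proj1 (pE k)).
          by rewrite -mulrA.
        rewrite sC qfJ; have := proj1 (contrP (f * w)) cfw (E k xi); rewrite qf1 (prj_qf _ (pE k)).
        by [].
    have [u u0 uE] := tau_fin T (AW k) (pW k) tW'; exists u; split=> // kn.
    have := ta k kn; rewrite WV (tauD T) // uE uvE -EFinD => -[<-].
    by rewrite lerD2l.
  have [u hu] := choice tW.
  have [AS pS tS] := tau_sum n AW pW (fun k => proj1 (hu k)).
  have cS : ple (c%:C *: (\sum_(k < n) W k)) d'.
    move=> xi; rewrite qfZ qf_sum; have := qfJ xl w xi; rewrite ssa => ->.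
    pose z := f (w xi); have fz : f z = z by rewrite /z prj_idem.
    have -> : qf xl (w xi) = qf xl z.
      have xlE : xl = adj f * xl * f by rewrite (proj2 pf) flx xlf.
      by rewrite {1}xlE qfJ.
    rewrite (eq_bigr (fun k : 'I_n => qf (E k) z)) => [|k _]; last by rewrite WJ qfJ mulbE.
    have keyz k (y : H) : E k y = y -> f y = y -> k.+1%:R * c * rp y y <= qf xl y.
      move=> Ey fy; have := form k _ (Xf y); rewrite fy /= (prj_qf _ (pE k)) Ey.
      have [_ [_ px _ _] _ _ _] := hx k; have := pos_ge0 y px; rewrite /lk; clear - c0; lra.
    apply: (chain_lower n (ltW c0) pxl pE xE EE) => k.
      by apply: keyz; [rewrite prj_idem|rewrite (comm_app _ (fE k)) fz].
    apply: keyz; first by rewrite -mulbE mulrBr (proj1 (pE k)) EE.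
    have fd : f * (E k - E k.+1) = (E k - E k.+1) * f by rewrite [LHS]mulrBr [RHS]mulrBl !fE.
    by rewrite (comm_app _ fd) fz.
  have pcS : pos (c%:C *: (\sum_(k < n) W k)) by apply: posZ => //; exact: ltW.
  have := tau_mono vA T (vNZ _ vA AS) pcS Ad' pd' cS.
  rewrite (tauZ T (ltW c0) AS pS) tS tdE -EFinM lee_fin => hfin.
  have : \sum_(k < n) c * Num.min s (v k) <= \sum_(k < n) (c * u k + c * tev).
    apply: ler_sum => k _; rewrite -mulrDr ler_wpM2l ?(ltW c0) //.
    by have [_ h] := hu k; exact: h.
  rewrite big_split /= -!mulr_sumr sumr_const card_ord -mulr_natl mulrA.
  clear - hfin tK ted; lra.
have claim2 C : (forall n, \sum_(k < n) c * Num.min s (v k) <= C) -> K <= 2 * c * s + C.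
  move=> hC; suff : K - (2 * c * s + C) <= 0 by lra.
  apply: small0 => d d0.
  pose d' := d / (1 + 2 * nrm psi); have n0 : 0 < 1 + 2 * nrm psi by have := nrm_ge0 psi; lra.
  have d'0 : 0 < d' by rewrite divr_gt0.
  have [p [y [zeta [c' [[Ap pp _ dy hn] [_ _ Xp yp py]]]]]] := density_approx vA T hD d'0.
  have [Ay posy _] := dy.
  have [M M0 hM] := pos_bound y.
  have [n hn'] : exists n : nat, M <= n.+2%:R * c.
    have Mc : 0 <= M / c by rewrite divr_ge0 // ltW.
    exists (Num.bound (M / c)); rewrite -ler_pdivrMr //; apply: le_trans (ltW (archi_boundP Mc)) _.
    by rewrite ler_nat ltnW // ltnW.
  have yn : ple y (cst (n.+2%:R * c)).
    by move=> xi; apply: le_trans (hM xi) _; rewrite !qf_cst ler_wpM2r // rp_ge0.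
  have sy := proj1 posy; pose q k := spec y (k.+2%:R * c).
  have pq k : prj (q k) := spec_prj _ sy.
  have Aq k : A (q k) by exact: vN_spec.
  (* A vector fixed by [q k] and killed by [E k] lies in the range of [p], where [y] and [X] agree;
     the levels [(k + 2) c] and [(k + 1) c] then force it to be 0. *)
  have qv k : (tau (q k) <= (v k)%:E)%E.
    rewrite -tE; apply: (tau_inj vA T) => // xi qxi Exi.
    have [_ _ hlow _] := specP (k.+2%:R * c) sy.
    have qp : q k * p = p * q k by apply: spec_comm => //; rewrite yp py.
    have pxi : p xi = xi.
      apply/esym/subr0_eq; have -> : xi - p xi = (1 - p) xi by [].
      have := hlow ((1 - p) xi); rewrite -/(q k).
      have -> : q k ((1 - p) xi) = (1 - p) xi.
        have qp' : q k * (1 - p) = (1 - p) * q k by rewrite mulrBl mulrBr mul1r mulr1 qp.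
        by rewrite (comm_app _ qp') qxi.
      have -> : qf y ((1 - p) xi) = 0 by rewrite /qf -mulbE mulrBr mulr1 yp subrr rp0l.
      have := rp_ge0 ((1 - p) xi); move=> h1 h2; apply/rp_eq0/le_anti; rewrite h1 andbT.
      by move: h2; rewrite pmulr_rle0 // mulr_gt0.
    have Xxi : X (xi, y xi) by have := Xp xi; rewrite pxi.
    have [_ _ _ Xk [xk _ _ _]] := hx k.
    have h1 : (1 - E k) xi = xi by rewrite subbE onebE Exi subr0.
    have Xk' : X ((1 - E k) xi, x k xi) := Xk xi.
    rewrite h1 in Xk'; have yx := Xu _ _ _ Xxi Xk'.
    have := hlow xi; rewrite -/(q k) qxi /qf yx -/(qf (x k) xi) => h2.
    have := xk xi; rewrite qf_cst => h3; have := rp_ge0 xi => h4.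
    apply/rp_eq0/le_anti; rewrite h4 andbT.
    have : k.+2%:R * c * rp xi xi <= k.+1%:R * c * rp xi xi by apply: le_trans h2 h3.
    rewrite -[k.+2%:R]natr1 mulrDl mul1r mulrDl gerDl pmulr_rle0 //.
  have hp := le_trans (kyfan_chain_le dy s0 c0 yn qv) (lerD (lexx _) (hC n)).
  have := kyfan_lip vA T psi (p psi) s0'; rewrite -/K.
  have pn : nrm (p psi) <= nrm psi by exact: contr_nrm (prj_contr pp).
  have e1 : d' * (1 + 2 * nrm psi) = d by rewrite /d' divfK // gt_eqF.
  have := nrm_ge0 (psi - p psi); have := nrm_ge0 psi; have := nrm_ge0 (p psi).
  move: (nrm (psi - p psi)) hn (nrm (p psi)) pn => n1 hn n2 pn.
  clear - hp e1 hn pn d'0; move: (nrm psi) e1 pn => n3 e1 pn h1 h2 h3 h4; nra.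
have Xk k := let: And5 _ _ _ h _ := hx k in h.
have pxk k : pos (x k) by have [_ []] := hx k.
have [|||||lower upper] := @layer_cake R (mu A tau X) s c v s0 c0 (@mu_measurable X s%:E).
- by move=> t _; exact: mu_ge0.
- by move=> k; have [] := hv k.
- move=> k t t0 vt; have [_ _ _ Xfk [xk _ _ _]] := hx k.
  by apply: (mu_le (ltW (lk0 k)) (AE k) (pE k) (pxk k) xk Xfk); rewrite tE lee_fin.
- move=> k t t0 vt; have [_ _ _ _ [_ hf _ _]] := hx k.
  by apply: (mu_ge lX (AE k) (pE k) (pxk k) hf); rewrite tE lte_fin.
- move=> t t0; have Mc : 0 <= N / (t * c) by rewrite divr_ge0 // mulr_ge0 // ltW.
  exists (Num.bound (N / (t * c))); set n := Num.bound _; have [v0 [_ hvn]] := hv n.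
  have := ltW (archi_boundP Mc); rewrite -/n ler_pdivrMr ?mulr_gt0 // => h.
  rewrite -(ler_pM2l (lk0 n)); apply: le_trans hvn _; apply: le_trans h _.
  by rewrite /lk -mulrA [t * c]mulrC ler_wpM2r ?mulr_ge0 ?(ltW c0) ?(ltW t0) // ler_nat.
have := upper K claim1 => IK.
pose C := fine I; have I0 : (0 <= I)%E by have := lower 0%N; rewrite big_ord0.
have IC : I = C%:E.
  by rewrite /C; move: I0 IK; rewrite -/I; case: (I) => [i| |].
exists C; first by rewrite -lee_fin -IC.
split; first by rewrite -IC.
split=> //; apply: claim2 => n; rewrite -lee_fin -IC; exact: lower.
Qed.

End Cuts.

End KyFanIntegral.

Section Majorization.
Context {R : realType} {H : hilbertType R}.
Context (A : set (bop H)) (tau : bop H -> \bar R).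
Context (vA : von_neumann_algebra A) (T : nsf_trace A tau).
Local Notation cut s := [set t : R | (0 < t)%R /\ (t%:E <= s)%E].

Lemma integral_mu_sup X : 
  ((fun n => \int[@lebesgue_measure R]_(t in cut n.+1%:R%:E) mu A tau X t) @ \oo -->
   \int[@lebesgue_measure R]_(t in cut +oo) mu A tau X t)%E.
Proof.
have -> : cut +oo%E = \bigcup_n cut n.+1%:R%:E.
  apply/seteqP; split=> t /=; last by case=> n _ [t0 _]; split; rewrite // leey.
  case=> t0 _; exists (Num.bound t) => //; split; rewrite // lee_fin.
  have h := archi_boundP (ltW t0); apply: le_trans (ltW h) _; rewrite ler_nat; exact: leqnSn.
apply: ge0_nondecreasing_set_cvg_integral.
- apply/nondecreasing_seqP => n; apply/subsetPset => t /= [t0 tn]; split=> //.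
  by apply: le_trans tn _; rewrite lee_fin ler_nat.
- by move=> n; apply: measurable_cut.
- by move=> n; exact: mu_measurable.
- by move=> n t _; exact: mu_ge0.
Qed.

(** For finite [s] this is [kyfan_mu]; the case [s = +oo] follows by monotone convergence, and the
    traces agree because each is the squared norm of its vector. *)
Lemma majorizedP (psi phi : H) X Y : density_operator A tau psi X -> density_operator A tau phi Y ->
  rp psi psi = rp phi phi ->
  majorized A tau X Y <-> forall s, 0 < s -> kyfan A tau s psi <= kyfan A tau s phi.
Proof.
move=> hX hY e; split=> [[h _] s s0|h].
  by rewrite -lee_fin -(kyfan_mu vA T hX s0) -(kyfan_mu vA T hY s0); apply: h; rewrite lte_fin.
have fin (s : R) : 0 < s -> (\int[@lebesgue_measure R]_(t in cut s%:E) mu A tau X t <=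
    \int[@lebesgue_measure R]_(t in cut s%:E) mu A tau Y t)%E.
  by move=> s0; rewrite (kyfan_mu vA T hX s0) (kyfan_mu vA T hY s0) lee_fin h.
split; last by rewrite (density_tau_ext vA T hX) (density_tau_ext vA T hY) e.
case=> [s s0|_|//]; first exact: fin.
have cX := @integral_mu_sup X; have cY := @integral_mu_sup Y.
rewrite -[leLHS](cvg_lim (@ereal_hausdorff R) cX) -[leRHS](cvg_lim (@ereal_hausdorff R) cY); apply: lee_lim.
- by apply/cvg_ex; eexists; exact: cX.
- by apply/cvg_ex; eexists; exact: cY.
- by apply: nearW => n; apply: fin.
Qed.

Lemma convertible_majorized (fA : factor A) (psi phi : H) X : density_operator A tau psi X ->
  rp psi psi = 1 -> rp phi phi = 1 -> approx_convertible A psi phi ->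
  forall s, 0 < s -> kyfan A tau s psi <= kyfan A tau s phi.
Proof.
move=> hX n1 n2 h s s0.
(* A cut at distance less than 1 from the unit vector [psi] has [p] nonzero, and so supplies the
   trace vector that [coeffect_near] asks for. *)
have [|p [x [zeta [c [[Ap pp dz _ hp] _]]]]] := @density_approx _ _ A tau vA T psi X hX (1 / 2).
  by rewrite divr_gt0.
have p0 : p != 0.
  apply/eqP => p0; move: hp; rewrite p0 oppr0 addr0 => h1; have := nrm2 psi; rewrite n1; have := nrm_ge0 psi; nra.
apply: (convertible_kyfan vA T s0 _ n1 n2 h) => xi d d0.
exact: (coeffect_near vA T fA xi pp p0 dz s0 d0).
Qed.

End Majorization.

(** * Kraus maps and protocols *)

Section Kraus.
Context {R : realType} {H : hilbertType R}.
Implicit Types (x y z u b c : bop H) (Phi Psi : bop H -> bop H).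

Lemma opnorm_contr x : (opnorm x <= 1)%E -> contr x.
Proof.
move=> h xi; rewrite -!nrm2 ler_pXn2r ?nnegrE ?nrm_ge0 // leNgt; apply/negP => h1.
have [x0|x0] := eqVneq (nrm xi) 0.
  by move: h1; rewrite x0 (nrm_eq0 x0) bop0 nrm0 ltxx.
have xp : 0 < nrm xi by rewrite lt_neqAle eq_sym x0 nrm_ge0.
suff : ((nrm (x xi) / nrm xi)%:E <= opnorm x)%E.
  move=> h2; have := le_trans h2 h; rewrite lee_fin ler_pdivrMr // mul1r.
  by rewrite leNgt h1.
apply: le_ereal_inf_tmp => _ [M [M0 hM] <-]; have [eta] := hM xi.
rewrite /graph /= => -> h3; by rewrite lee_fin ler_pdivrMr.
Qed.

Lemma functional_norm_le (w : bop H -> R[i]) (C : R) : (forall x, contr x -> cabs (w x) <= C) -> (functional_norm w <= C%:E)%E.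
Proof.
move=> h; apply: ge_ereal_sup => _ [x x1 <-]; rewrite lee_fin.
exact/h/opnorm_contr.
Qed.

Lemma square_summable_bop x (xi : nat -> H) : square_summable xi -> square_summable (x \o xi).
Proof.
move=> h; have [M M0 hM] := bop_bound x.
have := @series_le_cvg R (fun n => hnorm ((x \o xi) n) ^+ 2) (fun n => M ^+ 2 * hnorm (xi n) ^+ 2).
apply.
- by move=> n; exact: sqr_ge0.
- by move=> n; rewrite mulr_ge0 // sqr_ge0.
- move=> n; rewrite -exprMn ler_pXn2r ?nnegrE ?mulr_ge0 ?(ltW M0) ?nrm_ge0 //; exact: hM.
- exact: is_cvg_seriesZ.
Qed.

Definition kraus u : bop H -> bop H := fun x => adj u * x * u.

Lemma kraus_normal_functional u w : normal_functional w -> normal_functional (w \o kraus u).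
Proof.
move=> [xi [eta [sx se h]]]; exists (u \o xi), (u \o eta); split; try exact: square_summable_bop.
move=> x; have := h (kraus u x).
have -> // : series (fun n => <| kraus u x (xi n), eta n |>) = series (fun n => <| x ((u \o xi) n), (u \o eta) n |>).
apply/funext => n; apply: eq_bigr => i _; rewrite /kraus !mulbE.
by rewrite (adjP (adj u)) adjK.
Qed.

Lemma normal_mapP Phi : (forall (w : predual H) x, (fun y => sval w (Phi y)) @ nbhs (x : weakstar H) --> (sval w (Phi x) : R[i]^o)) ->
  normal_map Phi.
Proof.
move=> h x; apply: (proj2 (@wkP R H (Phi @ nbhs (x : weakstar H)) _ (Phi x))) => w.
exact: h.
Qed.

Lemma normal_map_functional Phi (w : predual H) x : normal_map Phi ->
  (fun y => sval w (Phi y)) @ nbhs (x : weakstar H) --> (sval w (Phi x) : R[i]^o).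
Proof. by move=> h; apply: (proj1 (@wkP R H (Phi @ nbhs (x : weakstar H)) _ (Phi x)) (h x) w). Qed.

Lemma kraus_normal u : normal_map (kraus u).
Proof.
apply: normal_mapP => w x; have := @normal_map_functional id (exist _ _ (kraus_normal_functional u (svalP w))) x.
by apply=> y; exact: cvg_id.
Qed.

Lemma predualD (w : predual H) x y : sval w (x + y) = sval w x + sval w y.
Proof.
have h := normal_functional_add (svalP w).
have h0 : sval w 0 = 0 by rewrite -(subrr (0 : bop H)) h subrr.
by have := h x (0 - y); rewrite opprB subr0 h h0 sub0r opprK.
Qed.

Lemma normal_mapD Phi Psi : normal_map Phi -> normal_map Psi -> normal_map (fun x => Phi x + Psi x).
Proof.
move=> h1 h2; apply: normal_mapP => w x.
have -> : (fun y => sval w (Phi y + Psi y)) = (fun y => sval w (Phi y)) \+ (fun y => sval w (Psi y)).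
  by apply/funext => y; rewrite predualD.
rewrite predualD; apply: (@cvgD R[i] R[i]^o); exact: normal_map_functional.
Qed.

Lemma kraus_linear u : linear (kraus u).
Proof. by move=> k x y; apply: bopP => xi; rewrite /kraus !(bE, bopD, bopZ). Qed.

Lemma kraus_CP u : normal_CP (kraus u).
Proof.
split; first exact: kraus_normal.
split; first exact: kraus_linear.
move=> n x hx xi; have := hx (fun i => u (xi i)).
have -> // : \sum_i \sum_j <| x i j (u (xi j)), u (xi i) |> = \sum_i \sum_j <| map_mx (kraus u) x i j (xi j), xi i |>.
by apply: eq_bigr => i _; apply: eq_bigr => j _; rewrite mxE /kraus !mulbE (adjP (adj u)) adjK.
Qed.

Lemma normal_CPD Phi Psi : normal_CP Phi -> normal_CP Psi -> normal_CP (fun x => Phi x + Psi x).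
Proof.
move=> [n1 [l1 c1]] [n2 [l2 c2]]; split; first exact: normal_mapD.
split; first by move=> k x y; rewrite l1 l2 scalerDr addrACA.
move=> n x hx xi; have := addr_ge0 (c1 n x hx xi) (c2 n x hx xi); rewrite -big_split.
congr (0 <= _); apply: eq_bigr => i _; rewrite -big_split; apply: eq_bigr => j _.
by rewrite !mxE addbE ipDl.
Qed.

Lemma normal_CP_comp Phi Psi : normal_CP Phi -> normal_CP Psi -> normal_CP (Phi \o Psi).
Proof.
move=> [n1 [l1 c1]] [n2 [l2 c2]]; split; first by move=> x; exact: (@continuous_comp (weakstar H) (weakstar H) (weakstar H) Psi Phi x (n2 x) (n1 (Psi x))).
split; first by move=> k x y /=; rewrite l2 l1.
move=> n x /c2/c1; congr (mx_positive _).
by apply/matrixP => i j; rewrite !mxE.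
Qed.

Lemma normal_CP_sum (I : nat -> bop H -> bop H) n : (forall k, normal_CP (I k)) -> normal_CP (fun x => \sum_(k < n) I k x).
Proof.
move=> h; elim: n => [|n IH].
  have -> : (fun x => \sum_(k < 0) I k x) = kraus 0.
    by apply/funext => x; rewrite big_ord0 /kraus mulr0.
  exact: kraus_CP.
have -> : (fun x => \sum_(k < n.+1) I k x) = (fun x => \sum_(k < n) I k x + I n x).
  by apply/funext => x; rewrite big_ord_recr.
exact: normal_CPD.
Qed.

Lemma kraus_CP_over C u : (forall x, C x -> x * u = u * x) -> (forall x, C x -> x * adj u = adj u * x) -> CP_over C (kraus u).
Proof.
move=> h1 h2; split; first exact: kraus_CP.
move=> a x c Ca Cc; rewrite /kraus !mulrA -(h2 a Ca) -!mulrA; congr (a * (adj u * (x * _))).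
exact: h1.
Qed.

Lemma CP_overD C Phi Psi : CP_over C Phi -> CP_over C Psi -> CP_over C (fun x => Phi x + Psi x).
Proof.
move=> [n1 h1] [n2 h2]; split; first exact: normal_CPD.
by move=> a x c Ca Cc; rewrite h1 // h2 // mulrDr mulrDl.
Qed.

End Kraus.

(** * One-way protocols and their error *)

Section Protocol.
Context {R : realType} {H : hilbertType R}.
Context (A : set (bop H)) (vA : von_neumann_algebra A).
Implicit Types (x y : bop H).

(* Measure with the Kraus operators [b k] in the commutant and, on outcome [k],
   apply the channel with Kraus operators [adj z] and [adj c] in [A]. *)
Definition local_step (b z c : bop H) : bop H -> bop H :=
  kraus b \o (fun x => z * x * adj z + c * x * adj c).

Lemma local_step_one_way b z c : commutant A b -> A z -> A c -> z * adj z + c * adj c = 1 ->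
  one_way_left A (local_step b z c).
Proof.
move=> Cb Az Ac e; exists (kraus b), (fun x => z * x * adj z + c * x * adj c); split=> //.
- apply: kraus_CP_over => x Ax; first exact: vN_commute Ax Cb.
  exact: vN_commute Ax (vN_comm_adj vA Cb).
- split; last by rewrite !mulr1.
  have h w : A w -> CP_over (commutant A) (fun x => w * x * adj w).
    move=> Aw; have := @kraus_CP_over R H (commutant A) (adj w).
    rewrite /kraus adjK; apply=> x Cx; last by rewrite (vN_commute Aw Cx).
    by rewrite (vN_commute (vN_adj vA Aw) Cx).
  exact: CP_overD (h z Az) (h c Ac).
Qed.

(** A single one-way left instrument suffices, so no linked rounds occur; its maps vanish from [N]
    on, and the partial sums are eventually constant. *)
Lemma LOCC_of_steps N (b z c : nat -> bop H) : (forall k, commutant A (b k)) -> (forall k, A (z k)) -> (forall k, A (c k)) ->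
  (forall k, z k * adj (z k) + c k * adj (c k) = 1) -> (forall k, (N <= k)%N -> b k = 0) ->
  \sum_(k < N) adj (b k) * b k = 1 ->
  LOCC A (fun x => \sum_(k < N) local_step (b k) (z k) (c k) x).
Proof.
move=> Cb Az Ac e b0 bS; pose I k := local_step (b k) (z k) (c k).
have nI k : normal_CP (I k).
  apply: normal_CP_comp; first exact: kraus_CP.
  have h w : normal_CP (fun x : bop H => w * x * adj w).
    by have := kraus_CP (adj w); rewrite /kraus adjK.
  exact: normal_CPD.
have sI : instrument_sum I (fun x => \sum_(k < N) I k x).
  split; last split; last first.
  - rewrite -[RHS]bS; apply: eq_bigr => k _.
    by rewrite /I /local_step /= /kraus !mulr1 e mulr1.
  - exact: normal_CP_sum.
  move=> x; apply: cvg_near_cst; exists N => // n /= Nn; apply/eqP.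
  rewrite (eq_bigl xpredT) => [|k]; last by apply/asboolP.
  rewrite -(subnKC Nn) big_split_ord /= [X in _ + X]big1 ?addr0 // => k _.
  by rewrite /I /local_step /= b0 ?leq_addr // /kraus mulr0.
exists 0%N, (fun=> I); split=> //; split; first by split=> //; eexists; exact: sI.
by right=> k; exact: local_step_one_way.
Qed.

Lemma ip_diff_le x (xi eta : H) (t : R) : 0 < t -> contr x ->
  cabs (<|x xi, xi|> - <|x eta, eta|>) <= t * (rp xi xi + rp eta eta) + rp (xi - eta) (xi - eta) / (2 * t).
Proof.
move=> t0 cx.
have -> : <|x xi, xi|> - <|x eta, eta|> = <|x (xi - eta), xi|> + <|x eta, xi - eta|>.
  have Nl (u v : H) : <|- u, v|> = - <|u, v|> by rewrite -scaleN1r ipZl mulN1r.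
  have Nr (u v : H) : <|v, - u|> = - <|v, u|> by rewrite -scaleN1r ipZr rmorphN rmorph1 mulN1r.
  by rewrite bopB ipDl ipDr Nl Nr; ring.
apply: le_trans (cabsD _ _) _.
have h1 := le_trans (ip_le (x (xi - eta)) xi) (ler_wpM2r (nrm_ge0 _) (contr_nrm (xi - eta) cx)).
have h2 := le_trans (ip_le (x eta) (xi - eta)) (ler_wpM2r (nrm_ge0 _) (contr_nrm eta cx)).
apply: le_trans (lerD h1 h2) _; rewrite -!nrm2; clear h1 h2.
move: (nrm (xi - eta)) (nrm xi) (nrm eta) => s k l.
suff h : 0 <= 2 * t * ((t * (k ^+ 2 + l ^+ 2) + s ^+ 2 / (2 * t)) - (s * k + l * s)).
  by rewrite -subr_ge0 -(pmulr_rge0 _ (mulr_gt0 (ltr0n _ 2) t0)).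
have -> : 2 * t * ((t * (k ^+ 2 + l ^+ 2) + s ^+ 2 / (2 * t)) - (s * k + l * s)) =
  (t * (k + l) - s) ^+ 2 + t ^+ 2 * (k - l) ^+ 2.
  by field; rewrite gt_eqF.
by apply: addr_ge0; [exact: sqr_ge0|apply: mulr_ge0; exact: sqr_ge0].
Qed.

(* An overlap sum near 1 makes the post-measurement vectors
   [adj (z k) (b k psi)] close to [l k phi] in total square norm. *)
Lemma LOCC_near (psi phi : H) n (l : nat -> R) (b z : nat -> bop H) (d t : R) :
  rp psi psi = 1 -> rp phi phi = 1 -> (forall k, 0 <= l k) -> \sum_(k < n) l k ^+ 2 = 1 ->
  (forall k, commutant A (b k)) -> (forall k, A (z k)) -> (forall k, contr (z k)) ->
  (forall xi, \sum_(k < n) rp (b k xi) (b k xi) <= rp xi xi) -> 0 < t ->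
  1 - d <= \sum_(k < n) l k * rp (b k psi) (z k phi) ->
  exists2 Theta, LOCC A Theta & (functional_norm (fun x => 
     predual_map Theta (vector_functional psi) x - vector_functional phi x)%R <= (2 * t + d / t + 2 * d)%:E)%E.
Proof.
move=> n1 n2 l0 lS Cb Az cz bS t0; set G := \sum_(k < n) _ => hG.
pose s := \sum_(k < n) adj (b k) * b k.
have vC := vN_commutant vA.
have Cs : commutant A s.
  rewrite /s; elim/big_ind: _ => [|x y Cx Cy|k _]; first exact: vN0 vC.
  - exact: (vND vC).
  - by apply: (vNM vC) => //; exact: vN_comm_adj.
have ss : sa s.
  rewrite /s; elim/big_ind: _ => [|x y Cx Cy|k _]; first exact: sa0.
  - exact: saD.
  - exact: saA.
have qs xi : qf s xi = \sum_(k < n) rp (b k xi) (b k xi).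
  by rewrite /s (@qf_sum _ _ (fun k => adj (b k) * b k)); apply: eq_bigr => k _; rewrite qfA.
have ps : pos (1 - s) by apply: posB => // [|xi]; [exact: sa1|rewrite qs qf1].
(* Outcome [n] completes the measurement to total 1, and [C k] completes the contraction [Z k] to a
   channel. *)
pose B k := if (k < n)%N then b k else if k == n then bsqrt (1 - s) else 0.
pose Z k := if (k < n)%N then z k else 1.
pose C k := bsqrt (1 - Z k * adj (Z k)).
have AZ k : A (Z k) by rewrite /Z; case: ifP => // _; exact: vN1.
have cZ k : contr (Z k) by rewrite /Z; case: ifP => // _; exact: contr1.
have pZ k : pos (1 - Z k * adj (Z k)).
  apply: posB; [exact: saA'|exact: sa1|] => xi.
  by have := contr_adj (cZ k); move/contrP; rewrite adjK; apply.
have AC k : A (C k) by apply: vN_sqrt => //; apply: vNB => //; [exact: vN1|apply: vNM => //; exact: vN_adj].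
have ZC k : Z k * adj (Z k) + C k * adj (C k) = 1.
  by rewrite (sqrt_sa (pZ k)) (sqrt_sq (pZ k)) addrCA subrr addr0.
have CB k : commutant A (B k).
  rewrite /B; case: ifP => // _; case: ifP => _; last exact: vN0.
  by apply: (vN_sqrt vC) => //; apply: (vNB vC) => //; exact: (vN1 vC).
have B0 k : (n.+1 <= k)%N -> B k = 0.
  by move=> nk; rewrite /B ltnNge (ltnW nk) /= gtn_eqF.
have BS : \sum_(k < n.+1) adj (B k) * B k = 1.
  have Bn : B n = bsqrt (1 - s) by rewrite /B ltnn eqxx.
  rewrite big_ord_recr /= Bn (sqrt_sa ps) (sqrt_sq ps).
  have -> : \sum_(k < n) adj (B k) * B k = s.
    by apply: eq_bigr => k _; rewrite /B ltn_ord.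
  by rewrite addrC subrK.
eexists; first exact: LOCC_of_steps CB AZ AC ZC B0 BS.
apply: functional_norm_le => x cx.
pose xi k := adj (Z k) (B k psi); pose eta k := adj (C k) (B k psi).
have step k : <|local_step (B k) (Z k) (C k) x psi, psi|> = <|x (xi k), xi k|> + <|x (eta k), eta k|>.
  rewrite -[local_step _ _ _ _]/(adj (B k) * (Z k * x * adj (Z k) + C k * x * adj (C k)) * B k).
  rewrite (mulbE _ (B k)) (mulbE (adj (B k))) (adjP (adj (B k))) adjK addbE ipDl !mulbE.
  by rewrite (adjP (Z k)) (adjP (C k)).
have nstep k : rp (xi k) (xi k) + rp (eta k) (eta k) = rp (B k psi) (B k psi).
  have := congr1 (fun y => qf y (B k psi)) (ZC k).
  by rewrite qfD qf1 -{1}[Z k]adjK -{1}[C k]adjK !qfA.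
have NS : \sum_(k < n.+1) rp (B k psi) (B k psi) = 1.
  have := congr1 (fun y => qf y psi) BS.
  rewrite (@qf_sum _ _ (fun k => adj (B k) * B k)) qf1 n1 => <-.
  by apply: eq_bigr => k _; rewrite qfA.
pose S := \sum_(k < n) rp (xi k) (xi k).
(* [O] is the weight of everything not steered towards [phi]. Since [S + O = 1] and
   [S >= 2 * G - 1], an overlap [G >= 1 - d] leaves [O <= 2 * d]. *)
pose O := \sum_(k < n) rp (eta k) (eta k) + (rp (xi n) (xi n) + rp (eta n) (eta n)).
have SO : S + O = 1.
  rewrite -NS big_ord_recr /= -nstep /S /O addrA -big_split; congr (_ + _).
  by apply: eq_bigr => k _; exact: nstep.
have DS : \sum_(k < n) rp (xi k - (l k)%:C *: phi) (xi k - (l k)%:C *: phi) = S - 2 * G + 1.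
  rewrite -[X in _ = _ + X]lS /S /G mulr_sumr -sumrB -big_split; apply: eq_bigr => k _ /=.
  have e1 : rp (xi k) phi = rp (b k psi) (z k phi).
    by rewrite /xi rp_adj adjK /B /Z ltn_ord.
  rewrite !rpE n2 (rpC phi (xi k)) e1; ring.
have O0 : 0 <= O.
  by rewrite addr_ge0 ?addr_ge0 ?rp_ge0 // sumr_ge0 // => k _; exact: rp_ge0.
have D0 : 0 <= S - 2 * G + 1 by rewrite -DS sumr_ge0 // => k _; exact: rp_ge0.
have ip_self v : cabs <|x v, v|> <= rp v v.
  apply: le_trans (ip_le _ _) _; rewrite -nrm2 expr2 ler_wpM2r ?nrm_ge0 //; exact: contr_nrm.
have h1 : cabs (\sum_(k < n) (<|x (xi k), xi k|> - <|x ((l k)%:C *: phi), (l k)%:C *: phi|>))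
    <= t * (S + 1) + (S - 2 * G + 1) / (2 * t).
  have := @cabs_sum _ (fun k => <|x (xi k), xi k|> - <|x ((l k)%:C *: phi), (l k)%:C *: phi|>) 0 n.
  rewrite !big_mkord => h; apply: le_trans h _.
  rewrite -DS -[X in _ * (_ + X)]lS /S -big_split mulr_sumr mulr_suml -big_split; apply: ler_sum => k _ /=.
  apply: le_trans (ip_diff_le _ _ t0 cx) _.
  by rewrite !rpE n2 mulr1 expr2.
have h2 : cabs (\sum_(k < n) <|x (eta k), eta k|>) <= \sum_(k < n) rp (eta k) (eta k).
  have := @cabs_sum _ (fun k => <|x (eta k), eta k|>) 0 n.
  by rewrite !big_mkord => h; apply: le_trans h _; apply: ler_sum => k _; exact: ip_self.
have -> : predual_map (fun x => \sum_(k < n.+1) local_step (B k) (Z k) (C k) x) (vector_functional psi) x - vector_functional phi x =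
  \sum_(k < n) (<|x (xi k), xi k|> - <|x ((l k)%:C *: phi), (l k)%:C *: phi|>) +
  (\sum_(k < n) <|x (eta k), eta k|> + (<|x (xi n), xi n|> + <|x (eta n), eta n|>)).
  rewrite /predual_map /vector_functional /= (@sum_app _ _ (fun k => local_step (B k) (Z k) (C k) x)).
  have -> : <|\sum_(k < n.+1) local_step (B k) (Z k) (C k) x psi, psi|> = \sum_(k < n.+1) <|local_step (B k) (Z k) (C k) x psi, psi|>.
    apply: (big_morph (fun v : H => <|v, psi|>)) => [u v|]; first exact: ipDl.
    by rewrite -(scale0r psi) ipZl mul0r.
  rewrite big_ord_recr /= step (eq_bigr (fun k : 'I_n => <|x (xi k), xi k|> + <|x (eta k), eta k|>)) => [|k _]; last exact: step.
  rewrite big_split /= sumrB.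
  have -> : \sum_(k < n) <|x ((l k)%:C *: phi), (l k)%:C *: phi|> = <|x phi, phi|>.
    rewrite -[RHS]mul1r -[1]/(1%:C) -lS rmorph_sum mulr_suml; apply: eq_bigr => k _.
    by rewrite bopZ ipZl ipZr mulrA conjCE /= expr2 rmorphM /= oppr0.
  by rewrite -[X in X - _]addrA addrAC.
apply: le_trans (cabsD _ _) _; apply: le_trans (lerD h1 (cabsD _ _)) _.
have h3 := le_trans (cabsD _ _) (lerD (ip_self (xi n)) (ip_self (eta n))).
apply: (@le_trans _ _ (t * (S + 1) + (S - 2 * G + 1) / (2 * t) + O)).
  by rewrite lerD2l /O; apply: lerD.
have S1 : S <= 1 by rewrite -SO lerDl.
have SG : (S - 2 * G + 1) / (2 * t) <= d / t.
  rewrite ler_pdivrMr ?mulr_gt0 // mulrCA divfK ?gt_eqF //; clear - S1 hG; lra.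
have : t * (S + 1) <= 2 * t by clear - S1 t0; nra.
clear - SG D0 SO hG; move: ((S - 2 * G + 1) / (2 * t)) (d / t) SG => u v; lra.
Qed.

End Protocol.

(** * Mixing densities *)

Section Chains.
Context {R : realType} {H : hilbertType R}.
Context (A : set (bop H)) (tau : bop H -> \bar R).
Context (vA : von_neumann_algebra A) (T : nsf_trace A tau) (fA : factor A).
Implicit Types (E G : nat -> bop H) (v w : nat -> R) (P Q z p q : bop H) (n m i j : nat).

Definition chain n E v P : Prop := [/\ A P, prj P,
  forall j, (j < n)%N -> [/\ A (E j), prj (E j), tau (E j) = (v j)%:E & P * E j = E j] &
  forall i j, (i <= j)%N -> (j < n)%N -> E i * E j = E j].

(** For a single pair no contraction exceeds [Num.min (v j) (w i)]; here one contraction attains it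
    for all pairs at once. [P] and [Q] confine its range and support, so that partial matchings can
    be added. *)
Definition matched n E v P m G w Q : Prop :=
  exists z, [/\ A z, contr z, P * z = z, z * Q = z &
    forall j i, (j < n)%N -> (i < m)%N ->
      ((Num.min (v j) (w i))%:E <= tau (E j * z * G i * adj (E j * z * G i))%R)%E].

Lemma prj_mulC p q : prj p -> prj q -> p * q = q -> q * p = q.
Proof. by move=> [_ sp] [_ sq] /(congr1 adj); rewrite adjM sp sq. Qed.

Lemma matched_sym n E v P m G w Q : chain n E v P -> chain m G w Q ->
  matched n E v P m G w Q -> matched m G w Q n E v P.
Proof.
move=> [AP pP hE _] [AQ pQ hG _] [z [Az cz Pz zQ h]]; exists (adj z); split.
- exact: vN_adj.
- exact: contr_adj.
- by rewrite -[in LHS](proj2 pQ) -adjM zQ.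
- by rewrite -[in LHS](proj2 pP) -adjM Pz.
move=> i j im jn; have [AE [_ sE] _ _] := hE j jn; have [AG [_ sG] _ _] := hG i im.
rewrite minC; apply: le_trans (h j i jn im) _.
have -> : G i * adj z * E j = adj (E j * z * G i) by rewrite !adjM sE sG mulrA.
rewrite adjK (tau_adj T) //; apply: (vNM vA) => //; exact: (vNM vA).
Qed.

Lemma chain_sub n N E v P e (c : R) : A e -> prj e -> tau e = c%:E -> chain N E v P -> (n <= N)%N ->
  (forall j, (j < n)%N -> E j * e = e) -> P * e = e -> chain n (fun j => E j - e) (fun j => v j - c) (P - e).
Proof.
move=> Ae pe te [AP pP hE nE] nN Ee Pe; have [ee se] := pe.
have eP := prj_mulC pP pe Pe.
split.
- exact: vNB.
- exact: prjB.
- move=> j jn; have [AE pE tE PE] := hE j (leq_trans jn nN).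
  have eE := prj_mulC pE pe (Ee j jn); have pB := prjB pe pE (Ee j jn).
  split=> //; first exact: vNB.
    have := tauD T (vNB vA AE Ae) (prj_pos pB) Ae (prj_pos pe).
    rewrite subrK tE te; move: (tau_ge0 T (vNB vA AE Ae) (prj_pos pB)).
    by case: (tau _) => [r| |] //= _ [->]; rewrite addrK.
  by rewrite mulrBr !mulrBl PE Pe eE ee subrr subr0.
- move=> i j ij jn; have [_ pE _ _] := hE j (leq_trans jn nN).
  have eE := prj_mulC pE pe (Ee j jn).
  by rewrite mulrBr !mulrBl (nE i j ij (leq_trans jn nN)) (Ee i (leq_ltn_trans ij jn)) eE ee subrr subr0.
Qed.

(** The smallest projection [e] of the first chain is carried into the smallest one of the second.
    Subtracting [e] and its image [f] shortens the first chain and lowers all traces by [v n], so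
    the induction hypothesis applies; the two partial matchings have orthogonal ranges and supports,
    so their traces add. *)
Lemma match_step n E v P m G w Q : chain n.+1 E v P -> chain m.+1 G w Q -> v n <= w m ->
  (forall E' v' P' G' w' Q', chain n E' v' P' -> chain m.+1 G' w' Q' -> matched n E' v' P' m.+1 G' w' Q') ->
  matched n.+1 E v P m.+1 G w Q.
Proof.
move=> cE cG vw IH; have [AP pP hE nE] := cE; have [AQ pQ hG nG] := cG.
have [Ae pe te Pe] := hE n (ltnSn n); have [Ag pg tg Qg] := hG m (ltnSn m).
have [||w0 [Aw we gw]] := compare_tau vA T fA Ae Ag pe pg.
- by rewrite te tg lee_fin.
- by rewrite tg ltry.
set e := E n in Ae pe te Pe we *; set f := w0 * adj w0.
have pw : prj (adj w0 * w0) by rewrite we.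
have pf : prj f by exact: pisom_prj.
have Af : A f by apply: (vNM vA) => //; exact: vN_adj.
have tf : tau f = (v n)%:E by rewrite /f -(tau_adj T) // we.
have [ee se] := pe; have [ff sf] := pf.
have w0e : w0 * e = w0 by rewrite -we; exact: pisom_adj.
have ew : e * adj w0 = adj w0 by rewrite -[in LHS]se -adjM w0e.
have fw : f * w0 = w0 by rewrite /f -mulrA we.
have wf : adj w0 * f = adj w0 by rewrite -[in LHS]sf -adjM fw.
have gf : G m * f = f by rewrite /f mulrA gw.
have Gf i : (i < m.+1)%N -> G i * f = f.
  by move=> im; rewrite -gf mulrA (nG i m) ?ltnSn //; rewrite -ltnS.
have Ee j : (j < n.+1)%N -> E j * e = e by move=> jn; apply: nE.
have Qf : Q * f = f by rewrite -gf mulrA Qg.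
have eP := prj_mulC pP pe Pe; have fQ := prj_mulC pQ pf Qf.
have cE' := chain_sub Ae pe te cE (leqnSn n) (fun j jn => Ee j (ltnW jn)) Pe.
have cG' := chain_sub Af pf tf cG (leqnn _) Gf Qf.
have [z1 [Az1 cz1 Pz1 zQ1 h]] := IH _ _ _ _ _ _ cE' cG'.
have ez1 : e * z1 = 0 by rewrite -Pz1 mulrA mulrBr eP ee subrr mul0r.
have zf1 : z1 * f = 0 by rewrite -zQ1 -mulrA mulrBl Qf ff subrr mulr0.
have cw : contr (adj w0) by apply/contrP; rewrite adjK; exact: prj_le1 pf.
have pQ' : prj (Q - f) by exact: prjB.
exists (adj w0 + z1); split.
- by apply: (vND vA) => //; exact: vN_adj.
- move=> xi; rewrite addbE -wf -zQ1 !mulbE.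
  have o : rp (adj w0 (f xi)) (z1 ((Q - f) xi)) = 0.
    by rewrite -ew mulbE (sa_rp _ _ se) -(mulbE e z1) ez1 zerobE rp0r.
  rewrite !(rpDl, rpDr) (rpC (z1 _)) o addr0 add0r.
  apply: le_trans (lerD (cw (f xi)) (cz1 ((Q - f) xi))) _.
  rewrite -!prj_qf // qfB addrCA subrr addr0 -qf1; exact: prj_le1.
- by rewrite mulrDr -{1}ew mulrA Pe ew -{1}Pz1 mulrA mulrBr (proj1 pP) Pe Pz1.
- by rewrite mulrDl -{1}wf -mulrA fQ wf -{1}zQ1 -mulrA mulrBl (proj1 pQ) fQ zQ1.
move=> j i jn im.
have [AE pE _ PE] := hE j jn; have [AG pG _ QG] := hG i im.
have EP := prj_mulC pP pE PE.
have eE := prj_mulC pE pe (Ee j jn); have fG := prj_mulC pG pf (Gf i im).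
set y1 := (E j - e) * z1 * (G i - f).
have Ay1 : A y1 by apply: (vNM vA); [apply: (vNM vA) => //|]; exact: (vNB vA).
have -> : E j * (adj w0 + z1) * G i = adj w0 + y1.
  rewrite mulrDr mulrDl; congr (_ + _).
    by rewrite -ew mulrA (Ee j jn) ew -wf -mulrA fG.
  have h1 : E j * (P - e) = E j - e by rewrite mulrBr EP (Ee j jn).
  have h2 : (Q - f) * G i = G i - f by rewrite mulrBl QG fG.
  by rewrite /y1 -h1 -h2 -!mulrA (mulrA z1) zQ1 (mulrA (P - e)) Pz1.
have fB : f * (G i - f) = 0 by rewrite mulrBr fG ff subrr.
have sB : sa (G i - f) by apply: saB => //; exact: (proj2 pG).
have y1w : y1 * w0 = 0.
  have := congr1 adj fB; rewrite adjM sB sf adj0 => Bf.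
  by rewrite -fw /y1 -mulrA (mulrA (G i - f)) Bf mul0r mulr0.
have -> : (adj w0 + y1) * adj (adj w0 + y1) = e + y1 * adj y1.
  have := congr1 adj y1w; rewrite adjM adj0 => wy1.
  by rewrite adjD adjK mulrDl !mulrDr we y1w wy1 addr0 add0r.
rewrite (tauD T) //; [|exact: prj_pos|by apply: (vNM vA) => //; exact: vN_adj|exact: posA'].
rewrite te; have [jn'|nj] := ltnP j n.
  apply: le_trans (leeD2l _ (h j i jn' im)); rewrite -/y1 -EFinD lee_fin.
  (* [min (v j) (w i) = v n + min (v j - v n) (w i - v n)]. *)
  by rewrite -lerBlDl le_min !lerD2r !ge_min !lexx orbT.
have {nj jn} jE : j = n by apply/eqP; rewrite eqn_leq nj -ltnS jn.
apply: le_trans (leeDl _ (tau_ge0 T _ (posA' _))); last by apply: (vNM vA) => //; exact: vN_adj.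
by rewrite lee_fin jE ge_min lexx.
Qed.

(* Northwest corner rule: match the projection of least trace first. *)
Lemma chain_match n E v P m G w Q : chain n E v P -> chain m G w Q -> matched n E v P m G w Q.
Proof.
have [N hN] := ubnP (n + m); elim: N => // N IH in n E v P m G w Q hN *.
move=> cE cG; have [AP _ _ _] := cE.
have triv : n = 0%N \/ m = 0%N -> matched n E v P m G w Q.
  move=> nm; exists 0; split; rewrite ?mulr0 ?mul0r //; first exact: vN0.
    by move=> xi; rewrite zerobE rp0l rp_ge0.
  by case: nm => ->.
case: n => [|n] in hN cE triv *; first by apply: triv; left.
case: m => [|m] in hN cG triv *; first by apply: triv; right.
have [vw|/ltW wv] := leP (v n) (w m).
  by apply: match_step => // *; apply: IH => //; rewrite -ltnS.
apply: matched_sym => //; apply: match_step => // *; apply: IH => //.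
by move: hN; rewrite !addSn !addnS !ltnS addnC.
Qed.

End Chains.

(** * The linear maximisation problem *)

Section Oracle.
Context {R : realType} {H : hilbertType R}.
Context (A : set (bop H)) (tau : bop H -> \bar R).
Context (vA : von_neumann_algebra A) (T : nsf_trace A tau) (fA : factor A).
Implicit Types (x y z g a m p q P : bop H) (zeta eta psi phi xi : H) (s t c M : R).

Section Pairing.
Context (zeta : H) (p : bop H) (pp : prj p) (dz : dens A tau zeta p).
Local Notation corner := (corner A p).

(** Both sides are the trace of [a y]; on the right it is evaluated through the trace vector
    [zeta]. *)
Lemma pair_pos eta y a : dens A tau eta y -> corner y -> A a -> pos a ->
  qf a eta = rp (a zeta) (y zeta).
Proof.
move=> dy cy Aa pa; have [Ay py _] := dy.
have pb : pos (p * a * p) by have := posJ p pa; rewrite (proj2 pp).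
have cb := corner_cut vA pp dz Aa.
have cs := corner_sqrt vA py cy; have ss := sqrt_sa py; have qs := sqrt_sq py.
have := dens_qf vA T dy Aa pa; set s := bsqrt y in cs ss qs *.
have cr := corner_sqrt vA pb cb; have sr := sqrt_sa pb; have qr := sqrt_sq pb.
set r := bsqrt (p * a * p) in cr sr qr *.
have [_ sp ps] := cs; have [_ rp' _] := cr.
have -> : s * a * s = (s * r) * adj (s * r).
  by rewrite adjM ss sr !mulrA -(mulrA s r r) qr !mulrA sp -(mulrA _ p s) ps.
have csr := cornerM vA cs cr; have [Asr srp _] := csr.
rewrite (tv_nrm dz Asr srp) => -[<-].
have cyr := cornerM vA cy cr.
have -> : rp ((s * r) zeta) ((s * r) zeta) = rp ((y * r) zeta) (r zeta).
  by rewrite !mulbE -(sa_rp _ _ ss) -(mulbE s s) qs.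
rewrite (tv_swap vA T pp dz cyr cr) adjM sr (proj1 py) mulbE (sa_rp _ _ sr) -(mulbE r r) qr.
have [_ _ py'] := cy.
by rewrite !mulbE (tv_fix vA T pp dz) -(sa_rp _ _ (proj2 pp)) -(mulbE p y) py' rpC.
Qed.

Lemma pair_sa eta y a : dens A tau eta y -> corner y -> A a -> sa a ->
  qf a eta = rp (a zeta) (y zeta).
Proof.
move=> dy cy Aa sa_a; have [M M0 hM] := pos_bound (- a).
have p1 : pos (a + cst M).
  split; first by apply: saD => //; apply: saZ; exact: sa1.
  by move=> xi; have := hM xi; rewrite qfD qfN qf0 => h; lra.
have := pair_pos dy cy (vND vA Aa (vN_cst M vA)) p1.
have := pair_pos dy cy (vN1 vA) pos1; rewrite qf1 onebE => h1.
by rewrite qfD qf_cst h1 addbE rpDl /cst scalebE onebE rpZl => /addIr.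
Qed.

Lemma pair_op eta y a : dens A tau eta y -> corner y -> A a -> qf a eta = rp (a zeta) (y zeta).
Proof.
move=> dy cy Aa; have Aa' := vN_adj vA Aa.
have [_ py _] := dy; have [_ _ py'] := cy.
have h : sa (a + adj a) by rewrite /sa adjD adjK addrC.
have := pair_sa dy cy (vND vA Aa Aa') h; rewrite qfD addbE rpDl.
have -> : qf (adj a) eta = qf a eta by rewrite /qf rp_adj adjK rpC.
have cut (b : bop H) : rp (b zeta) (y zeta) = rp ((p * b * p) zeta) (y zeta).
  by rewrite !mulbE (tv_fix vA T pp dz) (sa_rp _ _ (proj2 pp)) -(mulbE p y) py'.
have -> : rp (adj a zeta) (y zeta) = rp (a zeta) (y zeta).
  rewrite cut (tv_swap vA T pp dz (corner_cut vA pp dz Aa') cy) !adjM adjK (proj2 pp) (proj1 py) mulrA.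
  by rewrite -cut.
lra.
Qed.

End Pairing.

Lemma spec_range x t P : pos x -> 0 < t -> prj P -> x * P = x -> P * x = x -> P * spec x t = spec x t.
Proof.
move=> px t0 pP xP Px; have sx := proj1 px.
have [pe hc hl _] := specP t sx; have ce := hc P; rewrite xP Px in ce.
have {}ce : spec x t * (1 - P) = (1 - P) * spec x t by rewrite mulrBr mulrBl mulr1 mul1r ce.
suff h : (1 - P) * spec x t = 0 by move: h; rewrite mulrBl mul1r => /subr0_eq.
apply: bopP => xi; rewrite -ce zerobE mulbE.
have x0 : x (spec x t ((1 - P) xi)) = 0.
  by rewrite -(mulbE (spec x t)) ce -xP !mulbE -[in LHS](mulbE P) mulrBr (proj1 pP) mulr1 subrr zerobE bop0.
have := hl ((1 - P) xi); rewrite /qf x0 rp0l pmulr_rle0 // => h.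
by apply/rp_eq0/le_anti; rewrite h rp_ge0.
Qed.

Lemma spec_le x t xi : pos x -> t * qf (spec x t) xi <= qf x xi.
Proof.
move=> px; have [pe hc hl _] := specP t (proj1 px).
rewrite (qf_split xi pe (esym (hc x erefl))) prj_qf //.
by apply: le_trans (hl xi) _; rewrite lerDl; exact: pos_ge0.
Qed.

Lemma spec_tau x t M : A x -> pos x -> (tau x <= M%:E)%E -> 0 < t -> exists2 v : R, 0 <= v & tau (spec x t) = v%:E.
Proof.
move=> Ax px xM t0; have pe := spec_prj t (proj1 px); have Ae := vN_spec t vA Ax (proj1 px).
have : (tau (t%:C *: spec x t) <= M%:E)%E.
  apply: le_trans xM; apply: (tau_mono vA T) => //; first exact: vNZ.
    by apply: posZ (prj_pos pe); exact: ltW.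
  by move=> xi; rewrite qfZ; exact: spec_le.
rewrite (tauZ T) ?(ltW t0) //; last exact: prj_pos.
have := tau_ge0 T Ae (prj_pos pe); case: (tau _) => [v|//|//]; last by rewrite mulry gtr0_sg // mul1e.
by rewrite lee_fin => v0 _; exists v.
Qed.

Lemma spec_chain x c n P (v : nat -> R) : A x -> pos x -> 0 < c -> A P -> prj P -> x * P = x -> P * x = x ->
  (forall k, tau (spec x (k.+2%:R * c)) = (v k)%:E) -> chain A tau n (fun k => spec x (k.+2%:R * c)) v P.
Proof.
move=> Ax px c0 AP pP xP Px tE; have sx := proj1 px; split=> // [j _|i j ij _].
  split=> //; [exact: vN_spec|exact: spec_prj|].
  by apply: spec_range => //; rewrite mulr_gt0 // ltr0n.
move: ij; rewrite leq_eqVlt => /orP[/eqP->|ij]; first by have [] := spec_prj (j.+2%:R * c) sx.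
by apply: spec_mono => //; rewrite ltr_pM2r // ltr_nat.
Qed.

Lemma spec_chain_lower x c n xi : pos x -> 0 < c ->
  c * \sum_(k < n) qf (spec x (k.+2%:R * c)) xi <= qf x xi.
Proof.
move=> px c0; have sx := proj1 px; pose q k := spec x (k.+2%:R * c).
have qq k : q k * q k.+1 = q k.+1 by apply: spec_mono => //; rewrite ltr_pM2r // ltr_nat.
have h k eta : k.+1%:R * c * rp (q k eta) (q k eta) <= qf x (q k eta).
  have [_ _ hl _] := specP (k.+2%:R * c) sx; apply: le_trans (hl eta).
  by rewrite ler_wpM2r ?rp_ge0 // ler_wpM2r ?(ltW c0) // ler_nat.
apply: (@chain_lower _ _ x q) => //; first exact: ltW.
- by move=> k; exact: spec_prj.
- by move=> k; rewrite /q spec_comm.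
have pq k : prj (q k) := spec_prj _ sx.
move=> k; have -> : (q k - q k.+1) xi = q k (xi - q k.+1 xi).
  by rewrite bopB subbE -(mulbE (q k) (q k.+1)) qq.
exact: h.
Qed.

Lemma dens_tau eta y : dens A tau eta y -> tau y = (rp eta eta)%:E.
Proof. by move=> [Ay py] /(_ _ (vN1 vA)); rewrite adj1 mul1r mulr1 onebE. Qed.

Lemma cst_nat_bound x c : 0 < c -> exists N, forall n, (N <= n)%N -> ple x (cst (n.+2%:R * c)).
Proof.
move=> c0; have [M M0 hM] := pos_bound x; exists (Num.bound (M / c)) => n Nn.
apply: ple_trans hM _ => xi; rewrite !qf_cst ler_wpM2r ?rp_ge0 // -ler_pdivrMr //.
have := archi_boundP (divr_ge0 (ltW M0) (ltW c0)) => h; apply: le_trans (ltW h) _.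
by rewrite ler_nat; apply: leq_trans Nn _; rewrite -addn2 leq_addr.
Qed.

(** Slice the positive part [h] of [g] and the density [y] into layers [E k] and [G i], of traces
    [v k] and [w i], and let [z] match the two chains. The hypothesis at [s = v k] gives [<E k psi,
    psi> <= 2 c s + sum_i c min(s, w i)], and matching bounds the sum by [<E k z phi, z phi>]; the
    layers are then added up. The range of [z] lies where [g] is nonnegative, so [g] and [h] have
    the same form at [z phi]. *)
Lemma oracle psi phi zeta p x y g (e : R) : prj p -> dens A tau zeta p -> dens A tau psi x -> corner A p x ->
  dens A tau phi y -> (forall s, 0 < s -> kyfan A tau s psi <= kyfan A tau s phi) ->
  corner A p g -> sa g -> 0 < e ->
  exists z, [/\ A z, contr z, p * z = z & rp (g zeta) (x zeta) - e <= rp (g zeta) ((z * y * adj z) zeta)].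
Proof.
move=> pp dz dx cx dy hK cg sg e0; have [Ag gp pg] := cg; have [Ay py _] := dy; have [Ap _ _] := dz.
have [p0 hc0 hl0 hu0] := specP 0 sg; have Ag0 := vN_spec 0 vA Ag sg; set g0 := spec g 0 in p0 hc0 hl0 hu0 Ag0.
have cgg := hc0 g erefl; have cgp : g0 * p = p * g0 by apply: hc0; rewrite gp pg.
pose P := g0 * p.
have AP : A P by exact: (vNM vA).
have pP : prj P.
  split; first by rewrite /P mulrA -(mulrA g0 p g0) -cgp mulrA (proj1 p0) -mulrA (proj1 pp).
  by rewrite /sa /P adjM (proj2 p0) (proj2 pp) cgp.
pose h := g * g0.
have Ah : A h by exact: (vNM vA).
have hP : h * P = h by rewrite /h /P mulrA -(mulrA g) (proj1 p0) -mulrA cgp mulrA gp.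
have qh xi : qf h xi = qf g (g0 xi).
  by rewrite /qf -(sa_rp _ _ (proj2 p0)) -(mulbE g) -(mulbE g0) mulrA cgg -mulrA (proj1 p0).
have sh : sa h by rewrite /sa /h adjM sg (proj2 p0) cgg.
have Ph : P * h = h by have := congr1 adj hP; rewrite adjM sh (proj2 pP).
have ph : pos h.
  by split=> // xi; rewrite qf0 qh; apply: le_trans (hl0 xi); rewrite mul0r.
have gh xi : qf g xi <= qf h xi.
  rewrite qh (qf_split xi p0 (esym cgg)) gerDl; apply: le_trans (hu0 xi) _.
  by rewrite mul0r.
have [M M0 hM] := pos_bound h.
have hp : h * p = h by rewrite -hP /P -mulrA -mulrA (proj1 pp).
have php : p * h = h by have := congr1 adj hp; rewrite adjM sh (proj2 pp).
pose L := M * rp zeta zeta.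
have L0 : 0 <= L by rewrite mulr_ge0 ?rp_ge0 // ltW.
have tL : (tau h <= L%:E)%E.
  rewrite /L EFinM -(dens_tau dz) -(tauZ T) ?(ltW M0) //; last exact: prj_pos.
  apply: (tau_mono vA T) => //; [exact: vNZ|by apply: posZ (prj_pos pp); exact: ltW|].
  move=> xi; rewrite qfZ (prj_qf _ pp) -qf_cst; apply: le_trans (hM (p xi)).
  by rewrite /qf -(sa_rp _ _ (proj2 pp)) -(mulbE h) -(mulbE p) hp php.
have ty := dens_tau dy.
(* Layers of height [c] lose [2 c |psi|^2] in slicing [h], and [2 c L] in slicing [y] because
   [tau h <= L]; the summand 1 keeps [D] positive. *)
pose D := 2 * (rp psi psi + L + 1); have D0 : 0 < D.
  by rewrite mulr_gt0 // ltr_wpDl // addr_ge0 // rp_ge0.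
pose c := e / D; have c0 : 0 < c by rewrite divr_gt0.
have cD : c * D = e by rewrite /c divfK // gt_eqF.
pose E k := spec h (k.+2%:R * c); pose G k := spec y (k.+2%:R * c).
have k0 k : 0 < k.+2%:R * c :> R by rewrite mulr_gt0 // ltr0n.
have tE k : exists v : R, 0 <= v /\ tau (E k) = v%:E.
  by have [v v0 vE] := spec_tau Ah ph tL (k0 k); exists v.
have [v hv] := choice tE.
have tG k : exists w : R, 0 <= w /\ tau (G k) = w%:E.
  have [|w w0 wE] := spec_tau Ay py (M := rp phi phi) _ (k0 k); first by rewrite ty.
  by exists w.
have [w hw] := choice tG.
have [N1 hN1] := cst_nat_bound h c0; have [N2 hN2] := cst_nat_bound y c0.
pose n := maxn N1 N2; have hn := hN1 n (leq_maxl _ _); have yn := hN2 n (leq_maxr _ _).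
have cE := spec_chain n Ah ph c0 AP pP hP Ph (fun k => proj2 (hv k)).
have cG := spec_chain n Ay py c0 (vN1 vA) prj1 (mulr1 y) (mul1r y) (fun k => proj2 (hw k)).
have [z [Az cz Pz _ hz]] := chain_match vA T fA cE cG.
exists z; have pz : p * z = z by rewrite -Pz /P cgp !mulrA (proj1 pp).
have g0z : g0 * z = z by rewrite -Pz /P !mulrA (proj1 p0).
split=> //.
have dzy := dens_act vA dy Az.
have czy : corner A p (z * y * adj z).
  split; first exact: vN_conj.
    by rewrite -[in LHS](proj2 pp) -mulrA -adjM pz.
  by rewrite !mulrA pz.
rewrite -(pair_sa pp dz dx cx Ag sg) -(pair_sa pp dz dzy czy Ag sg).
have -> : qf g (z phi) = qf h (z phi) by rewrite qh -(mulbE g0) g0z.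
pose B k := \sum_(i < n) c * Num.min (v k) (w i).
have AE k : A (E k) by exact: vN_spec Ah sh.
have AG k : A (G k) by exact: vN_spec Ay (proj1 py).
have pE k : prj (E k) := spec_prj _ sh.
have pG k : prj (G k) := spec_prj _ (proj1 py).
have up k : qf (E k) psi <= 2 * c * v k + B k.
  have [v0 vE] := hv k; have B0 : 0 <= B k.
    apply: sumr_ge0 => i _; rewrite mulr_ge0 ?(ltW c0) // le_min v0.
    by have [] := hw i.
  have [v00|vn] := eqVneq (v k) 0.
    have -> : E k = 0 by apply: (tau_faithful T) (AE k) (prj_pos (pE k)) _; rewrite vE v00.
    by rewrite qf0 v00 mulr0 add0r.
  have vp : 0 < v k by rewrite lt_neqAle eq_sym vn.
  have wl i : (tau (G i) <= (w i)%:E)%E by have [_ ->] := hw i.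
  apply: le_trans (kyfan_chain_le vA T dy vp c0 yn wl).
  apply: le_trans (hK _ vp); apply: kyfan_ub => //.
  by split; [exact: AE|exact: prj_pos|exact: prj_le1|rewrite vE].
have low k : (k < n)%N -> B k <= qf (E k) (z phi).
  move=> kn; have AEz : A (E k * z) by exact: (vNM vA).
  have [_ _ hdy] := dy; have := hdy _ AEz.
  have -> : rp ((E k * z) phi) ((E k * z) phi) = qf (E k) (z phi) by rewrite prj_qf.
  move=> h1; rewrite -lee_fin -h1; clear h1.
  pose F i := E k * z * G i * adj (E k * z * G i).
  have AF i : A (F i).
    have Aw : A (E k * z * G i) by exact: (vNM vA).
    by apply: (vNM vA) => //; exact: vN_adj.
  have pF i : pos (F i) := posA' _.
  have cEz : contr (E k * z) := contrM (prj_contr (pE k)) cz.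
  have FE i : F i = (E k * z) * G i * adj (E k * z).
    by rewrite /F adjM (proj2 (pG i)) !mulrA -(mulrA _ (G i) (G i)) (proj1 (pG i)).
  have tF i : exists u : R, tau (F i) = u%:E.
    have [_ wE] := hw i.
    have := tau_contr vA T AEz cEz (AG i) (prj_pos (pG i)); rewrite -FE wE.
    by move=> /(tau_fin T (AF i) (pF i)) [u _ uE]; exists u.
  have [u hu] := choice tF; have [AS pS tS] := tau_sum vA T n AF pF hu.
  apply: (@le_trans _ _ (tau (c%:C *: \sum_(i < n) F i))).
    rewrite (tauZ T) ?(ltW c0) // tS -EFinM lee_fin mulr_sumr; apply: ler_sum => i _.
    rewrite ler_wpM2l ?(ltW c0) // -lee_fin -hu; exact: hz.
  apply: (tau_mono vA T) => //.
  - exact: vNZ.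
  - by apply: posZ => //; exact: ltW.
  - exact: vN_conj.
  - exact: pos_conj.
  move=> xi; rewrite qfZ qf_sum.
  have qE m : qf (E k * z * m * adj (E k * z)) xi = qf m (adj (E k * z) xi).
    by rewrite -{1}[E k * z]adjK qfJ.
  rewrite qE (eq_bigr (fun i : 'I_n => qf (G i) (adj (E k * z) xi))) => [|i _]; last by rewrite FE qE.
  exact: spec_chain_lower.
have vL : c * \sum_(k < n) v k <= L.
  have [AS pS tS] := tau_sum vA T n AE (fun k => prj_pos (pE k)) (fun k => proj2 (hv k)).
  rewrite -lee_fin EFinM -tS -(tauZ T) ?(ltW c0) //; apply: le_trans tL.
  apply: (tau_mono vA T) => //; [exact: vNZ|by apply: posZ => //; exact: ltW|].
  by move=> xi; rewrite qfZ qf_sum; exact: spec_chain_lower.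
have h1 : qf g psi <= 2 * c * rp psi psi + c * \sum_(k < n) qf (E k) psi.
  by apply: le_trans (gh psi) _; exact: chain_upper.
have h2 := spec_chain_lower n (z phi) ph c0.
have h3 : \sum_(k < n) qf (E k) psi <= 2 * c * (\sum_(k < n) v k) + \sum_(k < n) qf (E k) (z phi).
  rewrite mulr_sumr -big_split; apply: ler_sum => k _ /=; apply: le_trans (up k) _.
  by rewrite lerD2l; exact: low.
have h4 : c * \sum_(k < n) qf (E k) psi <= 2 * c * L + c * \sum_(k < n) qf (E k) (z phi).
  apply: le_trans (ler_wpM2l (ltW c0) h3) _; rewrite mulrDr lerD2r mulrCA ler_wpM2l //.
  by rewrite mulr_ge0 // ltW.
clear - h1 h2 h4 cD c0 L0; rewrite -cD /D.
have := rp_ge0 psi; nra.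
Qed.

End Oracle.

(** * Approximation by mixtures *)

Section FrankWolfe.
Context {R : realType} {H : hilbertType R}.
Context (A : set (bop H)) (tau : bop H -> \bar R).
Context (vA : von_neumann_algebra A) (T : nsf_trace A tau) (fA : factor A).
Implicit Types (x y z g m p s : bop H) (zeta psi phi xi : H) (l : nat -> R).

(* The weights are squared, as they are squares of amplitudes. *)
Definition mixture p y m : Prop := exists (n : nat) l (z : nat -> bop H),
  [/\ forall k, 0 <= l k, \sum_(k < n) l k ^+ 2 = 1,
      forall k, [/\ A (z k), contr (z k) & p * z k = z k] &
      m = \sum_(k < n) (l k ^+ 2)%:C *: (z k * y * adj (z k))].

Lemma mixture_cut p y : A p -> prj p -> mixture p y (p * y * p).
Proof.
move=> Ap pp; exists 1%N, (fun=> 1), (fun=> p); split=> //.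
- by rewrite big_ord_recl big_ord0 addr0 expr1n.
- by move=> _; split=> //; [exact: prj_contr|exact: (proj1 pp)].
- by rewrite big_ord_recl big_ord0 addr0 expr1n scale1r (proj2 pp).
Qed.

Lemma mixture_step p y m z (t : R) : 0 <= t -> t <= 1 -> mixture p y m -> A z -> contr z -> p * z = z ->
  mixture p y ((1 - t)%:C *: m + t%:C *: (z * y * adj z)).
Proof.
move=> t0 t1 [n [l [w [l0 lS hw ->]]]] Az cz pz; have t1' : 0 <= 1 - t by rewrite subr_ge0.
pose l' k := if (k < n)%N then Num.sqrt (1 - t) * l k else Num.sqrt t.
pose w' k := if (k < n)%N then w k else z.
have lE (k : 'I_n) : l' k ^+ 2 = (1 - t) * l k ^+ 2 by rewrite /l' ltn_ord exprMn sqr_sqrtr.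
have lN : l' n ^+ 2 = t by rewrite /l' ltnn sqr_sqrtr.
exists n.+1, l', w'; split.
- by move=> k; rewrite /l'; case: ifP => _; rewrite ?mulr_ge0 ?sqrtr_ge0.
- rewrite big_ord_recr /= lN (eq_bigr _ (fun k _ => lE k)) -mulr_sumr lS mulr1.
  by rewrite subrK.
- by move=> k; rewrite /w'; case: ifP => _ //; exact: hw.
- rewrite big_ord_recr /= lN /w' ltnn scaler_sumr; congr (_ + _).
  by apply: eq_bigr => k _; rewrite lE ltn_ord scalerA -rmorphM.
Qed.

Lemma mixtureP p y m (M : R) : 0 <= M -> A p -> prj p -> A y -> pos y -> ple y (cst M) -> mixture p y m ->
  [/\ corner A p m, pos m & ple m (cst M)].
Proof.
move=> M0 Ap pp Ay py yM [n [l [z [l0 lS hz ->]]]].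
have cz (k : nat) : corner A p (z k * y * adj (z k)).
  have [Az _ pz] := hz k; split; first exact: vN_conj.
    by rewrite -[in LHS](proj2 pp) -mulrA -adjM pz.
  by rewrite !mulrA pz.
have pz (k : nat) : pos (z k * y * adj (z k)) by exact: pos_conj.
split.
- elim/big_ind: _ => [|u v hu hv|k _]; last exact: cornerZ.
    by split; rewrite ?mulr0 ?mul0r //; exact: vN0.
  exact: cornerD.
- elim/big_ind: _ => [|u v hu hv|k _]; [exact: pos0|exact: posD|].
  by apply: posZ => //; exact: sqr_ge0.
move=> xi; rewrite (@qf_sum _ _ (fun k => (l k ^+ 2)%:C *: (z k * y * adj (z k)))).
rewrite qf_cst -[M]mul1r -lS !mulr_suml; apply: ler_sum => k _.
rewrite qfZ -[leRHS]mulrA ler_wpM2l ?sqr_ge0 //; have [Az ck _] := hz k.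
rewrite -{1}[z k]adjK qfJ; apply: le_trans (yM _) _; rewrite qf_cst ler_wpM2l //.
exact: contr_adj.
Qed.

(* Frank-Wolfe: the oracle supplies a descent direction towards [x] in the
   norm of the trace vector. *)
Lemma frank_wolfe psi phi zeta p x y (d : R) : prj p -> dens A tau zeta p -> dens A tau psi x -> corner A p x ->
  dens A tau phi y -> (forall t : R, 0 < t -> kyfan A tau t psi <= kyfan A tau t phi) -> 0 < d ->
  exists2 m, mixture p y m & rp ((x - m) zeta) ((x - m) zeta) <= d.
Proof.
move=> pp dz dx cx dy hK d0; have [Ap _ _] := dz; have [Ay py _] := dy.
pose f m := rp ((x - m) zeta) ((x - m) zeta).
pose S := [set f m | m in mixture p y].
have S0 : has_inf S.
  split; first by exists (f (p * y * p)); exists (p * y * p) => //; exact: mixture_cut.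
  by exists 0 => _ [m _ <-]; exact: rp_ge0.
(* Attainment of the infimum is avoided: if it were at least [d], one step from a near-minimiser
   would go below it. *)
have [hd|hd] := ltP (inf S) d.
  have [|_ [m hm <-]] := @inf_adherent _ S (d - inf S) _ S0; first by rewrite subr_gt0.
  by rewrite subrKC => h; exists m => //; exact: ltW.
have D0 : 0 < inf S by exact: lt_le_trans hd.
set D := inf S in hd D0; exfalso.
have [M M0 yM] := pos_bound y.
(* [C] bounds the squared length of [(s - m) zeta], and [t] makes [t * C] at most [D / 2]. The
   oracle with error [D / 4] then gives a decrease of at least [t * D], twice the distance of [m]
   from optimality. *)
pose C := (2 * M * nrm zeta) ^+ 2.
have C0 : 0 <= C by exact: sqr_ge0.
pose t := D / (2 * (C + D + 1)).
have t0 : 0 < t by rewrite divr_gt0 // mulr_gt0 // ltr_wpDl // addr_ge0 // ltW.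
have tE : t * (2 * (C + D + 1)) = D by rewrite /t divfK // gt_eqF // mulr_gt0 // ltr_wpDl // addr_ge0 // ltW.
have t2 : 2 * t <= 1 by nra.
have tC : t * C <= D / 2 by nra.
have [|_ [m hm <-] hmD] := @inf_adherent _ S (t * D / 2) _ S0.
  by rewrite divr_gt0 // mulr_gt0.
have [cm pm mM] := mixtureP (ltW M0) Ap pp Ay py yM hm.
have cg := cornerB vA cx cm; have sg : sa (x - m) by apply: saB; [case: dx => _ []|exact: (proj1 pm)].
have [|z [Az cz pz hz]] := oracle vA T fA pp dz dx cx dy hK cg sg (e := D / 4) _.
  by rewrite divr_gt0.
set s := z * y * adj z in hz; have t1 : t <= 1 by lra.
have hm' := mixture_step (ltW t0) t1 hm Az cz pz.
have : D <= f ((1 - t)%:C *: m + t%:C *: s).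
  by apply: ge_inf; [exists 0 => _ [m' _ <-]; exact: rp_ge0|exists ((1 - t)%:C *: m + t%:C *: s)].
have -> : f ((1 - t)%:C *: m + t%:C *: s) = f m - 2 * t * rp ((x - m) zeta) ((s - m) zeta) + t ^+ 2 * rp ((s - m) zeta) ((s - m) zeta).
  have -> : f ((1 - t)%:C *: m + t%:C *: s) = rp ((x - m) zeta - t%:C *: (s - m) zeta) ((x - m) zeta - t%:C *: (s - m) zeta).
    rewrite /f; suff -> : (x - ((1 - t)%:C *: m + t%:C *: s)) zeta = (x - m) zeta - t%:C *: (s - m) zeta by [].
    rewrite !subbE addbE !scalebE !scalerBr rmorphB rmorph1 scalerBl scale1r.
    by rewrite !opprD !opprK !addrA addrAC.
  by rewrite /f; move: ((x - m) zeta) ((s - m) zeta) => u v; rewrite !rpE (rpC v u); ring.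
have sM : nrm ((s - m) zeta) <= 2 * M * nrm zeta.
  have ps : pos s by exact: pos_conj.
  have sM : ple s (cst M).
    move=> xi; rewrite /s -{1}[z]adjK qfJ; apply: le_trans (yM _) _; rewrite !qf_cst ler_wpM2l ?(ltW M0) //.
    exact: contr_adj.
  rewrite subbE; apply: le_trans (nrmB _ _) _.
  have := lerD (pos_nrm zeta (ltW M0) ps sM) (pos_nrm zeta (ltW M0) pm mM).
  by move/le_trans; apply; lra.
have sC : rp ((s - m) zeta) ((s - m) zeta) <= C by exact: sq_le_nrm.
have -> : rp ((x - m) zeta) ((s - m) zeta) = rp ((x - m) zeta) (s zeta) - rp ((x - m) zeta) (m zeta).
  by rewrite [(s - m) zeta]subbE rpBr.
have h0 : f m = rp ((x - m) zeta) (x zeta) - rp ((x - m) zeta) (m zeta).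
  by rewrite /f {2}subbE rpBr.
have fD : D <= f m by apply: ge_inf; [exists 0 => _ [m' _ <-]; exact: rp_ge0|exists m].
apply/negP; rewrite -ltNge.
have h1 : 2 * t * (f m - D / 4) <= 2 * t * (rp ((x - m) zeta) (s zeta) - rp ((x - m) zeta) (m zeta)).
  apply: ler_wpM2l; first by rewrite mulr_ge0 // ltW.
  by rewrite h0; clear - hz; lra.
have h2 : t ^+ 2 * rp ((s - m) zeta) ((s - m) zeta) <= t * (D / 2).
  rewrite expr2 -mulrA ler_wpM2l ?(ltW t0) //; apply: le_trans tC; rewrite ler_wpM2l ?(ltW t0) //.
have h3 : 2 * t * D <= 2 * t * f m by apply: ler_wpM2l => //; rewrite mulr_ge0 // ltW.
have tD : 0 < t * D by rewrite mulr_gt0.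
apply: (@le_lt_trans _ _ (f m - 2 * t * (f m - D / 4) + t * (D / 2))).
  by apply: lerD => //; rewrite lerD2l lerN2.
clear - h3 tD hmD; move: (f m) hmD h3; move=> F; rewrite -/D => hmD h3; lra.
Qed.

End FrankWolfe.

(** * Conversion *)

Section Conversion.
Context {R : realType} {H : hilbertType R}.
Context (A : set (bop H)) (tau : bop H -> \bar R).
Context (vA : von_neumann_algebra A) (T : nsf_trace A tau) (fA : factor A).
Implicit Types (x y g m p : bop H) (zeta psi phi xi eta : H) (l : nat -> R).

Lemma qf_diff x xi eta : sa x -> qf x xi = qf x eta + rp (x (xi - eta)) (xi + eta).
Proof.
move=> sx; rewrite /qf bopB !rpE; have -> : rp (x eta) xi = rp (x xi) eta by rewrite (sa_rp _ _ sx) rpC.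
ring.
Qed.

(** Cauchy-Schwarz for families, by expanding the squared norms of
    [|eta| b k xi + |xi| l k z k eta]. *)
Lemma weighted_overlap n l (b z : nat -> bop H) xi eta : \sum_(k < n) l k ^+ 2 = 1 -> (forall k, contr (z k)) ->
  \sum_(k < n) rp (b k xi) (b k xi) <= rp xi xi ->
  - (nrm xi * nrm eta) <= \sum_(k < n) l k * rp (b k xi) (z k eta).
Proof.
move=> lS cz bS; set X := \sum_(k < n) l k * _.
have [x0|x0] := eqVneq (nrm xi) 0.
  rewrite /X big1 ?x0 ?mul0r ?oppr0 // => k _.
  by rewrite (nrm_eq0 x0) bop0 rp0l mulr0.
have [e0|e0] := eqVneq (nrm eta) 0.
  rewrite /X big1 ?e0 ?mulr0 ?oppr0 // => k _.
  by rewrite (nrm_eq0 e0) bop0 rp0r mulr0.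
have xp : 0 < nrm xi by rewrite lt_neqAle eq_sym x0 nrm_ge0.
have ep : 0 < nrm eta by rewrite lt_neqAle eq_sym e0 nrm_ge0.
rewrite lerNl -subr_ge0 opprK -(pmulr_rge0 _ (mulr_gt0 xp ep)).
pose v k := (nrm eta)%:C *: b k xi + (nrm xi * l k)%:C *: z k eta.
have h : 0 <= \sum_(k < n) rp (v k) (v k) by apply: sumr_ge0 => k _; exact: rp_ge0.
have h1 : \sum_(k < n) rp (v k) (v k) <= nrm eta ^+ 2 * \sum_(k < n) rp (b k xi) (b k xi) +
   2 * (nrm xi * nrm eta) * X + nrm xi ^+ 2 * (nrm eta ^+ 2 * \sum_(k < n) l k ^+ 2).
  rewrite /X !mulr_sumr -!big_split; apply: ler_sum => k _ /=.
  have := cz k eta; rewrite -nrm2 => h2.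
  have h3 : l k ^+ 2 * rp (z k eta) (z k eta) <= l k ^+ 2 * rp eta eta.
    by apply: ler_wpM2l; [exact: sqr_ge0|exact: cz].
  rewrite -(nrm2 eta) in h3; rewrite /v !rpE (rpC (z k eta) (b k xi)) -subr_ge0.
  set a := rp (b k xi) (b k xi); set c := rp (b k xi) _; set e := rp (z k eta) (z k eta) in h3 *.
  rewrite [X in 0 <= X](_ : _ = nrm xi ^+ 2 * (l k ^+ 2 * nrm eta ^+ 2 - l k ^+ 2 * e)); last by ring.
  by apply: mulr_ge0; [exact: sqr_ge0|rewrite subr_ge0].
have h4 := ler_wpM2l (sqr_ge0 (nrm eta)) bS.
rewrite lS mulr1 in h1; rewrite -nrm2 in h4.
by clear - h h1 h4; nra.
Qed.

(** The column version of [commutant_extend]: the hypothesis says that [z psi -> (z (ket k))_k] is a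
    contraction. The joint bound holds on [A psi], passes to its closure, and the [b k] vanish on
    the orthogonal complement. *)
Lemma commutant_family n psi (ket : nat -> H) :
  (forall z, A z -> \sum_(k < n) rp (z (ket k)) (z (ket k)) <= rp (z psi) (z psi)) ->
  exists b : nat -> bop H, [/\ forall k, commutant A (b k), forall k, (k < n)%N -> b k psi = ket k &
    forall xi, \sum_(k < n) rp (b k xi) (b k xi) <= rp xi xi].
Proof.
move=> h.
have ex k : exists b, commutant A b /\ ((k < n)%N -> b psi = ket k /\
    forall xi, (forall z, A z -> rp xi (z psi) = 0) -> b xi = 0).
  have [kn|kn] := ltnP k n; last by exists 0; split; [exact: vN0 (vN_commutant vA)|].
  have [|b [Cb bk b0]] := @commutant_extend _ _ A vA psi (ket k).
    move=> z Az; rewrite -(ler_pXn2r (ltn0Sn 1)) ?nnegrE ?nrm_ge0 // !nrm2.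
    apply: le_trans (h z Az); rewrite (bigD1 (Ordinal kn)) //= lerDl.
    by apply: sumr_ge0 => i _; exact: rp_ge0.
  by exists b; split.
have [b hb] := choice ex; exists b.
have Cb k := proj1 (hb k).
split=> // [k /(proj2 (hb k))[]//|xi].
have [e [pe Ce ea e0]] := cyclic_prj vA psi.
pose s := \sum_(k < n) adj (b k) * b k.
have ss : sa s.
  rewrite /s; elim/big_ind: _ => [|u v su sv|k _]; [exact: sa0|exact: saD|exact: saA].
have qs v : qf s v = \sum_(k < n) rp (b k v) (b k v).
  by rewrite /s (@qf_sum _ _ (fun k => adj (b k) * b k)); apply: eq_bigr => k _; rewrite qfA.
have -> : \sum_(k < n) rp (b k xi) (b k xi) = qf s (e xi).
  rewrite qs; apply: eq_bigr => k _; have [_ bz] := proj2 (hb k) (ltn_ord k).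
  have -> // : b k xi = b k (e xi).
  apply/subr0_eq; rewrite -bopB; apply: bz => z Az.
  by have := e0 xi z Az; rewrite subbE onebE.
apply: le_trans (prj_contr pe xi); rewrite -subr_le0.
have sD : sa (s - 1) by apply: saB => //; exact: sa1.
have -> : qf s (e xi) - rp (e xi) (e xi) = qf (s - 1) (e xi) by rewrite qfB qf1.
set v := e xi; have [M M0 hM] := bop_bound (s - 1).
apply: small0 => c c0; pose K := M * (2 * nrm v + 1) + 1.
have K0 : 0 < K by rewrite ltr_wpDl // mulr_ge0 ?(ltW M0) // addr_ge0 // mulr_ge0 // nrm_ge0.
pose d := Num.min 1 (c / K).
have d0 : 0 < d by rewrite lt_min ltr01 divr_gt0.
have [_ [z Az ->] hz] := ea xi d d0; rewrite -/v in hz.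
have zv : qf (s - 1) (z psi) <= 0.
  rewrite qfB qf1 subr_le0 qs; apply: le_trans (h z Az); apply: ler_sum => k _.
  have [bk _] := proj2 (hb k) (ltn_ord k).
  by rewrite -(mulbE (b k)) -(vN_commute Az (Cb k)) mulbE bk.
have d1 : d <= 1 by rewrite ge_min lexx.
have dc : K * d <= c by rewrite mulrC -ler_pdivlMr // ge_min lexx orbT.
rewrite (qf_diff v (z psi) sD).
have h1 := rp_le' ((s - 1) (v - z psi)) (v + z psi); have h2 := hM (v - z psi).
have h3 : nrm (v + z psi) <= 2 * nrm v + 1.
  have -> : v + z psi = v + v - (v - z psi) by rewrite opprB addrACA subrr addr0.
  apply: le_trans (nrmB _ _) _; have := nrmD v v; lra.
have h4 : nrm ((s - 1) (v - z psi)) <= M * d by apply: le_trans h2 _; rewrite ler_wpM2l // ltW.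
have := ler_pM (nrm_ge0 _) (nrm_ge0 _) h4 h3 => h5.
clear - h1 h5 zv dc d0; rewrite /K in dc; nra.
Qed.

(* AM-GM: [g <= g^2 / (4t) + t]. *)
Lemma dominating_inverse x g (t : R) : pos x -> sa g -> 0 < t ->
  let u := x + (4 * t)^-1%:C *: (g * g) + cst t in
  exists i, [/\ pos i, u * i = 1 /\ i * u = 1, (forall y, x * y = y * x -> g * y = y * g -> i * y = y * i) &
    ple x u /\ ple (x + g) u].
Proof.
move=> px sg t0 u; have t4 : 0 < 4 * t by rewrite mulr_gt0.
have ph : pos ((4 * t)^-1%:C *: (g * g)).
  by apply: posZ; [rewrite invr_ge0 ltW|exact: pos_sq].
have [i [pi ui iu ci _]] := inv_ex (posD px ph) t0; exists i; split=> //.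
  move=> y xy hy; apply: ci; rewrite mulrDl mulrDr xy -scalebAl -scalebAr -mulrA hy mulrA hy mulrA.
  by [].
have qh xi : qf (g * g) xi = rp (g xi) (g xi) by rewrite -{1}sg qfA.
split=> xi.
  rewrite /u !qfE qh -addrA lerDl; apply: addr_ge0; apply: mulr_ge0; rewrite ?rp_ge0 ?invr_ge0 //; exact: ltW.
rewrite /u !qfE qh.
have : 0 <= rp (g xi - (2 * t)%:C *: xi) (g xi - (2 * t)%:C *: xi) by exact: rp_ge0.
rewrite !rpE (rpC xi) -/(qf g xi); move: (rp (g xi) (g xi)) (qf g xi) (rp xi xi) => a b c h.
rewrite -addrA lerD2l -(ler_pM2l t4) mulrDr mulrA mulfV ?gt_eqF // mul1r; lra.
Qed.

(** Let [m] be a mixture close to [x], [u] an operator above [x] and [m], and [k = x u^{-1}]. Then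
    [k m adj k <= x], so the vectors [l j k z j phi] are dominated by [psi] and come from operators
    [b j] of the commutant. The overlap is [<k zeta, m zeta>], which by traciality is [<w, m zeta>]
    with [w = adj k zeta], and [<w, u zeta> = |psi|^2]. *)
Lemma near_transfer zeta p psi phi x y (c d : R) : prj p -> dens A tau zeta p -> dens A tau psi x ->
  corner A p x -> 0 < c -> ple (c%:C *: p) x -> dens A tau phi y ->
  (forall t : R, 0 < t -> kyfan A tau t psi <= kyfan A tau t phi) -> 0 < d ->
  exists (n : nat) l (b z : nat -> bop H),
    [/\ forall k, 0 <= l k, \sum_(k < n) l k ^+ 2 = 1, forall k, commutant A (b k),
        forall k, A (z k) /\ contr (z k) &
     (forall xi, \sum_(k < n) rp (b k xi) (b k xi) <= rp xi xi) /\
     rp psi psi - d <= \sum_(k < n) l k * rp (b k psi) (z k phi)].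
Proof.
move=> pp dz dx cx c0 cpx dy hK d0; have [Ap _ _] := dz; have [Ax px _] := dx; have [Ay py _] := dy.
have [Mx Mx0 hMx] := pos_bound x; have [My My0 hMy] := pos_bound y.
pose Z := nrm zeta; have Z0 : 0 <= Z := nrm_ge0 _.
pose W := Mx * Z / c; have W0 : 0 <= W by rewrite divr_ge0 ?mulr_ge0 // ltW.
(* [t] is fixed first because [N] grows like [1 / t]; [r], the distance demanded of the mixture, is
   then chosen small relative to [N]. Each contributes at most [d / 2] to [W * (N * r + t * Z)]. *)
pose t := d / (2 * (W * Z + 1)).
have D0 : 0 < 2 * (W * Z + 1) by rewrite mulr_gt0 // ltr_wpDl // mulr_ge0.
have t0 : 0 < t by rewrite divr_gt0.
have tE : t * (2 * (W * Z + 1)) = d by rewrite /t divfK // gt_eqF.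
pose M := My + Mx; have M0 : 0 <= M by rewrite addr_ge0 // ltW.
pose N := 1 + M / (4 * t); have N0 : 0 <= N by rewrite addr_ge0 // divr_ge0 // mulr_ge0 // ltW.
have V0 : 0 <= W * N by rewrite mulr_ge0.
pose r := d / (2 * (W * N + 1)).
have D1 : 0 < 2 * (W * N + 1) by rewrite mulr_gt0 // ltr_wpDl.
have r0 : 0 < r by rewrite divr_gt0.
have rE : r * (2 * (W * N + 1)) = d by rewrite /r divfK // gt_eqF.
have [|m hm mr] := frank_wolfe vA T fA pp dz dx cx dy hK (d := r ^+ 2) _; first by rewrite exprn_gt0.
have [cm pm mM] := mixtureP vA (ltW My0) Ap pp Ay py hMy hm.
have [Am mp pm'] := cm; have [_ xp px'] := cx.
pose g := m - x; have sg : sa g by apply: saB; [exact: (proj1 pm)|exact: (proj1 px)].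
have Ag : A g by exact: vNB.
have [i [pi [ui iu] ci [xu mu]]] := dominating_inverse px sg t0.
set u := x + _ *: (g * g) + cst t in ui iu xu mu.
have xg : x + g = m by rewrite /g addrC subrK.
rewrite xg in mu.
have su : sa u.
  apply: saD; last exact: saZ sa1.
  by apply: saD; [exact: (proj1 px)|apply: saZ; exact: (proj1 (pos_sq sg))].
have Ai : A i.
  apply: (vN_in vA) => v Cv; apply/esym/ci; [exact: vN_commute Ax Cv|exact: vN_commute Ag Cv].
have ip : i * p = p * i.
  by apply: ci; rewrite ?xp ?px' // /g mulrBl mulrBr mp pm' xp px'.
pose k := x * i; have Ak : A k by exact: (vNM vA).
have ck : corner A p k.
  by split=> //; rewrite /k ?mulrA ?px' // -mulrA ip mulrA xp.
have kE : adj k = i * x by rewrite /k adjM (proj1 pi) (proj1 px).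
have uw xi : u (adj k xi) = x xi by rewrite kE -!mulbE mulrA ui mul1r.
pose w := adj k zeta.
have xN xi : nrm (x xi) <= Mx * nrm xi by apply: pos_nrm => //; exact: ltW.
have mN xi : nrm (m xi) <= My * nrm xi by apply: pos_nrm => //; exact: ltW.
have gN xi : nrm (g xi) <= M * nrm xi.
  rewrite /g subbE; apply: le_trans (nrmB _ _) _; rewrite mulrDl; exact: lerD.
(* A bound independent of [t]: on the corner [u >= x >= c p], and [u w = x zeta]. *)
have wW : nrm w <= W.
  have pw : p w = w by rewrite /w kE -mulbE mulrA -ip -mulrA px'.
  have h1 : c * rp w w <= nrm (x zeta) * nrm w.
    apply: le_trans (rp_le' _ _); rewrite -(uw zeta) -/w -/(qf u w).
    by apply: le_trans (xu w); have := cpx w; rewrite qfZ (prj_qf _ pp) pw.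
  have h2 : c * nrm w ^+ 2 <= Mx * Z * nrm w.
    rewrite nrm2; apply: le_trans h1 _; rewrite ler_wpM2r ?nrm_ge0 //; exact: xN.
  have [w0|w0] := eqVneq (nrm w) 0; first by rewrite w0.
  have wp : 0 < nrm w by rewrite lt_neqAle eq_sym w0 nrm_ge0.
  by rewrite /W ler_pdivlMr // mulrC -(ler_pM2r wp) -mulrA -expr2.
have gz : nrm (g zeta) <= r.
  apply: nrm_le_sq; first exact: ltW.
  by rewrite /g -[m - x]opprB oppbE rpNl rpNr opprK.
have um : nrm ((u - m) zeta) <= N * r + t * Z.
  have -> : (u - m) zeta = (4 * t)^-1%:C *: g (g zeta) - g zeta + t%:C *: zeta.
    rewrite -xg /u /cst !bE opprD; set a := x zeta; set e := g zeta.
    by rewrite -(addrA a) addrACA subrr add0r addrAC.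
  apply: le_trans (nrmD _ _) _; rewrite nrmZr (gtr0_norm t0) lerD2r.
  apply: le_trans (nrmB _ _) _; rewrite nrmZr ger0_norm; last by rewrite invr_ge0 mulr_ge0 // ltW.
  have -> : N * r = (4 * t)^-1 * (M * r) + r by rewrite /N mulrDl mul1r addrC [M / _]mulrC -mulrA.
  apply: lerD => //; apply: ler_wpM2l; first by rewrite invr_ge0 mulr_ge0 // ltW.
  by apply: le_trans (gN _) _; rewrite ler_wpM2l.
have low : rp psi psi - d <= rp (k zeta) (m zeta).
  rewrite (tv_swap vA T pp dz ck cm) (proj1 pm) -/w.
  have -> : rp psi psi = rp w (u zeta).
    rewrite -(sa_rp _ _ su) uw -qf1 (pair_sa vA T pp dz dx cx (vN1 vA) sa1) onebE; exact: rpC.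
  have -> : rp w (m zeta) = rp w (u zeta) - rp w ((u - m) zeta) by rewrite subbE rpBr subKr.
  rewrite lerD2l lerN2; apply: le_trans (rp_le' _ _) _.
  apply: le_trans (ler_pM (nrm_ge0 _) (nrm_ge0 _) wW um) _.
  clear - tE rE V0 t0 r0 W0 Z0; have := mulr_ge0 W0 Z0; nra.
(* With [v = adj k xi], both [qf m v] and [qf x v] are at most [<x xi, v>]; positivity of [x] at
   [xi - v] then gives [<x xi, v> <= qf x xi]. *)
have kmx : ple (k * m * adj k) x.
  move=> xi; rewrite -{1}[k]adjK qfJ; set v := adj k xi.
  have h1 : qf m v <= rp (x xi) v by rewrite -(uw xi); exact: mu.
  have h2 : qf x v <= rp (x xi) v by rewrite -(uw xi); exact: xu.
  have h3 := pos_ge0 (xi - v) px; have h4 : qf x (xi - v) = qf x xi - 2 * rp (x xi) v + qf x v.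
    rewrite /qf bopB !rpE; have -> : rp (x v) xi = rp (x xi) v by rewrite (sa_rp _ _ (proj1 px)) rpC.
    ring.
  by lra.
case: hm => n [l [z [l0 lS hz mE]]].
pose ket j := (l j)%:C *: k (z j phi).
have dsz (j : nat) : dens A tau (z j phi) (z j * y * adj (z j)) by apply: dens_act => //; have [] := hz j.
have csz (j : nat) : corner A p (z j * y * adj (z j)).
  have [Az _ pz] := hz j; split; first exact: vN_conj.
    by rewrite -[in LHS](proj2 pp) -mulrA -adjM pz.
  by rewrite !mulrA pz.
have [v Av|b [Cb bk bS]] := @commutant_family n psi ket.
  pose F j := (l j ^+ 2)%:C *: ((v * k) * (z j * y * adj (z j)) * adj (v * k)).
  have Avk : A (v * k) by exact: (vNM vA).
  have As (j : nat) : A (z j * y * adj (z j)) by case: (csz j).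
  have ps (j : nat) : pos (z j * y * adj (z j)) by exact: pos_conj.
  have AF j : A (F j) by apply: (vNZ _ vA); exact: vN_conj.
  have pF j : pos (F j) by apply: posZ; [exact: sqr_ge0|exact: pos_conj].
  have tF j : tau (F j) = (rp (v (ket j)) (v (ket j)))%:E.
    rewrite (tauZ T) ?sqr_ge0 //; [|exact: vN_conj|exact: pos_conj].
    have [_ _ ->] := dsz j; last exact: Avk.
    by rewrite /ket bopZ !rpE -EFinM expr2 mulrA.
  have [AS pS tS] := tau_sum vA T n AF pF tF.
  rewrite -lee_fin -tS.
  have [_ _ hx] := dx; rewrite -(hx v Av).
  have -> : \sum_(j < n) F j = v * (k * m * adj k) * adj v.
    rewrite mE !(mulr_sumr, mulr_suml); apply: eq_bigr => j _.
    by rewrite /F adjM -!scalebAr -!scalebAl -!scalebAr -!scalebAl !mulrA.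
  apply: (tau_mono vA T).
  - by apply: vN_conj => //; apply: vN_conj.
  - by apply: pos_conj; exact: pos_conj.
  - exact: vN_conj.
  - exact: pos_conj.
  - exact: ple_conj.
exists n, l, b, z; split=> //; first by move=> j; have [] := hz j.
split=> //; apply: le_trans low _.
rewrite mE (@sum_app _ _ (fun j => (l j ^+ 2)%:C *: (z j * y * adj (z j)))).
have -> : rp (k zeta) (\sum_(j < n) ((l j ^+ 2)%:C *: (z j * y * adj (z j))) zeta) =
    \sum_(j < n) rp (k zeta) (((l j ^+ 2)%:C *: (z j * y * adj (z j))) zeta).
  by apply: (big_morph (rp (k zeta))) => [a e|]; [exact: rpDr|exact: rp0r].
apply: ler_sum => j _; rewrite bk // /ket scalebE !rpE mulrA -expr2.
rewrite -/(qf k (z j phi)) (pair_op vA T pp dz (dsz j) (csz j) Ak); exact: lexx.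
Qed.

End Conversion.

(** * Truncation and conversion *)

Section Truncation.
Context {R : realType} {H : hilbertType R}.
Context (A : set (bop H)) (tau : bop H -> \bar R).
Context (vA : von_neumann_algebra A) (T : nsf_trace A tau).
Implicit Types (x y p : bop H) (zeta psi phi xi : H) (s t r : R).
Local Notation K := (kyfan A tau).

Lemma kyfan_homo s t xi : 0 <= s -> s <= t -> K s xi <= K t xi.
Proof.
move=> s0 st; have t0 := le_trans s0 st; apply: (kyfan_le vA T) => // a [Aa pa a1 ta].
apply: (kyfan_ub vA T) => //; split=> //.
by apply: le_trans ta _; rewrite lee_fin.
Qed.

(** Scaling an effect by [s / t] takes trace [t] to trace [s]. This consequence of concavity is all
    that the truncation needs. *)
Lemma kyfan_concave s t xi : 0 < s -> s <= t -> s * K t xi <= t * K s xi.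
Proof.
move=> s0 st; have t0 := lt_le_trans s0 st.
rewrite mulrC -ler_pdivlMr //; apply: (kyfan_le vA T) => [|a [Aa pa a1 ta]]; first exact: ltW.
have r0 : 0 <= s / t by rewrite divr_ge0 // ltW.
rewrite ler_pdivlMr // mulrC -ler_pdivrMl // mulrA [t^-1 * s]mulrC -qfZ.
apply: (kyfan_ub vA T); first exact: ltW.
split.
- exact: vNZ.
- exact: posZ.
- move=> eta; rewrite qfZ; apply: le_trans (a1 eta); rewrite ler_piMl ?(pos_ge0 _ pa) //.
  by rewrite ler_pdivrMr // mul1r.
rewrite (tauZ T) //; apply: le_trans (lee_wpmul2l _ ta) _; first by rewrite lee_fin.
by rewrite -EFinM lee_fin divfK // gt_eqF.
Qed.

Lemma kyfan_scale s r xi : 0 <= s -> K s (r%:C *: xi) <= r ^+ 2 * K s xi.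
Proof.
move=> s0; apply: (kyfan_le vA T) => // a Da.
rewrite /qf bopZ !rpE mulrA -expr2 ler_wpM2l ?sqr_ge0 //; exact: (kyfan_ub vA T).
Qed.

Lemma kyfan_cut s p xi : 0 <= s -> A p -> prj p -> K s (p xi) <= K s xi.
Proof.
move=> s0 Ap pp; apply: (kyfan_le vA T) => // a [Aa pa a1 ta].
rewrite -qfJ (proj2 pp); apply: (kyfan_ub vA T) => //; split.
- by have := vN_J vA Aa Ap; rewrite (proj2 pp).
- by have := posJ p pa; rewrite (proj2 pp).
- have := pleJ p a1; rewrite (proj2 pp) mulr1 (proj1 pp) => h; apply: ple_trans h _; exact: prj_le1.
apply: le_trans ta; have := tau_contr vA T Ap (prj_contr pp) Aa pa.
by rewrite (proj2 pp).
Qed.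

Lemma kyfan_bound s x xi r : 0 <= s -> 0 <= r -> dens A tau xi x -> ple x (cst r) -> K s xi <= r * s.
Proof.
move=> s0 r0 dx xr; have [Ax px _] := dx; apply: (kyfan_le vA T) => // a [Aa pa a1 ta].
rewrite -lee_fin -(dens_qf vA T dx Aa pa) (tau_swap vA T) //.
apply: (@le_trans _ _ (tau (r%:C *: a))); last first.
  by rewrite (tauZ T) // EFinM; apply: lee_wpmul2l => //; rewrite lee_fin.
apply: (tau_mono vA T).
- exact: vN_sqJ.
- exact: pos_sqJ.
- exact: vNZ.
- exact: posZ.
have := ple_sqJ pa xr; rewrite /cst -scalebAr mulr1 -scalebAl (sqrt_sq pa).
by [].
Qed.

Lemma dens_scale xi x r : dens A tau xi x -> dens A tau (r%:C *: xi) ((r ^+ 2)%:C *: x).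
Proof.
move=> dx; have := dens_act vA dx (vN_cst r vA); rewrite {1}/cst scalebE onebE.
have -> // : cst r * x * adj (cst r) = (r ^+ 2)%:C *: x.
rewrite /cst adjZr adj1 -scalebAr mulr1 -scalebAl mul1r scalerA expr2 rmorphM.
by [].
Qed.

(** Cutting [psi] only lowers its functionals, but cutting [phi] lowers [K t phi] by up to a
    constant [cc]. The factor [1 - e] gained by shrinking [psi] absorbs [cc] for [t >= t1], where
    [K t phi] is bounded below; for smaller [t] the linear bound [M * t] on the left meets the
    concavity of the right. *)
Lemma truncation psi phi X Y d : density_operator A tau psi X -> density_operator A tau phi Y ->
  rp psi psi = 1 -> rp phi phi = 1 -> (forall t, 0 < t -> K t psi <= K t phi) -> 0 < d -> d <= 1 ->
  exists (psi' phi' zeta : H) (p x y : bop H) (c : R),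
    [/\ [/\ prj p, dens A tau zeta p, dens A tau psi' x, corner A p x & dens A tau phi' y],
        0 < c, ple (c%:C *: p) x, nrm (psi - psi') <= d /\ nrm (phi - phi') <= d &
        forall t, 0 < t -> K t psi' <= K t phi'].
Proof.
move=> hX hY npsi nphi hK d0 d1; pose e := d / 2; have e0 : 0 < e by rewrite divr_gt0.
have e1 : e <= 1 / 2 by rewrite /e; lra.
have e2 : 0 < 1 - e by lra.
have npsi1 : nrm psi = 1 by apply/eqP; rewrite -(@eqrXn2 _ 2) ?nrm_ge0 // nrm2 npsi expr1n.
have nphi1 : nrm phi = 1 by apply/eqP; rewrite -(@eqrXn2 _ 2) ?nrm_ge0 // nrm2 nphi expr1n.
have [p [x0 [zeta [c [[Ap pp dz dx hp] [c0 cpx _ xp px]]]]]] := density_approx vA T hX e0.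
have [Ax0 px0 _] := dx; set psi2 := p psi in dx hp.
have psi2n : nrm psi2 <= 1 by rewrite -npsi1; exact: contr_nrm (prj_contr pp).
have psi2p : 0 < rp psi2 psi2.
  rewrite -nrm2 exprn_gt0 //; have := nrmD (psi - psi2) psi2; rewrite subrK npsi1 => h'; lra.
have [M0 M00 hM0] := pos_bound x0.
have K2 t : 0 <= t -> K t psi2 <= M0 * t by move=> t0; apply: kyfan_bound (ltW M00) dx hM0.
(* Its supremum [M], the largest slope of [K t psi2], is finite because the density [x0] is bounded;
   [t1] is a point where it is nearly attained. *)
pose S := [set K t psi2 / t | t in [set t | 0 < t]].
have hS : has_sup S.
  split; first by exists (K 1 psi2 / 1); exists 1 => //=.
  by exists M0 => _ [t t0 <-]; rewrite ler_pdivrMr // K2 // ltW.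
pose M := sup S.
have KM t : 0 < t -> K t psi2 <= M * t.
  by move=> t0; rewrite -ler_pdivrMr //; apply: ub_le_sup; [case: hS|exists t].
have Mp : 0 < M.
  pose t := rp zeta zeta + 1; have t0 : 0 < t by rewrite ltr_wpDl // rp_ge0.
  have : 0 < K t psi2.
    apply: lt_le_trans psi2p _; have -> : rp psi2 psi2 = qf p psi2 by rewrite prj_qf // /psi2 prj_idem.
    apply: (kyfan_ub vA T) (ltW t0) _; split=> //; [exact: prj_pos|exact: prj_le1|].
    by rewrite (dens_tau vA dz) lee_fin /t lerDl.
  by move=> h; have := lt_le_trans h (KM t t0); rewrite pmulr_lgt0.
have [|_ [t1 t10 <-]] := @sup_adherent _ S (e * M) _ hS; first by rewrite mulr_gt0.
rewrite ltr_pdivlMr // -/M => ht1.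
have K12 t : 0 < t -> K t psi2 <= K t phi.
  by move=> t0; apply: le_trans (hK t t0); apply: kyfan_cut => //; exact: ltW.
have ht1' : (M - e * M) * t1 < K t1 phi by apply: lt_le_trans ht1 (K12 t1 t10).
have Kp : 0 < K t1 phi.
  by apply: le_lt_trans ht1'; rewrite mulr_ge0 ?(ltW t10) // subr_ge0; nra.
(* The first entry serves [t <= t1], the second [t >= t1]. Halving [cc] in [e'] compensates the
   factor [nrm phi + nrm phi' <= 2] of [kyfan_lip]. *)
pose cc := Num.min (K t1 phi - (M - e * M) * t1) (e * K t1 phi).
have cc0 : 0 < cc by rewrite lt_min subr_gt0 ht1' mulr_gt0.
pose e' := Num.min d (cc / 2).
have e'0 : 0 < e' by rewrite lt_min d0 divr_gt0.
have [p' [y [_ [_ [[Ap' pp' _ dy hp'] _]]]]] := density_approx vA T hY e'0.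
set phi' := p' phi in dy hp'.
have phin : nrm phi' <= 1 by rewrite -nphi1; exact: contr_nrm (prj_contr pp').
have Kphi t : 0 < t -> K t phi <= K t phi' + cc.
  move=> t0; apply: le_trans (kyfan_lip vA T phi phi' (ltW t0)) _; rewrite lerD2l nphi1.
  have e'c : e' <= cc / 2 by rewrite ge_min lexx orbT.
  have := nrm_ge0 (phi - phi'); have := nrm_ge0 phi'; clear - e'c hp' phin; nra.
have cc1 : cc <= K t1 phi - (M - e * M) * t1 by rewrite ge_min lexx.
have cc2 : cc <= e * K t1 phi by rewrite ge_min lexx orbT.
pose r := Num.sqrt (1 - e); have r2 : r ^+ 2 = 1 - e by rewrite sqr_sqrtr // ltW.
have r0 : 0 <= r by exact: sqrtr_ge0.
have r1 : r <= 1 by clear - r2 r0 e0; nra.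
exists (r%:C *: psi2), phi', zeta, p, ((r ^+ 2)%:C *: x0), y, (r ^+ 2 * c); split.
- split=> //; first exact: dens_scale.
  by apply: cornerZ.
- by rewrite r2 mulr_gt0.
- by move=> xi; rewrite !qfZ -mulrA ler_wpM2l ?sqr_ge0 // -qfZ; exact: cpx.
- split; last by apply: le_trans hp' _; rewrite ge_min lexx.
  apply: le_trans (nrm_tri psi2 psi _) _.
  have -> : psi2 - r%:C *: psi2 = (1 - r)%:C *: psi2 by rewrite rmorphB rmorph1 scalerBl scale1r.
  rewrite nrmZr ger0_norm ?subr_ge0 //.
  have : (1 - r) * nrm psi2 <= e by have := nrm_ge0 psi2; nra.
  by move: hp; rewrite /e; clear - d0; lra.
move=> t t0; apply: le_trans (kyfan_scale _ _ (ltW t0)) _; rewrite r2.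
have [tt1|/ltW t1t] := leP t t1.
  have h1 := KM t t0; have h2 := kyfan_concave phi' t0 tt1; have h3 := Kphi t1 t10.
  rewrite -(ler_pM2l t10); apply: le_trans h2.
  apply: (@le_trans _ _ (t * ((M - e * M) * t1))); last by rewrite ler_wpM2l ?(ltW t0) //; lra.
  have h4 : (1 - e) * K t psi2 <= (1 - e) * (M * t) by rewrite ler_wpM2l // ltW.
  have := ler_wpM2l (ltW t10) h4; clear - t10; lra.
have h1 := K12 t t0; have h2 := kyfan_homo phi (ltW t10) t1t; have h3 := Kphi t t0.
have h4 : (1 - e) * K t psi2 <= (1 - e) * K t phi by rewrite ler_wpM2l // ltW.
have h5 := ler_wpM2l (ltW e0) h2; clear - h3 h4 h5 cc2; lra.
Qed.

Lemma kyfan_convertible (fA : factor A) psi phi X Y : density_operator A tau psi X -> density_operator A tau phi Y ->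
  rp psi psi = 1 -> rp phi phi = 1 -> (forall t, 0 < t -> K t psi <= K t phi) -> approx_convertible A psi phi.
Proof.
move=> hX hY n1 n2 hK eps eps0; pose t := eps / 8; have t0 : 0 < t by rewrite divr_gt0.
(* Chosen so that the error of [LOCC_near] at [6 * d] is [2 t + 6 d / t + 12 d <= 2 t + t / 2 + t <
   8 t = eps]. *)
pose d := Num.min 1 (Num.min (t ^+ 2 / 12) (t / 12)).
have d0 : 0 < d by rewrite !lt_min ltr01 !divr_gt0 // exprn_gt0.
have d1 : d <= 1 by rewrite ge_min lexx.
have d2 : d <= t ^+ 2 / 12 by rewrite !ge_min lexx orbT.
have d3 : d <= t / 12 by rewrite !ge_min lexx !orbT.
have [psi' [phi' [zeta [p [x [y [c [[pp dz dx cx dy] c0 cpx [hpsi hphi] hK']]]]]]]] := truncation hX hY n1 n2 hK d0 d1.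
have [n [l [b [z [l0 lS Cb hz [bS hG]]]]]] := near_transfer vA T fA pp dz dx cx c0 cpx dy hK' d0.
have npsi1 : nrm psi = 1 by apply/eqP; rewrite -(@eqrXn2 _ 2) ?nrm_ge0 // nrm2 n1 expr1n.
have nphi1 : nrm phi = 1 by apply/eqP; rewrite -(@eqrXn2 _ 2) ?nrm_ge0 // nrm2 n2 expr1n.
(* The six units of [d]: one from [near_transfer], two from [|psi'|^2 >= 1 - 2 d], one from
   replacing [psi'] by [psi], and two from replacing [phi'] by [phi], as [|psi'| d <= 2 d]. *)
have [|Theta LT hT] := LOCC_near vA n1 n2 l0 lS Cb (fun k => proj1 (hz k)) (fun k => proj2 (hz k)) bS t0 (d := 6 * d).
  have o1 := weighted_overlap phi lS (fun k => proj2 (hz k)) (bS (psi - psi')).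
  have o2 := weighted_overlap (phi - phi') lS (fun k => proj2 (hz k)) (bS psi').
  have -> : \sum_(k < n) l k * rp (b k psi) (z k phi) = \sum_(k < n) l k * rp (b k psi') (z k phi') +
     \sum_(k < n) l k * rp (b k (psi - psi')) (z k phi) + \sum_(k < n) l k * rp (b k psi') (z k (phi - phi')).
    rewrite -!big_split; apply: eq_bigr => k _ /=; rewrite !bopB !rpE; ring.
  have s1 : 1 <= d + nrm psi'.
    by rewrite -npsi1 -[in leLHS](subrK psi' psi); apply: le_trans (nrmD _ _) _; rewrite lerD2r.
  have s2 : nrm psi' <= 1 + d.
    by rewrite -npsi1 -[in leLHS](subKr psi psi'); apply: le_trans (nrmB _ _) _; rewrite lerD2l.
  rewrite nphi1 mulr1 in o1; rewrite -nrm2 in hG.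
  have := nrm_ge0 (phi - phi'); have := nrm_ge0 psi'.
  move: (nrm psi') (nrm (phi - phi')) (nrm (psi - psi')) hpsi hphi s1 s2 o1 o2 hG => u v w.
  move: (\sum_(k < n) _) (\sum_(k < n) _) (\sum_(k < n) _) => S1 S2 S3 *.
  have h1 : u * v <= 2 * d by nra.
  have h2 : 1 - 2 * d <= u ^+ 2 by nra.
  lra.
exists Theta => //; apply: le_lt_trans hT _; rewrite lte_fin.
have h1 : 6 * d / t <= t / 2.
  by rewrite ler_pdivrMr //; clear - d2; rewrite expr2 in d2; lra.
have -> : eps = 8 * t by rewrite /t mulrC divfK.
by clear - h1 t0 d3; lra.
Qed.

End Truncation.

Theorem theorem5p3 (R : realType) (H : hilbertType R) (A : set (bop H))
    (tau : bop H -> \bar R) (psi phi : H) (rho_psi rho_phi : set (H * H))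
    (H_separable : separable_space H)
    (A_factor : vN_factor A) (A_semifinite : semifinite A)
    (tau_nsf : nsf_trace A tau)
    (psi_unit : `|psi| = 1) (phi_unit : `|phi| = 1)
    (rho_psi_density : density_operator A tau psi rho_psi)
    (rho_phi_density : density_operator A tau phi rho_phi) :
  approx_convertible A psi phi <-> majorized A tau rho_psi rho_phi.
Proof.
have [vA fA] := A_factor.
have unit (v : H) : `|v| = 1 -> rp v v = 1.
  by move=> v1; rewrite -nrm2 /nrm /hnorm v1 expr1n.
have n1 := unit _ psi_unit; have n2 := unit _ phi_unit.
have mP := majorizedP vA tau_nsf rho_psi_density rho_phi_density (etrans n1 (esym n2)).
split=> [h|/mP h].
  exact/mP/(convertible_majorized vA tau_nsf fA rho_psi_density n1 n2 h).
exact: (kyfan_convertible vA tau_nsf fA rho_psi_density rho_phi_density n1 n2 h).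
Qed.
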